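(* Let $d\in\{2,3\}$, $\Omega=[0,2\pi]^{d-1}$ with periodic boundary conditions (regarded as the $(d-1)$-dimensional torus), $V_\infty>0$ a constant, and let $V\colon\mathbb R\times\Omega\to\mathbb R$ be measurable such that $$\big(x_1\mapsto\|V(x_1,\cdot)-V_\infty\|_{L^\infty(\Omega)}\big)\in L^1(\mathbb R)\cap L^\infty(\mathbb R)\quad\text{and}\quad\big(x_1\mapsto\|V(x_1,\cdot)-V_\infty\|_{H^{3/2}(\Omega)}\big)\in L^2(\mathbb R).$$ Let $z\in\mathbb C\setminus[V_\infty,\infty)$ and let $\mathcal K(z)$ and its Galerkin truncations $\mathcal K_J(z)$, $J\in\mathbb N$, be as defined in the context. Then $\mathcal K_J(z)\in\mathcal B_2\big(L^2(\mathbb R\times\Omega;dx)\big)$. Moreover, $\mathcal K_J(z)$ converges to $\mathcal K(z)$ in Hilbert--Schmidt norm as $J\to\infty$ at rate $J^{(d-4)/4}$, that is, $\|\mathcal K(z)-\mathcal K_J(z)\|_{\mathcal B_2}=O(J^{(d-4)/4})$, and hence $$\mathcal F_{2,J}(z)={\det}_{2,L^2(\mathbb R\times\Omega;dx)}\big(I-\mathcal K_J(z)\big)$$ converges to $$\mathcal F_2(z)={\det}_{2,L^2(\mathbb R\times\Omega;dx)}\big(I-\mathcal K(z)\big)$$ as $J\to\infty$ at rate $J^{(d-4)/4}$, that is, $|\mathcal F_2(z)-\mathcal F_{2,J}(z)|=O(J^{(d-4)/4})$.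
   Context: Points of $\mathbb R\times\Omega$ are written $x=(x_1,y)$, $x'=(x_1',y')$. $\mathcal B_2$ is the Hilbert--Schmidt class and ${\det}_2(I-A)=\det\big((I-A)e^{A}\big)$ is the $2$-modified Fredholm determinant. $H^{3/2}(\Omega)$ is the $L^2$-based fractional Sobolev space of order $3/2$ on the torus $\Omega$. $H^{(0)}_{\Omega,{\rm p}}$ is the self-adjoint realization of $-\Delta_x+V_\infty$ in $L^2(\mathbb R\times\Omega;dx)$ with periodic boundary conditions on $\partial\Omega$, and, with $W=V-V_\infty$, $$\mathcal K(z)=-\big(H^{(0)}_{\Omega,{\rm p}}-zI\big)^{-1}W,\qquad z\in\mathbb C\setminus[V_\infty,\infty).$$ Fourier coefficients in $y$: $\widehat W_m(x_1)=(2\pi)^{1-d}\int_\Omega W(x_1,y)e^{-im\cdot y}\,dy$, $m\in\mathbb Z^{d-1}$. The Galerkin truncation $\mathcal K_J(z)$ is the integral operator on $L^2(\mathbb R\times\Omega;dx)$ with kernel $$\mathcal K_J(z,x,x')=-(2\pi)^{1-d}\sum_{\substack{j,m\in\mathbb Z^{d-1}\\|j|,|m|\le J}}e^{ij\cdot y}\,\frac{e^{-(V_\infty+|j|^2-z)^{1/2}|x_1-x_1'|}}{2(V_\infty+|j|^2-z)^{1/2}}\,\widehat W_{j-m}(x_1')\,e^{-im\cdot y'},$$ where $|\cdot|$ is the Euclidean norm on $\mathbb Z^{d-1}$ and the square root is chosen with $\operatorname{Re}\big((V_\infty+|j|^2-z)^{1/2}\big)>0$. *)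

(* Defs.v *)
From HB Require Import structures.
From mathcomp Require Import all_boot all_order all_algebra.
From mathcomp Require Import all_classical all_reals all_analysis.
From mathcomp Require Import measurable_realfun.
From mathcomp Require Import complex.
Set Implicit Arguments.
Unset Strict Implicit.
Unset Printing Implicit Defensive.
Import Order.TTheory GRing.Theory Num.Theory.
Import numFieldNormedType.Exports.
Local Open Scope classical_set_scope.
Local Open Scope ring_scope.
Local Open Scope complex_scope.

(* [Num.Theory] shadows the projections of R[i]. *)
Local Notation Re := complex.Re.
Local Notation Im := complex.Im.

Section complex_functions.
Context {R : realType}.
Implicit Types (z w : R[i]) (u : nat -> R[i]).

Definition cmod z : R := Normc.normc z.

Definition cexp z : R[i] :=
  (expR (Re z) * cos (Im z)) +i* (expR (Re z) * sin (Im z)).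

(* The square root with positive real part: for w outside ]-oo, 0] the set is
   a singleton. *)
Definition csqrt w : R[i] := xget 0 [set s | s ^+ 2 = w /\ 0 < Re s].

Definition clim u : R[i] :=
  lim (Re (u N) @[N --> \oo]) +i* lim (Im (u N) @[N --> \oo]).

End complex_functions.

(* Elements of L^2(T, mu; C) are represented by functions T -> R[i], and
   operators by maps on such functions. All notions below are invariant under
   changing functions on mu-null sets, so that a map A represents an operator
   on the quotient space as soon as [bounded_operator mu A]. *)
Section hilbert_space.
Context d (T : measurableType d) (R : realType).
Variable mu : {measure set T -> \bar R}.
Implicit Types (f g : T -> R[i]) (A B : (T -> R[i]) -> (T -> R[i])).
Implicit Types (e : nat -> T -> R[i]).

Definition cmeasurable_fun f :=
  measurable_fun setT (fun x => Re (f x)) /\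
  measurable_fun setT (fun x => Im (f x)).

Definition cintegral f : R[i] :=
  Rintegral mu setT (fun x => Re (f x)) +i*
  Rintegral mu setT (fun x => Im (f x)).

Definition L2norm f : \bar R := Lnorm mu 2%:E (fun x => (cmod (f x))%:E).

Definition L2 f := cmeasurable_fun f /\ (L2norm f < +oo)%E.

(* Antilinear in the first argument. *)
Definition inner f g : R[i] := cintegral (fun x => (f x)^* * g x).

Definition bounded_operator A :=
  [/\ forall f, L2 f -> L2 (A f),
      forall (a : R[i]) f g, L2 f -> L2 g ->
        ae_eq mu setT (A (fun x => a * f x + g x))
                      (fun x => a * A f x + A g x)
    & exists M : R, forall f, L2 f -> (L2norm (A f) <= M%:E * L2norm f)%E].

(* Bases indexed by nat, i.e. for L^2 spaces that are separable and infinite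
   dimensional, as is L^2(R x torus). *)
Definition orthonormal_basis e :=
  [/\ forall n, L2 (e n),
      forall m n, inner (e m) (e n) = (m == n)%:R
    & forall f, L2 f -> (forall n, inner (e n) f = 0) ->
        ae_eq mu setT f (cst 0)].

Definition hs_norm e A : \bar R :=
  ((\sum_(0 <= n <oo) (L2norm (A (e n))) ^+ 2) `^ 2^-1)%E.

Definition hilbert_schmidt A :=
  bounded_operator A /\
  forall e, orthonormal_basis e -> (hs_norm e A < +oo)%E.

Definition op_sub A B : (T -> R[i]) -> (T -> R[i]) := fun f x => A f x - B f x.

(* exp(A) f = \sum_k A^k f / k!, the series being summed in L^2. *)
Definition op_exp A : (T -> R[i]) -> (T -> R[i]) := fun f =>
  xget (cst 0) [set u | L2 u /\
    L2norm (fun x => \sum_(0 <= k < N) (k`!%:R)^-1 * iter k A f x - u x)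
      @[N --> \oo] --> 0%E].

(* The Fredholm determinant of B = I + S with S of trace class, obtained from
   the determinant of finite rank perturbations of I by continuity in trace
   norm: P_N S P_N converges to S in trace norm, where P_N projects onto the
   span of e_0, ..., e_{N-1}, and det (I + P_N S P_N) is the determinant of the
   matrix <e_i, B e_j>, i, j < N. The value does not depend on the basis. *)
Definition fredholm_det e B : R[i] :=
  clim (fun N => \det (\matrix_(i < N, j < N) inner (e i) (B (e j)))).

Definition det2 e A : R[i] := fredholm_det e (op_sub id A \o op_exp A).

End hilbert_space.

Definition in_Lp d (T : measurableType d) (R : realType)
    (mu : {measure set T -> \bar R}) (p : \bar R) (f : T -> \bar R) :=
  measurable_fun setT f /\ (Lnorm mu p f < +oo)%E.

(* Functions on the torus are represented by functions of y : Omega R n that are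
   only considered on the fundamental domain [0, 2 pi]^n: they are integrated
   against [torus n], the n-fold product of Lebesgue measure on [0, 2 pi].
   Functions on R * torus are likewise integrated against [cylinder n]. *)
Notation Omega R n := (n.-tuple (measurableTypeR R)).
Notation Cyl R n := (measurableTypeR R * Omega R n)%type.

Section torus.
Context {R : realType}.
Local Open Scope ereal_scope.

Definition I2pi : set (measurableTypeR R) := `[0%R, (2 * pi)%R].

Lemma measurable_I2pi : measurable I2pi. Proof. exact: measurable_itv. Qed.

Lemma I2pi_fin : @lebesgue_measure R I2pi < +oo.
Proof. by rewrite lebesgue_measure_itv; case: ifP => _; rewrite ?ltry. Qed.

Definition circle : {finite_measure set (measurableTypeR R) -> \bar R} :=
  mfrestr measurable_I2pi I2pi_fin.

Definition cons_pair n (p : Cyl R n) : Omega R n.+1 := [tuple of p.1 :: p.2].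

Lemma measurable_cons_pair n : measurable_fun setT (@cons_pair n).
Proof. exact: measurable_cons. Qed.

Definition torus_next n (m : {finite_measure set (Omega R n) -> \bar R}) :
  set (Omega R n.+1) -> \bar R := pushforward (circle \x m) (@cons_pair n).

Section torus_next_measure.
Variables (n : nat) (m : {finite_measure set (Omega R n) -> \bar R}).

Let next_measure : {measure set (Omega R n.+1) -> \bar R} :=
  @measure_function_pushforward__canonical__measure_function_Measure
    _ _ _ _ _ (circle \x m) _ (@measurable_cons_pair n).

HB.instance Definition _ := Measure.copy (torus_next m) next_measure.

Let next_fin : fin_num_fun (torus_next m).
Proof.
have mT : ((circle \x m) setT < +oo).
  rewrite -setXTT product_measure1E//= lte_mul_pinfty//.
    by rewrite fin_num_measure.
  by rewrite ltey_eq fin_num_measure.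
move=> A mA; rewrite ge0_fin_numE//; apply: le_lt_trans mT.
rewrite [leLHS]/torus_next /pushforward.
apply: (@le_measure _ _ _ (circle \x m)); rewrite ?inE//.
by rewrite -[X in measurable X]setTI; exact: measurable_cons_pair.
Qed.

HB.instance Definition _ := @Measure_isFinite.Build _ _ _ (torus_next m) next_fin.

End torus_next_measure.

Fixpoint torus n : {finite_measure set (Omega R n) -> \bar R} :=
  if n is n'.+1 then torus_next (torus n') else dirac [tuple].

Definition cylinder n : {measure set (Cyl R n) -> \bar R} :=
  lebesgue_measure \x torus n.
End torus.

Section schroedinger.
Context {R : realType}.
Variable n : nat.
Implicit Types (phi : R * 'rV[R]_n -> R) (f g h u : Cyl R n -> R[i]).
Implicit Types (V W : Cyl R n -> R) (Vinf : R) (z : R[i]).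

Definition smooth phi := forall vs : seq (R * 'rV[R]_n),
  let psi := foldr (fun v chi => 'D_v chi) phi vs in
  continuous psi /\ forall x v, derivable psi x v.

(* Real valued functions in C_c^oo(R x torus). *)
Definition test_function phi :=
  [/\ smooth phi,
      forall (i : 'I_n) p, phi (p.1, p.2 + (2 * pi) *: delta_mx 0 i) = phi p
    & exists M : R, forall p, M < `|p.1| -> phi p = 0].

Definition laplacian phi : R * 'rV[R]_n -> R := fun p =>
  'D_(1, 0) ('D_(1, 0) phi) p +
  \sum_(i < n) 'D_(0, delta_mx 0 i) ('D_(0, delta_mx 0 i) phi) p.

Definition vec (x : Cyl R n) : R * 'rV[R]_n := (x.1, \row_i tnth x.2 i).

(* The graph of the self-adjoint realization H0 of - Delta + Vinf with periodic
   boundary conditions: f is in its domain and H0 f = g iff f and g are in L^2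
   and - Delta f + Vinf f = g in the sense of distributions on R x torus. *)
Definition H0_graph Vinf f g :=
  [/\ L2 (cylinder n) f, L2 (cylinder n) g
    & forall phi, test_function phi ->
        cintegral (cylinder n)
          (fun x => f x * (- laplacian phi (vec x) + Vinf * phi (vec x))%:C) =
        cintegral (cylinder n) (fun x => g x * (phi (vec x))%:C)].

(* (H0 - z)^-1 h *)
Definition resolvent Vinf z h : Cyl R n -> R[i] :=
  xget (cst 0) [set u | exists2 g, H0_graph Vinf u g &
    ae_eq (cylinder n) setT (fun x => g x - z * u x) h].

Definition perturbation Vinf V : Cyl R n -> R := fun x => V x - Vinf.

(* K(z) = - (H0 - z)^-1 W *)
Definition birman_schwinger Vinf V z f : Cyl R n -> R[i] := fun x =>
  - resolvent Vinf z (fun x' => (perturbation Vinf V x')%:C * f x') x.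

Definition znorm (m : 'rV[int]_n) : R :=
  Num.sqrt (\sum_(i < n) (m 0 i)%:~R ^+ 2).

(* y |-> e^{i m . y} *)
Definition character (m : 'rV[int]_n) (y : Omega R n) : R[i] :=
  cexp (0 +i* \sum_(i < n) (m 0 i)%:~R * tnth y i).

Definition fourier (w : Omega R n -> R) (m : 'rV[int]_n) : R[i] :=
  (((2 * pi) ^+ n)^-1)%:C *
  cintegral (torus n) (fun y => (w y)%:C * character (- m) y).

(* The norm of H^s(torus) through Fourier coefficients; it is +oo when w is not
   in H^s. *)
Definition sobolev_norm (s : R) (w : Omega R n -> R) : \bar R :=
  ((\esum_(m in [set: 'rV[int]_n])
      ((1 + znorm m ^+ 2) `^ s * cmod (fourier w m) ^+ 2)%:E) `^ 2^-1)%E.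

(* Both sums range over the finitely many lattice points of a Euclidean ball. *)
Definition galerkin_kernel Vinf V z (J : nat) (x x' : Cyl R n) : R[i] :=
  - (((2 * pi) ^+ n)^-1)%:C *
  \sum_(j \in [set j : 'rV[int]_n | znorm j <= J%:R])
  \sum_(m \in [set m : 'rV[int]_n | znorm m <= J%:R])
    let kappa := csqrt ((Vinf + znorm j ^+ 2)%:C - z) in
    character j x.2 *
    (cexp (- kappa * `|x.1 - x'.1|%:C) / (2 * kappa)) *
    fourier (fun y => perturbation Vinf V (x'.1, y)) (j - m) *
    character (- m) x'.2.

(* K_J(z) *)
Definition galerkin Vinf V z J f : Cyl R n -> R[i] := fun x =>
  cintegral (cylinder n) (fun x' => galerkin_kernel Vinf V z J x x' * f x').

End schroedinger.

(* Main.v *)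
Require Import Defs.
From HB Require Import structures.
From mathcomp Require Import all_boot all_order all_algebra.
From mathcomp Require Import all_classical all_reals all_analysis.
From mathcomp Require Import measurable_realfun ess_sup_inf.
From mathcomp Require Import complex.
From mathcomp Require Import ring lra zify.
Set Implicit Arguments.
Unset Strict Implicit.
Unset Printing Implicit Defensive.
Import Order.TTheory GRing.Theory Num.Theory.
Import numFieldNormedType.Exports.
Local Open Scope classical_set_scope.
Local Open Scope ring_scope.
Local Open Scope complex_scope.
Local Notation Re := complex.Re.
Local Notation Im := complex.Im.

Local Notation "x ^*" := (Num.conj x) : complex_scope.


(** Write n = d - 1, W = V - Vinf, kappa_j = (Vinf + |j|^2 - z)^(1/2) and vol = (2 pi)^n. The
    characters e^{ij.y} diagonalise the transverse part of H0, and on mode j the resolvent is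
    convolution in x_1 with G_j(s) = e^{-kappa_j |s|} / (2 kappa_j), the Green function of -d^2/ds^2
    + kappa_j^2. Hence K(z), K_J(z) and their difference all send f to the sum over j of e^{ij.y}
    times the integral of G_j(x_1 - x_1') r_j(x') f(x') ([Tsum], [Aop]); only the profiles r_j
    differ. Up to sign and the factor 1/vol, r_j is W e^{-ij.y} for K(z); for K_J(z) it is the
    truncation of that function to frequencies |m| <= J, or 0 when |j| > J; for the difference it is
    the remaining Fourier tail.

    Different modes are orthogonal and the integral of |G_j|^2 is at most 1/(4 (Re kappa_j)^3). With
    Bessel's inequality this bounds the squared Hilbert-Schmidt norm by vol times the sum of |r_j|^2
    / (4 (Re kappa_j)^3), where |r_j| is the L^2 norm ([nsq_Aop_sum], [hs_norm_limit]). For the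
    difference, a frequency m survives in row j only if |m| > J or |j| > J, and then J^2 <= 2 (1 +
    |j|^2)(1 + |m+j|^2). Against the H^{3/2} weight this gives |r_j|^2 <= C (2/J^2)^s (1 + |j|^2)^s
    with s = (3 - n)/4 = (4 - d)/4 ([tail_constant], [tail_bound], [rD_bound]). As (Re kappa_j)^2 >=
    c (1 + |j|^2) ([Re_csqrt_lower]), what is left is the sum of (1 + |j|^2)^(-(n+3)/4), which
    converges for n <= 2 ([sum_zball]). The square root of (J^-2)^s is the rate J^((d-4)/4).

    The resolvent is only known as a choice among distributional solutions, so it has to be
    identified with the mode series. Existence: Green's identity for each mode shows that the L^2
    limit of the partial sums solves the weak equation ([green_identity], [weak_solution_exists]).
    Uniqueness: an L^2 solution of the homogeneous equation, paired with translates in x_1 of a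
    compactly supported profile times a character, gives a bounded solution of w'' = kappa^2 w,
    hence 0, and products of bumps and characters separate L^2 ([weak_unique]). Both meet in
    [resolvent_representation].

    For the determinants, det_2 is shown to be Lipschitz on Hilbert-Schmidt balls
    ([det2_lipschitz]). For a matrix X, (1 - X) times the truncated exponential of X is 1 + X b(X),
    where b is Lipschitz in Frobenius norm. Schur triangularisation gives |det(1 + XY)|^2 <=
    exp(|X|^2 + |Y|^2) in Frobenius norms, and a Cauchy estimate along a segment turns this into a
    Lipschitz bound ([det1DM_lipschitz]). All constants are free of the matrix size and of the
    degree, so the bound survives the limits in the section size, the degree and the size of the
    minor that define det_2 of an operator. *)

#[global] Arguments cmod : simpl never.
#[global] Arguments cintegral : simpl never.

(** * Complex numbers through real and imaginary parts *)

Section complex_numbers.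
Context {R : realType}.
Implicit Types (z w : R[i]) (a b : R).

Lemma complex_ext z w : Re z = Re w -> Im z = Im w -> z = w.
Proof. by case: z w => [a b] [c d] /= -> ->. Qed.

Lemma ReD z w : Re (z + w) = Re z + Re w. Proof. by case: z; case: w. Qed.
Lemma ImD z w : Im (z + w) = Im z + Im w. Proof. by case: z; case: w. Qed.
Lemma ReN z : Re (- z) = - Re z. Proof. by case: z. Qed.
Lemma ImN z : Im (- z) = - Im z. Proof. by case: z. Qed.
Lemma ReM z w : Re (z * w) = Re z * Re w - Im z * Im w.
Proof. by case: z; case: w. Qed.
Lemma ImM z w : Im (z * w) = Re z * Im w + Im z * Re w.
Proof. by case: z; case: w. Qed.
Lemma ReJ z : Re z^* = Re z. Proof. by case: z. Qed.
Lemma ImJ z : Im z^* = - Im z. Proof. by case: z. Qed.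
Lemma Re_sum (I : Type) (s : seq I) (P : pred I) (f : I -> R[i]) :
  Re (\sum_(i <- s | P i) f i) = \sum_(i <- s | P i) Re (f i).
Proof. exact: (big_morph _ ReD erefl). Qed.
Lemma Im_sum (I : Type) (s : seq I) (P : pred I) (f : I -> R[i]) :
  Im (\sum_(i <- s | P i) f i) = \sum_(i <- s | P i) Im (f i).
Proof. exact: (big_morph _ ImD erefl). Qed.

Lemma conjR a : (a%:C)^* = a%:C.
Proof. by apply: complex_ext; rewrite ?ReJ ?ImJ//= oppr0. Qed.
Lemma cconjD z w : (z + w)^* = z^* + w^*. Proof. exact: rmorphD. Qed.
Lemma cconjB z w : (z - w)^* = z^* - w^*. Proof. exact: rmorphB. Qed.
Lemma cconjM z w : (z * w)^* = z^* * w^*. Proof. exact: rmorphM. Qed.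
Lemma cconj_sum (I : Type) (s : seq I) (P : pred I) (f : I -> R[i]) :
  (\sum_(i <- s | P i) f i)^* = \sum_(i <- s | P i) (f i)^*.
Proof. exact: rmorph_sum. Qed.

Definition ReImE := (ReD, ImD, ReN, ImN, ReM, ImM, ReJ, ImJ).

Lemma cmodE z : cmod z = Num.sqrt (Re z ^+ 2 + Im z ^+ 2).
Proof. by case: z. Qed.
Lemma cmod_normE z : `|z| = (cmod z)%:C.
Proof. by rewrite normc_def cmodE. Qed.
Lemma cmod2E z : cmod z ^+ 2 = Re z ^+ 2 + Im z ^+ 2.
Proof. by rewrite cmodE sqr_sqrtr// addr_ge0// sqr_ge0. Qed.
Lemma cmod_ge0 z : 0 <= cmod z. Proof. by rewrite cmodE sqrtr_ge0. Qed.
Lemma cmod0 : cmod (0 : R[i]) = 0.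
Proof. by rewrite cmodE/= expr0n/= addr0 sqrtr0. Qed.
Lemma cmod1 : cmod (1 : R[i]) = 1.
Proof. by rewrite cmodE/= expr0n/= addr0 expr1n sqrtr1. Qed.
Lemma cmodM z w : cmod (z * w) = cmod z * cmod w.
Proof. exact: ComplexField.Normc.normcM. Qed.
Lemma cmodV z : cmod z^-1 = (cmod z)^-1.
Proof. exact: ComplexField.Normc.normcV. Qed.
Lemma cmodD z w : cmod (z + w) <= cmod z + cmod w.
Proof. exact: le_normcD. Qed.
Lemma cmodN z : cmod (- z) = cmod z.
Proof. exact: normcN. Qed.
Lemma cmodJ z : cmod z^* = cmod z.
Proof. by rewrite !cmodE ReJ ImJ sqrrN. Qed.
Lemma cmodB z w : cmod (z - w) = cmod (w - z).
Proof. by rewrite -cmodN opprB. Qed.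
Lemma cmodR a : cmod a%:C = `|a|.
Proof. by rewrite cmodE/= expr0n/= addr0 sqrtr_sqr. Qed.
Lemma cmodX z n : cmod (z ^+ n) = cmod z ^+ n.
Proof.
by elim: n => [|n IH]; rewrite ?expr0 ?cmod1// !exprS cmodM IH.
Qed.
Lemma cmod_eq0 z : (cmod z == 0) = (z == 0).
Proof.
apply/eqP/eqP => [/ComplexField.Normc.eq0_normc//|->]; exact: cmod0.
Qed.
Lemma Re_le_cmod z : `|Re z| <= cmod z.
Proof. by rewrite cmodE -sqrtr_sqr ler_wsqrtr// lerDl sqr_ge0. Qed.
Lemma Im_le_cmod z : `|Im z| <= cmod z.
Proof. by rewrite cmodE -sqrtr_sqr ler_wsqrtr// lerDr sqr_ge0. Qed.
Lemma cmod_le z : cmod z <= `|Re z| + `|Im z|.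
Proof.
rewrite -(@ler_pXn2r _ 2)// ?nnegrE ?addr_ge0 ?cmod_ge0// cmod2E.
rewrite sqrrD !real_normK ?num_real//; have := normr_ge0 (Re z).
have := normr_ge0 (Im z); nra.
Qed.
Lemma mulJz z : z^* * z = (cmod z ^+ 2)%:C.
Proof.
by apply: complex_ext; rewrite !ReImE cmod2E/= ?expr2; ring.
Qed.
Lemma cmod_sum (I : Type) (s : seq I) (P : pred I) (f : I -> R[i]) :
  cmod (\sum_(i <- s | P i) f i) <= \sum_(i <- s | P i) cmod (f i).
Proof.
elim/big_rec2 : _ => [|i x y _ h]; first by rewrite cmod0.
by apply: le_trans (cmodD _ _) _; rewrite lerD2l.
Qed.

End complex_numbers.

(** * Measurability and integration of complex functions *)

Section cmeasurable.
Context d (T : measurableType d) (R : realType).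
Implicit Types f g : T -> R[i].

Lemma cmeas_cst (c : R[i]) : cmeasurable_fun (fun _ : T => c).
Proof. by split; apply: measurable_cst. Qed.

Lemma cmeas_parts f (u v : T -> R) : measurable_fun setT u ->
  measurable_fun setT v -> (forall x, f x = u x +i* v x) -> cmeasurable_fun f.
Proof. by move=> mU mV /funext ->; apply: conj. Qed.

Lemma cmeasD f g : cmeasurable_fun f -> cmeasurable_fun g ->
  cmeasurable_fun (fun x => f x + g x).
Proof.
move=> [f1 f2] [g1 g2].
apply: (cmeas_parts (measurable_funD f1 g1) (measurable_funD f2 g2)) => x /=.
by case: (f x); case: (g x).
Qed.

Lemma cmeasN f : cmeasurable_fun f -> cmeasurable_fun (fun x => - f x).
Proof.
move=> [f1 f2].
apply: (cmeas_parts (measurable_funN f1) (measurable_funN f2)) => x /=.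
by case: (f x).
Qed.

Lemma cmeasB f g : cmeasurable_fun f -> cmeasurable_fun g ->
  cmeasurable_fun (fun x => f x - g x).
Proof. by move=> mf mg; apply: cmeasD => //; exact: cmeasN. Qed.

Lemma cmeasM f g : cmeasurable_fun f -> cmeasurable_fun g ->
  cmeasurable_fun (fun x => f x * g x).
Proof.
move=> [f1 f2] [g1 g2].
apply: (cmeas_parts (measurable_funB (measurable_funM f1 g1) (measurable_funM f2 g2))
  (measurable_funD (measurable_funM f1 g2) (measurable_funM f2 g1))) => x /=.
by case: (f x); case: (g x).
Qed.

Lemma cmeasJ f : cmeasurable_fun f -> cmeasurable_fun (fun x => (f x)^*).
Proof.
move=> [f1 f2]; apply: (cmeas_parts f1 (measurable_funN f2)) => x /=.
by case: (f x).
Qed.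

Lemma cmeasR (f : T -> R) : measurable_fun setT f ->
  cmeasurable_fun (fun x => (f x)%:C).
Proof. by move=> mf; split => //=; exact: measurable_cst. Qed.

Lemma cmeas_sum (I : Type) (s : seq I) (P : pred I) (F : I -> T -> R[i]) :
  (forall i, cmeasurable_fun (F i)) ->
  cmeasurable_fun (fun x => \sum_(i <- s | P i) F i x).
Proof.
move=> mF; elim: s => [|i s IH].
  have -> : (fun x => \sum_(i <- [::] | P i) F i x) = (fun=> 0).
    by apply/funext => x; rewrite big_nil.
  exact: cmeas_cst.
have -> : (fun x => \sum_(j <- i :: s | P j) F j x) = (fun x =>
    (if P i then F i x else 0) + \sum_(j <- s | P j) F j x).
  by apply/funext => x; rewrite big_cons; case: (P i) => //; rewrite add0r.
by apply: cmeasD => //; case: (P i) => //; exact: cmeas_cst.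
Qed.

Lemma cmeas_cmod f : cmeasurable_fun f -> measurable_fun setT (fun x => cmod (f x)).
Proof.
move=> [f1 f2].
have -> : (fun x => cmod (f x)) = (fun y => y `^ 2^-1) \o
    (fun x => Re (f x) ^+ 2 + Im (f x) ^+ 2).
  by apply/funext => x /=; rewrite cmodE -powR12_sqrt ?addr_ge0 ?sqr_ge0.
apply: measurableT_comp; first exact: measurable_powR.
by apply: measurable_funD; exact: measurable_funX.
Qed.

Lemma cmeas_cmod2 f : cmeasurable_fun f ->
  measurable_fun setT (fun x => cmod (f x) ^+ 2).
Proof. by move=> mf; apply: measurable_funX; exact: cmeas_cmod. Qed.

End cmeasurable.

Lemma cmeas_comp d d' (T : measurableType d) (U : measurableType d')
    (R : realType) (h : U -> T) (f : T -> R[i]) :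
  cmeasurable_fun f -> measurable_fun setT h -> cmeasurable_fun (f \o h).
Proof. by move=> [f1 f2] mh; split; [exact: measurableT_comp f1 mh|exact: measurableT_comp f2 mh]. Qed.

Section cintegral.
Context d (T : measurableType d) (R : realType).
Variable mu : {measure set T -> \bar R}.
Implicit Types (f g : T -> R[i]) (h : T -> R).

Definition cintegrable f :=
  mu.-integrable setT (fun x => (Re (f x))%:E) /\
  mu.-integrable setT (fun x => (Im (f x))%:E).

Lemma integrable_scale a h : mu.-integrable setT (fun x => (h x)%:E) ->
  mu.-integrable setT (fun x => (a * h x)%:E).
Proof. by move=> ih; under eq_fun do rewrite EFinM; exact: integrableZl. Qed.

Lemma cintegrable_meas f : cintegrable f -> cmeasurable_fun f.
Proof.
by move=> [/measurable_int/measurable_EFinP f1 /measurable_int/measurable_EFinP f2].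
Qed.

Lemma cintegrable_le f h : cmeasurable_fun f ->
  mu.-integrable setT (fun x => (h x)%:E) -> (forall x, cmod (f x) <= h x) ->
  cintegrable f.
Proof.
move=> [f1 f2] ih fh.
split; (apply: le_integrable ih => //; first exact/measurable_EFinP) => x _ /=;
  rewrite lee_fin.
- by apply: le_trans (Re_le_cmod _) _; apply: le_trans (fh x) (ler_norm _).
- by apply: le_trans (Im_le_cmod _) _; apply: le_trans (fh x) (ler_norm _).
Qed.

Lemma cintegrable_cmod f : cintegrable f ->
  mu.-integrable setT (fun x => (cmod (f x))%:E).
Proof.
move=> icf; have [f1 f2] := icf; have mf := cintegrable_meas icf.
apply: (@le_integrable _ _ _ mu setT _ _ (fun x => `|(Re (f x))%:E| + `|(Im (f x))%:E|)%E) => //.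
- exact/measurable_EFinP/cmeas_cmod.
- move=> x _ /=; rewrite lee_fin ger0_norm ?cmod_ge0//.
  by apply: le_trans (cmod_le _) _; exact: ler_norm.
- by apply: integrableD => //; exact: integrable_abse.
Qed.

Lemma cintegrableP f : cmeasurable_fun f ->
  (\int[mu]_x (cmod (f x))%:E < +oo)%E -> cintegrable f.
Proof.
move=> mf foo; apply: (@cintegrable_le f (fun x => cmod (f x))) => //.
apply/integrableP; split; first exact/measurable_EFinP/cmeas_cmod.
by under eq_integral do rewrite /= ger0_norm ?cmod_ge0//.
Qed.

Lemma cintegrable0 : cintegrable (fun=> 0).
Proof. by split; exact: integrable0. Qed.

Lemma cintegrableD f g : cintegrable f -> cintegrable g ->
  cintegrable (fun x => f x + g x).
Proof.
move=> [f1 f2] [g1 g2]; split; under eq_fun do rewrite ReImE EFinD;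
exact: integrableD.
Qed.

Lemma cintegrableZ c f : cintegrable f -> cintegrable (fun x => c * f x).
Proof.
move=> icf; apply: (@cintegrable_le _ (fun x => cmod c * cmod (f x))).
- by apply: cmeasM; [exact: cmeas_cst|exact: cintegrable_meas].
- exact/integrable_scale/cintegrable_cmod.
- by move=> x; rewrite cmodM.
Qed.

Lemma cintegrableN f : cintegrable f -> cintegrable (fun x => - f x).
Proof. by move=> /(cintegrableZ (-1)); under eq_fun do rewrite mulN1r. Qed.

Lemma cintegrableB f g : cintegrable f -> cintegrable g ->
  cintegrable (fun x => f x - g x).
Proof. by move=> icf icg; apply: cintegrableD => //; exact: cintegrableN. Qed.

Lemma cintegrableJ f : cintegrable f -> cintegrable (fun x => (f x)^*).
Proof.
move=> icf; apply: cintegrable_le (cintegrable_cmod icf) _.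
- exact/cmeasJ/cintegrable_meas.
- by move=> x; rewrite cmodJ.
Qed.

Lemma cintegrable_sum (I : Type) (s : seq I) (P : pred I) (F : I -> T -> R[i]) :
  (forall i, P i -> cintegrable (F i)) ->
  cintegrable (fun x => \sum_(i <- s | P i) F i x).
Proof.
move=> iF; elim: s => [|i s IH].
  by under eq_fun do rewrite big_nil; exact: cintegrable0.
under eq_fun do rewrite big_cons; case: (boolP (P i)) => [/iF ?|//].
exact: cintegrableD.
Qed.

Lemma cintegralD f g : cintegrable f -> cintegrable g ->
  cintegral mu (fun x => f x + g x) = cintegral mu f + cintegral mu g.
Proof.
move=> [f1 f2] [g1 g2]; apply: complex_ext; rewrite /cintegral !ReImE /= -RintegralD//;
by apply: eq_Rintegral => x _; rewrite ReImE.
Qed.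

Lemma cintegralZ c f : cintegrable f ->
  cintegral mu (fun x => c * f x) = c * cintegral mu f.
Proof.
move=> [f1 f2].
have Z := integrable_scale.
apply: complex_ext; rewrite /cintegral !ReImE /= -!RintegralZl//.
- rewrite -RintegralB//; [|exact: Z|exact: Z].
  by apply: eq_Rintegral => x _; rewrite ReImE.
- rewrite -RintegralD//; [|exact: Z|exact: Z].
  by apply: eq_Rintegral => x _; rewrite ReImE.
Qed.

Lemma cintegral0 : cintegral mu (fun=> 0) = 0.
Proof. by apply: complex_ext; rewrite /= Rintegral_cst// mul0r. Qed.

Lemma cintegralN f : cintegrable f ->
  cintegral mu (fun x => - f x) = - cintegral mu f.
Proof.
by move=> icf; under eq_fun do rewrite -mulN1r; rewrite cintegralZ// mulN1r.
Qed.

Lemma cintegralB f g : cintegrable f -> cintegrable g ->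
  cintegral mu (fun x => f x - g x) = cintegral mu f - cintegral mu g.
Proof.
by move=> icf icg; rewrite cintegralD ?cintegralN//; exact: cintegrableN.
Qed.

Lemma cintegral_sum (I : Type) (s : seq I) (P : pred I) (F : I -> T -> R[i]) :
  (forall i, P i -> cintegrable (F i)) ->
  cintegral mu (fun x => \sum_(i <- s | P i) F i x) =
  \sum_(i <- s | P i) cintegral mu (F i).
Proof.
move=> iF; elim: s => [|i s IH].
  by rewrite big_nil; under eq_fun do rewrite big_nil; exact: cintegral0.
under eq_fun do rewrite big_cons; rewrite big_cons; case: (boolP (P i)) => // Pi.
by rewrite cintegralD ?IH//; [exact: iF|exact: cintegrable_sum].
Qed.

Lemma cintegralJ f : cintegrable f ->
  cintegral mu (fun x => (f x)^*) = (cintegral mu f)^*.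
Proof.
move=> [f1 f2]; apply: complex_ext; rewrite /cintegral !ReImE /=.
  by apply: eq_Rintegral => x _; rewrite ReImE.
rewrite -mulN1r -RintegralZl//.
by apply: eq_Rintegral => x _; rewrite ReImE mulN1r.
Qed.

Lemma eq_cintegral f g : f =1 g -> cintegral mu f = cintegral mu g.
Proof. by move=> /funext ->. Qed.

Lemma ae_eq_cintegral f g : cmeasurable_fun f -> cmeasurable_fun g ->
  ae_eq mu setT f g -> cintegral mu f = cintegral mu g.
Proof.
move=> [f1 f2] [g1 g2] fg.
by apply: complex_ext => /=; congr fine; apply: ae_eq_integral => //;
  try exact/measurable_EFinP; move: fg; apply: filterS => x /= h /h ->.
Qed.

Lemma ae_eq_cintegrable f g : cmeasurable_fun g ->
  ae_eq mu setT f g -> cintegrable f -> cintegrable g.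
Proof.
move=> mg fg icf; apply: cintegrableP => //.
have mf := cintegrable_meas icf.
rewrite (@ae_eq_integral _ _ _ mu setT (fun x => (cmod (f x))%:E))//; last 3 first.
  exact/measurable_EFinP/cmeas_cmod.
  exact/measurable_EFinP/cmeas_cmod.
  by move: fg; apply: filterS => x /= h /h ->.
exact: integrable_lty (cintegrable_cmod icf).
Qed.

(** Multiplying by the conjugate of the integral [J] produces the non-negative number |J|^2, which
    is at most |J| times the integral of |f|; then |J| is cancelled. *)
Lemma cintegral_le f : cintegrable f ->
  cmod (cintegral mu f) <= Rintegral mu setT (fun x => cmod (f x)).
Proof.
move=> icf; set J := cintegral mu f.
have [->|J0] := eqVneq J 0; first by rewrite cmod0; apply: Rintegral_ge0 => x _; exact: cmod_ge0.
have cJ : 0 < cmod J by rewrite lt_neqAle cmod_ge0 andbT eq_sym cmod_eq0.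
have iJ : cintegrable (fun x => J^* * f x) by exact: cintegrableZ.
have : Re (J^* * J) <= cmod J * Rintegral mu setT (fun x => cmod (f x)).
  rewrite -{2}/J -cintegralZ// -RintegralZl//; last exact: cintegrable_cmod.
  apply: le_Rintegral => //; first by case: iJ.
    exact: (integrable_scale (cmod J) (cintegrable_cmod icf)).
  move=> x _; apply: le_trans (ler_norm _) _; apply: le_trans (Re_le_cmod _) _.
  by rewrite cmodM cmodJ.
by rewrite mulJz/= expr2 ler_pM2l.
Qed.

End cintegral.

(** * Geometry of L^2: Cauchy-Schwarz, orthonormal projections, Bessel *)

Section L2_space.
Context d (T : measurableType d) (R : realType).
Variable mu : {measure set T -> \bar R}.
Implicit Types (f g h : T -> R[i]) (c : R[i]).
Local Notation L2 := (L2 mu).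
Local Notation inner := (inner mu).

Definition nsq f : R := Rintegral mu setT (fun x => cmod (f x) ^+ 2).
Definition nrm f : R := Num.sqrt (nsq f).

Lemma L2normE f :
  L2norm mu f = ((\int[mu]_x (cmod (f x) ^+ 2)%:E) `^ 2^-1)%E.
Proof.
rewrite /L2norm unlock; congr (_ `^ _)%E; apply: eq_integral => x _.
by rewrite gee0_abs ?lee_fin ?cmod_ge0// poweR_EFin powR_mulrn ?cmod_ge0.
Qed.

Lemma L2_meas f : L2 f -> cmeasurable_fun f. Proof. by case. Qed.

Lemma L2I f : cmeasurable_fun f ->
  (\int[mu]_x (cmod (f x) ^+ 2)%:E < +oo)%E -> L2 f.
Proof. by move=> mf foo; split=> //; rewrite L2normE; exact: poweR_lty. Qed.

Lemma L2_int f : L2 f -> mu.-integrable setT (fun x => (cmod (f x) ^+ 2)%:E).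
Proof.
move=> [mf]; rewrite L2normE => /lty_poweRy h; apply/integrableP; split.
  exact/measurable_EFinP/cmeas_cmod2.
under eq_integral do rewrite gee0_abs ?lee_fin ?sqr_ge0//.
by apply: h; rewrite invr_neq0.
Qed.

Lemma L2_le f (h : T -> R) : cmeasurable_fun f ->
  mu.-integrable setT (fun x => (h x)%:E) ->
  (forall x, cmod (f x) ^+ 2 <= h x) -> L2 f.
Proof.
move=> mf ih fh; apply: L2I => //; apply: (le_lt_trans _ (integrable_lty measurableT ih)).
apply: le_integral => //; last by move=> x _; rewrite lee_fin.
apply: le_integrable ih => //; first exact/measurable_EFinP/cmeas_cmod2.
by move=> x _ /=; rewrite lee_fin ger0_norm ?sqr_ge0// (le_trans (fh x))// ler_norm.
Qed.

Lemma nsq_ge0 f : 0 <= nsq f.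
Proof. by apply: Rintegral_ge0 => x _; exact: sqr_ge0. Qed.

Lemma nrm_ge0 f : 0 <= nrm f. Proof. exact: sqrtr_ge0. Qed.

Lemma nrm2 f : nrm f ^+ 2 = nsq f.
Proof. by rewrite sqr_sqrtr// nsq_ge0. Qed.

Lemma nsqE f : L2 f -> (nsq f)%:E = (\int[mu]_x (cmod (f x) ^+ 2)%:E)%E.
Proof. by move=> /L2_int h; rewrite fineK//; exact: integrable_fin_num. Qed.

Lemma L2norm_nrm f : L2 f -> L2norm mu f = (nrm f)%:E.
Proof.
move=> Lf; rewrite L2normE -nsqE// poweR_EFin /nrm powR12_sqrt//.
exact: nsq_ge0.
Qed.

Lemma cintegrable_inner f g : L2 f -> L2 g ->
  cintegrable mu (fun x => (f x)^* * g x).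
Proof.
move=> Lf Lg.
apply: (cintegrable_le (h := fun x => cmod (f x) ^+ 2 + cmod (g x) ^+ 2)).
- by apply: cmeasM; [exact/cmeasJ/L2_meas|exact: L2_meas].
- by under eq_fun do rewrite EFinD; apply: integrableD => //; exact: L2_int.
- move=> x; rewrite cmodM cmodJ.
  have := cmod_ge0 (f x); have := cmod_ge0 (g x); nra.
Qed.

Lemma L2Z c f : L2 f -> L2 (fun x => c * f x).
Proof.
move=> Lf; apply: (L2_le (h := fun x => cmod c ^+ 2 * cmod (f x) ^+ 2)).
- by apply: cmeasM; [exact: cmeas_cst|exact: L2_meas].
- exact/integrable_scale/L2_int.
- by move=> x; rewrite cmodM exprMn.
Qed.

Lemma L2D f g : L2 f -> L2 g -> L2 (fun x => f x + g x).
Proof.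
move=> Lf Lg.
apply: (L2_le (h := fun x => 2 * cmod (f x) ^+ 2 + 2 * cmod (g x) ^+ 2)).
- by apply: cmeasD; exact: L2_meas.
- under eq_fun do rewrite EFinD.
  by apply: integrableD => //; exact/integrable_scale/L2_int.
- move=> x; have := cmodD (f x) (g x); have := cmod_ge0 (f x + g x).
  by have := sqr_ge0 (cmod (f x) - cmod (g x)); nra.
Qed.

Lemma L2_0 : L2 (fun=> 0).
Proof.
apply: L2I; first exact: cmeas_cst.
by under eq_integral do rewrite cmod0 expr0n/=; rewrite integral0.
Qed.

Lemma L2N f : L2 f -> L2 (fun x => - f x).
Proof. by move=> /(L2Z (-1)); under eq_fun do rewrite mulN1r. Qed.

Lemma L2B f g : L2 f -> L2 g -> L2 (fun x => f x - g x).
Proof. by move=> Lf Lg; apply: L2D => //; exact: L2N. Qed.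

Lemma L2J f : L2 f -> L2 (fun x => (f x)^*).
Proof.
move=> Lf; apply: L2_le (L2_int Lf) _; first exact/cmeasJ/L2_meas.
by move=> x; rewrite cmodJ.
Qed.

Lemma L2_sum (I : Type) (s : seq I) (P : pred I) (F : I -> T -> R[i]) :
  (forall i, P i -> L2 (F i)) -> L2 (fun x => \sum_(i <- s | P i) F i x).
Proof.
move=> LF; elim: s => [|i s IH].
  by under eq_fun do rewrite big_nil; exact: L2_0.
under eq_fun do rewrite big_cons; case: (boolP (P i)) => [/LF ?|//].
exact: L2D.
Qed.

Lemma innerDr f g h : L2 f -> L2 g -> L2 h ->
  inner f (fun x => g x + h x) = inner f g + inner f h.
Proof.
move=> Lf Lg Lh; rewrite /Defs.inner -cintegralD; try exact: cintegrable_inner.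
by apply: eq_cintegral => x; rewrite mulrDr.
Qed.

Lemma innerZr c f g : L2 f -> L2 g ->
  inner f (fun x => c * g x) = c * inner f g.
Proof.
move=> Lf Lg; rewrite /Defs.inner -cintegralZ; last exact: cintegrable_inner.
by apply: eq_cintegral => x; rewrite mulrCA.
Qed.

Lemma innerC f g : L2 f -> L2 g -> inner f g = (inner g f)^*.
Proof.
move=> Lf Lg; rewrite /Defs.inner -cintegralJ; last exact: cintegrable_inner.
by apply: eq_cintegral => x; rewrite cconjM conjCK mulrC.
Qed.

Lemma inner0r f : inner f (fun=> 0) = 0.
Proof.
rewrite /Defs.inner (_ : (fun x => _) = fun=> 0) ?cintegral0//.
by apply/funext => x; rewrite mulr0.
Qed.

Lemma innerNr f g : L2 f -> L2 g -> inner f (fun x => - g x) = - inner f g.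
Proof.
by move=> Lf Lg; rewrite -mulN1r -innerZr//; under eq_fun do rewrite -mulN1r.
Qed.

Lemma innerBr f g h : L2 f -> L2 g -> L2 h ->
  inner f (fun x => g x - h x) = inner f g - inner f h.
Proof. by move=> Lf Lg Lh; rewrite innerDr ?innerNr//; exact: L2N. Qed.

Lemma innerDl f g h : L2 f -> L2 g -> L2 h ->
  inner (fun x => f x + g x) h = inner f h + inner g h.
Proof.
move=> Lf Lg Lh; rewrite innerC//; last exact: L2D.
by rewrite innerDr// cconjD -(innerC Lf Lh) -(innerC Lg Lh).
Qed.

Lemma innerZl c f g : L2 f -> L2 g ->
  inner (fun x => c * f x) g = c^* * inner f g.
Proof.
move=> Lf Lg; rewrite innerC//; last exact: L2Z.
by rewrite innerZr// cconjM -(innerC Lf Lg).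
Qed.

Lemma innerBl f g h : L2 f -> L2 g -> L2 h ->
  inner (fun x => f x - g x) h = inner f h - inner g h.
Proof.
move=> Lf Lg Lh; rewrite innerC//; last exact: L2B.
by rewrite innerBr// cconjB -(innerC Lf Lh) -(innerC Lg Lh).
Qed.

Lemma inner_sumr (I : Type) (s : seq I) (P : pred I) (F : I -> T -> R[i]) f :
  L2 f -> (forall i, P i -> L2 (F i)) ->
  inner f (fun x => \sum_(i <- s | P i) F i x) =
  \sum_(i <- s | P i) inner f (F i).
Proof.
move=> Lf LF; rewrite /Defs.inner -cintegral_sum => [|i Pi]; last first.
  by apply: cintegrable_inner => //; exact: LF.
by apply: eq_cintegral => x; rewrite mulr_sumr.
Qed.

Lemma inner_suml (I : Type) (s : seq I) (P : pred I) (F : I -> T -> R[i]) f :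
  L2 f -> (forall i, P i -> L2 (F i)) ->
  inner (fun x => \sum_(i <- s | P i) F i x) f =
  \sum_(i <- s | P i) inner (F i) f.
Proof.
move=> Lf LF; rewrite innerC//; last exact: L2_sum.
rewrite inner_sumr// cconj_sum; apply: eq_bigr => i Pi.
by rewrite -innerC//; exact: LF.
Qed.

Lemma innerE f : inner f f = (nsq f)%:C.
Proof.
rewrite /Defs.inner /cintegral.
have -> : (fun x => Re ((f x)^* * f x)) = (fun x => cmod (f x) ^+ 2).
  by apply/funext => x; rewrite mulJz.
have -> : (fun x => Im ((f x)^* * f x)) = cst 0.
  by apply/funext => x; rewrite mulJz.
by rewrite Rintegral_cst// mul0r.
Qed.

Lemma nsqZ c f : L2 f -> nsq (fun x => c * f x) = cmod c ^+ 2 * nsq f.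
Proof.
move=> Lf; rewrite /nsq -RintegralZl//; last exact: L2_int.
by apply: eq_Rintegral => x _; rewrite cmodM exprMn.
Qed.

Lemma nsqD f g : L2 f -> L2 g ->
  nsq (fun x => f x + g x) = nsq f + 2 * Re (inner f g) + nsq g.
Proof.
move=> Lf Lg; have : inner (fun x => f x + g x) (fun x => f x + g x) =
    inner f f + inner f g + (inner f g)^* + inner g g.
  rewrite innerDl//; last exact: L2D.
  by rewrite !innerDr// -innerC// !addrA.
rewrite !innerE => /(congr1 (@complex.Re R)); rewrite !ReImE/= => ->; ring.
Qed.

Lemma nsqB f g : L2 f -> L2 g ->
  nsq (fun x => f x - g x) = nsq f - 2 * Re (inner f g) + nsq g.
Proof.
move=> Lf Lg; have := nsqD Lf (L2N Lg); rewrite innerNr// ReN => ->.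
rewrite (_ : nsq (fun x => - g x) = nsq g) ?mulrN//.
by apply: eq_Rintegral => x _; rewrite cmodN.
Qed.

Lemma ae_eq_L2 f g : cmeasurable_fun g -> ae_eq mu setT f g -> L2 f -> L2 g.
Proof.
move=> mg fg Lf; apply: L2I => //; have mf := L2_meas Lf.
have <- : (\int[mu]_x (cmod (f x) ^+ 2)%:E = \int[mu]_x (cmod (g x) ^+ 2)%:E)%E.
  apply: ae_eq_integral => //; try exact/measurable_EFinP/cmeas_cmod2.
  by move: fg; apply: filterS => x /= h /h ->.
exact: integrable_lty (L2_int Lf).
Qed.

Lemma ae_eq_inner f g h : L2 h -> L2 f -> L2 g -> ae_eq mu setT f g ->
  inner h f = inner h g.
Proof.
move=> Lh Lf Lg fg; apply: ae_eq_cintegral.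
- exact/cintegrable_meas/cintegrable_inner.
- exact/cintegrable_meas/cintegrable_inner.
- by move: fg; apply: filterS => x /= e /e ->.
Qed.

Lemma ae_eq_nsq f g : cmeasurable_fun f -> cmeasurable_fun g ->
  ae_eq mu setT f g -> nsq f = nsq g.
Proof.
move=> mf mg fg; congr fine; apply: ae_eq_integral => //.
- exact/measurable_EFinP/cmeas_cmod2.
- exact/measurable_EFinP/cmeas_cmod2.
- by move: fg; apply: filterS => x /= h /h ->.
Qed.

Lemma ae_eq_nrm f g : cmeasurable_fun f -> cmeasurable_fun g ->
  ae_eq mu setT f g -> nrm f = nrm g.
Proof. by move=> mf mg fg; rewrite /nrm (ae_eq_nsq mf mg fg). Qed.

Lemma nsq_eq0 f : L2 f -> nsq f = 0 -> ae_eq mu setT f (fun=> 0).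
Proof.
move=> Lf f0.
have : (\int[mu]_x `|(cmod (f x) ^+ 2)%:E| = 0)%E.
  under eq_integral do rewrite gee0_abs ?lee_fin ?sqr_ge0//.
  by rewrite -nsqE// f0.
have mf : measurable_fun setT (fun x => (cmod (f x) ^+ 2)%:E).
  exact/measurable_EFinP/cmeas_cmod2/L2_meas.
move/(ae_eq_integral_abs mu measurableT mf); apply: filterS => x /= h _.
by move: (h I) => /eqP; rewrite eqe sqrf_eq0 cmod_eq0 => /eqP.
Qed.

Lemma nrm_eq0 f : L2 f -> nrm f = 0 -> ae_eq mu setT f (fun=> 0).
Proof. by move=> Lf f0; apply: nsq_eq0 => //; rewrite -nrm2 f0 expr0n. Qed.

Lemma nsq0 : nsq (fun=> 0) = 0.
Proof. by rewrite /nsq; under eq_Rintegral do rewrite cmod0 expr0n/=; rewrite Rintegral_cst// mul0r. Qed.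

(** Positivity of the squared norm of <f,f> g - <f,g> f, divided by <f,f>. When <f,f> = 0, [f]
    vanishes almost everywhere and so does the pairing. *)
Lemma cauchy_schwarz2 f g : L2 f -> L2 g ->
  cmod (inner f g) ^+ 2 <= nsq f * nsq g.
Proof.
move=> Lf Lg; set c := inner f g.
have [f0|f0] := eqVneq (nsq f) 0.
  suff -> : c = 0 by rewrite cmod0 expr0n/= f0 mul0r.
  rewrite /c innerC// (ae_eq_inner Lg Lf L2_0) ?inner0r ?conjC0//.
  exact: nsq_eq0.
have fp : 0 < nsq f by rewrite lt_neqAle eq_sym f0 nsq_ge0.
have := nsq_ge0 (fun x => (nsq f)%:C * g x - c * f x).
rewrite nsqB; [|exact: L2Z|exact: L2Z].
rewrite innerZl ?innerZr//; last exact: L2Z.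
rewrite (innerC Lg Lf) -/c !nsqZ// cmodR real_normK ?num_real//.
rewrite conjR [c * _]mulrC mulJz -rmorphM/= => h.
have : 0 <= nsq f * (nsq f * nsq g - cmod c ^+ 2) by move: h; lra.
by rewrite pmulr_rge0// subr_ge0.
Qed.

Lemma cauchy_schwarz f g : L2 f -> L2 g -> cmod (inner f g) <= nrm f * nrm g.
Proof.
move=> Lf Lg; rewrite -(@ler_pXn2r _ 2)// ?nnegrE ?mulr_ge0 ?nrm_ge0 ?cmod_ge0//.
by rewrite exprMn !nrm2; exact: cauchy_schwarz2.
Qed.

Lemma nrmD f g : L2 f -> L2 g -> nrm (fun x => f x + g x) <= nrm f + nrm g.
Proof.
move=> Lf Lg.
rewrite -(@ler_pXn2r _ 2)// ?nnegrE ?addr_ge0 ?nrm_ge0// nrm2 nsqD// -!nrm2.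
have := cauchy_schwarz Lf Lg; have := Re_le_cmod (inner f g).
have := ler_norm (Re (inner f g)); nra.
Qed.

Lemma nrmZ c f : L2 f -> nrm (fun x => c * f x) = cmod c * nrm f.
Proof.
move=> Lf; rewrite /nrm nsqZ// sqrtrM ?sqr_ge0// sqrtr_sqr ger0_norm//.
exact: cmod_ge0.
Qed.

Lemma nrmN f : nrm (fun x => - f x) = nrm f.
Proof.
by congr Num.sqrt; apply: eq_Rintegral => x _; rewrite cmodN.
Qed.

Lemma nrmB f g : L2 f -> L2 g -> nrm (fun x => f x - g x) <= nrm f + nrm g.
Proof. by move=> Lf Lg; rewrite -(nrmN g); apply: nrmD => //; exact: L2N. Qed.

Lemma nrm_distC f g : nrm (fun x => f x - g x) = nrm (fun x => g x - f x).
Proof.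
by congr Num.sqrt; apply: eq_Rintegral => x _; rewrite cmodB.
Qed.

Lemma nrm_dist_tri g f h : L2 f -> L2 g -> L2 h ->
  nrm (fun x => f x - h x) <= nrm (fun x => f x - g x) + nrm (fun x => g x - h x).
Proof.
move=> Lf Lg Lh; rewrite [X in X <= _](_ : _ =
  nrm (fun x => (f x - g x) + (g x - h x))); first by apply: nrmD; exact: L2B.
by congr nrm; apply/funext => x; rewrite addrA subrK.
Qed.

Lemma nrm_le_sum (I : Type) (s : seq I) (P : pred I) (F : I -> T -> R[i]) :
  (forall i, P i -> L2 (F i)) ->
  nrm (fun x => \sum_(i <- s | P i) F i x) <= \sum_(i <- s | P i) nrm (F i).
Proof.
move=> LF; elim: s => [|i s IH].
  rewrite big_nil; under eq_fun do rewrite big_nil.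
  by rewrite /nrm nsq0 sqrtr0.
under eq_fun do rewrite big_cons; rewrite big_cons; case: (boolP (P i)) => // Pi.
apply: le_trans (nrmD (LF _ Pi) _) _; first exact: L2_sum.
by rewrite lerD2l.
Qed.

Section orthonormal.
Variables (I : eqType) (e : I -> T -> R[i]).
Hypothesis Le : forall i, L2 (e i).
Hypothesis oe : forall i j, inner (e i) (e j) = (i == j)%:R.

Definition proj (s : seq I) f : T -> R[i] :=
  fun x => \sum_(i <- s) inner (e i) f * e i x.

Lemma L2_proj s f : L2 (proj s f).
Proof. by apply: L2_sum => i _; exact: L2Z. Qed.

Lemma inner_proj s f j : uniq s ->
  inner (e j) (proj s f) = if j \in s then inner (e j) f else 0.
Proof.
move=> us; rewrite inner_sumr// => [|i _]; last exact: L2Z.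
under eq_bigr do rewrite innerZr// oe.
case: ifPn => js.
  rewrite (bigD1_seq j)//= eqxx mulr1 big1 ?addr0// => i ij.
  by rewrite eq_sym (negbTE ij) mulr0.
rewrite big_seq big1// => i /[dup] si.
by have [<-|_] := eqVneq j i; rewrite ?mulr0// (negbTE js).
Qed.

Lemma inner_projl s f g : L2 g ->
  inner (proj s f) g = \sum_(i <- s) (inner (e i) f)^* * inner (e i) g.
Proof.
move=> Lg; rewrite inner_suml// => [|i _]; last exact: L2Z.
by apply: eq_bigr => i _; rewrite innerZl.
Qed.

Lemma nsq_proj s f : uniq s ->
  nsq (proj s f) = \sum_(i <- s) cmod (inner (e i) f) ^+ 2.
Proof.
move=> us; have := innerE (proj s f); rewrite inner_projl; last exact: L2_proj.
rewrite big_seq; under eq_bigr => i si do rewrite inner_proj// si mulJz.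
by rewrite -big_seq -rmorph_sum/= => /complexI.
Qed.

Lemma nsq_sub_proj s f : uniq s -> L2 f ->
  nsq (fun x => f x - proj s f x) = nsq f - \sum_(i <- s) cmod (inner (e i) f) ^+ 2.
Proof.
move=> us Lf; have Lp := L2_proj s f; rewrite nsqB// innerC// ReJ inner_projl//.
under eq_bigr do rewrite mulJz.
by rewrite -rmorph_sum/= nsq_proj//; ring.
Qed.

Lemma bessel s f : uniq s -> L2 f ->
  \sum_(i <- s) cmod (inner (e i) f) ^+ 2 <= nsq f.
Proof. by move=> us Lf; rewrite -subr_ge0 -nsq_sub_proj// nsq_ge0. Qed.

Lemma nsq_projB s t f : uniq s -> uniq t -> {subset s <= t} -> L2 f ->
  nsq (fun x => proj t f x - proj s f x) =
  \sum_(i <- t) cmod (inner (e i) f) ^+ 2 - \sum_(i <- s) cmod (inner (e i) f) ^+ 2.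
Proof.
move=> us ut st Lf; have Ls := L2_proj s f; have Lt := L2_proj t f.
rewrite nsqB// innerC// ReJ inner_projl// big_seq.
under eq_bigr => i si do rewrite inner_proj// st// mulJz.
by rewrite -big_seq -rmorph_sum/= !nsq_proj//; ring.
Qed.

End orthonormal.
End L2_space.

(** * Completeness of L^2 *)

Section L2_completeness.
Context d (T : measurableType d) (R : realType).
Variable mu : {measure set T -> \bar R}.
Local Notation L2 := (L2 mu).
Local Notation nrm := (nrm mu).

(** The limit need only exist almost everywhere, where it agrees with the lower limit in Fatou's
    lemma. *)
Lemma fatou_le (F : nat -> T -> \bar R) (f : T -> \bar R) (B : \bar R) :
  (forall n, measurable_fun setT (F n)) -> (forall n x, (0 <= F n x)%E) ->
  measurable_fun setT f ->
  {ae mu, forall x, F n x @[n --> \oo] --> f x} ->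
  (forall n, (\int[mu]_x F n x <= B)%E) -> (\int[mu]_x f x <= B)%E.
Proof.
move=> mF F0 mf Ff FB.
have -> : (\int[mu]_x f x = \int[mu]_x limn_einf (F^~ x))%E.
  apply: ae_eq_integral => //; last first.
    by move: Ff; apply: filterS => x h _; rewrite (cvg_limn_einf_sup h).
  rewrite /limn_einf; apply: measurableT_comp => //.
  by apply: measurable_fun_limn_esup => n; exact: measurableT_comp.
apply: le_trans (fatou mu measurableT mF _) _ => //.
rewrite limn_einf_lim; apply: lime_le; first exact: is_cvg_einfs.
apply: nearW => n; apply: le_trans (FB n).
by apply: ereal_inf_lbound; exists n => //=.
Qed.

(* A dominating integrable series replaces Minkowski's inequality: if
   the increments satisfy [nrm <= 4^-k], then [\sum_k 4^k |increment_k|^2] is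
   finite almost everywhere, which forces geometric decay. *)
Lemma L2_fast_cauchy (g : nat -> T -> R[i]) :
  (forall k, L2 (g k)) ->
  (forall k, nrm (fun x => g k.+1 x - g k x) <= (4^-1) ^+ k) ->
  {ae mu, forall x, cvgn (fun k => Re (g k x)) /\ cvgn (fun k => Im (g k x))}.
Proof.
move=> Lg dg.
pose D k x := 4 ^+ k * cmod (g k.+1 x - g k x) ^+ 2 : R.
have D0 k x : 0 <= D k x by rewrite mulr_ge0 ?sqr_ge0 ?exprn_ge0.
have LD k : L2 (fun x => g k.+1 x - g k x) by exact: L2B.
have iD k : mu.-integrable setT (fun x => (D k x)%:E).
  exact/integrable_scale/L2_int.
have mD k : measurable_fun setT (fun x => (D k x)%:E).
  exact: measurable_int (iD k).
have ID k : (\int[mu]_x (D k x)%:E <= ((4^-1) ^+ k)%:E)%E.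
  under eq_integral do rewrite EFinM.
  rewrite (integralZl measurableT (L2_int (LD k))).
  rewrite -nsqE// -EFinM lee_fin -nrm2.
  apply: (@le_trans _ _ (4 ^+ k * ((4^-1) ^+ k) ^+ 2)).
    by rewrite ler_pM2l ?exprn_gt0// ler_pXn2r ?nnegrE ?nrm_ge0 ?exprn_ge0.
  by rewrite expr2 mulrA -exprMn divff ?expr1n ?mul1r.
have sumI n : (\sum_(0 <= k < n) (4^-1) ^+ k : R) = (4 / 3) * (1 - (4^-1) ^+ n).
  elim: n => [|n IH]; first by rewrite big_geq// expr0 subrr mulr0.
  by rewrite big_nat_recr//= IH exprS; field.
have Soo : (\int[mu]_x (\sum_(0 <= k <oo) (D k x)%:E) < +oo)%E.
  rewrite (integral_nneseries mu measurableT mD); last by move=> k x _; rewrite lee_fin; exact: D0.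
  apply: (@le_lt_trans _ _ (4 / 3)%:E); last exact: ltry.
  apply: lime_le; first by apply: is_cvg_nneseries => *; apply: integral_ge0 => *; rewrite lee_fin; exact: D0.
  apply: nearW => n; apply: (@le_trans _ _ (\sum_(0 <= k < n) ((4^-1) ^+ k)%:E)%E).
    by apply: lee_sum => k _; exact: ID.
  rewrite sumEFin lee_fin sumI ler_piMr// gerBl exprn_ge0//.
have mS : measurable_fun setT (fun x => (\sum_(0 <= k <oo) (D k x)%:E)%E).
  apply: ge0_emeasurable_sum => [k x _ _|k _]; [by rewrite lee_fin; exact: D0|exact: mD].
have S0 x : (0 <= \sum_(0 <= k <oo) (D k x)%:E)%E.
  by apply: nneseries_ge0 => *; rewrite lee_fin.
have iS : mu.-integrable setT (fun x => (\sum_(0 <= k <oo) (D k x)%:E)%E).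
  by apply/integrableP; split => //; under eq_integral do rewrite gee0_abs//.
have := integrable_ae measurableT iS; apply: filterS => x /(_ I) fx.
pose B : R := fine (\sum_(0 <= k <oo) (D k x)%:E)%E.
have B0 : 0 <= B by exact: fine_ge0.
(* Every term of a convergent non-negative series is below its sum [B], so the increments at [x] are
   at most sqrt(B) 2^-k. *)
have DB k : D k x <= B.
  rewrite -lee_fin fineK//.
  rewrite (nneseries_split 0 k.+1)//; last by move=> *; rewrite lee_fin.
  rewrite add0n big_nat_recr//= -addeA.
  apply: le_trans (leeDr _ (sume_ge0 _ _)); last by move=> *; rewrite lee_fin.
  by rewrite leeDl//; apply: nneseries_ge0 => *; rewrite lee_fin.
pose C := Num.sqrt B.
have geo k : cmod (g k.+1 x - g k x) <= C * (2^-1) ^+ k.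
  rewrite -(@ler_pXn2r _ 2)// ?nnegrE ?cmod_ge0 ?mulr_ge0 ?sqrtr_ge0 ?exprn_ge0//.
  rewrite exprMn sqr_sqrtr// -(@ler_pM2l _ (4 ^+ k)) ?exprn_gt0//.
  apply: le_trans (DB k) _; rewrite mulrCA -exprM mulnC exprM -exprMn.
  by rewrite (_ : 4 * (2^-1) ^+ 2 = 1 :> R) ?expr1n ?mulr1//; field.
have cv (a : nat -> R) : (forall k, `|a k.+1 - a k| <= C * (2^-1) ^+ k) -> cvgn a.
  move=> ha.
  have -> : a = (fun n => a 0%N + series (fun k => a k.+1 - a k) n).
    by apply/funext => n; rewrite /series/= telescope_sumr// addrC subrK.
  apply: is_cvgD; first exact: is_cvg_cst.
  apply: normed_cvg; apply: (@series_le_cvg _ _ (geometric C 2^-1)).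
  - by move=> n /=.
  - by move=> n /=; rewrite mulr_ge0 ?sqrtr_ge0 ?exprn_ge0.
  - by move=> n /=; exact: ha.
  - by apply: is_cvg_geometric_series; rewrite ger0_norm// invf_lt1// ltr1n.
split; apply: cv => k.
- by apply: le_trans (geo k); rewrite -ReN -ReD; exact: Re_le_cmod.
- by apply: le_trans (geo k); rewrite -ImN -ImD; exact: Im_le_cmod.
Qed.

Lemma cmod2_cvg (a : nat -> R[i]) (z : R[i]) :
  Re (a n) @[n --> \oo] --> Re z -> Im (a n) @[n --> \oo] --> Im z ->
  cmod (a n) ^+ 2 @[n --> \oo] --> cmod z ^+ 2.
Proof.
move=> h1 h2; rewrite cmod2E; under eq_fun do rewrite cmod2E.
by apply: cvgD; rewrite expr2; under eq_fun do rewrite expr2; exact: cvgM.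
Qed.

(** The almost-everywhere limit inherits the bound through Fatou's lemma applied to |g_m - g_k|^2 as
    m grows; it is square integrable because u - g_0 and g_0 are. *)
Lemma L2_fast_limit (g : nat -> T -> R[i]) :
  (forall k, L2 (g k)) ->
  (forall k m, (k <= m)%N -> nrm (fun x => g m x - g k x) <= (4^-1) ^+ k) ->
  exists2 u, L2 u & forall k, nrm (fun x => u x - g k x) <= (4^-1) ^+ k.
Proof.
move=> Lg dg.
have [Z [mZ Z0 sZ]] := L2_fast_cauchy Lg (fun k => dg k k.+1 (leqnSn k)).
(* Set to 0 on the null set [Z], [u] is everywhere the limit of g_k times the indicator of the
   complement of [Z], hence measurable. *)
pose u x : R[i] := if x \in Z then 0 else
  limn (fun k => Re (g k x)) +i* limn (fun k => Im (g k x)).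
have cu x : x \notin Z ->
    (Re (g k x) @[k --> \oo] --> Re (u x)) /\ (Im (g k x) @[k --> \oo] --> Im (u x)).
  move=> xZ; have [h1 h2] : cvgn (fun k => Re (g k x)) /\ cvgn (fun k => Im (g k x)).
    by apply/not_notP => h; move/negP: xZ; rewrite inE; apply; exact: sZ.
  by rewrite /u (negbTE xZ).
have mZc : measurable (~` Z) by exact: measurableC.
have mg k := L2_meas (Lg k).
have mu1 : cmeasurable_fun u.
  have mind : measurable_fun setT (\1_(~` Z) : T -> R) by exact: measurable_indic.
  have ind x : \1_(~` Z) x = (x \notin Z)%:R :> R by rewrite indicE in_setC.
  split.
  - apply: (@measurable_fun_cvg _ _ _ _ (fun k x => Re (g k x) * \1_(~` Z) x)).
      by move=> k; apply: measurable_funM => //; case: (mg k).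
    move=> x _; rewrite ind; case: (boolP (x \in Z)) => xZ /=.
      rewrite /u xZ /=; under eq_fun do rewrite mulr0; exact: cvg_cst.
    by under eq_fun do rewrite mulr1; have [] := cu _ xZ.
  - apply: (@measurable_fun_cvg _ _ _ _ (fun k x => Im (g k x) * \1_(~` Z) x)).
      by move=> k; apply: measurable_funM => //; case: (mg k).
    move=> x _; rewrite ind; case: (boolP (x \in Z)) => xZ /=.
      rewrite /u xZ /=; under eq_fun do rewrite mulr0; exact: cvg_cst.
    by under eq_fun do rewrite mulr1; have [] := cu _ xZ.
have fat k : (\int[mu]_x (cmod (u x - g k x) ^+ 2)%:E <= (((4^-1) ^+ k) ^+ 2)%:E)%E.
  apply: (@fatou_le (fun m x => (cmod (g (m + k)%N x - g k x) ^+ 2)%:E)).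
  - by move=> m; exact/measurable_EFinP/cmeas_cmod2/cmeasB.
  - by move=> m x; rewrite lee_fin sqr_ge0.
  - exact/measurable_EFinP/cmeas_cmod2/cmeasB.
  - exists Z; split => // x /= xF; apply/not_notP => nZ; apply: xF.
    have [h1 h2] : (Re (g k x) @[k --> \oo] --> Re (u x)) /\
        (Im (g k x) @[k --> \oo] --> Im (u x)).
      by apply: cu; apply/negP; rewrite inE.
    apply: cvg_EFin; first by apply: nearW.
    apply: cmod2_cvg; rewrite !ReImE; under eq_fun do rewrite !ReImE; apply: cvgB;
      try exact: cvg_cst.
    + by move: h1; rewrite -(cvg_shiftn k).
    + by move: h2; rewrite -(cvg_shiftn k).
  - move=> m; have LB : L2 (fun x => g (m + k)%N x - g k x) by exact: L2B.
    rewrite -nsqE// lee_fin -nrm2 ler_pXn2r ?nnegrE ?nrm_ge0 ?exprn_ge0//.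
    by apply: dg; exact: leq_addl.
have Ld k : L2 (fun x => u x - g k x).
  by apply: L2I; [exact: cmeasB|exact: le_lt_trans (fat k) (ltry _)].
exists u.
  have := L2D (Ld 0%N) (Lg 0%N); congr L2.
  by apply/funext => x; rewrite subrK.
move=> k; rewrite -(@ler_pXn2r _ 2)// ?nnegrE ?nrm_ge0 ?exprn_ge0//.
by rewrite nrm2 -lee_fin nsqE.
Qed.

Lemma L2_complete (f : nat -> T -> R[i]) : (forall n, L2 (f n)) ->
  (forall eps : R, 0 < eps -> exists N, forall m n, (N <= m)%N -> (N <= n)%N ->
    nrm (fun x => f m x - f n x) <= eps) ->
  exists2 u, L2 u & nrm (fun x => f n x - u x) @[n --> \oo] --> (0 : R).
Proof.
move=> Lf cf.
have /choice[N hN] k : exists N, forall m n, (N <= m)%N -> (N <= n)%N ->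
    nrm (fun x => f m x - f n x) <= (4^-1) ^+ k.
  by apply: cf; rewrite exprn_gt0// invr_gt0.
(* Summing the thresholds yields an index beyond all of [N 0], ..., [N k]. *)
pose phi k := (\sum_(i < k.+1) N i)%N.
have Nphi k m : (k <= m)%N -> (N k <= phi m)%N.
  move=> km; rewrite /phi (bigD1 (inord k))//= inordK// leq_addr//.
have [u Lu hu] := @L2_fast_limit (fun k => f (phi k)) (fun k => Lf (phi k))
  (fun k m km => hN k (phi m) (phi k) (Nphi k m km) (Nphi k k (leqnn k))).
exists u => //; apply/cvgrPdist_le => eps e0.
have [k hk] : exists k, 2 * (4^-1) ^+ k <= eps.
  have := @cvg_expr R (4^-1); rewrite ger0_norm// invf_lt1// ltr1n => /(_ isT).
  move/cvgrPdist_le => /(_ (eps / 2)); rewrite divr_gt0// => /(_ isT)[k _ /(_ k (leqnn k))].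
  rewrite sub0r normrN ger0_norm ?exprn_ge0// => h.
  by exists k; rewrite mulrC -ler_pdivlMr.
exists (phi k) => // n /= kn; rewrite sub0r normrN ger0_norm ?nrm_ge0//.
apply: le_trans hk; apply: le_trans (nrm_dist_tri (Lf n) (Lf (phi k)) Lu) _.
rewrite mulr_natl mulr2n; apply: lerD; last by rewrite nrm_distC.
by apply: hN; [exact: leq_trans (Nphi k k _) kn|exact: Nphi].
Qed.

End L2_completeness.

(** * Monotone sequences and Parseval's identity *)

Section real_sequences.
Context {R : realType}.
Implicit Types (a : nat -> R).

Lemma cvg_dist a l : a n @[n --> \oo] --> l -> forall eps, 0 < eps ->
  exists N, forall n, (N <= n)%N -> `|a n - l| <= eps.
Proof.
move=> /cvgrPdist_le al eps /al [N _ hN]; exists N => n Nn.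
by rewrite distrC; exact: hN.
Qed.

Lemma cvg_le_bound a l B : a n @[n --> \oo] --> l -> (forall n, a n <= B) -> l <= B.
Proof.
move=> al aB; rewrite -(cvg_lim (@Rhausdorff R) al).
by apply: limr_le; [apply/cvg_ex; exists l|exact: nearW].
Qed.

Lemma nondecreasing_bounded_cauchy a (B : R) :
  {homo a : m n / (m <= n)%N >-> m <= n} -> (forall n, a n <= B) ->
  forall eps, 0 < eps -> exists N, forall m n, (N <= m)%N -> (m <= n)%N ->
    a n - a m <= eps.
Proof.
move=> nda aB eps e0.
have /cvg_ex[l al] : cvgn a.
  by apply: nondecreasing_is_cvgn => //; exists B => _ [n _ <-].
have [N hN] := cvg_dist al (divr_gt0 e0 (ltr0n R 2)).
exists N => m n Nm mn.
have := hN n (leq_trans Nm mn); have := hN m Nm.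
by rewrite !ler_norml; lra.
Qed.

End real_sequences.

Section parseval.
Context d (T : measurableType d) (R : realType).
Variable mu : {measure set T -> \bar R}.
Local Notation L2 := (L2 mu).
Local Notation inner := (inner mu).
Local Notation nrm := (nrm mu).
Local Notation nsq := (nsq mu).

(** Totality: only 0 is orthogonal to the family. Neither orthonormality nor a countable index is
    built in, so bumps, characters and their products are all covered. *)
Definition separating (I : Type) (e : I -> T -> R[i]) :=
  forall f, L2 f -> (forall i, inner (e i) f = 0) -> ae_eq mu setT f (fun=> 0).

Variables (I : eqType) (e : I -> T -> R[i]) (F : nat -> seq I).
Hypothesis Le : forall i, L2 (e i).
Hypothesis oe : forall i j, inner (e i) (e j) = (i == j)%:R.
Hypothesis se : separating e.
Hypothesis uF : forall n, uniq (F n).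
Hypothesis ndF : forall m n, (m <= n)%N -> {subset F m <= F n}.
Hypothesis cF : forall i, exists n, i \in F n.

Lemma proj_cauchy f : L2 f -> forall eps : R, 0 < eps -> exists N,
  forall m n, (N <= m)%N -> (N <= n)%N ->
    nrm (fun x => proj mu e (F m) f x - proj mu e (F n) f x) <= eps.
Proof.
move=> Lf eps e0.
pose a n := \sum_(i <- F n) cmod (inner (e i) f) ^+ 2.
have aE m n : (m <= n)%N ->
    nsq (fun x => proj mu e (F n) f x - proj mu e (F m) f x) = a n - a m.
  by move=> mn; rewrite (nsq_projB Le oe)//; exact: ndF.
have nda : {homo a : m n / (m <= n)%N >-> m <= n}.
  by move=> m n mn; rewrite -subr_ge0 -aE// nsq_ge0.
have [|N hN] := nondecreasing_bounded_cauchy nda (fun n => bessel Le oe (uF n) Lf) (eps := eps ^+ 2).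
  by rewrite exprn_gt0.
exists N => m n Nm Nn.
wlog mn : m n Nm Nn / (n <= m)%N => [hw|].
  by have [|/ltnW] := leqP n m; [exact: hw|rewrite nrm_distC; exact: hw].
rewrite -(@ler_pXn2r _ 2)// ?nnegrE ?nrm_ge0 ?(ltW e0)// nrm2 aE//.
exact: hN.
Qed.

(** The projections are Cauchy by Bessel, hence converge to some [u]; the defect f - u is orthogonal
    to each member of the family, so it vanishes by totality. *)
Lemma proj_cvg f : L2 f ->
  nrm (fun x => f x - proj mu e (F n) f x) @[n --> \oo] --> (0 : R).
Proof.
move=> Lf.
have Lp n : L2 (proj mu e (F n) f) by exact: L2_proj.
have [u Lu uf] := L2_complete Lp (proj_cauchy Lf).
suff fu : ae_eq mu setT (fun x => f x - u x) (fun=> 0).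
  have -> : (fun n => nrm (fun x => f x - proj mu e (F n) f x)) =
      (fun n => nrm (fun x => proj mu e (F n) f x - u x)); last exact: uf.
  apply/funext => n; rewrite nrm_distC; apply: ae_eq_nrm.
  - exact: cmeasB (L2_meas (Lp n)) (L2_meas Lf).
  - exact: cmeasB (L2_meas (Lp n)) (L2_meas Lu).
  - by move: fu; apply: filterS => x /= h /h /eqP; rewrite subr_eq0 => /eqP ->.
apply: se; first exact: L2B.
move=> i; apply/eqP; rewrite -cmod_eq0 eq_le cmod_ge0 andbT.
rewrite innerBr//.
have [n0 in0] := cF i.
apply/ler_addgt0Pl => eps e0; rewrite addr0.
have ke : 0 < eps / (nrm (e i) + 1) by rewrite divr_gt0// ltr_wpDl ?nrm_ge0.
have [N hN] := cvg_dist uf ke.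
have := hN (maxn N n0) (leq_maxl _ _).
rewrite subr0 ger0_norm ?nrm_ge0// => h.
have ip : inner (e i) (proj mu e (F (maxn N n0)) f) = inner (e i) f.
  by rewrite (inner_proj Le oe)// (ndF (leq_maxr N n0) in0).
rewrite -ip -innerBr//.
apply: le_trans (cauchy_schwarz (Le i) (L2B (Lp (maxn N n0)) Lu)) _.
apply: (@le_trans _ _ (nrm (e i) * (eps / (nrm (e i) + 1)))).
  by rewrite ler_wpM2l ?nrm_ge0.
rewrite mulrCA ler_piMr ?(ltW e0)// ler_pdivrMr ?mul1r ?lerDl//.
by rewrite ltr_wpDl ?nrm_ge0.
Qed.

Lemma parseval_cvg f : L2 f ->
  \sum_(i <- F n) cmod (inner (e i) f) ^+ 2 @[n --> \oo] --> nsq f.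
Proof.
move=> Lf; have h := proj_cvg Lf.
have -> : (fun n => \sum_(i <- F n) cmod (inner (e i) f) ^+ 2) =
    (fun n => nsq f - nrm (fun x => f x - proj mu e (F n) f x) ^+ 2).
  by apply/funext => n; rewrite nrm2 (nsq_sub_proj Le oe)//; ring.
rewrite -[X in _ --> X]subr0; apply: cvgB; first exact: cvg_cst.
rewrite -[X in _ --> X](mulr0 0); under eq_fun do rewrite expr2.
exact: cvgM.
Qed.

(** By Parseval the squared residual is the sum of the squared coefficients with index outside [s],
    which the exhausting sets [F n] reach in the limit. *)
Lemma nsq_sub_proj_le f s (B : R) : L2 f -> uniq s ->
  (forall n, \sum_(i <- F n | i \notin s) cmod (inner (e i) f) ^+ 2 <= B) ->
  nsq (fun x => f x - proj mu e s f x) <= B.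
Proof.
move=> Lf us hB; rewrite (nsq_sub_proj Le oe)//.
rewrite lerBlDr; apply: (cvg_le_bound (parseval_cvg Lf)) => n.
rewrite (bigID (fun i => i \notin s))/= lerD//.
under eq_bigl do rewrite negbK.
rewrite -big_filter; apply: (@le_trans _ _ (\sum_(i <- s | i \in [seq i <- F n | i \in s]) cmod (inner (e i) f) ^+ 2)).
  rewrite -[leRHS]big_filter le_eqVlt; apply/orP; left; apply/eqP/perm_big.
  apply: uniq_perm; rewrite ?filter_uniq// => i.
  by rewrite !mem_filter; case: (i \in s); rewrite ?andbT ?andbF.
rewrite big_mkcond/=; apply: ler_sum => i _; case: ifP => // _; exact: sqr_ge0.
Qed.

End parseval.

(** * Fubini's theorem for complex integrands *)

Section complex_fubini.
Context d1 d2 (T1 : measurableType d1) (T2 : measurableType d2) (R : realType).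

Lemma cmeas_section1 (F : T1 * T2 -> R[i]) x :
  cmeasurable_fun F -> cmeasurable_fun (fun y => F (x, y)).
Proof. by move=> mF; apply: (cmeas_comp mF); exact: measurable_pair1. Qed.

Lemma cmeas_section2 (F : T1 * T2 -> R[i]) y :
  cmeasurable_fun F -> cmeasurable_fun (fun x => F (x, y)).
Proof. by move=> mF; apply: (cmeas_comp mF); exact: measurable_pair2. Qed.

Lemma cmeas_fst (f : T1 -> R[i]) :
  cmeasurable_fun f -> cmeasurable_fun (fun p : T1 * T2 => f p.1).
Proof. by move=> mf; exact: (cmeas_comp mf). Qed.

Lemma cmeas_snd (f : T2 -> R[i]) :
  cmeasurable_fun f -> cmeasurable_fun (fun p : T1 * T2 => f p.2).
Proof. by move=> mf; exact: (cmeas_comp mf). Qed.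

Variable m2 : {sigma_finite_measure set T2 -> \bar R}.

Lemma measurable_Rintegral_section (f : T1 * T2 -> R) : measurable_fun setT f ->
  measurable_fun setT (fun x => Rintegral m2 setT (fun y => f (x, y))).
Proof.
move=> mf.
have mef : measurable_fun setT (EFin \o f) by exact/measurable_EFinP.
have mF : measurable_fun setT (fun x => \int[m2]_y (f (x, y))%:E)%E.
  have -> : (fun x => \int[m2]_y (f (x, y))%:E)%E =
      (fubini_F m2 (EFin \o f)^\+ \- fubini_F m2 (EFin \o f)^\-)%E.
    apply/funext=> x; rewrite [LHS]integralE.
    rewrite /fubini_F; congr (_ - _)%E; apply: eq_integral => y _.
    - by rewrite !funeposE.
    - by rewrite !funenegE.
  apply: emeasurable_funB.
  - by apply: measurable_fun_fubini_tonelli_F => //; exact: measurable_funepos.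
  - by apply: measurable_fun_fubini_tonelli_F => //; exact: measurable_funeneg.
by apply: measurableT_comp => //; exact: fine_measurable.
Qed.

Lemma cmeas_cintegral (F : T1 * T2 -> R[i]) : cmeasurable_fun F ->
  cmeasurable_fun (fun x => cintegral m2 (fun y => F (x, y))).
Proof.
by move=> [F1 F2]; split;
  [exact: (measurable_Rintegral_section F1)|exact: (measurable_Rintegral_section F2)].
Qed.

Variable m1 : {sigma_finite_measure set T1 -> \bar R}.

(** Almost every section has a finite integral, and there [Rintegral] is the inner integral of
    Fubini's theorem; its default values elsewhere sit on a null set. *)
Lemma Rintegral_fubini1 (f : T1 * T2 -> R) :
  (m1 \x m2)%E.-integrable setT (fun p => (f p)%:E) ->
  m1.-integrable setT (fun x => (Rintegral m2 setT (fun y => f (x, y)))%:E) /\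
  Rintegral (m1 \x m2)%E setT f =
  Rintegral m1 setT (fun x => Rintegral m2 setT (fun y => f (x, y))).
Proof.
move=> jf; have iF := integrable_fubini_F jf.
have mf : measurable_fun setT f.
  by apply/measurable_EFinP; exact: measurable_int jf.
have mr := measurable_Rintegral_section mf.
have ae : ae_eq m1 setT (fubini_F m2 (EFin \o f))
    (fun x => (Rintegral m2 setT (fun y => f (x, y)))%:E).
  have := integrable_ae measurableT iF; apply: filterS => x /= /(_ I) h _.
  by rewrite /Rintegral fineK.
split.
  apply/integrableP; split; first exact/measurable_EFinP.
  have /integrableP[mF Foo] := iF.
  suff <- : (\int[m1]_x `|fubini_F m2 (EFin \o f) x| =
    \int[m1]_x `|(Rintegral m2 setT (fun y => f (x, y)))%:E|)%E by [].
  apply: ae_eq_integral => //.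
  - exact: measurableT_comp.
  - by apply: measurableT_comp => //; exact/measurable_EFinP.
  - by move: ae; apply: filterS => x /= h /h ->.
rewrite {1}/Rintegral -integral12_prod_meas1//; congr fine.
apply: ae_eq_integral => //; [exact: measurable_int iF|exact/measurable_EFinP].
Qed.

Lemma cintegral_fubini1 (F : T1 * T2 -> R[i]) : cintegrable (m1 \x m2)%E F ->
  cintegrable m1 (fun x => cintegral m2 (fun y => F (x, y))) /\
  cintegral (m1 \x m2)%E F = cintegral m1 (fun x => cintegral m2 (fun y => F (x, y))).
Proof.
move=> [F1 F2]; have [i1 e1] := Rintegral_fubini1 F1.
have [i2 e2] := Rintegral_fubini1 F2.
by split; [split|apply: complex_ext].
Qed.

Lemma cintegrable_section1 (F : T1 * T2 -> R[i]) : cintegrable (m1 \x m2)%E F ->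
  {ae m1, forall x, cintegrable m2 (fun y => F (x, y))}.
Proof.
by move=> [F1 F2]; have := ae_integrable1 F2; have := ae_integrable1 F1;
  apply: filterS2 => x; split.
Qed.

End complex_fubini.

Section complex_fubini2.
Context d1 d2 (T1 : measurableType d1) (T2 : measurableType d2) (R : realType).
Variables (m1 : {sigma_finite_measure set T1 -> \bar R})
  (m2 : {sigma_finite_measure set T2 -> \bar R}).

Lemma cmeas_swap (F : T1 * T2 -> R[i]) : cmeasurable_fun F ->
  cmeasurable_fun (fun p : T2 * T1 => F (p.2, p.1)).
Proof. by move=> mF; apply: (cmeas_comp mF); exact: measurable_swap. Qed.

Lemma cintegrable_swap (F : T1 * T2 -> R[i]) : cintegrable (m1 \x m2)%E F ->
  cintegrable (m2 \x m1)%E (fun p => F (p.2, p.1)).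
Proof.
move=> iF; have mF := cintegrable_meas iF; apply: cintegrableP.
  exact: cmeas_swap.
have mc : measurable_fun setT (fun p => (cmod (F p))%:E).
  exact/measurable_EFinP/cmeas_cmod.
have c0 p : (0 <= (cmod (F p))%:E)%E by rewrite lee_fin cmod_ge0.
rewrite (fubini_tonelli1 (fun p => (cmod (F (p.2, p.1)))%:E))//; last first.
  exact/measurable_EFinP/cmeas_cmod/cmeas_swap.
rewrite /fubini_F/= -(fubini_tonelli2 (fun p => (cmod (F p))%:E))//.
exact: integrable_lty (cintegrable_cmod iF).
Qed.

Lemma cintegral_swap (F : T1 * T2 -> R[i]) : cintegrable (m1 \x m2)%E F ->
  cintegral m1 (fun x => cintegral m2 (fun y => F (x, y))) =
  cintegral m2 (fun y => cintegral m1 (fun x => F (x, y))).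
Proof.
move=> iF.
have S (f : T1 * T2 -> R) : (m1 \x m2)%E.-integrable setT (fun p => (f p)%:E) ->
  (m2 \x m1)%E.-integrable setT (fun p => (f (p.2, p.1))%:E) ->
  Rintegral m1 setT (fun x => Rintegral m2 setT (fun y => f (x, y))) =
  Rintegral m2 setT (fun y => Rintegral m1 setT (fun x => f (x, y))).
  move=> jf jf'; rewrite -(Rintegral_fubini1 jf).2 -(Rintegral_fubini1 jf').2.
  rewrite /Rintegral -(integral21_prod_meas1 jf) -(integral12_prod_meas1 jf').
  by [].
have [i1 i2] := iF; have [j1 j2] := cintegrable_swap iF.
apply: complex_ext.
- exact: (S (fun p => Re (F p)) i1 j1).
- exact: (S (fun p => Im (F p)) i2 j2).
Qed.

Lemma cintegral_fubini2 (F : T1 * T2 -> R[i]) : cintegrable (m1 \x m2)%E F ->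
  cintegrable m2 (fun y => cintegral m1 (fun x => F (x, y))) /\
  cintegral (m1 \x m2)%E F = cintegral m2 (fun y => cintegral m1 (fun x => F (x, y))).
Proof.
move=> iF; rewrite (cintegral_fubini1 iF).2 cintegral_swap//; split=> //.
exact: (cintegral_fubini1 (cintegrable_swap iF)).1.
Qed.

Lemma cintegrable_tensor (f : T1 -> R[i]) (g : T2 -> R[i]) (K : T1 * T2 -> R[i]) (B : R) :
  cintegrable m1 f -> cintegrable m2 g -> cmeasurable_fun K ->
  (forall p, cmod (K p) <= B) ->
  cintegrable (m1 \x m2)%E (fun p => K p * (f p.1 * g p.2)).
Proof.
move=> jf jg mK KB.
have mf := cintegrable_meas jf; have mg := cintegrable_meas jg.
have mfg : cmeasurable_fun (fun p : T1 * T2 => f p.1 * g p.2).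
  exact: (@cmeasM _ _ R (fun p => f p.1) (fun p => g p.2) (@cmeas_fst _ _ T1 T2 R f mf) (@cmeas_snd _ _ T1 T2 R g mg)).
have ifg : cintegrable (m1 \x m2)%E (fun p => f p.1 * g p.2).
  apply: cintegrableP => //.
  rewrite (fubini_tonelli1 (fun p => (cmod (f p.1 * g p.2))%:E))//; last 2 first.
    exact/measurable_EFinP/cmeas_cmod.
    by move=> p; rewrite lee_fin cmod_ge0.
  rewrite /fubini_F/=.
  under eq_integral => x _.
    under eq_integral => y _ do rewrite cmodM EFinM.
    rewrite (integralZl measurableT (cintegrable_cmod jg)); over.
  rewrite -(@fineK _ (\int[m2]_y (cmod (g y))%:E)%E); last first.
    exact: integrable_fin_num (cintegrable_cmod jg).
  rewrite (integralZr measurableT (cintegrable_cmod jf)).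
  rewrite -(@fineK _ (\int[m1]_y (cmod (f y))%:E)%E) ?ltry//.
  exact: integrable_fin_num (cintegrable_cmod jf).
apply: (cintegrable_le (h := fun p => B * cmod (f p.1 * g p.2))).
- exact: cmeasM.
- exact/integrable_scale/cintegrable_cmod.
- by move=> p; rewrite cmodM ler_wpM2r ?cmod_ge0.
Qed.

End complex_fubini2.

(** * Complex exponential and roots of unity *)

Section complex_exponential.
Context {R : realType}.
Implicit Types z w : R[i].

Lemma Re_cexp z : Re (cexp z) = expR (Re z) * cos (Im z). Proof. by []. Qed.
Lemma Im_cexp z : Im (cexp z) = expR (Re z) * sin (Im z). Proof. by []. Qed.

Lemma cexpD z w : cexp (z + w) = cexp z * cexp w.
Proof.
apply: complex_ext; rewrite !ReImE !Re_cexp !Im_cexp !ReImE expRD ?cosD ?sinD; ring.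
Qed.

Lemma cexp0 : cexp (0 : R[i]) = 1.
Proof. by apply: complex_ext => /=; rewrite expR0 ?cos0 ?sin0 ?mulr1 ?mulr0. Qed.

Lemma cmod_cexp z : cmod (cexp z) = expR (Re z).
Proof.
rewrite cmodE Re_cexp Im_cexp !exprMn -mulrDr cos2Dsin2 mulr1 sqrtr_sqr.
by rewrite ger0_norm// expR_ge0.
Qed.

Lemma conj_cexp z : (cexp z)^* = cexp z^*.
Proof.
by apply: complex_ext; rewrite ?ReImE ?Re_cexp ?Im_cexp ?ReImE ?cosN ?sinN ?mulrN.
Qed.

Definition cis (t : R) : R[i] := cexp (0 +i* t).

Lemma cisE t : cis t = cos t +i* sin t.
Proof. by rewrite /cis /cexp/= expR0 !mul1r. Qed.

Lemma cisD s t : cis (s + t) = cis s * cis t.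
Proof. by rewrite /cis -cexpD; congr cexp; apply: complex_ext; rewrite !ReImE/= ?addr0. Qed.

Lemma cis0 : cis 0 = 1. Proof. exact: cexp0. Qed.

Lemma cmod_cis t : cmod (cis t) = 1.
Proof. by rewrite cmod_cexp expR0. Qed.

Lemma conj_cis t : (cis t)^* = cis (- t).
Proof. by rewrite conj_cexp; congr cexp; apply: complex_ext; rewrite !ReImE/= ?oppr0. Qed.

Lemma cis_mulrn t n : cis (t *+ n) = cis t ^+ n.
Proof. by elim: n => [|n IH]; rewrite ?mulr0n ?cis0// mulrS cisD IH exprS. Qed.

Lemma cis2pi : cis (2 * pi) = 1.
Proof.
rewrite cisE mulr_natl cos2pi (_ : sin (pi *+ 2) = 0)//.
by rewrite mulr2n sinD sinpi !mul0r mulr0 addr0.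
Qed.

Lemma cis_neq1 t : 0 < t < 2 * pi -> cis t != 1.
Proof.
move=> /andP[t0 t2]; apply/eqP; rewrite cisE => /(congr1 (@complex.Re R))/= ct.
have : 0 < sin (t / 2) by apply: sin_gt0_pi; rewrite divr_gt0//= ltr_pdivrMr// mulrC.
have : cos (t / 2 + t / 2) = 1 by rewrite -splitr.
rewrite cosD; have := cos2Dsin2 (t / 2); nra.
Qed.

Lemma exists_unit_prim_root n : (0 < n)%N ->
  exists2 z : R[i], n.-primitive_root z & cmod z = 1.
Proof.
move=> n0; pose t : R := 2 * pi / n%:R.
have nR : n%:R != 0 :> R by rewrite pnatr_eq0 -lt0n.
exists (cis t); last exact: cmod_cis.
rewrite /primitive_root_of_unity n0; apply/forallP => i.
rewrite unity_rootE -cis_mulrn; apply/eqP.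
have [->|iN] := eqVneq i.+1 n.
  by rewrite -[t *+ _]mulr_natr divfK// cis2pi eqxx.
apply/negbTE/cis_neq1; have ilt : (i.+1 < n)%N by rewrite ltn_neqAle iN ltn_ord.
have p0 := pi_gt0 R.
have n0' : 0 < n%:R :> R by rewrite ltr0n.
rewrite -[t *+ _]mulr_natr; apply/andP; split.
  by rewrite mulr_gt0 ?divr_gt0 ?mulr_gt0 ?ltr0n.
by rewrite -mulrA gtr_pMr ?mulr_gt0// mulrC ltr_pdivrMr// mul1r ltr_nat.
Qed.

End complex_exponential.

(** * Cauchy estimates for polynomials *)

Section cauchy_estimate.
Context {R : realType}.

(** A discrete Cauchy formula: with n the size of [p] and z a primitive n-th root of unity,
    averaging z^{-ik} p(rho z^i) over i isolates the k-th coefficient exactly, as all exponents are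
    below n. *)
Lemma coef_estimate (p : {poly R[i]}) (rho B : R) : 0 < rho ->
  (forall t, cmod t <= rho -> cmod p.[t] <= B) ->
  forall k, cmod p`_k * rho ^+ k <= B.
Proof.
move=> rho0 pB k.
have [kp|kp] := leqP (size p) k.
  rewrite nth_default// cmod0 mul0r.
  by apply: le_trans (pB 0 _); rewrite ?cmod0 ?cmod_ge0// ltW.
set n := size p in kp.
have n0 : (0 < n)%N by exact: leq_ltn_trans (leq0n k) kp.
have [z pz cz] := @exists_unit_prim_root R n n0.
have zz i : z ^+ i * z^* ^+ i = 1.
  by rewrite -exprMn mulrC mulJz cz expr1n rmorph1 expr1n.
have zn := prim_expr_order pz.
have geo m : (m < n)%N -> \sum_(i < n) (z ^+ m * z^* ^+ k) ^+ i = (m == k)%:R * n%:R.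
  move=> mn; have [->|mk] := eqVneq m k.
    by under eq_bigr do rewrite zz expr1n; rewrite sumr_const card_ord mul1r.
  rewrite mul0r; set w := z ^+ m * z^* ^+ k.
  have w1 : w != 1.
    apply/eqP => w1; have : z ^+ m == z ^+ k.
      by apply/eqP; rewrite -[LHS]mulr1 -(zz k) mulrCA mulrC -/w -[X in _ = X]mul1r; congr (_ * _); rewrite -w1 /w mulrC.
    by rewrite (eq_prim_root_expr pz) !modn_small// (negbTE mk).
  have wn : w ^+ n = 1.
    by rewrite /w exprMn -!exprM mulnC exprM zn expr1n mul1r mulnC exprM -rmorphXn zn rmorph1 expr1n.
  have := subrX1 w n; rewrite wn subrr => /esym/eqP.
  by rewrite mulf_eq0 subr_eq0 (negbTE w1) => /eqP.
have key : \sum_(i < n) (z^* ^+ k) ^+ i * p.[rho%:C * z ^+ i] =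
    n%:R * (p`_k * (rho ^+ k)%:C).
  have -> : n%:R * (p`_k * (rho ^+ k)%:C) =
      \sum_(m < n) p`_m * (rho ^+ m)%:C * ((m == k :> nat)%:R * n%:R).
    rewrite (bigD1 (Ordinal kp))//= eqxx mul1r big1 ?addr0 1?mulrC// => m.
    by rewrite -val_eqE/= => /negbTE ->; rewrite mul0r mulr0.
  under eq_bigr do rewrite horner_coef mulr_sumr.
  rewrite exchange_big/=; apply: eq_bigr => m _.
  rewrite -(geo m (ltn_ord m)) mulr_sumr; apply: eq_bigr => i _.
  rewrite !exprMn -!exprM rmorphXn/= (mulnC m) (mulnC k); ring.
have nR : 0 < n%:R :> R by rewrite ltr0n.
rewrite -(ler_pM2l nR).
have -> : n%:R * (cmod p`_k * rho ^+ k) = cmod (n%:R * (p`_k * (rho ^+ k)%:C)).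
  rewrite !cmodM cmodR [`|_|]ger0_norm ?exprn_ge0 ?(ltW rho0)//; congr (_ * _).
  by rewrite -(rmorph_nat (real_complex R)) cmodR ger0_norm.
rewrite -key; apply: le_trans (cmod_sum _ _ _) _.
have -> : n%:R * B = \sum_(i < n) B by rewrite sumr_const card_ord mulr_natl.
apply: ler_sum => i _; rewrite cmodM !cmodX cmodJ cz !expr1n mul1r.
by apply: pB; rewrite cmodM cmodX cz expr1n mulr1 cmodR ger0_norm// ltW.
Qed.

(** The difference is the sum of the non-constant coefficients, dominated by a geometric series of
    ratio 1/rho <= 1/2. *)
Lemma schwarz_estimate (p : {poly R[i]}) (rho B : R) : 2 <= rho ->
  (forall t, cmod t <= rho -> cmod p.[t] <= B) ->
  cmod (p.[1] - p.[0]) <= 2 * B / rho.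
Proof.
move=> rho2 pB; have rho0 : 0 < rho by lra.
have B0 : 0 <= B.
  by apply: le_trans (pB 0 _); rewrite ?cmod0 ?cmod_ge0// ltW.
have -> : p.[1] - p.[0] = \sum_(i < (size p).-1) p`_i.+1.
  rewrite horner_coef0 horner_coef; under eq_bigr do rewrite expr1n mulr1.
  case: (size p) (@nth_default _ 0 p 0) => [->//|m _].
    by rewrite !big_ord0 subrr.
  by rewrite big_ord_recl/= addrC addrA addNr add0r.
apply: le_trans (cmod_sum _ _ _) _.
have geo n : \sum_(i < n) (rho^-1) ^+ i.+1 <= 2 / rho - (2 / rho) * (rho^-1) ^+ n :> R.
  elim: n => [|n IH]; first by rewrite big_ord0 expr0 mulr1 subrr.
  rewrite big_ord_recr/=; apply: le_trans (lerD IH (lexx _)) _.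
  rewrite exprS -subr_ge0.
  have -> : 2 / rho - 2 / rho * (rho^-1 * rho^-1 ^+ n) -
    (2 / rho - 2 / rho * rho^-1 ^+ n + rho^-1 * rho^-1 ^+ n) =
    rho^-1 * (rho^-1) ^+ n * (1 - 2 * rho^-1) by ring.
  rewrite !mulr_ge0 ?exprn_ge0 ?invr_ge0 ?(ltW rho0)//.
  by rewrite subr_ge0 ler_pdivrMr// mul1r.
apply: (@le_trans _ _ (\sum_(i < (size p).-1) B * (rho^-1) ^+ i.+1)).
  apply: ler_sum => i _; rewrite exprVn ler_pdivlMr ?exprn_gt0//.
  exact: coef_estimate.
rewrite -mulr_sumr -mulrA mulrCA ler_wpM2l//; apply: le_trans (geo _) _.
by rewrite gerBl mulr_ge0 ?exprn_ge0 ?divr_ge0 ?invr_ge0 ?(ltW rho0).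
Qed.

End cauchy_estimate.

(** * Determinants controlled by the Frobenius norm *)

Section frobenius.
Context {R : realType}.
Local Open Scope sesquilinear_scope.
Local Notation C := R[i].

Lemma sum_cauchy_schwarz (I : finType) (a b : I -> R) :
  (\sum_i a i * b i) ^+ 2 <= (\sum_i a i ^+ 2) * (\sum_i b i ^+ 2).
Proof.
rewrite -subr_ge0.
have -> : (\sum_i a i ^+ 2) * (\sum_i b i ^+ 2) - (\sum_i a i * b i) ^+ 2 =
    2^-1 * \sum_i \sum_j (a i * b j - a j * b i) ^+ 2.
  have e (u v : I -> R) : (\sum_i u i) * (\sum_j v j) = \sum_i \sum_j u i * v j.
    by rewrite mulr_suml; apply: eq_bigr => i _; rewrite mulr_sumr.
  have -> : \sum_i \sum_j (a i * b j - a j * b i) ^+ 2 =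
    \sum_i \sum_j (a i ^+ 2 * b j ^+ 2) + \sum_i \sum_j (b i ^+ 2 * a j ^+ 2) -
    2 * \sum_i \sum_j ((a i * b i) * (a j * b j)).
    rewrite mulr_sumr -big_split -sumrB; apply: eq_bigr => i _ /=.
    by rewrite mulr_sumr -big_split -sumrB; apply: eq_bigr => j _ /=; ring.
  by rewrite -!e expr2; field.
by rewrite mulr_ge0 ?invr_ge0// sumr_ge0// => i _; rewrite sumr_ge0// => j _; exact: sqr_ge0.
Qed.

Definition fro2 m n (A : 'M[C]_(m, n)) : R := \sum_i \sum_j cmod (A i j) ^+ 2.
Definition fro m n (A : 'M[C]_(m, n)) : R := Num.sqrt (fro2 A).

Lemma fro2_ge0 m n (A : 'M[C]_(m, n)) : 0 <= fro2 A.
Proof. by rewrite sumr_ge0// => i _; rewrite sumr_ge0// => j _; exact: sqr_ge0. Qed.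
Lemma fro_ge0 m n (A : 'M[C]_(m, n)) : 0 <= fro A.
Proof. exact: sqrtr_ge0. Qed.
Lemma sqr_fro m n (A : 'M[C]_(m, n)) : fro A ^+ 2 = fro2 A.
Proof. by rewrite sqr_sqrtr// fro2_ge0. Qed.
Lemma fro_le m n (A : 'M[C]_(m, n)) (c : R) : 0 <= c -> fro2 A <= c ^+ 2 -> fro A <= c.
Proof. by move=> c0 Ac; rewrite -(@ler_pXn2r _ 2) ?nnegrE ?fro_ge0// sqr_fro. Qed.

Lemma froD m n (A B : 'M[C]_(m, n)) : fro (A + B) <= fro A + fro B.
Proof.
apply: fro_le; first by rewrite addr_ge0 ?fro_ge0.
have pE (M : 'M[C]_(m, n)) : fro2 M = \sum_(p : 'I_m * 'I_n) cmod (M p.1 p.2) ^+ 2.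
  by rewrite /fro2 pair_bigA.
have cs : \sum_(p : 'I_m * 'I_n) cmod (A p.1 p.2) * cmod (B p.1 p.2) <= fro A * fro B.
  rewrite -(@ler_pXn2r _ 2) ?nnegrE ?mulr_ge0 ?fro_ge0//; last first.
    by rewrite sumr_ge0// => p _; rewrite mulr_ge0 ?cmod_ge0.
  by rewrite exprMn !sqr_fro !pE; exact: sum_cauchy_schwarz.
rewrite sqrrD !sqr_fro mulr2n.
apply: (@le_trans _ _ (fro2 A + 2 * (\sum_(p : 'I_m * 'I_n) cmod (A p.1 p.2) * cmod (B p.1 p.2)) + fro2 B)); last first.
  by rewrite lerD2r lerD2l; lra.
rewrite !pE mulr_sumr -!big_split/=; apply: ler_sum => p _.
rewrite mxE; have := cmodD (A p.1 p.2) (B p.1 p.2).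
by have := cmod_ge0 (A p.1 p.2 + B p.1 p.2); nra.
Qed.

Lemma froZ m n (c : C) (A : 'M[C]_(m, n)) : fro (c *: A) = cmod c * fro A.
Proof.
rewrite /fro (_ : fro2 _ = cmod c ^+ 2 * fro2 A).
  by rewrite sqrtrM ?sqr_ge0// sqrtr_sqr ger0_norm ?cmod_ge0.
rewrite /fro2 mulr_sumr; apply: eq_bigr => i _; rewrite mulr_sumr.
by apply: eq_bigr => j _; rewrite mxE cmodM exprMn.
Qed.

Lemma froN m n (A : 'M[C]_(m, n)) : fro (- A) = fro A.
Proof. by rewrite -scaleN1r froZ cmodN cmod1 mul1r. Qed.

Lemma fro0 m n : fro (0 : 'M[C]_(m, n)) = 0.
Proof. by rewrite -(scale0r 0) froZ cmod0 mul0r. Qed.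

Lemma froB m n (A B : 'M[C]_(m, n)) : fro (A - B) <= fro A + fro B.
Proof. by rewrite -(froN B); exact: froD. Qed.

Lemma fro_sum (I : Type) (s : seq I) (P : pred I) m n (F : I -> 'M[C]_(m, n)) :
  fro (\sum_(i <- s | P i) F i) <= \sum_(i <- s | P i) fro (F i).
Proof.
elim/big_rec2 : _ => [|i x y _ h]; first by rewrite fro0.
by apply: le_trans (froD _ _) _; rewrite lerD2l.
Qed.

Lemma froM m n p (A : 'M[C]_(m, n)) (B : 'M[C]_(n, p)) :
  fro (A *m B) <= fro A * fro B.
Proof.
apply: fro_le; first by rewrite mulr_ge0 ?fro_ge0.
rewrite exprMn !sqr_fro /fro2 [X in _ * X]exchange_big/= mulr_suml.
apply: ler_sum => i _; rewrite mulr_sumr; apply: ler_sum => j _; rewrite mxE.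
apply: le_trans (sum_cauchy_schwarz _ _).
rewrite ler_pXn2r ?nnegrE ?cmod_ge0//; last first.
  by rewrite sumr_ge0// => k _; rewrite mulr_ge0 ?cmod_ge0.
apply: le_trans (cmod_sum _ _ _) _.
by apply: ler_sum => k _; rewrite cmodM.
Qed.

Lemma fro2_tr n (A : 'M[C]_n) : (fro2 A)%:C = \tr (A *m A^t*).
Proof.
rewrite /fro2 /mxtrace rmorph_sum; apply: eq_bigr => i _.
rewrite mxE rmorph_sum; apply: eq_bigr => j _; rewrite !mxE mulrC.
exact/esym/mulJz.
Qed.

(** Schur triangularisation preserves the Frobenius norm and the modulus of the determinant. For a
    triangular matrix, x <= e^(x-1) is applied to each squared diagonal entry. *)
Lemma det_bound n (A : 'M[C]_n) :
  cmod (\det A) ^+ 2 <= expR (fro2 A - n%:R).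
Proof.
have [n0|n0] := posnP n.
  subst n; rewrite det_mx00 cmod1 expr1n.
  by rewrite /fro2 big_ord0 subr0 expR0.
have [P uP] := Schur A n0; move=> trP.
have : is_trig_mx (conjmx P A) by exact: trP.
rewrite conjymx// => /is_trig_mxP tP.
set B := _ *m _ in tP.
have PP := unitarymxP uP.
have detB : cmod (\det A) = cmod (\det B).
  rewrite /B !det_mulmx mulrAC -det_mulmx PP det1 mul1r//.
have froBA : fro2 A = fro2 B.
  apply: (@complexI R); rewrite !fro2_tr /B.
  have -> : (P *m A *m P^t* )^t* = P *m A^t* *m P^t*.
    have PK : (P^t* )^t* = P by apply/matrixP => i j; rewrite !mxE conjCK.
    by rewrite !trmx_mul !map_mxM PK mulmxA.
  by rewrite !mulmxA mulmxKtV// [RHS]mxtrace_mulC !mulmxA (mulmx1C PP) mul1mx.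
rewrite detB froBA det_trig; last exact/is_trig_mxP.
have -> : cmod (\prod_i B i i) ^+ 2 = \prod_i (cmod (B i i) ^+ 2).
  by rewrite prodrXl; congr (_ ^+ _); apply: (big_morph _ (@cmodM R) (@cmod1 R)).
have -> : expR (fro2 B - n%:R) = \prod_(i < n) expR (\sum_j cmod (B i j) ^+ 2 - 1).
  rewrite -expR_sum; congr expR; rewrite sumrB sumr_const card_ord//.
apply: ler_prod => i _; rewrite sqr_ge0/=.
apply: le_trans (expR_ge1Dx _); rewrite addrC subrK (bigD1 i)//= lerDl sumr_ge0// => j _.
exact: sqr_ge0.
Qed.

Lemma fro_eq0 m n (A : 'M[C]_(m, n)) : fro A = 0 -> A = 0.
Proof.
move=> A0; have : fro2 A = 0 by rewrite -sqr_fro A0 expr0n.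
move/eqP; rewrite psumr_eq0 => [/allP h|i _]; last first.
  by rewrite sumr_ge0// => j _; exact: sqr_ge0.
apply/matrixP => i j; have := h i (mem_index_enum _); rewrite psumr_eq0 => [/allP h2|k _]; last exact: sqr_ge0.
by have := h2 j (mem_index_enum _); rewrite sqrf_eq0 cmod_eq0 mxE => /eqP.
Qed.

(** The block matrix with identity diagonal blocks and off-diagonal blocks -Y, X has this
    determinant. The two identities contribute 2n to its squared norm, exactly what [det_bound]
    subtracts, so the size disappears. *)
Lemma det1DM_bound n (X Y : 'M[C]_n) :
  cmod (\det (1%:M + X *m Y)) ^+ 2 <= expR (fro2 X + fro2 Y).
Proof.
pose M := block_mx 1%:M (- Y) X 1%:M.
have -> : \det (1%:M + X *m Y) = \det M.
  have -> : M = block_mx 1%:M 0 X 1%:M *m block_mx 1%:M (- Y) 0 (1%:M + X *m Y).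
    rewrite mulmx_block !mul1mx !mulmx0 !mul0mx !mulmx1 !addr0.
    by rewrite mulmxN [X in block_mx _ _ _ X]addrC addrK.
  by rewrite det_mulmx det_lblock det_ublock !det1 !mul1r.
apply: le_trans (det_bound M) _; rewrite ler_expR.
have f1 : fro2 (1%:M : 'M[C]_n) = n%:R.
  rewrite /fro2 (eq_bigr (fun=> 1)); first by rewrite sumr_const card_ord.
  move=> i _; rewrite (bigD1 i)//= big1 => [|j ij].
    by rewrite mxE eqxx cmod1 expr1n addr0.
  by rewrite mxE eq_sym (negbTE ij) cmod0 expr0n.
have -> : fro2 M = n%:R + fro2 Y + (fro2 X + n%:R).
  rewrite {1}/fro2 big_split_ord/=; congr (_ + _).
  - rewrite -{1}f1 /fro2 -big_split/=; apply: eq_bigr => i _.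
    rewrite big_split_ord/=; congr (_ + _); apply: eq_bigr => j _.
      by rewrite block_mxEul.
    by rewrite block_mxEur mxE cmodN.
  - rewrite -{1}f1 /fro2 -big_split/=; apply: eq_bigr => i _.
    rewrite big_split_ord/=; congr (_ + _); apply: eq_bigr => j _.
      by rewrite block_mxEdl.
    by rewrite block_mxEdr.
by rewrite natrD; lra.
Qed.

(* The determinant along the segment from (X, Y) to (X', Y') is a polynomial,
   bounded on a disc of radius inversely proportional to the distance. *)
Lemma det1DM_lipschitz n (X Y X' Y' : 'M[C]_n) (r : R) : 0 <= r ->
  fro X <= r -> fro Y <= r -> fro X' <= r -> fro Y' <= r ->
  cmod (\det (1%:M + X' *m Y') - \det (1%:M + X *m Y)) <=
  4 * expR ((r + 1) ^+ 2) * (fro (X' - X) + fro (Y' - Y)).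
Proof.
move=> r0 Xr Yr Xr' Yr'; set del := fro _ + fro _.
have bd (U V : 'M[C]_n) : fro U <= r + 1 -> fro V <= r + 1 ->
    cmod (\det (1%:M + U *m V)) <= expR ((r + 1) ^+ 2).
  move=> Ur Vr; rewrite -(@ler_pXn2r _ 2) ?nnegrE ?cmod_ge0 ?expR_ge0//.
  apply: le_trans (det1DM_bound _ _) _; rewrite expr2 -expRD ler_expR -!sqr_fro.
  by apply: lerD; rewrite ler_pXn2r ?nnegrE ?fro_ge0 ?addr_ge0.
have del0 : 0 <= del by rewrite addr_ge0 ?fro_ge0.
have e0 := expR_gt0 ((r + 1) ^+ 2).
have rr1 : r <= r + 1 by rewrite lerDl.
(* If [del] exceeds 1/2, bounding the two determinants separately is enough. *)
have [dl|dl] := leP del 2^-1; last first.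
  apply: le_trans (cmodD _ _) _; rewrite cmodN.
  have := bd X' Y' (le_trans Xr' rr1) (le_trans Yr' rr1).
  have := bd X Y (le_trans Xr rr1) (le_trans Yr rr1).
  nra.
have [d0|d0] := eqVneq del 0.
  have /eqP : del = 0 by [].
  rewrite /del paddr_eq0 ?fro_ge0// => /andP[/eqP/fro_eq0/eqP + /eqP/fro_eq0/eqP].
  rewrite !subr_eq0 => /eqP -> /eqP ->.
  by rewrite subrr cmod0 !mulr_ge0 ?addr_ge0 ?fro_ge0 ?expR_ge0.
have dp : 0 < del by rewrite lt_neqAle eq_sym d0.
pose lin (U V : 'M[C]_n) := map_mx polyC U + 'X *: map_mx polyC V.
pose p : {poly C} := \det (1%:M + lin X (X' - X) *m lin Y (Y' - Y)).
have pE t : p.[t] = \det (1%:M + (X + t *: (X' - X)) *m (Y + t *: (Y' - Y))).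
  have le U V : map_mx (horner_eval t) (lin U V) = U + t *: V.
    by apply/matrixP => i j; rewrite !mxE horner_evalE hornerD hornerM hornerX !hornerC.
  by rewrite /p -horner_evalE -det_map_mx map_mxD map_mx1 map_mxM !le.
(* On the disc |t| <= 1/del each factor moves by at most 1, which is why [bd] allows norms up to r +
   1. *)
have rho2 : 2 <= del^-1 by rewrite -[2]invrK lef_pV2 ?posrE ?invr_gt0.
have := @schwarz_estimate R p del^-1 (expR ((r + 1) ^+ 2)) rho2.
rewrite !pE !scale1r !scale0r !addr0 ![_ + (_ - _)]addrC !subrK invrK => h.
apply: le_trans (h _) _; last by rewrite ler_pM2r// ler_pM2r// ler_nat.
move=> t; rewrite -div1r ler_pdivlMr// => ht; rewrite pE.
have tf (U V : 'M[C]_n) : fro U <= r -> fro V <= del -> fro (U + t *: V) <= r + 1.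
  move=> Ur Vd; apply: le_trans (froD _ _) _; apply: lerD => //; rewrite froZ.
  by apply: le_trans ht; rewrite ler_wpM2l ?cmod_ge0.
by apply: bd; apply: tf => //; rewrite /del ?lerDl ?lerDr ?fro_ge0.
Qed.

End frobenius.

(** * Limits of complex sequences *)

Section complex_limits.
Context {R : realType}.
Local Notation C := R[i].
Implicit Types (u v : nat -> C) (z w : C).

Definition ccvg u z := forall eps : R, 0 < eps ->
  exists N, forall n, (N <= n)%N -> cmod (u n - z) <= eps.

Lemma ccvg_cst z : ccvg (fun=> z) z.
Proof. by move=> eps e0; exists 0%N => n _; rewrite subrr cmod0 ltW. Qed.

Lemma ccvgD u v z w : ccvg u z -> ccvg v w -> ccvg (fun n => u n + v n) (z + w).
Proof.
move=> uz vw eps e0; have e2 : 0 < eps / 2 by rewrite divr_gt0.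
have [N hN] := uz _ e2; have [M hM] := vw _ e2.
exists (maxn N M) => n; rewrite geq_max => /andP[Nn Mn].
rewrite opprD addrACA (splitr eps); apply: le_trans (cmodD _ _) _.
by apply: lerD; [exact: hN|exact: hM].
Qed.

Lemma ccvgM u v z w : ccvg u z -> ccvg v w -> ccvg (fun n => u n * v n) (z * w).
Proof.
move=> uz vw eps e0.
pose d := Num.min 1 (eps / (cmod z + cmod w + 1)).
have k0 : 0 < cmod z + cmod w + 1 by rewrite ltr_wpDl// addr_ge0 ?cmod_ge0.
have d0 : 0 < d by rewrite lt_min ltr01 divr_gt0.
have [N hN] := uz _ d0; have [M hM] := vw _ d0.
exists (maxn N M) => n; rewrite geq_max => /andP[/hN h1 /hM h2].
have -> : u n * v n - z * w = (u n - z) * (v n - w) + z * (v n - w) + (u n - z) * w by ring.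
apply: le_trans (cmodD _ _) _; apply: le_trans (lerD (cmodD _ _) (lexx _)) _.
rewrite !cmodM.
have d1 : d <= 1 by rewrite ge_min lexx.
have d2 : d * (cmod z + cmod w + 1) <= eps.
  by rewrite -ler_pdivlMr// ge_min lexx orbT.
apply: le_trans d2.
have := cmod_ge0 z; have := cmod_ge0 w; have := cmod_ge0 (u n - z).
have := cmod_ge0 (v n - w); nra.
Qed.

Lemma ccvg_sum (I : Type) (s : seq I) (P : pred I) (f : I -> nat -> C) (g : I -> C) :
  (forall i, P i -> ccvg (f i) (g i)) ->
  ccvg (fun n => \sum_(i <- s | P i) f i n) (\sum_(i <- s | P i) g i).
Proof.
move=> fg; elim: s => [|i s IH].
  by rewrite big_nil; under eq_fun do rewrite big_nil; exact: ccvg_cst.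
rewrite big_cons; under eq_fun do rewrite big_cons.
by case: (boolP (P i)) => // /fg ?; exact: ccvgD.
Qed.

Lemma ccvg_prod (I : Type) (s : seq I) (P : pred I) (f : I -> nat -> C) (g : I -> C) :
  (forall i, P i -> ccvg (f i) (g i)) ->
  ccvg (fun n => \prod_(i <- s | P i) f i n) (\prod_(i <- s | P i) g i).
Proof.
move=> fg; elim: s => [|i s IH].
  by rewrite big_nil; under eq_fun do rewrite big_nil; exact: ccvg_cst.
rewrite big_cons; under eq_fun do rewrite big_cons.
by case: (boolP (P i)) => // /fg ?; exact: ccvgM.
Qed.

Lemma ccvgZ c u z : ccvg u z -> ccvg (fun n => c * u n) (c * z).
Proof. by move=> uz; apply: ccvgM => //; exact: ccvg_cst. Qed.

Lemma ccvgB u v z w : ccvg u z -> ccvg v w -> ccvg (fun n => u n - v n) (z - w).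
Proof.
move=> uz vw; apply: ccvgD => //; rewrite -mulN1r.
by under eq_fun do rewrite -mulN1r; exact: ccvgZ.
Qed.

Lemma ccvg_det n (f : nat -> 'M[C]_n) (g : 'M[C]_n) :
  (forall i j, ccvg (fun k => f k i j) (g i j)) -> ccvg (fun k => \det (f k)) (\det g).
Proof.
move=> fg; rewrite /determinant; apply: ccvg_sum => s _; apply: ccvgZ.
by apply: ccvg_prod => i _; exact: fg.
Qed.

Lemma ccvg_eventually_eq u v z n0 : (forall n, (n0 <= n)%N -> u n = v n) ->
  ccvg u z -> ccvg v z.
Proof.
move=> uv uz eps /uz[N hN]; exists (maxn n0 N) => n; rewrite geq_max => /andP[n0n Nn].
by rewrite -uv// hN.
Qed.

Lemma ccvg_le_bound u z n0 (B : R) : ccvg u z ->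
  (forall n, (n0 <= n)%N -> cmod (u n) <= B) -> cmod z <= B.
Proof.
move=> uz uB; apply/ler_addgt0Pl => eps /uz[N hN].
have h1 := hN _ (leq_maxl N n0); have h2 := uB _ (leq_maxr N n0).
have -> : z = u (maxn N n0) - (u (maxn N n0) - z) by rewrite opprB addrC subrK.
by apply: le_trans (cmodD _ _) _; rewrite cmodN addrC; apply: lerD.
Qed.

Lemma ccvg_shift u z k : ccvg u z -> ccvg (fun n => u (n + k)%N) z.
Proof.
move=> uz eps /uz[N hN]; exists N => n Nn; apply: hN.
exact: leq_trans (leq_addr _ _).
Qed.

Lemma ccvg_clim u :
  (forall eps : R, 0 < eps -> exists N, forall m n, (N <= m)%N -> (m <= n)%N ->
    cmod (u n - u m) <= eps) -> ccvg u (clim u).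
Proof.
move=> cu.
have cR (p : C -> R) : (forall z w, p (z - w) = p z - p w) ->
    (forall z, `|p z| <= cmod z) -> cvgn (fun n => p (u n)).
  move=> pB pc; apply/cauchy_cvgP/cauchyP => eps e0.
  have [N hN] := cu _ (divr_gt0 e0 (ltr0n R 2)); exists (p (u N)).
  exists N => // n Nn; rewrite /ball/= distrC -pB; apply: le_lt_trans (pc _) _.
  by apply: le_lt_trans (hN _ _ (leqnn N) Nn) _; rewrite ltr_pdivrMr// ltr_pMr// ltr1n.
have c1 : cvgn (fun n => Re (u n)).
  by apply: cR => [z w|z]; [rewrite !ReImE|exact: Re_le_cmod].
have c2 : cvgn (fun n => Im (u n)).
  by apply: cR => [z w|z]; [rewrite !ReImE|exact: Im_le_cmod].
move=> eps e0; have e2 : 0 < eps / 2 by rewrite divr_gt0.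
have [N hN] := cvg_dist c1 e2; have [M hM] := cvg_dist c2 e2.
exists (maxn N M) => n; rewrite geq_max => /andP[/hN h1 /hM h2].
apply: le_trans (cmod_le _) _; rewrite !ReImE (splitr eps).
exact: lerD.
Qed.

End complex_limits.

(** * Matrices (1 - X) e^X with truncated exponential *)

Section regularized_determinants.
Context {R : realType}.
Local Notation C := R[i].

Lemma expR_partial_sum (r : R) q : 0 <= r ->
  \sum_(k < q) r ^+ k / k`!%:R <= expR r.
Proof.
move=> r0; rewrite -(big_mkord xpredT (fun k => r ^+ k / k`!%:R)).
apply: (@nondecreasing_cvgn_le _ (series (exp_coeff r))).
  apply: nondecreasing_series => n _; rewrite /exp_coeff/= divr_ge0 ?exprn_ge0//.
exact: is_cvg_series_exp_coeff.
Qed.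

Section matrix_series.
Variable n : nat.
Implicit Types X Y Z : 'M[C]_n.+1.

Definition mxseries (c : nat -> C) q X := \sum_(k < q) c k *: X ^+ k.

Lemma fro_expM X Z r k : fro X <= r -> fro (X ^+ k * Z) <= r ^+ k * fro Z.
Proof.
move=> Xr; elim: k => [|k IH]; first by rewrite !expr0 !mul1r.
rewrite !exprS -!mulrA; apply: le_trans (froM _ _) _.
by apply: ler_pM; rewrite ?fro_ge0.
Qed.

Lemma fro_exp X r k : fro X <= r -> fro (X ^+ k.+1) <= r ^+ k.+1.
Proof.
move=> Xr; have r0 := le_trans (fro_ge0 X) Xr.
rewrite exprSr; apply: le_trans (fro_expM _ _ Xr) _.
by rewrite exprSr ler_wpM2l ?exprn_ge0.
Qed.

Lemma fro_expB X Y r k : fro X <= r -> fro Y <= r ->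
  fro (X ^+ k.+1 - Y ^+ k.+1) <= k.+1%:R * r ^+ k * fro (X - Y).
Proof.
move=> Xr Yr; have r0 := le_trans (fro_ge0 X) Xr.
elim: k => [|k IH]; first by rewrite !expr1 expr0 !mul1r.
have -> : X ^+ k.+2 - Y ^+ k.+2 = X * (X ^+ k.+1 - Y ^+ k.+1) + (X - Y) * Y ^+ k.+1.
  by rewrite !(exprS _ k.+1) mulrBr mulrBl addrA subrK.
apply: le_trans (froD _ _) _.
have h1 : fro (X * (X ^+ k.+1 - Y ^+ k.+1)) <= r * (k.+1%:R * r ^+ k * fro (X - Y)).
  by apply: le_trans (froM _ _) _; apply: ler_pM; rewrite ?fro_ge0.
have h2 : fro ((X - Y) * Y ^+ k.+1) <= fro (X - Y) * r ^+ k.+1.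
  by apply: le_trans (froM _ _) _; apply: ler_wpM2l; rewrite ?fro_ge0 ?fro_exp.
apply: le_trans (lerD h1 h2) _; rewrite -(natr1 k.+1) exprS; lra.
Qed.

Variables (c : nat -> C) (q : nat) (r : R).
Hypothesis cq : forall k, cmod (c k) <= (k.+1`!%:R)^-1.

Lemma fact_inv_le k : (k.+1`!%:R)^-1 <= (k`!%:R)^-1 :> R.
Proof.
by rewrite lef_pV2 ?posrE ?ltr0n ?fact_gt0// ler_nat factS leq_pmull.
Qed.

(** The Frobenius norm of the identity grows with the size, so the series is estimated only after
    multiplication by [Z]; the constant is then free of size and degree. *)
Lemma fro_mxseriesM X Z : fro X <= r -> fro (mxseries c q X * Z) <= expR r * fro Z.
Proof.
move=> Xr; have r0 := le_trans (fro_ge0 X) Xr.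
rewrite /mxseries mulr_suml; apply: le_trans (fro_sum _ _ _) _.
apply: (@le_trans _ _ ((\sum_(k < q) r ^+ k / k`!%:R) * fro Z)); last first.
  by rewrite ler_wpM2r ?fro_ge0// expR_partial_sum.
rewrite mulr_suml; apply: ler_sum => k _.
rewrite -scalerAl froZ [_ / _]mulrC -mulrA; apply: ler_pM; rewrite ?cmod_ge0 ?fro_ge0//.
  exact: le_trans (cq _) (fact_inv_le _).
exact: fro_expM.
Qed.

(** The difference of (k+1)-st powers costs (k+1) r^k, and the coefficient bound 1/(k+1)! turns this
    into r^k / k!, which sums to at most e^r. *)
Lemma fro_mulmxseriesB X Y : fro X <= r -> fro Y <= r ->
  fro (X * mxseries c q X - Y * mxseries c q Y) <= expR r * fro (X - Y).
Proof.
move=> Xr Yr; have r0 := le_trans (fro_ge0 X) Xr.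
rewrite /mxseries !mulr_sumr -sumrB; apply: le_trans (fro_sum _ _ _) _.
apply: (@le_trans _ _ ((\sum_(k < q) r ^+ k / k`!%:R) * fro (X - Y))); last first.
  by rewrite ler_wpM2r ?fro_ge0// expR_partial_sum.
rewrite mulr_suml; apply: ler_sum => k _.
rewrite -!scalerAr -!exprS -scalerBr froZ.
apply: (@le_trans _ _ ((k.+1`!%:R)^-1 * (k.+1%:R * r ^+ k * fro (X - Y)))).
  by apply: ler_pM; rewrite ?cmod_ge0 ?fro_ge0 ?fro_expB.
rewrite le_eqVlt; apply/orP; left; apply/eqP.
rewrite factS natrM; have : k`!%:R != 0 :> R by rewrite pnatr_eq0 -lt0n fact_gt0.
have : k.+1%:R != 0 :> R by rewrite pnatr_eq0.
set u := k.+1%:R; set v := k`!%:R => u0 v0; field.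
by apply/andP; split.
Qed.

Lemma mxseries_comm X : X * mxseries c q X = mxseries c q X * X.
Proof.
rewrite /mxseries mulr_sumr mulr_suml; apply: eq_bigr => k _.
by rewrite -scalerAr -scalerAl -exprS -exprSr.
Qed.

End matrix_series.

Definition ifact k : C := (k`!%:R)^-1.

Lemma cmod_ifact k : cmod (ifact k) = (k`!%:R)^-1.
Proof.
rewrite cmodV; congr (_^-1).
have e : (k`!%:R : C) = (k`!%:R : R)%:C by rewrite rmorph_nat.
by rewrite e cmodR normr_nat.
Qed.

Section polynomial.
Variable n : nat.
Implicit Types X Y Z : 'M[C]_n.+1.

(** (1 - X) e^X with the exponential series stopped at degree q + 1. *)
Definition qmx q X := (1 - X) * mxseries ifact q.+2 X.
(** The cofactor of X in [qmxE]. It still contains a factor X, so (1 - X) e^X - 1 is a product of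
    two factors controlled in Frobenius norm; this second-order vanishing is what the regularisation
    buys. *)
Definition bmx q X :=
  X * mxseries (fun k => ifact k.+2) q X - X * mxseries (fun k => ifact k.+1) q.+1 X.

Lemma mxseriesS (c : nat -> C) q X :
  mxseries c q.+1 X = c 0%N *: 1 + X * mxseries (fun k => c k.+1) q X.
Proof.
rewrite /mxseries big_ord_recl expr0 mulr_sumr; congr (_ + _).
by apply: eq_bigr => k _; rewrite -scalerAr -exprS.
Qed.

Lemma qmxE q X : qmx q X = 1 + X * bmx q X.
Proof.
set S1 := mxseries (fun k => ifact k.+2) q X.
set S2 := mxseries (fun k => ifact k.+1) q.+1 X.
have E1 : mxseries ifact q.+2 X = 1 + X * S2.
  by rewrite mxseriesS /ifact fact0 invr1 scale1r.
have E2 : S2 = 1 + X * S1.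
  by rewrite /S2 (mxseriesS (fun k => ifact k.+1)) /ifact factS fact0 invr1 scale1r.
rewrite /qmx /bmx -/S1 -/S2 mulrBl mul1r E1 {1}E2 !mulrDr !mulr1 mulrN.
by rewrite -addrA opprD addrACA subrr add0r.
Qed.

Variable r : R.

Lemma ifact_le1 k : cmod (ifact k.+1) <= (k.+1`!%:R)^-1.
Proof. by rewrite cmod_ifact. Qed.

Lemma ifact_le2 k : cmod (ifact k.+2) <= (k.+1`!%:R)^-1.
Proof. by rewrite cmod_ifact fact_inv_le. Qed.

Lemma bmx_comm q X : bmx q X = (mxseries (fun k => ifact k.+2) q X -
  mxseries (fun k => ifact k.+1) q.+1 X) * X.
Proof. by rewrite /bmx !mxseries_comm mulrBl. Qed.

Lemma fro_bmxB q X Y : fro X <= r -> fro Y <= r ->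
  fro (bmx q X - bmx q Y) <= 2 * expR r * fro (X - Y).
Proof.
move=> Xr Yr; rewrite /bmx opprB [X in _ + X]addrC addrACA.
apply: le_trans (froD _ _) _; rewrite -mulrA mulr_natl mulr2n; apply: lerD.
  exact: (fro_mulmxseriesB q ifact_le2 Xr Yr).
rewrite addrC -(froN (X - Y)) opprB.
exact: (fro_mulmxseriesB q.+1 ifact_le1 Yr Xr).
Qed.

Lemma fro_bmx q X : fro X <= r -> fro (bmx q X) <= 2 * expR r * r.
Proof.
move=> Xr; rewrite bmx_comm mulrBl; apply: le_trans (froB _ _) _.
have h (A : R) : A <= expR r * fro X -> A <= expR r * r.
  by move=> hA; apply: le_trans hA _; rewrite ler_wpM2l ?expR_ge0.
rewrite -mulrA mulr_natl mulr2n; apply: lerD; apply: h.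
  exact: (fro_mxseriesM q ifact_le2 X Xr).
exact: (fro_mxseriesM q.+1 ifact_le1 X Xr).
Qed.

(** In [bmx_comm] the factor X stands on the right, so a right factor [Z] acts on X directly and the
    norm of [Z] itself never enters. *)
Lemma fro_bmx_cut q X Z Z' : fro X <= r -> X * Z = Z' ->
  fro (bmx q X * Z) <= 2 * expR r * fro Z'.
Proof.
move=> Xr XZ; rewrite bmx_comm -[_ * Z]mulrA XZ mulrBl; apply: le_trans (froB _ _) _.
rewrite -mulrA mulr_natl mulr2n; apply: lerD.
  exact: (fro_mxseriesM q ifact_le2 Z' Xr).
exact: (fro_mxseriesM q.+1 ifact_le1 Z' Xr).
Qed.

End polynomial.

Section truncation.

Definition detN (m : nat -> nat -> C) N := \det (\matrix_(i < N, j < N) m i j).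

(** Padding a leading minor by an identity block keeps its determinant and makes minors of different
    sizes comparable within one matrix size. *)
Lemma detN_extend (m : nat -> nat -> C) N L : (N <= L)%N ->
  detN m N = \det (\matrix_(i < L, j < L)
    if (i < N)%N && (j < N)%N then m i j else (i == j :> nat)%:R).
Proof.
move=> /subnKC <-; set K := (L - N)%N.
rewrite [X in \det X](_ : _ = block_mx (\matrix_(i < N, j < N) m i j) 0 0 1%:M).
  by rewrite det_ublock det1 mulr1.
apply/matrixP => k l; rewrite mxE -[k]fintype.splitK -[l]fintype.splitK.
case: (fintype.split k) => i'; case: (fintype.split l) => j' /=.
- by rewrite block_mxEul mxE !ltn_ord.
- rewrite block_mxEur mxE ltn_ord/= ltnNge leq_addr/=.
  by rewrite ltn_eqF// (leq_trans (ltn_ord i'))// leq_addr.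
- rewrite block_mxEdl mxE ltnNge leq_addr/=.
  by rewrite gtn_eqF// (leq_trans (ltn_ord j'))// leq_addr.
- rewrite block_mxEdr mxE ltnNge leq_addr/= eqn_add2l.
  by rewrite -val_eqE.
Qed.

Variable n : nat.
Implicit Types X Y : 'M[C]_n.+1.

Definition rowcut N X : 'M[C]_n.+1 := \matrix_(i, j) if (i < N)%N then X i j else 0.
Definition colcut N X : 'M[C]_n.+1 := \matrix_(i, j) if (j < N)%N then X i j else 0.

Lemma colcutM N X Y : X * colcut N Y = colcut N (X * Y).
Proof.
apply/matrixP => i j; rewrite !mxE; case: ifP => jN.
  by apply: eq_bigr => k _; rewrite mxE jN.
by rewrite big1// => k _; rewrite mxE jN mulr0.
Qed.

Lemma fro_mono m p (A B : 'M[C]_(m, p)) :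
  (forall i j, cmod (A i j) <= cmod (B i j)) -> fro A <= fro B.
Proof.
move=> AB; rewrite ler_wsqrtr// ler_sum// => i _; apply: ler_sum => j _.
by rewrite ler_pXn2r ?nnegrE ?cmod_ge0.
Qed.

Lemma fro_rowcut N X : fro (rowcut N X) <= fro X.
Proof. by apply: fro_mono => i j; rewrite mxE; case: ifP; rewrite ?cmod0 ?cmod_ge0. Qed.

Lemma fro_colcut N X : fro (colcut N X) <= fro X.
Proof. by apply: fro_mono => i j; rewrite mxE; case: ifP; rewrite ?cmod0 ?cmod_ge0. Qed.

Lemma rowcutB N X Y : rowcut N X - rowcut N Y = rowcut N (X - Y).
Proof. by apply/matrixP => i j; rewrite !mxE; case: ifP; rewrite ?subr0. Qed.

Lemma colcutB N X Y : colcut N X - colcut N Y = colcut N (X - Y).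
Proof. by apply/matrixP => i j; rewrite !mxE; case: ifP; rewrite ?subr0. Qed.

(** A leading minor of 1 + X b(X) only sees the first rows of X and the first columns of b(X), so it
    is a full determinant of the shape handled by [det1DM_lipschitz]. *)
Lemma detN_qmx q X N : (N <= n.+1)%N ->
  detN (fun i j => qmx q X (inord i) (inord j)) N =
  \det (1%:M + rowcut N X *m colcut N (bmx q X)).
Proof.
move=> Nn; rewrite (detN_extend _ Nn); congr (\det _); apply/matrixP => i j.
rewrite mxE !inord_val qmxE mulmxE colcutM !mxE.
case: (ltnP i N) => iN /=; last first.
  rewrite [X in _ + X](_ : _ = 0) ?addr0 ?val_eqE//.
  by case: ifP => // _; rewrite big1// => k _; rewrite mxE ltnNge iN mul0r.
case: ifP => jN; last by rewrite addr0 val_eqE.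
by congr (_ + _); apply: eq_bigr => k _; congr (_ * _); rewrite mxE iN.
Qed.

End truncation.
End regularized_determinants.

(** * Passing determinant estimates to infinite matrices *)

Section determinant_limits.
Context {R : realType}.
Local Notation C := R[i].
Implicit Types (a m : nat -> nat -> C).

Definition sect a L : 'M[C]_L.+1 := \matrix_(i, j) a i j.

Definition qsect a q L i j : C := qmx q (sect a L) (inord i) (inord j).

(** The entries [m] arise from finite sections of [a] in two successive limits, section size and
    then degree. Only entrywise convergence is asked; uniformity comes from the determinant
    bounds. *)
Definition approximates a m := exists mq : nat -> nat -> nat -> C,
  (forall q i j, ccvg (fun L => qsect a q L i j) (mq q i j)) /\
  (forall i j, ccvg (fun q => mq q i j) (m i j)).

(** Determinants of a fixed size are continuous in their entries, so a bound uniform in [q] and in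
    all large [L] passes through both limits. *)
Lemma detN_approx a m a' m' N N' (B : R) : approximates a m -> approximates a' m' ->
  (forall q L, (N <= L)%N -> (N' <= L)%N ->
    cmod (detN (qsect a q L) N - detN (qsect a' q L) N') <= B) ->
  cmod (detN m N - detN m' N') <= B.
Proof.
move=> [mq [h1 h2]] [mq' [h1' h2']] hB.
have cd (f : nat -> nat -> nat -> C) g M : (forall i j, ccvg (fun k => f k i j) (g i j)) ->
    ccvg (fun k => detN (f k) M) (detN g M).
  by move=> fg; apply: ccvg_det => i j; rewrite mxE; under eq_fun do rewrite mxE; exact: fg.
apply: (ccvg_le_bound (n0 := 0%N) (ccvgB (cd mq m N h2) (cd mq' m' N' h2'))) => q _.
have := ccvgB (cd (qsect a q) (mq q) N (h1 q)) (cd (qsect a' q) (mq' q) N' (h1' q)).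
move/(@ccvg_le_bound _ _ _ (maxn N N')); apply => L; rewrite geq_max => /andP[NL N'L].
exact: hB.
Qed.

Variable r : R.

Lemma detN_lipschitz : exists2 K : R, 0 <= K &
  forall a m a' m' (del : R), approximates a m -> approximates a' m' ->
  (forall L, fro (sect a L) <= r) -> (forall L, fro (sect a' L) <= r) ->
  (forall L, fro (sect a' L - sect a L) <= del) ->
  forall N, cmod (detN m' N - detN m N) <= K * del.
Proof.
(* One radius for both factors: [r] bounds X and [fro_bmx] bounds b(X). *)
pose r' := Num.max r (2 * expR r * r).
pose K := 4 * expR ((r' + 1) ^+ 2) * (1 + 2 * expR r).
exists K; first by rewrite !mulr_ge0 ?expR_ge0// addr_ge0// mulr_ge0 ?expR_ge0.
move=> a m a' m' del am am' ar ar' aB N.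
have r0 : 0 <= r := le_trans (fro_ge0 _) (ar 0%N).
have r'0 : 0 <= r' by rewrite le_max r0.
apply: (detN_approx am' am) => q L NL _; have NL1 := leq_trans NL (leqnSn L).
rewrite /qsect !detN_qmx//.
have X1 : fro (rowcut N (sect a L)) <= r'.
  by rewrite le_max (le_trans (fro_rowcut _ _) (ar L)).
have X2 : fro (rowcut N (sect a' L)) <= r'.
  by rewrite le_max (le_trans (fro_rowcut _ _) (ar' L)).
have Y1 : fro (colcut N (bmx q (sect a L))) <= r'.
  by apply: le_trans (fro_colcut _ _) _; rewrite le_max fro_bmx ?orbT.
have Y2 : fro (colcut N (bmx q (sect a' L))) <= r'.
  by apply: le_trans (fro_colcut _ _) _; rewrite le_max fro_bmx ?orbT.
apply: le_trans (det1DM_lipschitz r'0 X1 Y1 X2 Y2) _.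
rewrite -[leRHS]mulrA ler_wpM2l ?mulr_ge0 ?expR_ge0//.
rewrite mulrDl mul1r; apply: lerD.
  by rewrite rowcutB (le_trans (fro_rowcut _ _)).
rewrite colcutB (le_trans (fro_colcut _ _))// (le_trans (fro_bmxB _ (ar' L) (ar L)))//.
by rewrite ler_wpM2l// mulr_ge0 ?expR_ge0.
Qed.

(** The masses of the leading squares increase to a finite limit. Rows and columns beyond [N0] lie
    outside the leading square of size [N0], so they carry little mass, uniformly in [L]. *)
Lemma sect_bounded_cut a : (forall L, fro (sect a L) <= r) ->
  forall eps : R, 0 < eps -> exists N0, forall N N' L, (N0 <= N)%N -> (N <= N')%N ->
    fro (rowcut N' (sect a L) - rowcut N (sect a L)) <= eps /\
    fro (colcut N' (sect a L) - colcut N (sect a L)) <= eps.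
Proof.
move=> ar eps e0; have r0 : 0 <= r := le_trans (fro_ge0 _) (ar 0%N).
pose sq M := \sum_(i < M) \sum_(j < M) cmod (a i j) ^+ 2.
pose w M i j := if (i < M)%N && (j < M)%N then cmod (a i j) ^+ 2 else 0.
have w0 M i j : 0 <= w M i j by rewrite /w; case: ifP; rewrite ?sqr_ge0.
have sqE M L : (M <= L)%N -> sq M = \sum_(i < L) \sum_(j < L) w M i j.
  move=> ML; rewrite /sq (big_ord_widen _ (fun i => \sum_(j < M) cmod (a i j) ^+ 2) ML).
  rewrite big_mkcond/=; apply: eq_bigr => i _.
  rewrite /w; case: (ltnP i M) => iM /=; last by rewrite big1.
  by rewrite (big_ord_widen _ (fun j => cmod (a i j) ^+ 2) ML) big_mkcond.
have nds : {homo sq : M L / (M <= L)%N >-> M <= L}.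
  move=> M L ML; rewrite (sqE M L ML) /sq; apply: ler_sum => i _; apply: ler_sum => j _.
  by rewrite /w; case: ifP; rewrite ?sqr_ge0.
have sqS L : sq L.+1 = fro2 (sect a L).
  by apply: eq_bigr => i _; apply: eq_bigr => j _; rewrite mxE.
have sr M : sq M <= r ^+ 2.
  apply: le_trans (nds _ _ (leqnSn M)) _; rewrite sqS -sqr_fro.
  by rewrite ler_pXn2r ?nnegrE ?fro_ge0.
have [|N0 hN0] := nondecreasing_bounded_cauchy nds sr (eps := eps ^+ 2); first by rewrite exprn_gt0.
exists N0 => N N' L N0N NN'.
have e0' := ltW e0.
have small : fro2 (sect a L) - \sum_(i < L.+1) \sum_(j < L.+1) w N0 i j <= eps ^+ 2.
  rewrite -sqS; have [LN|NL] := leqP L.+1 N0; last by rewrite -sqE ?hN0// ltnW.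
  rewrite (_ : \sum_(i < L.+1) _ = sq L.+1) ?subrr ?sqr_ge0//.
  apply: eq_bigr => i _; apply: eq_bigr => j _.
  by rewrite /w !(leq_trans (ltn_ord _) LN).
have gen (M : 'M[C]_L.+1) : (forall i j : 'I_L.+1, cmod (M i j) ^+ 2 + w N0 i j <= cmod (a i j) ^+ 2) ->
    fro M <= eps.
  move=> hM; apply: fro_le => //; apply: le_trans small.
  rewrite lerBrDr /fro2 -big_split/=; apply: ler_sum => i _; rewrite -big_split/=.
  by apply: ler_sum => j _; rewrite mxE.
split; apply: gen => i j; rewrite !mxE /w.
- case: (ltnP i N) => iN; first by rewrite (leq_trans iN NN') subrr cmod0 expr0n/= add0r; case: ifP; rewrite ?sqr_ge0.
  rewrite [(i < N0)%N]ltnNge (leq_trans N0N iN)/= addr0 subr0.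
  by case: ifP => _; rewrite ?lexx// cmod0 expr0n/= sqr_ge0.
- case: (ltnP j N) => jN; first by rewrite (leq_trans jN NN') subrr cmod0 expr0n/= add0r; case: ifP; rewrite ?sqr_ge0.
  rewrite [(j < N0)%N]ltnNge (leq_trans N0N jN)/= andbF addr0 subr0.
  by case: ifP => _; rewrite ?lexx// cmod0 expr0n/= sqr_ge0.
Qed.

(** Enlarging a minor changes the two factors only in late rows and columns, which are small by
    [sect_bounded_cut]; hence the minors are Cauchy. *)
Lemma detN_cvg a m : approximates a m -> (forall L, fro (sect a L) <= r) ->
  ccvg (detN m) (clim (detN m)).
Proof.
move=> am ar; apply: ccvg_clim => eps e0.
have r0 : 0 <= r := le_trans (fro_ge0 _) (ar 0%N).
pose r' := Num.max r (2 * expR r * r).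
pose K := 4 * expR ((r' + 1) ^+ 2) * (1 + 2 * expR r).
have r'0 : 0 <= r' by rewrite le_max r0.
have K0 : 0 < K by rewrite !mulr_gt0 ?expR_gt0// ltr_wpDr// mulr_ge0 ?expR_ge0.
have [N0 hN0] := sect_bounded_cut ar (divr_gt0 e0 K0).
exists N0 => N N' N0N NN'.
apply: (detN_approx am am) => q L N'L NL.
rewrite /qsect !detN_qmx ?(leq_trans _ (leqnSn L))//.
have [h1 h2] := hN0 N N' L N0N NN'.
have X1 M : fro (rowcut M (sect a L)) <= r'.
  by rewrite le_max (le_trans (fro_rowcut _ _) (ar L)).
have Y1 M : fro (colcut M (bmx q (sect a L))) <= r'.
  by apply: le_trans (fro_colcut _ _) _; rewrite le_max fro_bmx ?orbT.
apply: le_trans (det1DM_lipschitz r'0 (X1 N) (Y1 N) (X1 N') (Y1 N')) _.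
apply: (@le_trans _ _ (4 * expR ((r' + 1) ^+ 2) * ((1 + 2 * expR r) * (eps / K)))); last first.
  by rewrite mulrA -/K mulrC divfK ?lt0r_neq0.
rewrite ler_wpM2l ?mulr_ge0 ?expR_ge0//.
rewrite mulrDl mul1r; apply: lerD => //.
(* Cutting columns is right multiplication by a diagonal projection, which [fro_bmx_cut] moves onto
   the section itself. *)
have cE M : colcut M (bmx q (sect a L)) = bmx q (sect a L) * colcut M 1.
  by rewrite colcutM mulr1.
have cE' M : colcut M (sect a L) = sect a L * colcut M 1.
  by rewrite colcutM mulr1.
rewrite !cE -mulrBr; apply: le_trans (fro_bmx_cut q (ar L) (erefl _)) _.
by rewrite ler_wpM2l ?mulr_ge0 ?expR_ge0// mulrBr -!cE'.
Qed.

End determinant_limits.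

(** * Bounded operators on L^2 and their exponential *)

Section operators.
Context d (T : measurableType d) (R : realType).
Variable mu : {measure set T -> \bar R}.
Local Notation C := R[i].
Local Notation L2 := (L2 mu).
Local Notation inner := (inner mu).
Local Notation nrm := (nrm mu).
Local Notation nsq := (nsq mu).
Implicit Types (f g : T -> C) (u v : nat -> T -> C) (A : (T -> C) -> T -> C).

Definition lcvg u f := forall eps : R, 0 < eps ->
  exists N, forall n, (N <= n)%N -> nrm (fun x => u n x - f x) <= eps.

Lemma cvg_lcvg u f : nrm (fun x => u n x - f x) @[n --> \oo] --> (0 : R) -> lcvg u f.
Proof.
move=> uf eps e0; have [N hN] := cvg_dist uf e0; exists N => n /hN.
by rewrite subr0 ger0_norm ?nrm_ge0.
Qed.

Lemma lcvg_cvg u f : lcvg u f -> nrm (fun x => u n x - f x) @[n --> \oo] --> (0 : R).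
Proof.
move=> uf; apply/cvgrPdist_le => eps e0; have [N hN] := uf _ e0.
by exists N => // n /hN; rewrite sub0r normrN ger0_norm ?nrm_ge0.
Qed.

Lemma lcvg_inner u f g : (forall n, L2 (u n)) -> L2 f -> L2 g -> lcvg u f ->
  ccvg (fun n => inner g (u n)) (inner g f).
Proof.
move=> Lu Lf Lg uf eps e0.
have k0 : 0 < nrm g + 1 by rewrite ltr_wpDl ?nrm_ge0.
have [N hN] := uf _ (divr_gt0 e0 k0); exists N => n /hN h.
rewrite -innerBr//; apply: le_trans (cauchy_schwarz Lg (L2B (Lu n) Lf)) _.
rewrite -(divfK (lt0r_neq0 k0) eps) mulrC.
by apply: ler_pM; rewrite ?nrm_ge0 ?lerDl.
Qed.

Lemma lcvg_scaled u f (v : nat -> T -> C) g (M : R) : 0 <= M -> lcvg u f ->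
  (forall n, nrm (fun x => v n x - g x) <= M * nrm (fun x => u n x - f x)) ->
  lcvg v g.
Proof.
move=> M0 uf h eps e0; have k0 : 0 < M + 1 by rewrite ltr_wpDl.
have [N hN] := uf _ (divr_gt0 e0 k0); exists N => n /hN hn.
apply: le_trans (h n) _; rewrite -(divfK (lt0r_neq0 k0) eps) mulrC.
by apply: ler_pM; rewrite ?nrm_ge0 ?lerDl.
Qed.

Section bounded.
Variable A : (T -> C) -> T -> C.
Hypothesis bA : bounded_operator mu A.

Lemma op_L2 f : L2 f -> L2 (A f). Proof. by case: bA => h _ _; exact: h. Qed.

Lemma op_lin (c : C) f g : L2 f -> L2 g ->
  ae_eq mu setT (A (fun x => c * f x + g x)) (fun x => c * A f x + A g x).
Proof. by case: bA => _ h _; exact: h. Qed.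

Lemma op_bound : exists2 M : R, 0 <= M & forall f, L2 f -> nrm (A f) <= M * nrm f.
Proof.
case: bA => h1 _ [M hM]; exists `|M| => // f Lf.
have := hM f Lf; rewrite (L2norm_nrm (h1 _ Lf)) (L2norm_nrm Lf) -EFinM lee_fin => h.
by apply: le_trans h _; rewrite ler_wpM2r ?nrm_ge0// ler_norm.
Qed.

Lemma op_contr M : (forall f, L2 f -> nrm (A f) <= M * nrm f) ->
  forall f g, L2 f -> L2 g ->
  nrm (fun x => A f x - A g x) <= M * nrm (fun x => f x - g x).
Proof.
move=> hM f g Lf Lg.
have Lh : L2 (fun x => -1 * g x + f x) by exact: L2D (L2Z (-1) Lg) Lf.
rewrite (_ : nrm (fun x => A f x - A g x) = nrm (A (fun x => -1 * g x + f x))).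
  apply: le_trans (hM _ Lh) _; rewrite (_ : (fun x => -1 * g x + f x) = (fun x => f x - g x))//.
  by apply/funext => x; rewrite mulN1r addrC.
apply: ae_eq_nrm.
- exact: cmeasB (L2_meas (op_L2 Lf)) (L2_meas (op_L2 Lg)).
- exact: L2_meas (op_L2 Lh).
- have := op_lin (-1) Lg Lf; apply: filterS => x /= h /h ->.
  by rewrite mulN1r addrC.
Qed.

Lemma op_sum (I : Type) (s : seq I) (c : I -> C) (F : I -> T -> C) :
  (forall i, L2 (F i)) ->
  ae_eq mu setT (A (fun x => \sum_(i <- s) c i * F i x))
    (fun x => \sum_(i <- s) c i * A (F i) x).
Proof.
move=> LF; elim: s => [|i s IH].
  have -> : (fun x => \sum_(i <- [::]) c i * F i x) = (fun=> 0).
    by apply/funext => x; rewrite big_nil.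
  have := op_lin (-1) (L2_0 mu) (L2_0 mu).
  have -> : (fun x : T => -1 * 0 + 0 : C) = (fun=> 0).
    by apply/funext => x; rewrite mulr0 addr0.
  by apply: filterS => x /= h /h ->; rewrite big_nil mulN1r addNr.
have -> : (fun x => \sum_(j <- i :: s) c j * F j x) =
    (fun x => c i * F i x + \sum_(j <- s) c j * F j x).
  by apply/funext => x; rewrite big_cons.
have := op_lin (c i) (LF i) (L2_sum (P := xpredT) s (fun j _ => L2Z (c j) (LF j))).
move: IH; apply: filterS2 => x /= h1 h2 _.
by rewrite h2// h1// big_cons.
Qed.

Lemma op_cvg u f : (forall n, L2 (u n)) -> L2 f -> lcvg u f ->
  lcvg (fun n => A (u n)) (A f).
Proof.
move=> Lu Lf uf; have [M M0 hM] := op_bound.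
by apply: (lcvg_scaled M0 uf) => n; exact: op_contr.
Qed.

Lemma op_iter_L2 f k : L2 f -> L2 (iter k A f).
Proof. by move=> Lf; elim: k => //= k IH; exact: op_L2. Qed.

Lemma op_iter_bound M f k : 0 <= M -> (forall f, L2 f -> nrm (A f) <= M * nrm f) ->
  L2 f -> nrm (iter k A f) <= M ^+ k * nrm f.
Proof.
move=> M0 hM Lf; elim: k => [|k IH]; first by rewrite expr0 mul1r.
apply: le_trans (hM _ (op_iter_L2 k Lf)) _.
by rewrite exprS -mulrA ler_wpM2l.
Qed.

Definition exp_sum f N x := \sum_(0 <= k < N) (k`!%:R)^-1 * iter k A f x.

Lemma exp_sum_L2 f N : L2 f -> L2 (exp_sum f N).
Proof. by move=> Lf; apply: L2_sum => k _; apply: L2Z; exact: op_iter_L2. Qed.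

(** The choice in [op_exp] is made from a non-empty set: the partial sums are Cauchy, dominated by
    the series of M^k / k!, and L^2 is complete. *)
Lemma op_expP f : L2 f -> L2 (op_exp mu A f) /\ lcvg (exp_sum f) (op_exp mu A f).
Proof.
move=> Lf; have LS N := exp_sum_L2 N Lf.
suff [u Lu uf] : exists2 u, L2 u & nrm (fun x => exp_sum f n x - u x) @[n --> \oo] --> (0 : R).
  have : [set u | L2 u /\ L2norm mu (fun x => exp_sum f N x - u x) @[N --> \oo] --> 0%E] u.
    split => //; have -> : (fun N => L2norm mu (fun x => exp_sum f N x - u x)) =
        (fun N => (nrm (fun x => exp_sum f N x - u x))%:E).
      by apply/funext => n; rewrite L2norm_nrm//; exact: L2B.
    by apply: cvg_EFin => //; exact: nearW.
  move=> /(xgetI (fun=> 0 : C)) [L1 c1]; split=> //; apply: cvg_lcvg.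
  have -> : (fun n => nrm (fun x => exp_sum f n x - op_exp mu A f x)) =
      (fun n => fine (L2norm mu (fun x => exp_sum f n x - op_exp mu A f x))).
    by apply/funext => n; rewrite L2norm_nrm//; exact: L2B.
  by apply/fine_cvg.
have [M M0 hM] := op_bound.
apply: L2_complete => // eps e0.
pose a n := \sum_(k < n) M ^+ k / k`!%:R.
have nda : {homo a : m n / (m <= n)%N >-> m <= n}.
  move=> m n mn; rewrite /a -!(big_mkord xpredT (fun k => M ^+ k / k`!%:R)).
  rewrite [leRHS](big_cat_nat (n := m))//= lerDl sumr_ge0// => k _.
  by rewrite divr_ge0 ?exprn_ge0.
have k0 : 0 < nrm f + 1 by rewrite ltr_wpDl ?nrm_ge0.
have [N hN] := nondecreasing_bounded_cauchy nda (fun n => expR_partial_sum n M0) (divr_gt0 e0 k0).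
exists N => m n Nm Nn.
wlog mn : m n Nm Nn / (n <= m)%N => [hw|].
  by have [|/ltnW] := leqP n m; [exact: hw|rewrite nrm_distC; exact: hw].
have -> : (fun x => exp_sum f m x - exp_sum f n x) =
    (fun x => \sum_(n <= k < m) (k`!%:R)^-1 * iter k A f x).
  by apply/funext => x; rewrite /exp_sum (big_cat_nat (n := n) (p := m))//= addrAC subrr add0r.
apply: le_trans (nrm_le_sum _ _) _; first by move=> k _; apply: L2Z; exact: op_iter_L2.
rewrite -(divfK (lt0r_neq0 k0) eps).
apply: (@le_trans _ _ ((a m - a n) * nrm f)); last first.
  apply: ler_pM; rewrite ?nrm_ge0 ?lerDl ?subr_ge0 ?nda//.
  exact: hN.
rewrite /a -!(big_mkord xpredT (fun k => M ^+ k / k`!%:R)).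
rewrite [X in _ <= (X - _) * _](big_cat_nat (n := n) (p := m))//= addrAC subrr add0r mulr_suml.
apply: ler_sum => k _; rewrite nrmZ; last exact: op_iter_L2.
rewrite -/(ifact k) cmod_ifact mulrC mulrAC ler_wpM2r ?invr_ge0//.
exact: op_iter_bound.
Qed.

End bounded.
End operators.

(** * Lipschitz continuity of det_2 in Hilbert-Schmidt norm *)

Section det2_continuity.
Context d (T : measurableType d) (R : realType).
Variable mu : {measure set T -> \bar R}.
Local Notation C := R[i].
Local Notation L2 := (L2 mu).
Local Notation inner := (inner mu).
Local Notation nrm := (nrm mu).
Local Notation nsq := (nsq mu).
Implicit Types (f g : T -> C) (A B : (T -> C) -> T -> C).
Variable e : nat -> T -> C.
Hypothesis onb : orthonormal_basis mu e.

Let Le n : L2 (e n). Proof. by case: onb. Qed.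
Let oe m n : inner (e m) (e n) = (m == n)%:R. Proof. by case: onb. Qed.
Let se : separating mu e.
Proof. by move=> f Lf f0; case: onb => _ _; exact. Qed.

Definition coefs A i j : C := inner (e i) (A (e j)).

Let Fi n := index_iota 0 n.
Let uFi n : uniq (Fi n). Proof. exact: iota_uniq. Qed.
Let ndFi m n : (m <= n)%N -> {subset Fi m <= Fi n}.
Proof. by move=> mn i; rewrite !mem_index_iota => /leq_trans; exact. Qed.
Let cFi i : exists n, i \in Fi n.
Proof. by exists i.+1; rewrite mem_index_iota/=. Qed.

Lemma hs_norm_le A (r : R) : 0 <= r -> (hs_norm mu e A <= r%:E)%E <->
  (\sum_(0 <= n <oo) (L2norm mu (A (e n))) ^+ 2 <= (r ^+ 2)%:E)%E.
Proof.
move=> r0; have S0 : (0 <= \sum_(0 <= n <oo) (L2norm mu (A (e n))) ^+ 2)%E.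
  by apply: nneseries_ge0 => n _ _; rewrite sqre_ge0.
rewrite /hs_norm poweR12_sqrt// -lee_sqr ?sqrte_ge0 ?lee_fin// sqr_sqrte//.
Qed.

(** Bessel's inequality bounds each column of the section by the squared norm of A e_j; the columns
    are then summed. *)
Lemma hs_sections A (r : R) : (forall f, L2 f -> L2 (A f)) -> 0 <= r ->
  (hs_norm mu e A <= r%:E)%E -> forall L, fro (sect (coefs A) L) <= r.
Proof.
move=> LA r0 hA L; apply: fro_le => //.
have S := (hs_norm_le A r0).1 hA.
rewrite -lee_fin; apply: le_trans S.
apply: (@le_trans _ _ (\sum_(0 <= n < L.+1) (L2norm mu (A (e n))) ^+ 2)%E); last first.
  by apply: nneseries_lim_ge => n _ _; rewrite sqre_ge0.
rewrite (eq_bigr (fun n => (nsq (A (e n)))%:E)); last first.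
  by move=> n _; rewrite (L2norm_nrm (LA _ (Le n))) -EFin_expe nrm2.
rewrite sumEFin lee_fin /fro2 exchange_big/= big_mkord; apply: ler_sum => j _.
under eq_bigr do rewrite mxE.
have := bessel Le oe (uFi L.+1) (LA _ (Le j)).
by rewrite /Fi big_mkord.
Qed.

Section one_operator.
Variable A : (T -> C) -> T -> C.
Hypothesis bA : bounded_operator mu A.

Let mom k i j := inner (e i) (iter k A (e j)).

(** For j <= L this is (P A P)^k e_j, where P projects onto the span of e_0, ..., e_L. *)
Let xL j k L : T -> C :=
  fun x => \sum_(l < L.+1) (sect (coefs A) L ^+ k) l (inord j) * e l x.

Let LxL j k L : L2 (xL j k L).
Proof. by apply: L2_sum => l _; exact: L2Z. Qed.

Let proj_contr s f g : uniq s -> L2 f -> L2 g ->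
  nrm (fun x => proj mu e s f x - proj mu e s g x) <= nrm (fun x => f x - g x).
Proof.
move=> us Lf Lg; have LB := L2B Lf Lg.
rewrite (_ : (fun x => proj mu e s f x - proj mu e s g x) = proj mu e s (fun x => f x - g x)).
  by rewrite ler_wsqrtr// (nsq_proj Le oe)//; exact: bessel.
apply/funext => x; rewrite /proj -sumrB; apply: eq_bigr => i _.
by rewrite innerBr// mulrBl.
Qed.

(** Induction on [k]: the next vector is P A applied to the current one, [A] is bounded, and the
    projections are contractions converging strongly to the identity. *)
Lemma sect_exp_cvg j k : lcvg mu (xL j k) (iter k A (e j)).
Proof.
elim: k => [|k IH].
  move=> eps e0; exists j => L jL; rewrite (_ : (fun x => _) = fun=> 0).
    by rewrite /nrm nsq0 sqrtr0 ltW.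
  apply/funext => x; rewrite /xL/= expr0 (bigD1 (inord j))//= !mxE eqxx mul1r.
  rewrite inordK// big1 ?addr0 ?subrr// => i ij.
  by rewrite mxE (negbTE ij) mul0r.
have LA : L2 (iter k A (e j)) by exact: op_iter_L2.
have h1 := op_cvg bA (LxL j k) LA IH.
have h2 := cvg_lcvg (cvg_trans _ (proj_cvg Le oe se uFi ndFi cFi (op_L2 bA LA))).
have xS L : xL j k.+1 L = proj mu e (Fi L.+1) (A (xL j k L)).
  apply/funext => x; rewrite /xL /proj /Fi big_mkord; apply: eq_bigr => l _; congr (_ * _).
  rewrite (ae_eq_inner (Le l) (op_L2 bA (LxL j k L)) _ (op_sum bA _ (fun p : 'I_L.+1 => (sect (coefs A) L ^+ k) p (inord j)) (fun p : 'I_L.+1 => Le p))); last first.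
    by apply: L2_sum => p _; apply: L2Z; exact: op_L2.
  rewrite inner_sumr// => [|p _]; last by apply: L2Z; exact: op_L2.
  rewrite exprS mxE; apply: eq_bigr => p _; rewrite innerZr//; last exact: op_L2.
  by rewrite mxE mulrC.
move=> eps e0; have e2 : 0 < eps / 2 by rewrite divr_gt0.
have [N1 hN1] := h1 _ e2.
have [N2 hN2] := cvg_dist (proj_cvg Le oe se uFi ndFi cFi (op_L2 bA LA)) e2.
exists (maxn N1 N2) => L; rewrite geq_max => /andP[NL1 NL2].
rewrite xS/=; have LAx := op_L2 bA (LxL j k L); have LAA := op_L2 bA LA.
apply: le_trans (nrm_dist_tri (L2_proj Le (Fi L.+1) _) (L2_proj Le (Fi L.+1) (A (iter k A (e j)))) LAA) _.
rewrite (splitr eps); apply: lerD.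
  by apply: le_trans (proj_contr (uFi _) LAx LAA) _; exact: hN1.
have := hN2 L.+1 (leq_trans NL2 (leqnSn L)).
by rewrite subr0 ger0_norm ?nrm_ge0// nrm_distC.
Qed.

Lemma sect_exp_entry k i j :
  ccvg (fun L => (sect (coefs A) L ^+ k) (inord i) (inord j)) (mom k i j).
Proof.
apply: (ccvg_eventually_eq (u := fun L => inner (e i) (xL j k L)) (n0 := i)).
  move=> L iL; rewrite /xL inner_sumr// => [|l _]; last exact: L2Z.
  rewrite (bigD1 (inord i))//= innerZr// oe inordK// eqxx mulr1 big1 ?addr0// => l il.
  rewrite innerZr// oe [i == l](_ : _ = false) ?mulr0//.
  apply/negbTE; apply: contra il => /eqP il.
  by apply/eqP/val_inj; rewrite /= inordK ?il.
apply: (lcvg_inner _ _ (Le i) (sect_exp_cvg j k)) => //; exact: op_iter_L2.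
Qed.

(** For fixed degree, entries of powers of the sections tend to those of powers of [A]. Then the
    degree grows: the exponential sums and their images under [A] converge in L^2 and are paired
    with e_i. *)
Lemma det2_approximates : approximates (coefs A)
  (fun i j => inner (e i) ((op_sub id A \o op_exp mu A) (e j))).
Proof.
exists (fun q i j => \sum_(k < q.+2) ifact k * (mom k i j - mom k.+1 i j)); split.
  move=> q i j; rewrite /qsect /qmx.
  have -> : (fun L => ((1 - sect (coefs A) L) * mxseries (@ifact R) q.+2 (sect (coefs A) L)) (inord i) (inord j)) =
    (fun L => \sum_(k < q.+2) ifact k * ((sect (coefs A) L ^+ k) (inord i) (inord j) -
       (sect (coefs A) L ^+ k.+1) (inord i) (inord j))).
    apply/funext => L; rewrite /mxseries mulr_sumr summxE; apply: eq_bigr => k _.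
    by rewrite -scalerAr mxE mulrBl mul1r -exprS !mxE.
  apply: ccvg_sum => k _; apply: ccvgZ.
  by apply: ccvgB; exact: sect_exp_entry.
move=> i j; have [LE cE] := op_expP bA (Le j).
have LAE := op_L2 bA LE.
have LS N := exp_sum_L2 bA N (Le j).
have h1 : ccvg (fun N => inner (e i) (exp_sum A (e j) N) - inner (e i) (A (exp_sum A (e j) N)))
   (inner (e i) (op_exp mu A (e j)) - inner (e i) (A (op_exp mu A (e j)))).
  apply: ccvgB; apply: lcvg_inner => //; first by move=> N; exact: op_L2.
  exact: op_cvg.
rewrite /op_sub/= innerBr//.
(* Index [q] stands for q + 2 terms of the series, hence the shift by 2. *)
apply: (ccvg_eventually_eq (n0 := 0%N) _ (ccvg_shift 2 h1)) => q _.
rewrite addn2 /exp_sum.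
have -> : inner (e i) (A (fun x => \sum_(0 <= k < q.+2) (k`!%:R)^-1 * iter k A (e j) x)) =
    \sum_(0 <= k < q.+2) (k`!%:R)^-1 * mom k.+1 i j.
  rewrite (ae_eq_inner (Le i) _ _ (op_sum bA _ _ (fun k => op_iter_L2 bA k (Le j)))).
  - rewrite inner_sumr// => [|k _]; last by apply: L2Z; exact: op_L2 (op_iter_L2 bA k (Le j)).
    by apply: eq_bigr => k _; rewrite innerZr//; exact: op_L2 (op_iter_L2 bA k (Le j)).
  - exact: op_L2 (LS q.+2).
  - by apply: L2_sum => k _; apply: L2Z; exact: op_L2 (op_iter_L2 bA k (Le j)).
rewrite inner_sumr// => [|k _]; last by apply: L2Z; exact: op_iter_L2.
rewrite -sumrB big_mkord; apply: eq_bigr => k _.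
by rewrite innerZr ?mulrBr//; exact: op_iter_L2.
Qed.

End one_operator.

(** Hilbert-Schmidt bounds give Frobenius bounds on all sections, so [detN_lipschitz] compares the
    minors of every size with one constant, and [detN_cvg] identifies the determinants as their
    limits. *)
Theorem det2_lipschitz (r : R) : 0 <= r -> exists2 K : R, 0 <= K &
  forall A B (del : R), bounded_operator mu A -> bounded_operator mu B ->
  (hs_norm mu e A <= r%:E)%E -> (hs_norm mu e B <= r%:E)%E ->
  0 <= del -> (hs_norm mu e (op_sub A B) <= del%:E)%E ->
  cmod (det2 mu e A - det2 mu e B) <= K * del.
Proof.
move=> r0; have [K K0 hK] := detN_lipschitz r; exists K => // A B del bA bB hA hB d0 hAB.
have LA f : L2 f -> L2 (A f) by exact: op_L2.
have LB f : L2 f -> L2 (B f) by exact: op_L2.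
have sA := hs_sections LA r0 hA; have sB := hs_sections LB r0 hB.
have aA := det2_approximates bA; have aB := det2_approximates bB.
have sAB L : fro (sect (coefs A) L - sect (coefs B) L) <= del.
  rewrite (_ : _ - _ = sect (coefs (op_sub A B)) L).
    by apply: hs_sections => // f Lf; exact: L2B (LA _ Lf) (LB _ Lf).
  apply/matrixP => i j; rewrite !mxE /coefs /op_sub.
  by rewrite (innerBr (Le i) (op_L2 bA (Le j)) (op_L2 bB (Le j))).
have cA := detN_cvg aA sA; have cB := detN_cvg aB sB.
apply: (ccvg_le_bound (n0 := 0%N) (ccvgB cA cB)) => N _.
exact: (hK _ _ _ _ del aB aA sB sA sAB N).
Qed.

End det2_continuity.

(** * Bounded limits, the circle measure and differentiation of integrals *)

Section bounded_limits.
Context d (T : measurableType d) (R : realType).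
Variable mu : {measure set T -> \bar R}.

(** Dominated convergence with majorant |f|; it carries orthogonality from smooth approximants to
    indicators. *)
Lemma Rintegral_bounded_limit (f : T -> R) (g_ : nat -> T -> R) (g : T -> R) :
  mu.-integrable setT (fun x => (f x)%:E) ->
  (forall n, measurable_fun setT (g_ n)) -> measurable_fun setT g ->
  (forall x, g_ n x @[n --> \oo] --> g x) -> (forall n x, `|g_ n x| <= 1) ->
  (forall n, Rintegral mu setT (fun x => f x * g_ n x) = 0) ->
  Rintegral mu setT (fun x => f x * g x) = 0.
Proof.
move=> jf mg_ mg gg g1 h0.
have mf : measurable_fun setT f by apply/measurable_EFinP; exact: measurable_int jf.
have jn : mu.-integrable setT (abse \o (fun x => (f x)%:E)) by exact: integrable_abse.
have [|||//||_ _ cv] := @dominated_convergence _ _ _ mu setT measurableT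
  (fun n x => (f x * g_ n x)%:E) (fun x => (f x * g x)%:E) (abse \o (fun x => (f x)%:E)).
- by move=> n; exact/measurable_EFinP/measurable_funM.
- exact/measurable_EFinP/measurable_funM.
- apply: aeW => x _; apply: cvg_EFin; first exact: nearW.
  by apply: cvgM; [exact: cvg_cst|exact: gg].
- apply: aeW => x n _ /=; rewrite lee_fin normrM ler_piMr//.
have jfn n : mu.-integrable setT (fun x => (f x * g_ n x)%:E).
  apply: le_integrable jn => //; first exact/measurable_EFinP/measurable_funM.
  by move=> x _ /=; rewrite lee_fin normrM normr_id ler_piMr.
have e0 : (fun n => \int[mu]_x (f x * g_ n x)%:E)%E = (fun=> 0%E).
  apply/funext => n; rewrite -[LHS]fineK; last exact: integrable_fin_num (jfn n).
  by have := h0 n; rewrite /Rintegral => ->.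
move: cv; rewrite e0 => cv; rewrite /Rintegral.
by rewrite -(cvg_lim (@ereal_hausdorff R) cv) lim_cst//; exact: ereal_hausdorff.
Qed.

End bounded_limits.

Section circle_measure.
Context {R : realType}.
Local Notation leb := (@lebesgue_measure R).
Implicit Types f : measurableTypeR R -> \bar R.

Lemma setT_I2pi : setT `\` ~` (@I2pi R) = I2pi.
Proof. by rewrite setTD setCK. Qed.

Lemma circle_C : (@circle R) (~` I2pi) = 0%E.
Proof. by rewrite -[LHS]/(leb (~` I2pi `&` I2pi)) setICl measure0. Qed.

Lemma circle_eq f : (\int[circle]_(x in I2pi) f x = \int[leb]_(x in I2pi) f x)%E.
Proof.
apply: eq_measure_integral => A mA AI.
by rewrite -[LHS]/(leb (A `&` I2pi)); congr (leb _); exact: setIidl.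
Qed.

Lemma circle_integrable f : measurable_fun setT f ->
  (circle.-integrable setT f <-> leb.-integrable I2pi f).
Proof.
move=> mf; have mI := @measurable_I2pi R.
rewrite (negligible_integrable (measurableC mI) measurableT mf circle_C) setT_I2pi.
split=> /integrableP[mfI foo]; apply/integrableP; split => //.
- by rewrite -circle_eq.
- by rewrite circle_eq.
Qed.

Lemma circle_integral f : circle.-integrable setT f ->
  (\int[circle]_x f x = \int[leb]_(x in I2pi) f x)%E.
Proof.
move=> jf; have mI := @measurable_I2pi R.
by rewrite (negligible_integral (measurableC mI) measurableT jf circle_C) setT_I2pi circle_eq.
Qed.

Lemma circle_ge0_integral f : measurable_fun setT f -> (forall x, 0 <= f x)%E ->
  (\int[circle]_x f x = \int[leb]_(x in I2pi) f x)%E.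
Proof.
move=> mf f0; have mI := @measurable_I2pi R.
by rewrite (ge0_negligible_integral (measurableC mI) measurableT mf _ circle_C)// setT_I2pi circle_eq.
Qed.

Lemma circle_ae (P : R -> Prop) : {ae leb, forall x, I2pi x -> P x} ->
  {ae circle, forall x, P x}.
Proof.
move=> [N [mN N0 sN]]; have mI := @measurable_I2pi R.
exists (N `|` ~` I2pi); split.
- by apply: measurableU => //; exact: measurableC.
- rewrite -[LHS]/(leb ((N `|` ~` I2pi) `&` I2pi)) setIUl setICl setU0.
  by apply: (subset_measure0 _ _ (@subIsetl _ N I2pi)) => //; exact: measurableI.
- move=> x /= nP; have [xI|xI] := pselect (I2pi x); last by right.
  by left; apply: sN => /= h; exact/nP/h.
Qed.

End circle_measure.

Section interval_differentiation.
Context {R : realType}.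
Local Notation leb := (@lebesgue_measure R).

(** Lebesgue differentiation along intervals of radius r(x) / (2 (n+1)), which shrink nicely to [x]:
    the averages are 0 and tend to f(x) at almost every point. *)
Lemma ae_eq0_of_intervals (f : R -> R) (D : set R) (r : R -> R) :
  locally_integrable setT f -> (forall x, 0 < r x) ->
  (forall x rho : R, D x -> 0 < rho -> rho < r x ->
    (\int[leb]_(y in `[(x - rho)%R, (x + rho)%R]) (f y)%:E = 0)%E) ->
  {ae leb, forall x, D x -> f x = 0}.
Proof.
move=> lf r0 hf.
pose rho (x : R) n := r x / 2 * (n.+1%:R)^-1.
have rho0 x n : 0 < rho x n by rewrite mulr_gt0 ?divr_gt0 ?invr_gt0.
have rho1 x n : rho x n < r x.
  apply: (@le_lt_trans _ _ (r x / 2)).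
    by rewrite ler_piMr ?divr_ge0 ?(ltW (r0 x))// invf_le1// ler1n.
  by rewrite ltr_pdivrMr// ltr_pMr// ltr1n.
pose E (x : R) n : set R := `[x - rho x n, x + rho x n]%classic.
have rho2 x n : 0 < rho x n + rho x n by rewrite addr_gt0.
have hE x : nicely_shrinking x (E x).
  split=> [n|]; first exact: measurable_itv.
  exists (2, fun n => PosNum (rho2 x n)); split => //=.
  - have h : (fun n => rho x n + rho x n) = (fun n => r x * harmonic n).
      by apply/funext => n; rewrite /rho/= -mulrDl -splitr.
    rewrite h -[X in _ --> X](mulr0 (r x)).
    by apply: cvgM; [exact: cvg_cst|exact: cvg_harmonic].
  - move=> n y; rewrite /E/= in_itv/= => /andP[h1 h2].
    by rewrite /ball/= ltr_norml; have := rho0 x n; lra.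
  - move=> n; rewrite lebesgue_measure_ball ?(ltW (rho2 x n))//.
    rewrite lebesgue_measure_itv/= lte_fin ifT; last by have := rho0 x n; lra.
    by rewrite -EFinD -EFinM lee_fin; have := rho0 x n; lra.
have := lebesgue_differentiation lf; apply: filter_app.
  exact: (ae_filter_ringOfSetsType leb).
apply: aeW => x fx Dx.
have := nice_lebesgue_differentiation hE lf fx.
have -> : (fun n => (leb (E x n))^-1 * \int[leb]_(y in E x n) (f y)%:E)%E = (fun=> 0%E).
  by apply/funext => n; rewrite hf// mule0.
move=> /(cvg_lim (@ereal_hausdorff R)); rewrite lim_cst; last exact: ereal_hausdorff.
by move=> [].
Qed.

End interval_differentiation.

(** * Separating families on product spaces *)

Section product_separation.
Context d1 d2 (T1 : measurableType d1) (T2 : measurableType d2) (R : realType).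
Variables (m1 : {sigma_finite_measure set T1 -> \bar R})
  (m2 : {sigma_finite_measure set T2 -> \bar R}).
Local Notation m12 := (m1 \x m2)%E.

Lemma L2_section (u : T1 * T2 -> R[i]) : L2 m12 u ->
  {ae m1, forall x, L2 m2 (fun y => u (x, y))}.
Proof.
move=> Lu; have mu := L2_meas Lu.
have := ae_integrable1 (L2_int Lu); apply: filterS => x ix.
by apply: (L2_le (h := fun y => cmod (u (x, y)) ^+ 2)) => //; exact: cmeas_section1.
Qed.

Lemma nsq_fubini (u : T1 * T2 -> R[i]) : L2 m12 u ->
  m1.-integrable setT (fun x => (nsq m2 (fun y => u (x, y)))%:E) /\
  nsq m12 u = Rintegral m1 setT (fun x => nsq m2 (fun y => u (x, y))).
Proof.
by move=> Lu; exact: (@Rintegral_fubini1 _ _ _ _ _ m2 m1 (fun p => cmod (u p) ^+ 2) (L2_int Lu)).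
Qed.

Lemma L2_tensor (f : T1 -> R[i]) (g : T2 -> R[i]) : L2 m1 f -> L2 m2 g ->
  L2 m12 (fun p => f p.1 * g p.2).
Proof.
move=> Lf Lg; have mf := L2_meas Lf; have mg := L2_meas Lg.
have cf : cintegrable m1 (fun x => (cmod (f x) ^+ 2)%:C).
  apply: cintegrable_le (L2_int Lf) _; first exact/cmeasR/cmeas_cmod2.
  by move=> x; rewrite cmodR ger0_norm// sqr_ge0.
have cg : cintegrable m2 (fun x => (cmod (g x) ^+ 2)%:C).
  apply: cintegrable_le (L2_int Lg) _; first exact/cmeasR/cmeas_cmod2.
  by move=> x; rewrite cmodR ger0_norm// sqr_ge0.
have c1 (p : T1 * T2) : cmod (1 : R[i]) <= 1 by rewrite cmod1.
have jn := cintegrable_cmod (cintegrable_tensor cf cg (cmeas_cst _ _) c1).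
apply: L2_le jn _.
  exact: (@cmeasM _ _ R (fun p => f p.1) (fun p => g p.2) (@cmeas_fst _ _ T1 T2 R f mf) (@cmeas_snd _ _ T1 T2 R g mg)).
move=> p; rewrite mul1r !cmodM !cmodR !ger0_norm ?sqr_ge0// exprMn//.
Qed.

Lemma L2_inner_section (psi : T2 -> R[i]) (u : T1 * T2 -> R[i]) :
  L2 m2 psi -> L2 m12 u -> L2 m1 (fun x => inner m2 psi (fun y => u (x, y))).
Proof.
move=> Lp Lu; have mu := L2_meas Lu; have mp := L2_meas Lp.
have mF : cmeasurable_fun (fun x => inner m2 psi (fun y => u (x, y))).
  apply: (@cmeas_cintegral _ _ _ _ _ m2 (fun p => (psi p.2)^* * u p)).
  by apply: cmeasM => //; exact: (@cmeas_snd _ _ T1 T2 R _ (cmeasJ mp)).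
apply: L2I => //.
have [jn _] := nsq_fubini Lu.
apply: (@le_lt_trans _ _ (\int[m1]_x (nsq m2 psi * nsq m2 (fun y => u (x, y)))%:E)%E).
  apply: ae_ge0_le_integral => //.
  - by move=> x _; rewrite lee_fin sqr_ge0.
  - exact/measurable_EFinP/cmeas_cmod2.
  - by move=> x _; rewrite lee_fin mulr_ge0 ?nsq_ge0.
  - exact: measurable_int (integrable_scale _ jn).
  - have := L2_section Lu; apply: filterS => x Lux _.
    by rewrite lee_fin; exact: cauchy_schwarz2.
exact: (integrable_lty measurableT (integrable_scale _ jn)).
Qed.

(** Pairing [u] with psi_j in the second variable gives an L^2 function orthogonal to all phi_i,
    hence null. The enumeration of [J] merges the exceptional sets, so almost every section of [u]
    is orthogonal to all psi_j at once. *)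
Lemma separating_product (I J : Type) (phi : I -> T1 -> R[i]) (psi : J -> T2 -> R[i])
    (enumJ : nat -> option J) :
  (forall j, exists n, enumJ n = Some j) ->
  (forall i, L2 m1 (phi i)) -> (forall j, L2 m2 (psi j)) ->
  separating m1 phi -> separating m2 psi ->
  separating m12 (fun ij : I * J => fun p => phi ij.1 p.1 * psi ij.2 p.2).
Proof.
move=> eJ Lphi Lpsi s1 s2 u Lu u0; have mu := L2_meas Lu.
have F0 j : ae_eq m1 setT (fun x => inner m2 (psi j) (fun y => u (x, y))) (fun=> 0).
  apply: s1; first exact: L2_inner_section.
  move=> i; have LT := L2_tensor (Lphi i) (Lpsi j).
  have jT := cintegrable_inner LT Lu.
  rewrite -(u0 (i, j)) /inner (cintegral_fubini1 jT).2.
  apply: ae_eq_cintegral.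
  - apply: cmeasM; first exact/cmeasJ/L2_meas/Lphi.
    exact: L2_meas (L2_inner_section (Lpsi j) Lu).
  - exact: cintegrable_meas (cintegral_fubini1 jT).1.
  have := L2_section Lu; apply: filterS => x Lux _ /=.
  rewrite -cintegralZ; last exact: cintegrable_inner.
  by apply: eq_cintegral => y; rewrite cconjM mulrA.
have F0' : {ae m1, forall x, forall n, if enumJ n is Some j then
    inner m2 (psi j) (fun y => u (x, y)) = 0 else True}.
  apply: ae_foralln => n; case: (enumJ n) => [j|]; last exact: aeW.
  by have := F0 j; apply: filterS => x /= h; exact: h.
apply: nsq_eq0 => //; have [_ ->] := nsq_fubini Lu.
rewrite /Rintegral (_ : \int[m1]_x _ = 0)%E//.
have [jn _] := nsq_fubini Lu.
rewrite (@ae_eq_integral _ _ _ m1 setT (fun=> 0%E)) ?integral0//.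
  exact: measurable_int jn.
have := L2_section Lu; move: F0'; apply: filterS2 => x hx Lux _.
suff e : ae_eq m2 setT (fun y => u (x, y)) (fun=> 0).
  by rewrite (ae_eq_nsq (L2_meas Lux) (cmeas_cst _ _) e) nsq0.
by apply: s2 => // j; have [n en] := eJ j; have := hx n; rewrite en.
Qed.

End product_separation.

(** * Unfolding the torus as a circle times a smaller torus *)

Section torus_integrals.
Context {R : realType}.

Section push.
Variable n : nat.
Implicit Types (f : Omega R n.+1 -> \bar R).

Lemma torusS_ge0_integral f : measurable_fun setT f -> (forall x, 0 <= f x)%E ->
  (\int[torus n.+1]_y f y = \int[circle \x torus n]_p f (cons_pair p))%E.
Proof.
move=> mf f0; have := @ge0_integral_pushforward _ _ _ _ R _ (@measurable_cons_pair R n)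
  (circle \x torus n)%E setT f measurableT mf (fun y _ => f0 y).
by rewrite preimage_setT.
Qed.

Lemma torusS_integrable f : measurable_fun setT f ->
  (torus n.+1).-integrable setT f <->
  (circle \x torus n)%E.-integrable setT (fun p => f (cons_pair p)).
Proof.
move=> mf; have mfc : measurable_fun setT (fun p => f (@cons_pair R n p)).
  by apply: measurableT_comp => //; exact: measurable_cons_pair.
have e : (\int[torus n.+1]_y `|f y| = \int[circle \x torus n]_p `|f (cons_pair p)|)%E.
  by apply: torusS_ge0_integral => //; exact: measurableT_comp.
by split=> /integrableP[_ foo]; apply/integrableP; split; rewrite // ?e// -e.
Qed.

Lemma torusS_integral f : (torus n.+1).-integrable setT f ->
  (\int[torus n.+1]_y f y = \int[circle \x torus n]_p f (cons_pair p))%E.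
Proof.
move=> jf; have mf := measurable_int _ jf.
have mc := @measurable_cons_pair R n.
rewrite integralE [RHS]integralE; congr (_ - _)%E.
- rewrite torusS_ge0_integral; [by apply: eq_integral => p _; rewrite !funeposE|exact: measurable_funepos|by move=> x; exact: funepos_ge0].
- rewrite torusS_ge0_integral; [by apply: eq_integral => p _; rewrite !funenegE|exact: measurable_funeneg|by move=> x; exact: funeneg_ge0].
Qed.

End push.

Lemma torusS_cintegrable n (f : Omega R n.+1 -> R[i]) : cmeasurable_fun f ->
  cintegrable (torus n.+1) f <->
  cintegrable (circle \x torus n)%E (fun p => f (cons_pair p)).
Proof.
move=> [m1 m2]; rewrite /cintegrable (torusS_integrable (f := fun y => (Re (f y))%:E)).
  by rewrite (torusS_integrable (f := fun y => (Im (f y))%:E))//; exact/measurable_EFinP.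
exact/measurable_EFinP.
Qed.

Lemma torusS_cintegral n (f : Omega R n.+1 -> R[i]) : cintegrable (torus n.+1) f ->
  cintegral (torus n.+1) f = cintegral (circle \x torus n)%E (fun p => f (cons_pair p)).
Proof.
by move=> [j1 j2]; apply: complex_ext; rewrite /cintegral/= /Rintegral torusS_integral.
Qed.

Lemma cmeas_cons n (f : Omega R n.+1 -> R[i]) : cmeasurable_fun f ->
  cmeasurable_fun (fun p => f (@cons_pair R n p)).
Proof. by move=> mf; apply: (cmeas_comp mf); exact: measurable_cons_pair. Qed.

Lemma torusS_L2 n (f : Omega R n.+1 -> R[i]) : L2 (torus n.+1) f ->
  L2 (circle \x torus n)%E (fun p => f (cons_pair p)).
Proof.
move=> Lf; have mf := L2_meas Lf; apply: L2I; first exact: cmeas_cons.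
rewrite -(torusS_ge0_integral (f := fun y => (cmod (f y) ^+ 2)%:E)).
- exact: (integrable_lty measurableT (L2_int Lf)).
- exact/measurable_EFinP/cmeas_cmod2.
- by move=> y; rewrite lee_fin sqr_ge0.
Qed.

Lemma torusS_nsq n (f : Omega R n.+1 -> R[i]) : cmeasurable_fun f ->
  nsq (torus n.+1) f = nsq (circle \x torus n)%E (fun p => f (cons_pair p)).
Proof.
move=> mf; congr fine; rewrite torusS_ge0_integral//.
- exact/measurable_EFinP/cmeas_cmod2.
- by move=> y; rewrite lee_fin sqr_ge0.
Qed.

End torus_integrals.

(** * Polynomials approximating a step function *)

Section step_polynomials.
Context {R : realType}.

Lemma bernoulli_ge (h : R) n : -1 <= h -> 1 + n%:R * h <= (1 + h) ^+ n.
Proof.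
move=> h1; elim: n => [|n IH]; first by rewrite mul0r addr0 expr0.
rewrite exprS -natr1; apply: (@le_trans _ _ ((1 + h) * (1 + n%:R * h))).
  have := sqr_ge0 h; have : 0 <= n%:R :> R by []; nra.
by rewrite ler_wpM2l//; lra.
Qed.

Lemma cvg_natM_expr (q : R) : 0 <= q < 1 -> n%:R * q ^+ n @[n --> \oo] --> (0 : R).
Proof.
move=> /andP[q0 q1]; pose r := Num.sqrt q.
have r0 : 0 <= r by exact: sqrtr_ge0.
have r2 : r ^+ 2 = q by rewrite sqr_sqrtr.
have r1 : r < 1 by rewrite -(@ltr_pXn2r _ 2) ?nnegrE// r2 expr1n.
have b n : n%:R * (1 - r) * r ^+ n <= 1.
  apply: (@le_trans _ _ ((1 + (1 - r)) ^+ n * r ^+ n)).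
    rewrite ler_wpM2r ?exprn_ge0//; apply: (le_trans _ (bernoulli_ge _ _)); last lra.
    by rewrite lerDr.
  by rewrite -exprMn exprn_ile1//; nra.
apply: (@squeeze_cvgr _ _ _ _ (fun=> 0) (fun n => (1 - r)^-1 * r ^+ n)).
- apply: nearW => n; rewrite mulr_ge0 ?exprn_ge0//= -r2 -exprM mulnC exprM expr2 mulrA.
  rewrite ler_wpM2r ?exprn_ge0// -[leRHS]mul1r ler_pdivlMr ?subr_gt0//.
  by have := b n; lra.
- exact: cvg_cst.
- rewrite -[X in _ --> X](mulr0 (1 - r)^-1); apply: cvgM; first exact: cvg_cst.
  by apply: cvg_expr; rewrite ger0_norm.
Qed.

(** On [0,1] these polynomials in [s] converge boundedly to a step at 1/2, a device of elementary
    proofs of the Stone-Weierstrass theorem. *)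
Definition stepf (s : R) n : R := 1 - (1 - s ^+ n) ^+ (n * 2 ^ n).

Lemma stepf_bound s n : 0 <= s <= 1 -> `|stepf s n| <= 1.
Proof.
move=> /andP[s0 s1]; have h : 0 <= 1 - s ^+ n by rewrite subr_ge0 exprn_ile1.
have h1 : 1 - s ^+ n <= 1 by rewrite lerBlDr lerDl exprn_ge0.
have := exprn_ge0 (n * 2 ^ n) h; have := exprn_ile1 (n * 2 ^ n) h h1.
by rewrite /stepf ler_norml; lra.
Qed.

Lemma stepf_cvg (s : R) : 0 <= s <= 1 ->
  stepf s n @[n --> \oo] --> (if 2^-1 <= s then 1 else 0 : R).
Proof.
move=> /andP[s0 s1]; case: (leP 2^-1 s) => hs.
  rewrite -[X in _ --> X]subr0; apply: cvgB; first exact: cvg_cst.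
  apply: (@squeeze_cvgr _ _ _ _ (fun=> 0) (@harmonic R)).
  - apply: nearW => n; have h0 : 0 <= 1 - s ^+ n by rewrite subr_ge0 exprn_ile1.
    (* For s >= 1/2, 1 - s^n <= e^(-2^-n), and the exponent n 2^n turns this into e^-n. *)
    rewrite exprn_ge0//=; apply: (@le_trans _ _ (expR (- n%:R))).
      apply: (@le_trans _ _ (expR (- 2^-1 ^+ n) ^+ (n * 2 ^ n))).
        apply: lerXn2r; rewrite ?nnegrE ?expR_ge0//.
        apply: le_trans (expR_ge1Dx _); rewrite lerD2l lerN2.
        by apply: lerXn2r; rewrite ?nnegrE.
      rewrite -expRM_natl; rewrite ler_expR natrM natrX mulrN -mulrA -exprMn divff// expr1n mulr1//.
    rewrite expRN /harmonic/= lef_pV2 ?posrE ?expR_gt0// -natr1 addrC.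
    exact: expR_ge1Dx.
  - exact: cvg_cst.
  - exact: cvg_harmonic.
have h2 : 0 <= 2 * s < 1 by apply/andP; split; lra.
apply: (@squeeze_cvgr _ _ _ _ (fun=> 0) (fun n => n%:R * (2 * s) ^+ n)).
- apply: nearW => n; have h0 : 0 <= s ^+ n by exact: exprn_ge0.
  have h1 : s ^+ n <= 1 by rewrite exprn_ile1.
  rewrite /stepf subr_ge0 exprn_ile1 ?subr_ge0//=; last by rewrite lerBlDr lerDl.
  (* For s < 1/2, Bernoulli's inequality gives (1 - s^n)^(n 2^n) >= 1 - n (2 s)^n. *)
  have := @bernoulli_ge (- s ^+ n) (n * 2 ^ n).
  by rewrite lerN2 h1 natrM natrX => /(_ isT); rewrite exprMn; lra.
- exact: cvg_cst.
- exact: cvg_natM_expr.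
Qed.

End step_polynomials.

(** * Totality of the exponentials on the circle *)

Section circle_separation.
Context {R : realType}.
Local Notation leb := (@lebesgue_measure R).

Lemma cos_cis (t : R) : (cos t)%:C = 2^-1 * cis t + 2^-1 * cis (- t).
Proof.
rewrite !cisE cosN sinN; have -> : (2^-1 : R[i]) = (2^-1 : R)%:C.
  by rewrite rmorphV ?unitfE// rmorph_nat.
by apply: complex_ext; rewrite !ReImE/=; lra.
Qed.

Definition trigpoly (g : R -> R[i]) := exists s : seq (R[i] * int),
  g = fun t => \sum_(p <- s) p.1 * cis (p.2%:~R * t).

Lemma trigpoly_cst c : trigpoly (fun=> c).
Proof.
exists [:: (c, 0)]; apply/funext => t.
by rewrite big_seq1/= mul0r cis0 mulr1.
Qed.

Lemma trigpoly_cis (c : R[i]) k : trigpoly (fun t => c * cis (k%:~R * t)).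
Proof. by exists [:: (c, k)]; apply/funext => t; rewrite big_seq1. Qed.

Lemma trigpolyD f g : trigpoly f -> trigpoly g -> trigpoly (fun t => f t + g t).
Proof. by move=> [s ->] [r ->]; exists (s ++ r); apply/funext => t; rewrite big_cat. Qed.

Lemma trigpolyM f g : trigpoly f -> trigpoly g -> trigpoly (fun t => f t * g t).
Proof.
move=> [s ->] [r ->]; exists [seq (p.1 * q.1, p.2 + q.2) | p <- s, q <- r].
apply/funext => t; rewrite big_allpairs_dep/= mulr_suml.
apply: eq_bigr => p _; rewrite mulr_sumr; apply: eq_bigr => q _.
by rewrite rmorphD/= mulrDl cisD; ring.
Qed.

Lemma trigpolyX f n : trigpoly f -> trigpoly (fun t => f t ^+ n).
Proof.
move=> tf; elim: n => [|n IH]; first exact: trigpoly_cst.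
have -> : (fun t => f t ^+ n.+1) = (fun t => f t * f t ^+ n).
  by apply/funext => t; rewrite exprS.
exact: trigpolyM.
Qed.

(** A trigonometric polynomial with values in [0,1] whose superlevel set at 1/2 is, under the
    hypotheses of [arcE], the interval of radius [rho] about [c]; composed with [stepf] it
    approximates the indicator of that interval. *)
Definition arc (c rho t : R) : R := 2^-1 + 4^-1 * (cos (t - c) - cos rho).

Lemma trigpoly_arc c rho : trigpoly (fun t => (arc c rho t)%:C).
Proof.
have -> : (fun t => (arc c rho t)%:C) = (fun t =>
    (2^-1 - 4^-1 * cos rho)%:C + ((4^-1)%:C * (2^-1 * cis (- c)) * cis (1%:~R * t) +
    (4^-1)%:C * (2^-1 * cis c) * cis ((-1)%:~R * t))).
  apply/funext => t; rewrite /arc rmorphD rmorphM rmorphB/= cos_cis opprB !cisD.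
  rewrite rmorphB/= [in RHS]rmorphM/= mul1r (_ : (-1)%:~R = -1)// mulN1r.
  ring.
apply: trigpolyD; first exact: trigpoly_cst.
by apply: trigpolyD; exact: trigpoly_cis.
Qed.

Lemma arc_bound c rho t : 0 <= arc c rho t <= 1.
Proof.
rewrite /arc; have := cos_le1 (t - c); have := cos_geN1 (t - c).
by have := cos_le1 rho; have := cos_geN1 rho; lra.
Qed.

Lemma arcE c rho t : 0 < rho -> rho < c -> rho < 2 * pi - c -> 0 <= t <= 2 * pi ->
  (2^-1 <= arc c rho t) = (c - rho <= t <= c + rho).
Proof.
move=> r0 rc rc2 /andP[t0 t2].
have -> : (2^-1 <= arc c rho t) = (cos rho <= cos (t - c)) by rewrite /arc; lra.
have -> : (c - rho <= t <= c + rho) = (`|t - c| <= rho) by rewrite ler_norml; lra.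
have -> : cos (t - c) = cos `|t - c|.
  by have [h|h] := ger0P (t - c); rewrite ?cosN.
have p0 := pi_gt0 R.
set u := `|t - c|; have u0 : 0 <= u by exact: normr_ge0.
have u1 : u < 2 * pi - rho by rewrite /u ltr_norml; lra.
have rp : rho < pi by lra.
have [up|up] := leP u pi.
  by rewrite -!leNgt || (rewrite leNgt ltr_cos ?in_itv/= ?u0 ?up ?(ltW r0) ?(ltW rp)// -leNgt).
have -> : cos u = cos (2 * pi - u).
  by rewrite mulr_natl addrC cosD2pi cosN.
have h : cos (2 * pi - u) < cos rho by rewrite ltr_cos ?in_itv/=; lra.
by rewrite leNgt h /= leNgt; apply/esym/negbTE; rewrite negbK; lra.
Qed.

Lemma cmeas_cis (k : R) : cmeasurable_fun (fun t : measurableTypeR R => cis (k * t)).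
Proof.
apply: (cmeas_parts (u := fun t => cos (k * t)) (v := fun t => sin (k * t))).
- apply: continuous_measurable_fun => x; apply: continuous_comp; last exact: continuous_cos.
  by apply: cvgM; [exact: cvg_cst|exact: cvg_id].
- apply: continuous_measurable_fun => x; apply: continuous_comp; last exact: continuous_sin.
  by apply: cvgM; [exact: cvg_cst|exact: cvg_id].
- by move=> t; rewrite cisE.
Qed.

Lemma L2_bounded d (T : measurableType d) (mu : {finite_measure set T -> \bar R})
    (f : T -> R[i]) (B : R) :
  cmeasurable_fun f -> (forall x, cmod (f x) <= B) -> L2 mu f.
Proof.
move=> mf fB; apply: (L2_le (h := fun=> B ^+ 2)) => //.
  exact: (finite_measure_integrable_cst mu (B ^+ 2) measurableT).
move=> x; rewrite ler_pXn2r ?nnegrE ?cmod_ge0//.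
exact: le_trans (cmod_ge0 _) (fB x).
Qed.

Lemma L2_cis (k : int) : L2 circle (fun t : measurableTypeR R => cis (k%:~R * t)).
Proof.
by apply: (@L2_bounded _ _ circle _ 1) => [|t]; [exact: cmeas_cis|rewrite cmod_cis].
Qed.

(** A function orthogonal to all exponentials is orthogonal to all trigonometric polynomials, hence
    in the limit to indicators of short intervals inside ]0, 2 pi[; Lebesgue differentiation then
    applies to its real and imaginary parts. *)
Lemma separating_circle :
  separating circle (fun (k : int) (t : measurableTypeR R) => cis (k%:~R * t)).
Proof.
move=> v Lv v0; have mv := L2_meas Lv; have [mv1 mv2] := mv.
have jg (g : R -> R[i]) : trigpoly g -> cintegrable circle (fun t => g t * v t).
  move=> [s ->].
  have -> : (fun t => (\sum_(p <- s) p.1 * cis (p.2%:~R * t)) * v t) =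
    (fun t => \sum_(p <- s) p.1 * ((cis ((- p.2)%:~R * t))^* * v t)).
    apply/funext => t; rewrite mulr_suml; apply: eq_bigr => p _.
    by rewrite mulrA conj_cis rmorphN/= mulNr opprK.
  by apply: cintegrable_sum => p _; apply: cintegrableZ; exact: cintegrable_inner (L2_cis _) Lv.
have tv (g : R -> R[i]) : trigpoly g -> cintegral circle (fun t => g t * v t) = 0.
  move=> [s ->].
  have -> : (fun t => (\sum_(p <- s) p.1 * cis (p.2%:~R * t)) * v t) =
    (fun t => \sum_(p <- s) p.1 * ((cis ((- p.2)%:~R * t))^* * v t)).
    apply/funext => t; rewrite mulr_suml; apply: eq_bigr => p _.
    by rewrite mulrA conj_cis rmorphN/= mulNr opprK.
  have ji (p : R[i] * int) := cintegrable_inner (L2_cis (- p.2)) Lv.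
  rewrite cintegral_sum => [|p _]; last exact/cintegrableZ/ji.
  rewrite big1// => p _; rewrite cintegralZ; last exact: ji.
  by have := v0 (- p.2); rewrite /inner => ->; rewrite mulr0.
pose q c rho n t := stepf (arc c rho t) n.
have tq c rho n : trigpoly (fun t => (q c rho n t)%:C).
  have tX := trigpolyX n (trigpoly_arc c rho).
  have -> : (fun t => (q c rho n t)%:C) = (fun t => 1 + (-1) * (1 + (-1) * (arc c rho t)%:C ^+ n) ^+ (n * 2 ^ n)).
    by apply/funext => t; rewrite /q /stepf !mulN1r !rmorphB !rmorphXn/= rmorphB rmorphXn.
  apply: trigpolyD; first exact: trigpoly_cst.
  apply: trigpolyM; first exact: trigpoly_cst.
  apply: trigpolyX; apply: trigpolyD; first exact: trigpoly_cst.
  by apply: trigpolyM; first exact: trigpoly_cst.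
have one : (fun t => 1 * v t) = v by apply/funext => t; rewrite mul1r.
have [jv1 jv2] : cintegrable circle v by rewrite -one; exact/jg/trigpoly_cst.
have marc c rho : measurable_fun setT (arc c rho : measurableTypeR R -> R).
  apply: continuous_measurable_fun => x; apply: cvgD; first exact: cvg_cst.
  apply: cvgM; first exact: cvg_cst.
  apply: cvgB; last exact: cvg_cst.
  apply: continuous_comp; last exact: continuous_cos.
  by apply: cvgB; [exact: cvg_id|exact: cvg_cst].
have mq c rho n : measurable_fun setT (q c rho n : measurableTypeR R -> R).
  apply: measurable_funB; first exact: measurable_cst.
  apply: measurable_funX; apply: measurable_funB; first exact: measurable_cst.
  by apply: measurable_funX; exact: marc.
pose I := @I2pi R; have mI : measurable I by exact: measurable_I2pi.
have part (f : measurableTypeR R -> R) : circle.-integrable setT (fun t => (f t)%:E) ->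
    (forall c rho n, Rintegral circle setT (fun t => f t * q c rho n t) = 0) ->
    {ae circle, forall t, f t = 0}.
  move=> jf fq.
  have mf : measurable_fun setT f by apply/measurable_EFinP; exact: measurable_int jf.
  pose ft := f \_ I.
  have jft : leb.-integrable setT (fun t => (ft t)%:E).
    have := (circle_integrable (measurable_int _ jf)).1 jf.
    rewrite (integrable_mkcond _ mI); apply: eq_integrable => // t _.
    by rewrite /ft !patchE; case: ifP.
  have lft : locally_integrable setT ft by apply: open_integrable_locally => //; exact: openT.
  pose D : set R := `]0, 2 * pi[%classic.
  (* This radius keeps the interval inside the period, as [arcE] requires; the value 1 only makes
     [r] positive outside. *)
  pose r (t : R) : R := if (0 < t) && (t < 2 * pi) then Num.min t (2 * pi - t) else 1.
  have r0 t : 0 < r t.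
    by rewrite /r; case: ifP => // /andP[t0 t2]; rewrite lt_min t0 subr_gt0.
  have hD : {ae leb, forall t, D t -> ft t = 0}.
    apply: (ae_eq0_of_intervals lft r0) => c rho.
    rewrite /D/= in_itv/= => Dc rho0; rewrite /r Dc lt_min => /andP[rc rc2].
    have := @Rintegral_bounded_limit _ _ _ circle f (q c rho)
      (fun t => if 2^-1 <= arc c rho t then 1 else 0) jf (mq c rho) _ _ _ (fq c rho).
    have mi : measurable_fun setT (fun t : measurableTypeR R => if 2^-1 <= arc c rho t then 1 else 0 : R).
      apply: measurable_fun_ifT => //.
      by apply: measurable_fun_ler => //; exact: marc.
    move=> /(_ mi (fun t => stepf_cvg (arc_bound c rho t)) (fun n t => stepf_bound n (arc_bound c rho t))).
    have jfi : circle.-integrable setT (fun t => (f t * (if 2^-1 <= arc c rho t then 1 else 0))%:E).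
      apply: le_integrable jf => //.
        by apply/measurable_EFinP; exact: measurable_funM.
      move=> t _ /=; rewrite lee_fin normrM ler_piMr//.
      by case: ifP => _; rewrite ?normr1 ?normr0.
    rewrite /Rintegral circle_integral// => fin0.
    have jfi2 := (circle_integrable (measurable_int _ jfi)).1 jfi.
    have {fin0} : (\int[leb]_(t in I2pi) (f t * (if 2^-1 <= arc c rho t then 1 else 0))%:E = 0)%E.
      by rewrite -[LHS]fineK ?fin0//; exact: integrable_fin_num.
    rewrite integral_mkcond => <-; rewrite [LHS]integral_mkcond; apply: eq_integral => t _.
    rewrite !patchE /ft patchE.
    case: (boolP (t \in I)) => tI; last by case: ifP.
    have tI' : 0 <= t <= 2 * pi by move: tI; rewrite inE /I /I2pi /= in_itv/=.
    rewrite arcE//; rewrite mem_setE in_itv/=.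
    by case: ifP; rewrite ?mulr1 ?mulr0.
  apply: circle_ae.
  have n0 : {ae leb, forall t, t != 0}.
    exists [set 0]; split => //; first exact: lebesgue_measure_set1.
    by move=> t /= /negP; rewrite negbK => /eqP.
  have n2 : {ae leb, forall t, t != 2 * pi}.
    exists [set 2 * pi]; split => //; first exact: lebesgue_measure_set1.
    by move=> t /= /negP; rewrite negbK => /eqP.
  have FF := ae_filter_ringOfSetsType leb.
  move: hD n0 n2; apply: filterS3 => t hD t0 t2 It.
  have := hD _; rewrite /ft patchE mem_set//; apply.
  by move: It; rewrite /I2pi /D/= !in_itv/= !lt_neqAle eq_sym t0 t2.
have h1 : {ae circle, forall t, Re (v t) = 0}.
  apply: part => // c rho n; have := tv _ (tq c rho n) => /(congr1 (@complex.Re R)).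
  rewrite /cintegral/= => e; rewrite -[RHS]e; apply: eq_Rintegral => t _.
  by rewrite ReImE/= mul0r subr0 mulrC.
have h2 : {ae circle, forall t, Im (v t) = 0}.
  apply: part => // c rho n; have := tv _ (tq c rho n) => /(congr1 (@complex.Im R)).
  rewrite /cintegral/= => e; rewrite -[RHS]e; apply: eq_Rintegral => t _.
  by rewrite ReImE/= mul0r addr0 mulrC.
by move: h1 h2; apply: filterS2 => t e1 e2 _; exact: complex_ext.
Qed.

End circle_separation.

(** * Fundamental theorem of calculus and circle integrals *)

Section fundamental_theorem.
Context {R : realType}.
Local Notation leb := (@lebesgue_measure R).

Lemma FTC_integral (F f : R -> R) (a b : R) : a < b ->
  (forall x, is_derive x (1 : R) F (f x)) -> continuous f ->
  (\int[leb]_(x in `[a, b]) (f x)%:E = (F b - F a)%:E)%E.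
Proof.
move=> ab dF cf; rewrite EFinB; apply: continuous_FTC2 => //.
- by apply: continuous_subspaceT; exact: cf.
- have cF : continuous F.
    move=> x; apply: differentiable_continuous; apply/derivable1_diffP.
    by have [] := dF x.
  split.
  + by move=> x _; have [] := dF x.
  + by apply: cvg_at_right_filter; exact: cF.
  + by apply: cvg_at_left_filter; exact: cF.
- by move=> x _; rewrite derive1E; exact: derive_val.
Qed.

Lemma continuous_integrable_itv (f : R -> R) (a b : R) : continuous f ->
  leb.-integrable `[a, b] (fun x => (f x)%:E).
Proof.
move=> cf; apply: continuous_compact_integrable; first exact: segment_compact.
by apply: continuous_subspaceT; exact: cf.
Qed.

Lemma is_derive_cos_lin (k x : R) : is_derive x (1 : R) (fun t => cos (k * t)) (- k * sin (k * x)).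
Proof.
have h1 : is_derive x (1 : R) (fun t : R => k * t) k.
  by apply: is_derive_eq; rewrite [LHS]mulr1.
apply: is_derive_eq; rewrite /GRing.scale/=; ring.
Qed.

Lemma is_derive_sin_lin (k x : R) : is_derive x (1 : R) (fun t => sin (k * t)) (k * cos (k * x)).
Proof.
have h1 : is_derive x (1 : R) (fun t : R => k * t) k.
  by apply: is_derive_eq; rewrite [LHS]mulr1.
apply: is_derive_eq; rewrite /GRing.scale/=; ring.
Qed.

Lemma is_derive_continuous (F : R -> R) (f : R -> R) :
  (forall x, is_derive x (1 : R) F (f x)) -> continuous F.
Proof.
move=> dF x; apply: differentiable_continuous; apply/derivable1_diffP.
by have [] := dF x.
Qed.

Lemma continuous_cos_lin (k : R) : continuous (fun t : R => cos (k * t)).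
Proof. exact: is_derive_continuous (is_derive_cos_lin k). Qed.

Lemma continuous_sin_lin (k : R) : continuous (fun t : R => sin (k * t)).
Proof. exact: is_derive_continuous (is_derive_sin_lin k). Qed.

Lemma cis_int2pi (k : int) : cis (k%:~R * (2 * pi)) = 1 :> R[i].
Proof.
have nat n : cis (n%:R * (2 * pi)) = 1 :> R[i].
  by rewrite mulr_natl cis_mulrn cis2pi expr1n.
case: k => n; first exact: nat.
by rewrite NegzE rmorphN/= mulNr -conj_cis nat conjC1.
Qed.

Lemma circle_cis (k : int) :
  cintegral circle (fun t : measurableTypeR R => cis (k%:~R * t)) = (k == 0)%:R * (2 * pi)%:C.
Proof.
have p0 : 0 < 2 * pi :> R by rewrite mulr_gt0 ?pi_gt0.
have [m1 m2] := @cmeas_cis R k%:~R.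
have RC (f : measurableTypeR R -> R) : measurable_fun setT f -> continuous (f : R -> R) ->
    (Rintegral circle setT f)%:E = (\int[leb]_(t in `[0%R, (2 * pi)%R]) (f t)%:E)%E.
  move=> mf cf; have jf : leb.-integrable I2pi (fun t => (f t)%:E).
    exact: continuous_integrable_itv.
  have mef : measurable_fun setT (fun t => (f t)%:E) by exact/measurable_EFinP.
  have jfc := (circle_integrable mef).2 jf.
  rewrite /Rintegral fineK ?circle_integral//.
  by rewrite -circle_integral//; exact: integrable_fin_num.
have e1 : (fun t : measurableTypeR R => Re (cis (k%:~R * t))) = (fun t => cos (k%:~R * t)).
  by apply/funext => t; rewrite cisE.
have e2 : (fun t : measurableTypeR R => Im (cis (k%:~R * t))) = (fun t => sin (k%:~R * t)).
  by apply/funext => t; rewrite cisE.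
rewrite e1 in m1; rewrite e2 in m2.
have := cis_int2pi k; rewrite cisE => /[dup] /(congr1 (@complex.Re R))/= c2 /(congr1 (@complex.Im R))/= s2.
apply: complex_ext; rewrite /cintegral /= ?e1 ?e2; apply: EFin_inj;
  rewrite RC//; try exact: continuous_cos_lin; try exact: continuous_sin_lin;
  have [->|k0] := eqVneq k 0; rewrite ?mul1r ?mul0r/=.
- rewrite (eq_integral (cst 1%E)) => [|t _]; last by rewrite mul0r cos0.
  rewrite integral_cst// mul1e; have := @lebesgue_measure_itv R `[0%R, (2 * pi)%R].
  by rewrite /= lte_fin p0 -EFinB subr0.
- have kR : k%:~R != 0 :> R by rewrite intr_eq0.
  have d (x : R) : is_derive x (1 : R) (fun t => k%:~R^-1 * sin (k%:~R * t)) (cos (k%:~R * x)).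
    have h := is_derive_sin_lin k%:~R x.
    by apply: is_derive_eq; rewrite /GRing.scale/= mulrA mulVf// mul1r.
  rewrite (FTC_integral p0 d (@continuous_cos_lin k%:~R)).
  by rewrite s2 !mulr0 sin0 mulr0 subrr.
- by rewrite (eq_integral (cst 0%E)) => [|t _]; rewrite ?integral0 ?mul0r ?sin0.
- have kR : k%:~R != 0 :> R by rewrite intr_eq0.
  have d (x : R) : is_derive x (1 : R) (fun t => - k%:~R^-1 * cos (k%:~R * t)) (sin (k%:~R * x)).
    have h := is_derive_cos_lin k%:~R x.
    by apply: is_derive_eq; rewrite /GRing.scale/= mulrA mulrNN mulVf// mul1r.
  rewrite (FTC_integral p0 d (@continuous_sin_lin k%:~R)).
  by rewrite c2 !mulr0 cos0 subrr.
Qed.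

End fundamental_theorem.

(** * Characters of the torus: orthogonality and totality *)

Section characters.
Context {R : realType}.

Lemma characterE n (m : 'rV[int]_n) (y : Omega R n) :
  character m y = cis (\sum_(i < n) (m 0 i)%:~R * tnth y i).
Proof. by []. Qed.

Lemma cmod_character n (m : 'rV[int]_n) (y : Omega R n) : cmod (character m y) = 1.
Proof. by rewrite characterE cmod_cis. Qed.

Lemma conj_character n (m : 'rV[int]_n) (y : Omega R n) :
  (character m y)^* = character (- m) y.
Proof.
rewrite !characterE conj_cis; congr cis; rewrite -sumrN; apply: eq_bigr => i _.
by rewrite mxE rmorphN mulNr.
Qed.

Lemma characterD n (m k : 'rV[int]_n) (y : Omega R n) :
  character (m + k) y = character m y * character k y.
Proof.
rewrite !characterE -cisD; congr cis; rewrite -big_split; apply: eq_bigr => i _ /=.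
by rewrite mxE rmorphD mulrDl.
Qed.

Lemma character0 n (y : Omega R n) : character (0 : 'rV[int]_n) y = 1.
Proof.
by rewrite characterE big1 ?cis0// => i _; rewrite mxE mul0r.
Qed.

Definition rtail n (m : 'rV[int]_n.+1) : 'rV[int]_n := \row_i m 0 (lift ord0 i).
Definition rcons0 n (k : int) (m : 'rV[int]_n) : 'rV[int]_n.+1 :=
  \row_j if unlift ord0 j is Some i then m 0 i else k.

Lemma rcons0_head n k (m : 'rV[int]_n) : rcons0 k m 0 ord0 = k.
Proof. by rewrite mxE unlift_none. Qed.
Lemma rcons0_tail n k (m : 'rV[int]_n) : rtail (rcons0 k m) = m.
Proof. by apply/rowP => i; rewrite !mxE liftK. Qed.

Lemma characterS n (m : 'rV[int]_n.+1) (p : Cyl R n) :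
  character m (cons_pair p) = cis ((m 0 ord0)%:~R * p.1) * character (rtail m) p.2.
Proof.
rewrite !characterE big_ord_recl cisD; congr (_ * cis _).
by apply: eq_bigr => i _; rewrite mxE tnthS.
Qed.

Lemma cmeas_character n (m : 'rV[int]_n) : cmeasurable_fun (fun y : Omega R n => character m y).
Proof.
have ms : measurable_fun setT (fun y : Omega R n => \sum_(i < n) (m 0 i)%:~R * tnth y i).
  apply: measurable_sum => i; apply: measurable_funM; first exact: measurable_cst.
  exact: measurable_tnth.
apply: (cmeas_parts (u := fun y : Omega R n => cos (\sum_(i < n) (m 0 i)%:~R * tnth y i))
  (v := fun y : Omega R n => sin (\sum_(i < n) (m 0 i)%:~R * tnth y i))).
- by apply: measurableT_comp => //; apply: continuous_measurable_fun; exact: continuous_cos.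
- by apply: measurableT_comp => //; apply: continuous_measurable_fun; exact: continuous_sin.
- by move=> y; rewrite characterE cisE.
Qed.

Lemma L2_character n (m : 'rV[int]_n) : L2 (torus n) (fun y : Omega R n => character m y).
Proof.
apply: (@L2_bounded _ _ _ (torus n) _ 1); first exact: cmeas_character.
by move=> y; rewrite cmod_character.
Qed.

Lemma cintegral_tensor d1 d2 (T1 : measurableType d1) (T2 : measurableType d2)
    (m1 : {sigma_finite_measure set T1 -> \bar R})
    (m2 : {sigma_finite_measure set T2 -> \bar R}) f g :
  cintegrable m1 f -> cintegrable m2 g ->
  cintegral (m1 \x m2)%E (fun p => f p.1 * g p.2) = cintegral m1 f * cintegral m2 g.
Proof.
move=> jf jg.
have c1 (p : T1 * T2) : cmod (1 : R[i]) <= 1 by rewrite cmod1.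
have jT := cintegrable_tensor jf jg (cmeas_cst _ _) c1.
have e : (fun p : T1 * T2 => 1 * (f p.1 * g p.2)) = (fun p => f p.1 * g p.2).
  by apply/funext => p; rewrite mul1r.
rewrite e in jT; rewrite (cintegral_fubini1 jT).2 mulrC -cintegralZ//.
by apply: eq_cintegral => x /=; rewrite cintegralZ// mulrC.
Qed.

Lemma cintegrable_character n (m : 'rV[int]_n) :
  cintegrable (torus n) (fun y : Omega R n => character m y).
Proof.
have := cintegrable_inner (L2_character (0 : 'rV[int]_n)) (L2_character m).
have -> // : (fun y : Omega R n => (character 0 y)^* * character m y) = character m.
by apply/funext => y; rewrite character0 conjC1 mul1r.
Qed.

Lemma cintegral_torus0 (f : Omega R 0 -> R[i]) : cmeasurable_fun f ->
  cintegral (torus 0) f = f [tuple].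
Proof.
move=> [m1 m2].
have h (g : Omega R 0 -> R) : measurable_fun setT g -> Rintegral (torus 0) setT g = g [tuple].
  move=> mg; rewrite /Rintegral integral_dirac; [|exact: measurableT|exact/measurable_EFinP].
  rewrite diracE. rewrite mem_set//. rewrite mul1e//.
by apply: complex_ext; rewrite /cintegral/= h.
Qed.

Lemma torus_character n (m : 'rV[int]_n) :
  cintegral (torus n) (fun y : Omega R n => character m y) = (m == 0)%:R * ((2 * pi) ^+ n)%:C.
Proof.
elim: n m => [|n IH] m.
  rewrite expr0 mulr1 (_ : m = 0) ?eqxx; last by apply/rowP => -[].
  by rewrite cintegral_torus0 ?character0 ?mul1r//; exact: cmeas_character.
rewrite (torusS_cintegral (cintegrable_character m)).
have jc : cintegrable circle (fun t : measurableTypeR R => cis ((m 0 ord0)%:~R * t)).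
  have := cintegrable_inner (@L2_cis R 0) (L2_cis (m 0 ord0)).
  have -> // : (fun t : measurableTypeR R => (cis (0%:~R * t))^* * cis ((m 0 ord0)%:~R * t)) =
    (fun t => cis ((m 0 ord0)%:~R * t)).
  by apply/funext => t; rewrite mul0r cis0 conjC1 mul1r.
have := cintegral_tensor jc (cintegrable_character (rtail m)).
have -> : (fun p : Cyl R n => cis ((m 0 ord0)%:~R * p.1) * character (rtail m) p.2) =
  (fun p => character m (cons_pair p)) by apply/funext => p; rewrite characterS.
move=> ->; rewrite circle_cis IH exprS rmorphM mulrACA -natrM mulnb; congr (_%:R * _).
congr (nat_of_bool _); apply/andP/eqP => [[/eqP m0 /eqP mt]|->]; last first.
  by rewrite mxE eqxx; split => //; apply/eqP/rowP => i; rewrite !mxE.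
apply/rowP => j; rewrite mxE; case: (unliftP ord0 j) => [i ->|->//].
by have := congr1 (fun v : 'rV_n => v 0 i) mt; rewrite !mxE.
by rewrite -!rmorphM.
Qed.

Lemma inner_character n (m k : 'rV[int]_n) :
  inner (torus n) (fun y : Omega R n => character m y) (fun y => character k y) =
  (m == k)%:R * ((2 * pi) ^+ n)%:C.
Proof.
rewrite /inner -[m == k]eq_sym -subr_eq0 -torus_character; apply: eq_cintegral => y.
by rewrite conj_character -characterD addrC.
Qed.

(** Induction on the dimension: a character is an exponential in the first coordinate times a
    character of the rest, so [separating_product] applies with the countable lattice as second
    index. *)
Lemma separating_character n :
  separating (torus n) (fun (m : 'rV[int]_n) (y : Omega R n) => character m y).
Proof.
elim: n => [|n IH] f Lf f0; have mf := L2_meas Lf.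
  have := f0 0; rewrite /inner.
  have -> : (fun y : Omega R 0 => (character 0 y)^* * f y) = f.
    by apply/funext => y; rewrite character0 conjC1 mul1r.
  rewrite cintegral_torus0// => h; apply: aeW => y _.
  by rewrite (tuple0 y).
apply: nsq_eq0 => //; rewrite torusS_nsq//.
have sp : separating (circle \x torus n)%E (fun (ij : int * 'rV[int]_n) (p : Cyl R n) =>
    cis (ij.1%:~R * p.1) * character ij.2 p.2).
  have enum (m : 'rV[int]_n) : exists k, unpickle k = Some m.
    by exists (pickle m); rewrite pickleK.
  exact: (separating_product enum (@L2_cis R) (@L2_character n)
    (@separating_circle R) (IH)).
have Lc := torusS_L2 Lf.
suff e : ae_eq (circle \x torus n)%E setT (fun p => f (cons_pair p)) (fun=> 0).
  by rewrite (ae_eq_nsq (L2_meas Lc) (cmeas_cst _ _) e) nsq0.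
apply: sp => // -[k m] /=.
rewrite -(f0 (rcons0 k m)) /inner torusS_cintegral; last first.
  exact: cintegrable_inner (L2_character _) Lf.
by apply: eq_cintegral => p; rewrite characterS rcons0_head rcons0_tail.
Qed.

End characters.

(** * Finite lattice balls *)

Section lattice_balls.
Context {R : realType} (n : nat).
Local Notation zvec := 'rV[int]_n.

Definition zcube M : seq zvec :=
  [seq \row_i ((f i : nat)%:Z - M%:Z) | f : {ffun 'I_n -> 'I_(2 * M).+1}].

(** A duplicate-free list of the lattice points of the ball: it turns the finitely supported sums of
    the Galerkin kernel into sums over lists and exhausts the lattice for Parseval. *)
Definition zball M : seq zvec := [seq m <- zcube M | znorm m <= M%:R :> R].

Lemma zcube_inj M : injective
  (fun f : {ffun 'I_n -> 'I_(2 * M).+1} => \row_i ((f i : nat)%:Z - M%:Z)).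
Proof.
move=> f g fg; apply/ffunP => i; apply: val_inj => /=.
have := congr1 (fun v : zvec => v 0 i) fg; rewrite !mxE => /addIr.
by case.
Qed.

Lemma zball_uniq M : uniq (zball M).
Proof. by apply: filter_uniq; rewrite map_inj_uniq ?enum_uniq//; exact: zcube_inj. Qed.

Lemma znorm2 (m : zvec) : znorm m ^+ 2 = \sum_(i < n) (m 0 i)%:~R ^+ 2 :> R.
Proof. by rewrite sqr_sqrtr// sumr_ge0// => i _; exact: sqr_ge0. Qed.

Lemma znorm_ge0 (m : zvec) : 0 <= znorm m :> R. Proof. exact: sqrtr_ge0. Qed.

Lemma mem_zball M (m : zvec) : (m \in zball M) = (znorm m <= M%:R :> R).
Proof.
rewrite mem_filter andb_idr// => mM; apply/mapP.
have mi i : (`|m 0 i| <= M%:Z)%R.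
  rewrite -(ler_int R) intr_norm -(@ler_pXn2r _ 2)// ?nnegrE//.
  apply: (@le_trans _ _ (znorm m ^+ 2)); last by rewrite ler_pXn2r ?nnegrE ?znorm_ge0 ?ler0n.
  rewrite znorm2 (bigD1 i)//= -normrX (ger0_norm (sqr_ge0 _)) lerDl sumr_ge0// => j _; exact: sqr_ge0.
have pf i : (absz (m 0 i + M%:Z)%R < (2 * M).+1)%N by have := mi i; lia.
exists [ffun i => Ordinal (pf i)]; first by rewrite mem_enum.
by apply/rowP => i; rewrite !mxE ffunE /=; have := mi i; lia.
Qed.

Lemma zball_sub M N : (M <= N)%N -> {subset zball M <= zball N}.
Proof.
by move=> MN m; rewrite !mem_zball => /le_trans; apply; rewrite ler_nat.
Qed.

Lemma zball_exhaust (m : zvec) : exists M, m \in zball M.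
Proof.
exists (Num.truncn (znorm m : R)).+1; rewrite mem_zball ltW//.
by have := truncnS_gt (znorm m : R).
Qed.

Lemma fsum_zball (V : zmodType) (F : zvec -> V) J :
  \sum_(j \in [set j : zvec | znorm j <= J%:R :> R]) F j = \sum_(j <- zball J) F j.
Proof.
have -> : [set j : zvec | znorm j <= J%:R :> R] = [set` zball J].
  by apply/seteqP; split => j /=; rewrite mem_zball.
by rewrite -fsbig_seq ?zball_uniq.
Qed.

Lemma znormN (m : zvec) : znorm (- m) = znorm m :> R.
Proof.
by congr Num.sqrt; apply: eq_bigr => i _; rewrite mxE rmorphN sqrrN.
Qed.

Lemma znormD2 (j k : zvec) : znorm (j + k) ^+ 2 <= 2 * (znorm j ^+ 2 + znorm k ^+ 2) :> R.
Proof.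
rewrite !znorm2 -big_split mulr_sumr; apply: ler_sum => i _ /=.
rewrite mxE rmorphD; set a := (_%:~R : R); set b := (_%:~R : R).
by have := sqr_ge0 (a - b); nra.
Qed.

End lattice_balls.
Arguments zball R {n} M.

(** * Fourier series on the torus *)

Section torus_parseval.
Context {R : realType} (n : nat).
Local Notation T := (torus n : {measure set (Omega R n) -> \bar R}).
Local Notation vol := ((2 * pi) ^+ n : R).

Lemma vol_gt0 : 0 < vol. Proof. by rewrite exprn_gt0// mulr_gt0// pi_gt0. Qed.
Hint Resolve vol_gt0 : core.

Definition echar (m : 'rV[int]_n) (y : Omega R n) : R[i] :=
  (Num.sqrt vol)^-1%:C * character m y.

Definition fc (m : 'rV[int]_n) (g : Omega R n -> R[i]) : R[i] :=
  (vol^-1)%:C * inner T (fun y => character m y) g.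

Definition tsum (s : seq 'rV[int]_n) (g : Omega R n -> R[i]) (y : Omega R n) : R[i] :=
  \sum_(m <- s) fc m g * character m y.

Lemma L2_echar m : L2 T (echar m). Proof. by apply: L2Z; exact: L2_character. Qed.

Lemma sqrt_vol2 : (Num.sqrt vol)^-1 * (Num.sqrt vol)^-1 = vol^-1.
Proof. by rewrite -invfM -expr2 sqr_sqrtr// ltW. Qed.

Lemma inner_echar m g : L2 T g ->
  inner T (echar m) g = (Num.sqrt vol)^-1%:C * inner T (fun y => character m y) g.
Proof.
by move=> Lg; rewrite innerZl ?conjR//; exact: L2_character.
Qed.

Lemma echar_orthonormal m k : inner T (echar m) (echar k) = (m == k)%:R.
Proof.
rewrite inner_echar; last exact: L2_echar.
rewrite innerZr; [|exact: L2_character|exact: L2_character].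
rewrite inner_character; set a := (Num.sqrt vol)^-1; set b := (m == k)%:R.
have -> : a%:C * (a%:C * (b * vol%:C)) = b * (a * a * vol)%:C by rewrite !rmorphM; ring.
by rewrite sqrt_vol2 mulVf ?gt_eqF// mulr1.
Qed.

Lemma echar_separating : separating T echar.
Proof.
move=> f Lf f0; apply: separating_character => // m; apply/eqP.
have := f0 m; rewrite inner_echar// => /eqP; rewrite mulf_eq0 => /orP[/eqP|//].
by move=> /(congr1 (@complex.Re R))/= /eqP; rewrite invr_eq0 gt_eqF ?sqrtr_gt0.
Qed.

Lemma proj_echar s g : L2 T g -> proj T echar s g = tsum s g.
Proof.
move=> Lg; apply/funext => y; apply: eq_bigr => m _.
by rewrite inner_echar// /echar /fc -sqrt_vol2 rmorphM; ring.
Qed.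

Lemma cmod_inner_echar m g : L2 T g ->
  cmod (inner T (echar m) g) ^+ 2 = vol * cmod (fc m g) ^+ 2.
Proof.
move=> Lg; rewrite inner_echar// /fc; have : 0 < vol := vol_gt0; move: (vol) => v v0.
rewrite !cmodM !cmodR !ger0_norm ?invr_ge0 ?sqrtr_ge0 ?(ltW v0)//.
rewrite !exprMn exprVn sqr_sqrtr ?(ltW v0)//.
have vn : v != 0 by rewrite gt_eqF.
by field.
Qed.

Lemma tsum_cvg g : L2 T g ->
  nrm T (fun y => g y - tsum (zball R M) g y) @[M --> \oo] --> (0 : R).
Proof.
move=> Lg; rewrite -[X in _ --> X]/0.
have := proj_cvg (F := fun M => zball R M) L2_echar echar_orthonormal echar_separating
  (@zball_uniq R n) (fun M N => @zball_sub R n M N) (@zball_exhaust R n) Lg.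
by under eq_fun => M do rewrite proj_echar//.
Qed.

Lemma nsq_sub_tsum g s B : L2 T g -> uniq s ->
  (forall M, \sum_(m <- zball R M | m \notin s) vol * cmod (fc m g) ^+ 2 <= B) ->
  nsq T (fun y => g y - tsum s g y) <= B.
Proof.
move=> Lg us hB; rewrite -proj_echar//.
apply: (nsq_sub_proj_le (F := fun M => zball R M) L2_echar echar_orthonormal echar_separating
  (@zball_uniq R n) (fun M N => @zball_sub R n M N) (@zball_exhaust R n) Lg us) => M.
by under eq_bigr do rewrite cmod_inner_echar//.
Qed.

Lemma nsq_sub_tsum_le g s : L2 T g -> uniq s ->
  nsq T (fun y => g y - tsum s g y) <= nsq T g.
Proof.
move=> Lg us; rewrite -proj_echar// (nsq_sub_proj L2_echar echar_orthonormal)//.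
by rewrite gerBl sumr_ge0// => i _; exact: sqr_ge0.
Qed.

Lemma nsq_character_sum (s : seq 'rV[int]_n) (c : 'rV[int]_n -> R[i]) : uniq s ->
  nsq T (fun y => \sum_(m <- s) c m * character m y) = vol * \sum_(m <- s) cmod (c m) ^+ 2.
Proof.
move=> us.
have Lc m : L2 T (fun y => c m * character m y) by apply: L2Z; exact: L2_character.
have Ls : L2 T (fun y => \sum_(m <- s) c m * character m y) by apply: L2_sum => m _.
apply: complexI; rewrite -innerE inner_suml// rmorphM rmorph_sum mulr_sumr.
apply: eq_big_seq => m sm /=; rewrite inner_sumr// (bigD1_seq m)//= big1 => [|k km].
  rewrite addr0 innerZl ?innerZr; try by [exact: L2_character|exact: Lc].
  by rewrite inner_character eqxx mul1r -mulJz; ring.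
rewrite innerZl ?innerZr; try by [exact: L2_character|exact: Lc].
by rewrite inner_character eq_sym (negbTE km) mul0r !mulr0.
Qed.

Lemma fourier_fc (w : Omega R n -> R) m : fourier w m = fc m (fun y => (w y)%:C).
Proof.
congr (_ * _); apply: eq_cintegral => y; by rewrite conj_character mulrC.
Qed.

(** Twisting by e^{-ij.y} shifts frequencies, so truncating row [j] of the kernel in [m] means
    discarding coefficients of [w] of index m + j. *)
Lemma fc_shift (w : Omega R n -> R) j m :
  fc m (fun y => (w y)%:C * character (- j) y) = fourier w (m + j).
Proof.
rewrite fourier_fc; congr (_ * _); apply: eq_cintegral => y.
by rewrite !conj_character opprD characterD; ring.
Qed.

End torus_parseval.

(** * Smooth functions of one variable *)

Section one_variable.
Context {R : realType}.
Implicit Types (f g : R -> R) (P : {poly R}).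

(** C^k regularity with derivatives given existentially, so that closure properties follow by
    induction without naming iterated derivatives. *)
Fixpoint ndiff k g : Prop :=
  if k is k'.+1 then exists g', (forall x, is_derive x (1 : R) g (g' x)) /\ ndiff k' g'
  else continuous g.

Lemma ndiffW k g : ndiff k.+1 g -> ndiff k g.
Proof.
elim: k g => [|k IH] g [g' [dg sg]]; first exact: is_derive_continuous dg.
by exists g'; split => //; exact: IH.
Qed.

Lemma ndiff_continuous k g : ndiff k g -> continuous g.
Proof. by elim: k => [//|k IH] /ndiffW; exact: IH. Qed.

Lemma ndiffD k f g : ndiff k f -> ndiff k g -> ndiff k (fun x => f x + g x).
Proof.
elim: k f g => [|k IH] f g; first by move=> cf cg x; apply: cvgD; [exact: cf|exact: cg].
move=> [f' [df sf]] [g' [dg sg]]; exists (fun x => f' x + g' x); split; last exact: IH.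
by move=> x; have h1 := df x; have h2 := dg x; exact: is_deriveD.
Qed.

Lemma ndiffM k f g : ndiff k f -> ndiff k g -> ndiff k (fun x => f x * g x).
Proof.
elim: k f g => [|k IH] f g; first by move=> cf cg x; apply: cvgM; [exact: cf|exact: cg].
move=> Sf Sg; move: (ndiffW Sf) (ndiffW Sg) => Wf Wg.
move: Sf Sg => [f' [df sf]] [g' [dg sg]]; exists (fun x => f x * g' x + g x * f' x).
split; last by apply: ndiffD; exact: IH.
by move=> x; have h1 := df x; have h2 := dg x; exact: is_deriveM.
Qed.

Lemma ndiff_cst k (c : R) : ndiff k (fun=> c).
Proof.
elim: k c => [|k IH] c; first by move=> x; exact: cvg_cst.
by exists (fun=> 0); split => [x|]; [exact: is_derive_cst|exact: IH].
Qed.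

Lemma is_derive_affine (c b x : R) : is_derive x (1 : R) (fun t => c * t + b) c.
Proof. by apply: is_derive_eq; rewrite addr0 [LHS]mulr1. Qed.

Lemma ndiff_affine k (c b : R) g : ndiff k g -> ndiff k (fun x => g (c * x + b)).
Proof.
elim: k g => [|k IH] g.
  move=> cg x; apply: continuous_comp; last exact: cg.
  exact: (is_derive_continuous (is_derive_affine c b)).
move=> [g' [dg sg]]; exists (fun x => g' (c * x + b) * c); split; last first.
  by apply: ndiffM; [exact: IH|exact: ndiff_cst].
move=> x; have h := dg (c * x + b); have h2 := is_derive_affine c b x.
exact: (is_derive1_comp (f := g) (g := fun t => c * t + b) h h2).
Qed.

Lemma ndiff_trig k : ndiff k (@cos R) /\ ndiff k (@sin R).
Proof.
elim: k => [|k [IHc IHs]]; first by split; [exact: continuous_cos|exact: continuous_sin].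
split; first exists (fun x => -1 * sin x); [|exists (@cos R)]; split => //.
- by move=> x; rewrite mulN1r; exact: is_derive_cos.
- by apply: ndiffM => //; exact: ndiff_cst.
- by move=> x; exact: is_derive_sin.
Qed.

(** The polynomial makes the family stable under differentiation; P = 1 gives the classical flat
    function. *)
Definition flat P (x : R) : R := if 0 < x then P.[x^-1] * expR (- x^-1) else 0.

Lemma poly_growth P (t : R) : 1 <= t -> `|P.[t]| <= (\sum_(i < size P) `|P`_i|) * t ^+ size P.
Proof.
move=> t1; rewrite horner_coef mulr_suml; apply: le_trans (ler_norm_sum _ _ _) _.
apply: ler_sum => i _; rewrite normrM ler_wpM2l// normrX ger0_norm ?(le_trans _ t1)//.
by rewrite ler_weXn2l// ltnW.
Qed.

(** With t = 1/x, e^t exceeds t^(m+1) / (m+1)!, where m + 1 is two more than the size of [P]; this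
    beats P(t) t^2. *)
Lemma flat_small P : exists2 C : R, 0 <= C &
  forall x : R, 0 < x -> x <= 1 -> `|flat P x| <= C * x ^+ 2.
Proof.
pose S := \sum_(i < size P) `|P`_i|; pose m := (size P).+1.
have S0 : 0 <= S by apply: sumr_ge0.
exists (S * m.+1`!%:R) => [|x x0 x1]; first by rewrite mulr_ge0.
rewrite /flat x0 normrM [X in _ * X]ger0_norm ?expR_ge0// expRN.
set t := x^-1; have t1 : 1 <= t by rewrite invf_ge1.
have t0 : 0 < t by exact: lt_le_trans t1.
have h := poly_growth P t1; rewrite -/S in h.
have h2 : t ^+ m.+1 / m.+1`!%:R <= expR t.
  by apply: le_trans (expR_ge1Dxn m (ltW t0)); rewrite lerDr.
have f0 : 0 < m.+1`!%:R :> R by rewrite ltr0n fact_gt0.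
have xt : x = t^-1 by rewrite invrK.
clearbody t; rewrite xt ler_pdivrMr ?expR_gt0//.
apply: (le_trans h); rewrite -!mulrA; apply: ler_wpM2l => //.
have -> : m.+1`!%:R * (t^-1 * (t^-1 * expR t)) = (t ^+ 2)^-1 * (expR t * m.+1`!%:R).
  by rewrite -exprVn expr2; ring.
by rewrite ler_pdivlMl ?exprn_gt0// -exprD add2n -ler_pdivrMr.
Qed.

(** For x > 0 the derivative of P(1/x) e^(-1/x) is x^-2 (P - P')(1/x) e^(-1/x), of the same form. At
    0 the quadratic bound of [flat_small] kills the difference quotient. *)
Lemma is_derive_flat P x : is_derive x (1 : R) (flat P) (flat ('X^2 * (P - P^`())) x).
Proof.
have [x0|x0|->] := ltgtP x 0.
- rewrite [X in is_derive _ _ _ X]/flat (ltNge 0 x) (ltW x0)/=.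
  apply: (@near_eq_is_derive _ _ _ (fun _ : R => 0 : R)).
  near=> y; rewrite /flat ltNge (_ : y <= 0)//; near: y.
  by apply: filterS (lt_nbhsl x0) => y /ltW.
- rewrite [X in is_derive _ _ _ X]/flat x0.
  have xn : x != 0 by rewrite gt_eqF.
  have dv : is_derive x (1 : R) (fun y : R => y^-1) (- x ^- 2).
    by have := is_deriveV xn (is_derive_id x (1:R)); rewrite /GRing.scale/= mulr1.
  have dP : is_derive x (1 : R) (fun y : R => P.[y^-1]) (P^`().[x^-1] * (- x ^- 2)).
    exact: (is_derive1_comp (f := horner P) (g := fun y => y^-1) (is_derive_poly _ _) dv).
  have de : is_derive x (1 : R) (fun y : R => expR (- y^-1)) (expR (- x^-1) * x ^- 2).
    rewrite -[x ^- 2]opprK.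
    exact: (is_derive1_comp (f := expR) (g := fun y => - y^-1) (is_derive_expR _) (is_deriveN dv)).
  have D := is_deriveM dP de; refine (near_eq_is_derive _ (is_derive_eq D _)).
    near=> y; rewrite /flat (_ : 0 < y)//; near: y; exact: lt_nbhsr.
  by rewrite !hornerE exprVn /GRing.scale/=; ring.
- rewrite [X in is_derive _ _ _ X]/flat ltxx.
  have [C C0 hC] := flat_small P.
  have h : (fun h : R => h^-1 *: ((flat P \o shift 0) (h *: 1) - flat P 0)) @ 0^' --> (0 : R).
    apply/cvgrPdist_le => e e0.
    have d0 : 0 < Num.min 1 (e / (C + 1)) by rewrite lt_min ltr01 divr_gt0// ltr_wpDl.
    near=> y.
    have yd : `|y| < Num.min 1 (e / (C + 1)).
      near: y; apply: dnbhs0_lt => //.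
    rewrite sub0r normrN /= addr0 [y *: 1]mulr1 [flat P 0]/flat ltxx subr0 normrM.
    have [y0|y0] := ltP 0 y; last by rewrite /flat ltNge y0/= normr0 mulr0 ltW.
    have yi : 0 < y^-1 by rewrite invr_gt0.
    rewrite (gtr0_norm yi).
    move: yd; rewrite lt_min (gtr0_norm y0) => /andP[/ltW y1 ye].
    rewrite ler_pdivrMl//.
    apply: le_trans (hC _ y0 y1) _; rewrite expr2 mulrA [y * e]mulrC ler_wpM2r ?(ltW y0)//.
    move: ye; rewrite ltr_pdivlMr ?ltr_wpDl// => /ltW; apply: le_trans.
    by rewrite mulrDr mulr1 mulrC lerDl ltW.
  split; last exact: cvg_lim h.
  by apply/cvg_ex; exists 0.
Unshelve. all: by end_near. Qed.

Lemma ndiff_flat k P : ndiff k (flat P).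
Proof.
elim: k P => [|k IH] P; first exact: is_derive_continuous (is_derive_flat P).
by exists (flat ('X^2 * (P - P^`()))); split => [x|]; [exact: is_derive_flat|exact: IH].
Qed.

(** For N > 0, smooth and zero outside ]a, b[; along the positive integers N it tends to the
    indicator of that interval. *)
Definition bump (N a b : R) (x : R) : R := flat 1 (N * x + - (N * a)) * flat 1 ((- N) * x + N * b).

Lemma ndiff_bump k N a b : ndiff k (bump N a b).
Proof. by apply: ndiffM; apply: ndiff_affine; exact: ndiff_flat. Qed.

Lemma flat1_bounds (x : R) : 0 <= flat 1 x <= 1.
Proof.
rewrite /flat; case: ifP => [x0|_]; last by rewrite lexx ler01.
by rewrite hornerC mul1r expR_ge0 -[leRHS]expR0 ler_expR oppr_le0 invr_ge0 ltW.
Qed.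

Lemma bump_bounds N a b x : 0 <= bump N a b x <= 1.
Proof.
have /andP[h1 h2] := flat1_bounds (N * x + - (N * a)).
have /andP[h3 h4] := flat1_bounds ((- N) * x + N * b).
by rewrite /bump mulr_ge0//= mulr_ile1.
Qed.

Lemma bump_out N a b x : 0 < N -> ~~ (a < x < b) -> bump N a b x = 0.
Proof.
move=> N0; rewrite negb_and -!leNgt /bump => /orP[h|h].
- by rewrite {1}/flat ifF ?mul0r//; apply/negbTE; rewrite -leNgt subr_le0 ler_pM2l.
- rewrite {2}/flat ifF ?mulr0//; apply/negbTE.
  by rewrite -leNgt mulNr addrC subr_le0 ler_pM2l.
Qed.

Lemma flat1_cvg (t : R) : 0 < t -> flat 1 (n.+1%:R * t) @[n --> \oo] --> (1 : R).
Proof.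
move=> t0.
have -> : (fun n => flat 1 (n.+1%:R * t)) = (fun n => expR (- (n.+1%:R^-1 * t^-1))).
  by apply/funext => n; rewrite /flat mulr_gt0// hornerC mul1r invfM.
have h : - (n.+1%:R^-1 * t^-1) @[n --> \oo] --> - (0 * t^-1).
  by apply: cvgN; apply: cvgMr_tmp; exact: cvg_harmonic.
rewrite mul0r oppr0 in h; rewrite -[X in _ --> X]expR0.
apply: continuous_cvg; [exact: continuous_expR|exact: h].
Qed.

Lemma bump_cvg a b x : bump n.+1%:R a b x @[n --> \oo] --> (\1_(`]a, b[%classic : set R) x : R).
Proof.
have [h|h] := boolP (a < x < b).
  rewrite indicE mem_set ?in_itv//= /bump; have /andP[ax xb] := h.
  rewrite -[X in _ --> X]mulr1; apply: cvgM.
  - have := @flat1_cvg (x - a); rewrite subr_gt0 => /(_ ax).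
    by under eq_fun do rewrite mulrBr.
  - have := @flat1_cvg (b - x); rewrite subr_gt0 => /(_ xb).
    by under eq_fun do rewrite mulrBr addrC -mulNr.
rewrite indicE memNset; last by rewrite /= in_itv/=; exact/negP.
by under eq_fun do rewrite bump_out//; exact: cvg_cst.
Qed.

End one_variable.

(** * Bumps separate L^2 of the line and, with characters, of the cylinder *)

Section compact_support.
Context {R : realType}.
Local Notation leb := (@lebesgue_measure R).

Lemma L2_supp d (T : measurableType d) (mu : {measure set T -> \bar R}) (f : T -> R[i])
    (A : set T) (C : R) :
  cmeasurable_fun f -> measurable A -> (mu A < +oo)%E ->
  (forall x, cmod (f x) <= C * \1_A x) -> L2 mu f.
Proof.
move=> mf mA Aoo fC; apply: (L2_le (h := fun x => C ^+ 2 * \1_A x)) => //.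
  apply: integrable_scale; apply/integrableP; split; first exact/measurable_EFinP.
  under eq_integral do rewrite gee0_abs ?lee_fin ?indicE ?ler0n//.
  by under eq_integral do rewrite -indicE; rewrite integral_indic// setIT.
move=> x; have := fC x; rewrite indicE; case: (x \in A) => /=; rewrite ?mulr1 ?mulr0.
  by move=> h; rewrite ler_pXn2r ?nnegrE ?cmod_ge0// (le_trans (cmod_ge0 _) h).
by move=> h; rewrite (_ : cmod _ = 0) ?expr0n//; apply/eqP; rewrite eq_le h cmod_ge0.
Qed.

Lemma L2_indic d (T : measurableType d) (mu : {measure set T -> \bar R}) (A : set T) :
  measurable A -> (mu A < +oo)%E -> L2 mu (fun x => (\1_A x : R)%:C).
Proof.
move=> mA Aoo; apply: (@L2_supp _ _ _ _ A 1) => //.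
  by apply: cmeasR; exact: measurable_indic.
by move=> x; rewrite cmodR mul1r ger0_norm// indicE ler0n.
Qed.

Lemma L2_locally_integrable (v : measurableTypeR R -> R[i]) : L2 leb v ->
  locally_integrable setT (fun x : R => Re (v x)) /\
  locally_integrable setT (fun x : R => Im (v x)).
Proof.
move=> Lv; have [m1 m2] := L2_meas Lv.
have key K : compact K -> leb.-integrable K (fun x => (Re (v x))%:E) /\
    leb.-integrable K (fun x => (Im (v x))%:E).
  move=> cK; have mK := compact_measurable cK; have fK := compact_finite_measure cK.
  have [j1 j2] := cintegrable_inner (@L2_indic _ _ leb K mK fK) Lv.
  split; rewrite integrable_mkcond//; [move: j1|move: j2]; apply: eq_integrable => // x _;
    rewrite ReImE /= patchE indicE; case: (x \in K) => /=;
    by rewrite ?mul1r ?mul0r ?oppr0 ?mul0r ?subr0 ?addr0.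
split; split => //; try exact: openT.
- move=> K _ /key[h _]; have /integrableP[_] := h; by under eq_integral do rewrite abse_EFin.
- move=> K _ /key[_ h]; have /integrableP[_] := h; by under eq_integral do rewrite abse_EFin.
Qed.

Definition bumps (p : nat * R * R) (x : measurableTypeR R) : R[i] :=
  (bump p.1.1.+1%:R p.1.2 p.2 x)%:C.

Lemma measurable_bump (N a b : R) : measurable_fun setT (bump N a b : measurableTypeR R -> R).
Proof. by apply: continuous_measurable_fun; exact: ndiff_continuous (ndiff_bump 0 N a b). Qed.

Lemma bump_le_indic N a b x : 0 < N -> bump N a b x <= \1_(`[a, b]%classic : set R) x.
Proof.
move=> N0; have /andP[b0 b1] := bump_bounds N a b x.
have [h|h] := boolP (a < x < b); last by rewrite bump_out.
rewrite indicE mem_set//= in_itv/=; by case/andP: h => /ltW -> /ltW ->.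
Qed.

Lemma L2_bumps p : L2 leb (bumps p).
Proof.
apply: (@L2_supp _ (measurableTypeR R) leb (bumps p) (`[p.1.2, p.2]%classic : set (measurableTypeR R)) 1).
- by apply: cmeasR; exact: measurable_bump.
- exact: measurable_itv.
- exact/compact_finite_measure/segment_compact.
- move=> x; rewrite cmodR mul1r ger0_norm; last by case/andP: (bump_bounds p.1.1.+1%:R p.1.2 p.2 x).
  exact: bump_le_indic.
Qed.

(** Pairings with bumps tend to integrals over open intervals, which therefore vanish, and Lebesgue
    differentiation concludes. The indicator of [a, b] is inserted since the function is only
    locally integrable. *)
Lemma separating_bumps : separating leb bumps.
Proof.
move=> v Lv v0; have [mv1 mv2] := L2_meas Lv.
have [lv1 lv2] := L2_locally_integrable Lv.
have part (f : measurableTypeR R -> R) : locally_integrable setT (f : R -> R) ->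
    (forall n a b, Rintegral leb setT (fun x => f x * bump n.+1%:R a b x) = 0) ->
    {ae leb, forall x, f x = 0}.
  move=> lf fb; have [mf _ foo] := lf.
  have mef : measurable_fun setT (fun y : measurableTypeR R => (f y)%:E) by exact/measurable_EFinP.
  have FF := ae_filter_ringOfSetsType leb.
  suff h : {ae leb, forall x, [set: R] x -> f x = 0}.
    by move: h; apply: filterS => x; exact.
  apply: (ae_eq0_of_intervals lf (r := fun=> 1)) => // x rho _ r0 _.
  set a := x - rho; set b := x + rho.
  have mI : measurable (`[a, b]%classic : set (measurableTypeR R)) by exact: measurable_itv.
  have jf : leb.-integrable setT (fun y => (f y * \1_(`[a, b]%classic : set R) y)%:E).
    have : leb.-integrable `[a, b]%classic (fun y => (f y)%:E).
      apply/integrableP; split; first exact: measurable_funTS.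
      by under eq_integral do rewrite abse_EFin; apply: foo => //; exact: segment_compact.
    rewrite integrable_mkcond//; apply: eq_integrable => // y _.
    by rewrite patchE indicE; case: (_ \in _); rewrite ?mulr1 ?mulr0.
  have ff (g : R -> R) : (forall y, ~~ (a < y < b) -> g y = 0) ->
      (fun y => f y * \1_(`[a, b]%classic : set R) y * g y) = (fun y => f y * g y).
    move=> g0; apply/funext => y; have [h|h] := boolP (a < y < b); last by rewrite g0// !mulr0.
    rewrite indicE mem_set ?mulr1//= in_itv/=; by case/andP: h => /ltW -> /ltW ->.
  have mb n : measurable_fun setT (bump n.+1%:R a b : measurableTypeR R -> R) by exact: measurable_bump.
  have mo : measurable_fun setT (fun y : measurableTypeR R => \1_(`]a, b[%classic : set R) y : R).
    by apply: measurable_indic; exact: measurable_itv.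
  have b1 n y : `|bump n.+1%:R a b y| <= 1.
    by have /andP[? ?] := bump_bounds n.+1%:R a b y; rewrite ger0_norm.
  have z0 n : Rintegral leb setT (fun y => f y * \1_(`[a, b]%classic : set R) y * bump n.+1%:R a b y) = 0.
    by rewrite ff ?fb// => y; exact: bump_out.
  have := Rintegral_bounded_limit jf mb mo (@bump_cvg R a b) b1 z0.
  rewrite ff => [|y h]; last by rewrite indicE memNset// /= in_itv/=; exact/negP.
  rewrite integral_itv_bndoo; last exact: measurable_funTS.
  have jo : leb.-integrable setT (fun y => (f y * \1_(`]a, b[%classic : set R) y)%:E).
    apply: le_integrable jf => //.
      apply/measurable_EFinP; apply: measurable_funM => //; apply: measurable_indic; exact: measurable_itv.
    move=> y _ /=; rewrite lee_fin !normrM ler_wpM2l// !ger0_norm//.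
    rewrite !indicE; case: (boolP (y \in `]a, b[%classic)) => // h.
    by rewrite mem_set//; move: h; rewrite inE; exact: subset_itvW.
  rewrite /Rintegral => fin0.
  have {}fin0 : (\int[leb]_y (f y * \1_(`]a, b[%classic : set R) y)%:E = 0)%E.
    by rewrite -[LHS]fineK ?fin0//; exact: integrable_fin_num.
  rewrite -fin0 [LHS]integral_mkcond; apply: eq_integral => y _.
  by rewrite patchE indicE; case: (_ \in _); rewrite ?mulr1 ?mulr0.
have tb (p : nat * R * R) x : (bumps p x)^* * v x = (bump p.1.1.+1%:R p.1.2 p.2 x)%:C * v x.
  by rewrite /bumps conjR.
have h1 : {ae leb, forall t, Re (v t) = 0}.
  apply: part => // n a b; have := v0 (n, a, b) => /(congr1 (@complex.Re R)).
  rewrite /inner /cintegral/= => e; rewrite -[RHS]e; apply: eq_Rintegral => t _.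
  by rewrite tb ReImE/= mul0r subr0 mulrC.
have h2 : {ae leb, forall t, Im (v t) = 0}.
  apply: part => // n a b; have := v0 (n, a, b) => /(congr1 (@complex.Im R)).
  rewrite /inner /cintegral/= => e; rewrite -[RHS]e; apply: eq_Rintegral => t _.
  by rewrite tb ReImE/= mul0r addr0 mulrC.
have FF := ae_filter_ringOfSetsType leb.
by move: h1 h2; apply: filterS2 => t e1 e2 _; exact: complex_ext.
Qed.

Lemma separating_cylinder n :
  separating (cylinder n) (fun (ij : (nat * R * R) * 'rV[int]_n) (p : Cyl R n) =>
    bumps ij.1 p.1 * character ij.2 p.2).
Proof.
have enum (m : 'rV[int]_n) : exists k, unpickle k = Some m by exists (pickle m); rewrite pickleK.
exact: (separating_product enum L2_bumps (@L2_character R n) separating_bumps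
  (@separating_character R n)).
Qed.

End compact_support.

(** * Test functions on the cylinder *)

Section smooth_functions.
Context {R : realType} {n : nat}.
Local Notation E := (R * 'rV[R]_n)%type.
Implicit Types (phi psi : E -> R).

Fixpoint nsm k phi : Prop := continuous phi /\
  (if k is k'.+1 then
     forall v, exists psi, (forall x, is_derive x v phi (psi x)) /\ nsm k' psi
   else True).

Lemma nsm_continuous k phi : nsm k phi -> continuous phi.
Proof. by case: k => [|k] []. Qed.

Lemma nsmW k phi : nsm k.+1 phi -> nsm k phi.
Proof.
elim: k phi => [|k IH] phi [cp dp]; first by split.
split => // v; have [psi [dpsi sp]] := dp v; exists psi; split => //; exact: IH.
Qed.

Lemma nsmD k phi psi : nsm k phi -> nsm k psi -> nsm k (fun x => phi x + psi x).
Proof.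
elim: k phi psi => [|k IH] phi psi [c1 d1] [c2 d2];
  (split; first by move=> x; apply: cvgD; [exact: c1|exact: c2]) => // v.
have [p1 [h1 s1]] := d1 v; have [p2 [h2 s2]] := d2 v.
exists (fun x => p1 x + p2 x); split; last exact: IH.
by move=> x; have := h1 x; have := h2 x => *; exact: is_deriveD.
Qed.

Lemma nsmM k phi psi : nsm k phi -> nsm k psi -> nsm k (fun x => phi x * psi x).
Proof.
elim: k phi psi => [|k IH] phi psi S1 S2.
  have c1 := nsm_continuous S1; have c2 := nsm_continuous S2.
  by split => // x; apply: cvgM; [exact: c1|exact: c2].
have W1 := nsmW S1; have W2 := nsmW S2; case: S1 S2 => [c1 d1] [c2 d2].
split; first by move=> x; apply: cvgM; [exact: c1|exact: c2].
move=> v; have [p1 [h1 s1]] := d1 v; have [p2 [h2 s2]] := d2 v.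
exists (fun x => phi x * p2 x + psi x * p1 x); split; last by apply: nsmD; exact: IH.
by move=> x; have := h1 x; have := h2 x => *; exact: is_deriveM.
Qed.

Lemma nsm_smooth phi : (forall k, nsm k phi) -> smooth phi.
Proof.
move=> sp vs /=.
have h : forall k, nsm k (foldr (fun v chi => 'D_v chi) phi vs).
  elim: vs => [//|v vs IH] k /=; have [_ /(_ v)[psi [dpsi s]]] := IH k.+1.
  suff -> : 'D_v (foldr (fun v chi => 'D_v chi) phi vs) = psi by [].
  by apply/funext => x; have dx := dpsi x; exact: derive_val.
split; first exact: nsm_continuous (h 0%N).
by move=> x v; have [_ /(_ v)[psi [dpsi _]]] := h 1%N; have [] := dpsi x.
Qed.

Lemma is_derive_line (f : E -> R) (x v : E) (df : R) :
  is_derive (0 : R) (1 : R) (fun h : R => f (h *: v + x)) df -> is_derive x v f df.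
Proof.
move=> [d1 d2]; split; first exact/derivable1P.
rewrite -d2 /derive; set g1 := fun h => h^-1 *: _; set g2 := fun h => h^-1 *: _.
suff -> : g1 = g2 by [].
by apply/funext => h; rewrite /g1 /g2 /= addr0 scale0r add0r [_%:A]mulr1.
Qed.

Lemma is_derive_comp_lin (g : R -> R) (dg : R) (ell : E -> R) (x v : E) :
  (forall (h : R) v x, ell (h *: v + x) = h * ell v + ell x) ->
  is_derive (ell x) (1 : R) g dg -> is_derive x v (fun p => g (ell p)) (dg * ell v).
Proof.
move=> el dgx; apply: is_derive_line.
have -> : (fun h : R => g (ell (h *: v + x))) = g \o (fun h => ell v * h + ell x).
  by apply/funext => h; rewrite el/= [h * _]mulrC.
apply: is_derive1_comp; last exact: is_derive_affine.
by rewrite mulr0 add0r.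
Qed.

Lemma nsm_comp k (g : R -> R) (ell : E -> R) : continuous ell ->
  (forall (h : R) v x, ell (h *: v + x) = h * ell v + ell x) ->
  ndiff k g -> nsm k (fun p => g (ell p)).
Proof.
move=> cl el; elim: k g => [|k IH] g sg; have cg := ndiff_continuous sg;
  (split; first by move=> x; apply: continuous_comp; [exact: cl|exact: cg]) => // v.
case: sg => g' [dg sg']; exists (fun p => g' (ell p) * ell v); split.
  by move=> x; exact: is_derive_comp_lin.
apply: nsmM; first exact: IH.
have c0 : forall j c, nsm j (fun _ : E => c : R).
  elim=> [|j IHj] c; (split; first by move=> x; exact: cvg_cst) => // w.
  by exists (fun=> 0); split => [x|]; [exact: (is_derive_cst c x w)|exact: IHj].
exact: c0.
Qed.

Definition ell (m : 'rV[int]_n) (p : E) : R := \sum_(i < n) (m 0 i)%:~R * p.2 0 i.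

Lemma ell_lin m (h : R) v x : ell m (h *: v + x) = h * ell m v + ell m x.
Proof.
rewrite /ell mulr_sumr -big_split; apply: eq_bigr => i _ /=.
by rewrite !mxE; ring.
Qed.

Lemma ell_continuous m : continuous (ell m).
Proof.
rewrite /ell; elim: (index_enum _) => [|i s IH] p.
  rewrite (_ : (fun _ => _) = fun=> 0); first exact: cvg_cst.
  by apply/funext => q; rewrite big_nil.
rewrite (_ : (fun _ => _) = (fun q : E => (m 0 i)%:~R * q.2 0 i + \sum_(i <- s) (m 0 i)%:~R * q.2 0 i)).
  apply: cvgD; last exact: IH.
  apply: cvgM; first exact: cvg_cst.
  by apply: (continuous_comp (f := snd) (g := fun y : 'rV[R]_n => y 0 i)); [exact: cvg_snd|exact: coord_continuous].
by apply/funext => q; rewrite big_cons.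
Qed.

Lemma fst_lin (h : R) (v x : E) : (h *: v + x).1 = h * v.1 + x.1.
Proof. by []. Qed.

(** With cosine and sine for [q] these are the real and imaginary parts of g(x_1) e^{im.y}; test
    functions being real, the character has to be split. *)
Definition tf (g q : R -> R) m : E -> R := fun p => g p.1 * q (ell m p).

Lemma tf_test (g q : R -> R) m (M : R) :
  (forall k, ndiff k g) -> (forall k, ndiff k q) ->
  (forall x, M < `|x| -> g x = 0) ->
  (forall t (k : int), q (t + k%:~R * (2 * pi)) = q t) ->
  test_function (tf g q m).
Proof.
move=> sg sq g0 per; split.
- apply: nsm_smooth => k; apply: nsmM.
    by apply: (nsm_comp (ell := fst)) => // x; exact: cvg_fst.
  by apply: nsm_comp => //; [exact: ell_continuous|exact: ell_lin].
- move=> i p; rewrite /tf /=; congr (_ * _).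
  rewrite -[RHS](per _ (m 0 i)); congr q.
  rewrite /ell /= [in LHS](bigD1 i)//= [in RHS](bigD1 i)//= !mxE !eqxx mulr1 mulrDr addrAC.
  by congr (_ + _ + _); apply: eq_bigr => j ji; rewrite !mxE eqxx (negbTE ji) mulr0 addr0.
- by exists M => p /g0 h; rewrite /tf h mul0r.
Qed.

Lemma is_derive_tf (g g1 q q1 : R -> R) m (p v : E) :
  is_derive p.1 (1 : R) g (g1 p.1) -> is_derive (ell m p) (1 : R) q (q1 (ell m p)) ->
  is_derive p v (tf g q m) (v.1 * (g1 p.1 * q (ell m p)) + ell m v * (g p.1 * q1 (ell m p))).
Proof.
move=> dg dq.
have h1 := is_derive_comp_lin v fst_lin dg.
have h2 := is_derive_comp_lin v (ell_lin m) dq.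
refine (is_derive_eq (is_deriveM h1 h2) _); rewrite /GRing.scale/=; ring.
Qed.

Lemma laplacian_tf (g g1 g2 q q1 : R -> R) m p :
  (forall x, is_derive x (1 : R) g (g1 x)) -> (forall x, is_derive x (1 : R) g1 (g2 x)) ->
  (forall x, is_derive x (1 : R) q (q1 x)) -> (forall x, is_derive x (1 : R) q1 (- q x)) ->
  laplacian (tf g q m) p = tf g2 q m p - znorm m ^+ 2 * tf g q m p.
Proof.
move=> dg dg1 dq dq1.
have D1 (f f1 : R -> R) : (forall x, is_derive x (1 : R) f (f1 x)) ->
    'D_((1 : R), (0 : 'rV[R]_n)) (tf f q m) = tf f1 q m.
  move=> df; apply/funext => x.
  have := is_derive_tf (1, 0) (df x.1) (dq (ell m x)) => h; rewrite derive_val.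
  rewrite /= (_ : ell m (1, 0) = 0) ?mul0r ?addr0 ?mul1r//.
  by rewrite /ell big1// => i _; rewrite !mxE mulr0.
have el i : ell m (0, delta_mx 0 i) = (m 0 i)%:~R.
  rewrite /ell (bigD1 i)//= !mxE !eqxx mulr1 big1 ?addr0// => j ji.
  by rewrite !mxE (negbTE ji) mulr0.
have D2 i (f f1 r r1 : R -> R) : (forall x, is_derive x (1 : R) f (f1 x)) ->
    (forall x, is_derive x (1 : R) r (r1 x)) ->
    'D_((0 : R), delta_mx 0 i) (tf f r m) = tf (fun x => (m 0 i)%:~R * f x) r1 m.
  move=> df dr; apply/funext => x.
  have := is_derive_tf (0, delta_mx 0 i) (df x.1) (dr (ell m x)) => h; rewrite derive_val.
  by rewrite el/= mul0r add0r mulrA.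
rewrite /laplacian (D1 _ _ dg) znorm2 mulr_suml -sumrN; congr (_ + _).
  exact: (congr1 (fun F : E -> R => F p) (D1 _ _ dg1)).
apply: eq_bigr => i _; rewrite (D2 i _ _ _ _ dg dq).
have dmg x : is_derive x (1 : R) (fun x => (m 0 i)%:~R * g x) ((m 0 i)%:~R * g1 x).
  by have h := dg x; apply: is_derive_eq.
transitivity (tf (fun x => (m 0 i)%:~R * ((m 0 i)%:~R * g x)) (fun x => - q x) m p).
  exact: (congr1 (fun F : E -> R => F p) (D2 i _ _ _ _ dmg dq1)).
by rewrite /tf expr2 /=; ring.
Qed.

End smooth_functions.

(** * Calculus for complex functions of a real variable *)

Section complex_calculus.
Context {R : realType}.
Local Notation leb := (@lebesgue_measure R).
Implicit Types (F f g : R -> R[i]).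

Definition cder F f := forall x,
  is_derive x (1 : R) (fun t => Re (F t)) (Re (f x)) /\
  is_derive x (1 : R) (fun t => Im (F t)) (Im (f x)).

Definition ccont f := continuous (fun t => Re (f t)) /\ continuous (fun t => Im (f t)).

Lemma cder_ccont F f : cder F f -> ccont F.
Proof.
move=> dF; split; [apply: (@is_derive_continuous _ _ (fun x => Re (f x)))|
  apply: (@is_derive_continuous _ _ (fun x => Im (f x)))] => x; by have [] := dF x.
Qed.

Lemma cder_eq F f g : cder F f -> f =1 g -> cder F g.
Proof. by move=> dF fg x; rewrite -fg. Qed.

Lemma cderM F f G g : cder F f -> cder G g ->
  cder (fun t => F t * G t) (fun t => F t * g t + f t * G t).
Proof.
move=> dF dG x; have [F1 F2] := dF x; have [G1 G2] := dG x; split.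
- have -> : (fun t => Re (F t * G t)) = (fun t => Re (F t) * Re (G t) - Im (F t) * Im (G t)).
    by apply/funext => t; rewrite ReImE.
  refine (is_derive_eq (is_deriveB (is_deriveM F1 G1) (is_deriveM F2 G2)) _).
  by rewrite !ReImE /GRing.scale/=; ring.
- have -> : (fun t => Im (F t * G t)) = (fun t => Re (F t) * Im (G t) + Im (F t) * Re (G t)).
    by apply/funext => t; rewrite ReImE.
  refine (is_derive_eq (is_deriveD (is_deriveM F1 G2) (is_deriveM F2 G1)) _).
  by rewrite !ReImE /GRing.scale/=; ring.
Qed.

Lemma cderD F f G g : cder F f -> cder G g -> cder (fun t => F t + G t) (fun t => f t + g t).
Proof.
move=> dF dG x; have [F1 F2] := dF x; have [G1 G2] := dG x; split.
- have -> : (fun t => Re (F t + G t)) = (fun t => Re (F t) + Re (G t)).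
    by apply/funext => t; rewrite ReImE.
  by refine (is_derive_eq (is_deriveD F1 G1) _); rewrite ReImE.
- have -> : (fun t => Im (F t + G t)) = (fun t => Im (F t) + Im (G t)).
    by apply/funext => t; rewrite ReImE.
  by refine (is_derive_eq (is_deriveD F2 G2) _); rewrite ReImE.
Qed.

Lemma cder_cst (c : R[i]) : cder (fun=> c) (fun=> 0).
Proof. by move=> x; split; exact: is_derive_cst. Qed.

Lemma cderZ (c : R[i]) F f : cder F f -> cder (fun t => c * F t) (fun t => c * f t).
Proof.
by move=> dF; apply: (cder_eq (cderM (cder_cst c) dF)) => t; rewrite mul0r addr0.
Qed.

Lemma cderR (F f : R -> R) : (forall x, is_derive x (1 : R) F (f x)) ->
  cder (fun t => (F t)%:C) (fun t => (f t)%:C).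
Proof. by move=> dF x; split => //=; exact: is_derive_cst. Qed.

Lemma is_derive_affine_shift (a c x : R) : is_derive x (1 : R) (fun t => a * (t - c)) a.
Proof.
have -> : (fun t => a * (t - c)) = (fun t => a * t + - (a * c)) by apply/funext => t; ring.
exact: is_derive_affine.
Qed.

Lemma cder_exp (k : R[i]) (c : R) :
  cder (fun t => cexp (k * (t - c)%:C)) (fun t => k * cexp (k * (t - c)%:C)).
Proof.
move=> x.
have e (t : R) : k * (t - c)%:C = (Re k * (t - c)) +i* (Im k * (t - c)).
  by case: (k) => a b; apply: complex_ext => /=; ring.
have d1 := is_derive_affine_shift (Re k) c x; have d2 := is_derive_affine_shift (Im k) c x.
have dE := is_derive1_comp (f := expR) (g := fun t => Re k * (t - c)) (is_derive_expR (Re k * (x - c))) d1.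
have dC := is_derive1_comp (f := cos) (g := fun t => Im k * (t - c)) (is_derive_cos (Im k * (x - c))) d2.
have dS := is_derive1_comp (f := sin) (g := fun t => Im k * (t - c)) (is_derive_sin (Im k * (x - c))) d2.
split.
- have -> : (fun t => Re (cexp (k * (t - c)%:C))) =
      (fun t => expR (Re k * (t - c)) * cos (Im k * (t - c))) by apply/funext => t; rewrite e Re_cexp.
  refine (is_derive_eq (is_deriveM dE dC) _).
  by rewrite ReImE e Re_cexp Im_cexp /GRing.scale/=; ring.
- have -> : (fun t => Im (cexp (k * (t - c)%:C))) =
      (fun t => expR (Re k * (t - c)) * sin (Im k * (t - c))) by apply/funext => t; rewrite e Im_cexp.
  refine (is_derive_eq (is_deriveM dE dS) _).
  by rewrite ReImE e Re_cexp Im_cexp /GRing.scale/=; ring.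
Qed.

Lemma ccontM f g : ccont f -> ccont g -> ccont (fun t => f t * g t).
Proof.
move=> [f1 f2] [g1 g2]; split => x.
- rewrite /continuous_at (_ : (fun t => Re (f t * g t)) = (fun t => Re (f t) * Re (g t) - Im (f t) * Im (g t))); last first.
    by apply/funext => t; rewrite ReImE.
  by rewrite ReImE; apply: cvgB; apply: cvgM; [exact: f1|exact: g1|exact: f2|exact: g2].
- rewrite /continuous_at (_ : (fun t => Im (f t * g t)) = (fun t => Re (f t) * Im (g t) + Im (f t) * Re (g t))); last first.
    by apply/funext => t; rewrite ReImE.
  by rewrite ReImE; apply: cvgD; apply: cvgM; [exact: f1|exact: g2|exact: f2|exact: g1].
Qed.

Lemma ccontR (f : R -> R) : continuous f -> ccont (fun t => (f t)%:C).
Proof. by move=> cf; split => //= x; exact: cvg_cst. Qed.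

Lemma ccont_cst (c : R[i]) : ccont (fun=> c).
Proof. by split => x; exact: cvg_cst. Qed.

Lemma ccontD f g : ccont f -> ccont g -> ccont (fun t => f t + g t).
Proof.
move=> [f1 f2] [g1 g2]; split => x.
- rewrite /continuous_at (_ : (fun t => Re (f t + g t)) = (fun t => Re (f t) + Re (g t))); last first.
    by apply/funext => t; rewrite ReImE.
  by rewrite ReImE; apply: cvgD; [exact: f1|exact: g1].
- rewrite /continuous_at (_ : (fun t => Im (f t + g t)) = (fun t => Im (f t) + Im (g t))); last first.
    by apply/funext => t; rewrite ReImE.
  by rewrite ReImE; apply: cvgD; [exact: f2|exact: g2].
Qed.

Lemma ccont_exp (k : R[i]) (g : R -> R) : continuous g -> ccont (fun t => cexp (k * (g t)%:C)).
Proof.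
move=> cg; have e (t : R) : k * (g t)%:C = (Re k * g t) +i* (Im k * g t).
  by case: (k) => a b; apply: complex_ext => /=; ring.
have cl (a : R) (h : R -> R) : continuous h -> continuous (fun t => h (a * g t)).
  move=> ch x; apply: continuous_comp; last exact: ch.
  by apply: cvgM; [exact: cvg_cst|exact: cg].
split => x.
- rewrite /continuous_at (_ : (fun t => Re (cexp (k * (g t)%:C))) =
      (fun t => expR (Re k * g t) * cos (Im k * g t))); last by apply/funext => t; rewrite e Re_cexp.
  by rewrite e Re_cexp; apply: cvgM; apply: cl; [exact: continuous_expR|exact: continuous_cos].
- rewrite /continuous_at (_ : (fun t => Im (cexp (k * (g t)%:C))) =
      (fun t => expR (Re k * g t) * sin (Im k * g t))); last by apply/funext => t; rewrite e Im_cexp.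
  by rewrite e Im_cexp; apply: cvgM; apply: cl; [exact: continuous_expR|exact: continuous_sin].
Qed.

(** Made for integrands with a kink at [c], such as those containing the Green function: each side
    has its own formula and antiderivative. *)
Lemma FTC_split (f f1 f2 F1 F2 : R -> R) (a c b : R) : a < c -> c < b -> continuous f ->
  continuous f1 -> continuous f2 ->
  (forall x, x <= c -> f x = f1 x) -> (forall x, c <= x -> f x = f2 x) ->
  (forall x, is_derive x (1 : R) F1 (f1 x)) -> (forall x, is_derive x (1 : R) F2 (f2 x)) ->
  Rintegral leb `[a, b]%classic f = F1 c - F1 a + (F2 b - F2 c).
Proof.
move=> ac cb cf cf1 cf2 e1 e2 d1 d2.
have j := continuous_integrable_itv a b cf.
have := @Rintegral_itvB _ f (BLeft a) (BRight b) c j.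
rewrite !bnd_simp => /(_ (ltW ac) (ltW cb)) /eqP; rewrite subr_eq => /eqP ->.
rewrite Rintegral_itv_obnd_cbnd; last first.
  apply: integrableS j => // t; rewrite /= !in_itv/= => /andP[h ->].
  by rewrite (ltW (lt_trans ac h)).
rewrite addrC; congr (_ + _).
- rewrite [RHS](_ : _ = fine (F1 c - F1 a)%:E)// -(FTC_integral ac d1 cf1); congr fine; apply: eq_integral => x.
  by rewrite inE/= in_itv/= => /andP[_ xc]; rewrite e1.
- rewrite [RHS](_ : _ = fine (F2 b - F2 c)%:E)// -(FTC_integral cb d2 cf2); congr fine; apply: eq_integral => x.
  by rewrite inE/= in_itv/= => /andP[cx _]; rewrite e2.
Qed.

Lemma Rintegral_supp d (T : measurableType d) (mu : {measure set T -> \bar R}) (A : set T) (f : T -> R) :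
  (forall x, ~ A x -> f x = 0) -> Rintegral mu setT f = Rintegral mu A f.
Proof.
move=> f0; rewrite /Rintegral [in RHS]integral_mkcond; congr fine; apply: eq_integral => x _.
by rewrite patchE; case: ifPn => // /negP h; rewrite f0// => Ax; apply: h; rewrite inE.
Qed.

Lemma cFTC_split f f1 f2 F1 F2 (a c b : R) : a < c -> c < b -> ccont f ->
  ccont f1 -> ccont f2 -> (forall x, ~ (a <= x <= b) -> f x = 0) ->
  (forall x, x <= c -> f x = f1 x) -> (forall x, c <= x -> f x = f2 x) ->
  cder F1 f1 -> cder F2 f2 ->
  cintegral leb f = F1 c - F1 a + (F2 b - F2 c).
Proof.
move=> ac cb [c1 c2] [c11 c12] [c21 c22] f0 e1 e2 d1 d2.
apply: complex_ext; rewrite /cintegral /= (@Rintegral_supp _ _ leb (`[a, b]%classic : set (measurableTypeR R))).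
- rewrite !ReImE.
  apply: (@FTC_split _ (fun x => Re (f1 x)) (fun x => Re (f2 x)) (fun x => Re (F1 x)) (fun x => Re (F2 x))) => // x.
  + by move=> /e1 ->.
  + by move=> /e2 ->.
  + by have [] := d1 x.
  + by have [] := d2 x.
- by move=> x /= h; rewrite f0// => h'; apply: h; rewrite in_itv.
- rewrite !ReImE.
  apply: (@FTC_split _ (fun x => Im (f1 x)) (fun x => Im (f2 x)) (fun x => Im (F1 x)) (fun x => Im (F2 x))) => // x.
  + by move=> /e1 ->.
  + by move=> /e2 ->.
  + by have [] := d1 x.
  + by have [] := d2 x.
- by move=> x /= h; rewrite f0// => h'; apply: h; rewrite in_itv.
Qed.

End complex_calculus.

(** * The square root with positive real part *)

Section square_root.
Context {R : realType}.

Lemma csqrtP (w : R[i]) : ~ (Im w = 0 /\ Re w <= 0) ->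
  csqrt w ^+ 2 = w /\ 0 < Re (csqrt w).
Proof.
move=> hw; apply: (@xgetPex _ 0 [set s | s ^+ 2 = w /\ 0 < Re s]).
set r := cmod w; have r2 : r ^+ 2 = Re w ^+ 2 + Im w ^+ 2 by rewrite /r cmod2E.
have r0 : 0 <= r by exact: cmod_ge0.
have p : 0 < r + Re w.
  have [h|h] := ltP 0 (Re w); first by rewrite ltr_wpDl.
  have i0 : Im w != 0 by apply/eqP => i0; apply: hw.
  rewrite -[Re w]opprK subr_gt0 -(@ltr_pXn2r _ 2)// ?nnegrE ?oppr_ge0// sqrrN r2 ltrDl.
  by rewrite exprn_even_gt0.
(* Real part of the principal root; the imaginary part is then forced to be Im w / (2 x). *)
set x := Num.sqrt ((r + Re w) / 2).
have x0 : 0 < x by rewrite sqrtr_gt0 divr_gt0.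
have x2 : x ^+ 2 = (r + Re w) / 2 by rewrite sqr_sqrtr// ltW// divr_gt0.
exists (x +i* (Im w / (2 * x))) => /=; split => //.
have xn : x != 0 by rewrite gt_eqF.
apply: complex_ext; rewrite expr2 ReImE/=; last by field.
have -> : x * x - Im w / (2 * x) * (Im w / (2 * x)) = x ^+ 2 - Im w ^+ 2 / (4 * x ^+ 2) by field.
have pn : r + Re w != 0 by rewrite gt_eqF.
rewrite x2; have -> : Im w ^+ 2 = r ^+ 2 - Re w ^+ 2 by rewrite r2; ring.
by field.
Qed.

Lemma Re_csqrt2 (w : R[i]) : ~ (Im w = 0 /\ Re w <= 0) ->
  Re (csqrt w) ^+ 2 = (cmod w + Re w) / 2.
Proof.
move=> /csqrtP[s2 _]; move: (csqrt w) s2 => s <-.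
have e : Re (s ^+ 2) = Re s ^+ 2 - Im s ^+ 2 by rewrite !expr2 ReImE.
by rewrite cmodX cmod2E e; field.
Qed.

(** For w = A + t + iB the left side is compared with (|w| + A + t) / 2, which is at least A + t;
    this suffices if A > 0 or t is large. Otherwise B is non-zero and (|w| - A - t)(|w| + A + t) =
    B^2, with the first factor bounded, keeps the second away from 0. *)
Lemma Re_csqrt_lower (A B : R) : ~ (B = 0 /\ A <= 0) ->
  exists2 c : R, 0 < c & forall t, 0 <= t ->
    c * (1 + t) <= Re (csqrt ((A + t) +i* B)) ^+ 2.
Proof.
move=> hAB.
have hw t : 0 <= t -> ~ (Im ((A + t) +i* B) = 0 /\ Re ((A + t) +i* B) <= 0).
  by move=> t0 /= [b0 at0]; apply: hAB; split => //; lra.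
have [A0|A0] := ltP 0 A.
  exists (Num.min A 1) => [|t t0]; first by rewrite lt_min A0 ltr01.
  rewrite Re_csqrt2; last exact: hw.
  have h := Re_le_cmod ((A + t) +i* B); rewrite /= in h.
  apply: (@le_trans _ _ (A + t)).
    rewrite mulrDr mulr1 lerD//; first by rewrite ge_min lexx.
    by rewrite ler_piMl// ge_min lexx orbT.
  rewrite ler_pdivlMr// mulr2n mulrDr mulr1 lerD//=.
  exact: le_trans (ler_norm _) h.
have B0 : 0 < B ^+ 2.
  rewrite exprn_even_gt0//=; apply/eqP => B0; exact: hAB.
(* A bound for |w| - (A + t) that does not depend on [t]. *)
set D := 2 * (1 + 3 * - A + `|B|).
have D0 : 0 < D by rewrite /D mulr_gt0//; have := normr_ge0 B; lra.
exists (Num.min (2^-1 ^+ 2) (B ^+ 2 / (2 * D * (2 - 2 * A)))) => [|t t0].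
  rewrite lt_min; apply/andP; split; first by rewrite exprn_gt0.
  have q : 0 < 2 - 2 * A by clear -A0; lra.
  exact: (divr_gt0 B0 (mulr_gt0 (mulr_gt0 (ltr0Sn _ 1) D0) q)).
rewrite Re_csqrt2; last exact: hw.
set r := cmod _; have r2 : r ^+ 2 = (A + t) ^+ 2 + B ^+ 2 by rewrite /r cmod2E.
have r0 : 0 <= r by exact: cmod_ge0.
have hr : `|A + t| <= r by exact: (Re_le_cmod ((A + t) +i* B)).
have rp : A + t <= r by exact: le_trans (ler_norm _) hr.
rewrite /=; have [ht|ht] := leP (1 - 2 * A) t.
  apply: (@le_trans _ _ ((2^-1 ^+ 2) * (1 + t))).
    by rewrite ler_wpM2r ?ge_min ?lexx//; lra.
  by rewrite expr2; lra.
apply: (@le_trans _ _ (B ^+ 2 / (2 * D * (2 - 2 * A)) * (1 + t))).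
  by rewrite ler_wpM2r ?ge_min ?lexx ?orbT//; lra.
have hD : r - (A + t) <= D.
  have : r <= - A + t + `|B|.
    rewrite -(@ler_pXn2r _ 2)// ?nnegrE ?r2//; last by have := normr_ge0 B; lra.
    have -> : B ^+ 2 = `|B| ^+ 2 by rewrite real_normK// num_real.
    by have := normr_ge0 B; nra.
  by rewrite /D; lra.
have e : (r - (A + t)) * (r + (A + t)) = B ^+ 2 by rewrite -subr_sqr r2; ring.
have h1 : B ^+ 2 / D <= r + (A + t).
  rewrite ler_pdivrMr// -e mulrC; apply: ler_wpM2l => //.
  by move: hr; rewrite ler_norml => /andP[]; lra.
apply: (@le_trans _ _ (B ^+ 2 / D / 2)); last by rewrite ler_wpM2r.
clearbody D.
have Dn : D != 0 by rewrite gt_eqF.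
have An : 2 - 2 * A != 0 by apply/eqP => h; clear -h A0; lra.
have -> : B ^+ 2 / (2 * D * (2 - 2 * A)) * (1 + t) = B ^+ 2 / D / 2 * ((1 + t) / (2 - 2 * A)).
  by field; rewrite An Dn.
rewrite ler_piMr ?divr_ge0 ?(ltW B0) ?(ltW D0)//.
by rewrite ler_pdivrMr; clear -A0 ht t0; lra.
Qed.

End square_root.

(** * Sigma-finiteness of the cylinder *)

Section cylinder_measure.
Context {R : realType} (n : nat).

(** A copy of [cylinder] that carries the sigma-finite structure, so that Fubini applies to products
    with the cylinder as a factor. *)
Definition cylm : set (Cyl R n) -> \bar R := cylinder n.


HB.instance Definition _ := Measure.copy cylm (cylinder n).

Lemma cylinder_sigma_finite : sigma_finite setT cylm.
Proof.
have /sigma_finiteP[F [TF ndF Foo]] := sigma_finiteT (@lebesgue_measure R).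
exists (fun k => F k `*` setT).
  rewrite predeqE => -[x y]; split => // _.
  have : (\bigcup_k F k) x by rewrite -TF.
  by move=> [k _ Fx]; exists k.
move=> k; have [mF Fk] := Foo k; split; first exact: measurableX.
have -> : cylm (F k `*` setT) = (@lebesgue_measure R (F k) * torus n setT)%E.
  exact: product_measure1E.
rewrite lte_mul_pinfty//.
  by rewrite ge0_fin_numE.
by rewrite ltey_eq fin_num_measure.
Qed.

HB.instance Definition _ := Measure_isSigmaFinite.Build _ _ _ cylm cylinder_sigma_finite.

End cylinder_measure.
Arguments cylm {R} n A : rename.

(** * The Green function on the line *)

Section green_function.
Context {R : realType}.
Local Notation leb := (@lebesgue_measure R).

(** Green function of -d^2/ds^2 + k^2 on the line, for Re k > 0. *)
Definition Gk (k : R[i]) (s : R) : R[i] := cexp (- k * `|s|%:C) / (2 * k).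

Lemma cmod_2 : cmod (2 : R[i]) = 2.
Proof. by have := cmodR (2 : R); rewrite rmorph_nat normr_nat. Qed.

Lemma cmod_GkE k s : cmod (Gk k s) = expR (- Re k * `|s|) / (2 * cmod k).
Proof.
rewrite /Gk cmodM cmodV cmodM cmod_2 cmod_cexp; congr (expR _ / _).
by case: k => a b /=; ring.
Qed.

Lemma cmod_Gk k s : 0 < Re k -> cmod (Gk k s) <= (2 * Re k)^-1.
Proof.
move=> k0; rewrite cmod_GkE -[leRHS]mul1r; apply: ler_pM.
- exact: expR_ge0.
- by rewrite invr_ge0 mulr_ge0 ?cmod_ge0.
- by rewrite -expR0 ler_expR mulNr oppr_le0 mulr_ge0// ltW.
- have h := le_trans (ler_norm _) (Re_le_cmod k).
  by rewrite lef_pV2 ?posrE ?mulr_gt0// ?(lt_le_trans k0 h)// ler_wpM2l.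
Qed.

Lemma cmod_Gk2 k s : 0 < Re k ->
  cmod (Gk k s) ^+ 2 <= (4 * Re k ^+ 2)^-1 * expR (- (2 * Re k) * `|s|).
Proof.
move=> k0; rewrite cmod_GkE exprMn -expRM_natl mulrC.
have h := le_trans (ler_norm _) (Re_le_cmod k).
have -> : 2%:R * (- Re k * `|s|) = - (2 * Re k) * `|s| by ring.
apply: ler_wpM2r; first exact: expR_ge0.
have -> : (4 : R) * Re k ^+ 2 = (2 * Re k) ^+ 2 by ring.
rewrite exprVn lef_pV2 ?posrE ?exprn_gt0 ?mulr_gt0// ?(lt_le_trans k0 h)//.
by rewrite ler_pXn2r ?nnegrE ?mulr_ge0 ?cmod_ge0 ?(ltW k0)// ler_wpM2l.
Qed.

Lemma continuous_dist (c : R) : continuous (fun x : R => `|x - c|).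
Proof.
by move=> x; apply: cvg_norm; apply: cvgB; [exact: cvg_id|exact: cvg_cst].
Qed.

Lemma continuous_exp_dist (b c : R) : continuous (fun x : R => expR (b * `|x - c|)).
Proof.
move=> x; apply: (continuous_comp (f := fun x : R => b * `|x - c|) (g := @expR R)); last exact: continuous_expR.
by apply: cvgM; [exact: cvg_cst|exact: continuous_dist].
Qed.

Lemma ccont_Gk k c : ccont (fun x => Gk k (x - c)).
Proof.
apply: ccontM; last exact: ccont_cst.
by apply: (@ccont_exp _ (- k) (fun x => `|x - c|)); exact: continuous_dist.
Qed.

Lemma cmeas_Gk k : cmeasurable_fun (fun s : measurableTypeR R => Gk k s).
Proof.
have [c1 c2] := @ccont_Gk k 0.
split; [have := continuous_measurable_fun c1|have := continuous_measurable_fun c2];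
  by under eq_fun do rewrite subr0.
Qed.

(** Exact integration on growing intervals centred at [c], half by half, followed by Fatou's
    lemma. *)
Lemma int_exp_dist (b c : R) : 0 < b ->
  (\int[leb]_x (expR (- b * `|x - c|))%:E <= (2 / b)%:E)%E.
Proof.
move=> b0.
pose I N : set (measurableTypeR R) := `[c - N.+1%:R, c + N.+1%:R]%classic.
have mI N : measurable (I N) by exact: measurable_itv.
have mf : measurable_fun setT (fun x : measurableTypeR R => expR (- b * `|x - c|)).
  by apply: continuous_measurable_fun; exact: continuous_exp_dist.
apply: (@fatou_le _ _ _ leb (fun N x => (expR (- b * `|x - c|) * \1_(I N) x)%:E)).
- by move=> N; apply/measurable_EFinP; apply: measurable_funM => //; exact: measurable_indic.
- by move=> N x; rewrite lee_fin mulr_ge0 ?expR_ge0.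
- exact/measurable_EFinP.
- apply: aeW => x; apply: cvg_near_cst.
  have := truncnS_gt `|x - c|; set N0 := Num.truncn _ => hN; exists N0 => // N /= N0N.
  rewrite indicE mem_set ?mulr1// /I/= in_itv/= -ler_distlC distrC.
  by apply: le_trans (ltW hN) _; rewrite ler_nat.
- move=> N; have N0 : 0 < N.+1%:R :> R by [].
  have d1 (x : R) : is_derive x (1 : R) (fun t => b^-1 * expR (b * (t - c))) (expR (b * (x - c))).
    have h := is_derive1_comp (f := expR) (g := fun t => b * (t - c)) (is_derive_expR _)
      (is_derive_affine_shift b c x).
    refine (is_derive_eq (is_deriveZ b^-1 h) _).
    by rewrite /GRing.scale/= mulrCA mulVf ?mulr1// gt_eqF.
  have d2 (x : R) : is_derive x (1 : R) (fun t => - b^-1 * expR (- b * (t - c))) (expR (- b * (x - c))).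
    have h := is_derive1_comp (f := expR) (g := fun t => - b * (t - c)) (is_derive_expR _)
      (is_derive_affine_shift (- b) c x).
    refine (is_derive_eq (is_deriveZ (- b^-1) h) _).
    by rewrite /GRing.scale/= mulrCA mulrNN mulVf ?mulr1// gt_eqF.
  have cN1 : c - N.+1%:R < c by rewrite ltrBlDr ltrDl.
  have cN2 : c < c + N.+1%:R by rewrite ltrDl.
  have ce1 : continuous (fun x : R => expR (b * (x - c))).
    by apply: is_derive_continuous => x; exact: (is_derive1_comp (f := expR) (g := fun t => b * (t - c))
      (is_derive_expR _) (is_derive_affine_shift b c x)).
  have ce2 : continuous (fun x : R => expR (- b * (x - c))).
    by apply: is_derive_continuous => x; exact: (is_derive1_comp (f := expR) (g := fun t => - b * (t - c))
      (is_derive_expR _) (is_derive_affine_shift (- b) c x)).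
  have := @FTC_split _ _ _ _ _ _ _ _ _ cN1 cN2 (@continuous_exp_dist (- b) c) ce1 ce2 _ _ d1 d2.
  have h1 (x : R) : x <= c -> expR (- b * `|x - c|) = expR (b * (x - c)).
    by move=> xc; rewrite ler0_norm ?subr_le0// mulrNN.
  have h2 (x : R) : c <= x -> expR (- b * `|x - c|) = expR (- b * (x - c)).
    by move=> xc; rewrite ger0_norm ?subr_ge0.
  move=> /(_ h1 h2) e.
  have jf := continuous_integrable_itv (c - N.+1%:R) (c + N.+1%:R) (@continuous_exp_dist (- b) c).
  have -> : (\int[leb]_x (expR (- b * `|x - c|) * \1_(I N) x)%:E =
      \int[leb]_(x in I N) (expR (- b * `|x - c|))%:E)%E.
    rewrite [RHS]integral_mkcond; apply: eq_integral => x _.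
    by rewrite patchE indicE; case: (_ \in _); rewrite ?mulr1 ?mulr0.
  rewrite -[X in (X <= _)%E]fineK; last exact: integrable_fin_num jf.
  move: e; rewrite /Rintegral => ->; rewrite lee_fin subrr mulr0 expR0 mulr1 mulr0 expR0.
  have e1 := expR_ge0 (b * (c - N.+1%:R - c)); have e2 := expR_ge0 (- b * (c + N.+1%:R - c)).
  have bi : 0 < b^-1 by rewrite invr_gt0.
  move: e1 e2; set u := expR _; set v := expR _ => u0 v0.
  have : 0 <= b^-1 * u by rewrite mulr_ge0// ltW.
  have : 0 <= b^-1 * v by rewrite mulr_ge0// ltW.
  by rewrite (_ : 2 / b = b^-1 + b^-1); [lra|ring].
Qed.

Lemma int_Gk k c : 0 < Re k ->
  (\int[leb]_x (cmod (Gk k (x - c)) ^+ 2)%:E <= ((4 * Re k ^+ 3)^-1)%:E)%E.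
Proof.
move=> k0; have mG : cmeasurable_fun (fun x : measurableTypeR R => Gk k (x - c)).
  by have [c1 c2] := ccont_Gk k c; split; apply: continuous_measurable_fun.
apply: (@le_trans _ _ (\int[leb]_x ((4 * Re k ^+ 2)^-1 * expR (- (2 * Re k) * `|x - c|))%:E)%E).
  apply: ge0_le_integral => //.
  - by move=> x _; rewrite lee_fin sqr_ge0.
  - exact/measurable_EFinP/cmeas_cmod2.
  - apply/measurable_EFinP; apply: measurable_funM => //.
    by apply: continuous_measurable_fun; exact: continuous_exp_dist.
  - by move=> x _; rewrite lee_fin; exact: cmod_Gk2.
under eq_integral do rewrite EFinM.
rewrite ge0_integralZl//; last 2 first.
- by apply/measurable_EFinP; apply: continuous_measurable_fun; exact: continuous_exp_dist.
- by rewrite lee_fin invr_ge0 mulr_ge0// sqr_ge0.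
have k2 : 0 < 2 * Re k by rewrite mulr_gt0.
have ck : (0 <= ((4 * Re k ^+ 2)^-1)%:E :> \bar R)%E by rewrite lee_fin invr_ge0 mulr_ge0// sqr_ge0.
apply: le_trans (lee_wpmul2l ck (int_exp_dist c k2)) _.
have -> : (4 * Re k ^+ 3)^-1 = (4 * Re k ^+ 2)^-1 * (2 / (2 * Re k)).
  by field; rewrite gt_eqF.
by rewrite EFinM.
Qed.

End green_function.

(** * The operator of a single Fourier mode *)

Section green_operator.
Context {R : realType} (n : nat).
Local Notation leb := (@lebesgue_measure R).
Local Notation cyl := (cylm n : {sigma_finite_measure set (Cyl R n) -> \bar R}).

Lemma L2_bdM d (T : measurableType d) (mu : {measure set T -> \bar R}) (K r : T -> R[i]) (B : R) :
  cmeasurable_fun K -> (forall x, cmod (K x) <= B) -> L2 mu r -> L2 mu (fun x => K x * r x).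
Proof.
move=> mK KB Lr; apply: (L2_le (h := fun x => B ^+ 2 * cmod (r x) ^+ 2)).
- exact: cmeasM mK (L2_meas Lr).
- by apply: integrable_scale; exact: L2_int.
- move=> x; rewrite cmodM exprMn ler_wpM2r ?sqr_ge0//.
  by rewrite ler_pXn2r ?nnegrE ?cmod_ge0// (le_trans (cmod_ge0 _) (KB x)).
Qed.

Variables (k : R[i]) (r : Cyl R n -> R[i]).
Hypothesis k0 : 0 < Re k.
Hypothesis Lr : L2 cyl r.

(** Coefficient of one transverse mode of the output; [r] is the part of the kernel that depends on
    x' alone. *)
Definition Aop (f : Cyl R n -> R[i]) (x1 : R) : R[i] :=
  cintegral cyl (fun x' => Gk k (x1 - x'.1) * (r x' * f x')).

Let H (x1 : R) : R := nsq cyl (fun x' => Gk k (x1 - x'.1) * r x').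

Lemma cmeas_Gk_section x1 : cmeasurable_fun (fun x' : Cyl R n => Gk k (x1 - x'.1)).
Proof.
apply: (cmeas_comp (cmeas_Gk k)); apply: measurable_funB; first exact: measurable_cst.
exact: measurable_fst.
Qed.

Lemma cmeas_Gk_prod : cmeasurable_fun (fun p : measurableTypeR R * Cyl R n => Gk k (p.1 - p.2.1)).
Proof.
apply: (cmeas_comp (cmeas_Gk k)); apply: measurable_funB; first exact: measurable_fst.
by apply: measurableT_comp; [exact: measurable_fst|exact: measurable_snd].
Qed.

Lemma L2_Gr x1 : L2 cyl (fun x' => Gk k (x1 - x'.1) * r x').
Proof.
by apply: L2_bdM => //; [exact: cmeas_Gk_section|move=> x; exact: cmod_Gk].
Qed.

(** Tonelli in the other order: for fixed x' the integral of |G|^2 in x_1 is bounded by [int_Gk]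
    whatever the translation, and |r(x')|^2 remains. *)
Lemma Gr_fubini : leb.-integrable setT (fun x => (H x)%:E) /\
  Rintegral leb setT H <= (4 * Re k ^+ 3)^-1 * nsq cyl r.
Proof.
pose u (p : measurableTypeR R * Cyl R n) := Gk k (p.1 - p.2.1) * r p.2.
have mu : cmeasurable_fun u.
  by apply: cmeasM; [exact: cmeas_Gk_prod|exact: (@cmeas_snd _ _ _ _ R r (L2_meas Lr))].
have c0 : 0 <= (4 * Re k ^+ 3)^-1 by rewrite invr_ge0 mulr_ge0// exprn_ge0// ltW.
have le : (\int[leb \x cyl]_p (cmod (u p) ^+ 2)%:E <= ((4 * Re k ^+ 3)^-1 * nsq cyl r)%:E)%E.
  rewrite fubini_tonelli2//; last 2 first.
  - exact/measurable_EFinP/cmeas_cmod2.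
  - by move=> p; rewrite lee_fin sqr_ge0.
  rewrite EFinM nsqE// -ge0_integralZl//; last 2 first.
  - by apply/measurable_EFinP; exact: cmeas_cmod2 (L2_meas Lr).
  - by move=> p _; rewrite lee_fin sqr_ge0.
  apply: ge0_le_integral => //.
  - by move=> y _; apply: integral_ge0 => x _; rewrite lee_fin sqr_ge0.
  - apply: measurable_fun_fubini_tonelli_G => //; first exact/measurable_EFinP/cmeas_cmod2.
  - by move=> y; rewrite lee_fin sqr_ge0.
  - by apply: measurable_funeM; apply/measurable_EFinP; exact: cmeas_cmod2 (L2_meas Lr).
  - move=> y _; rewrite /fubini_G.
    under eq_integral => x _ do rewrite /u/= cmodM exprMn mulrC EFinM.
    rewrite ge0_integralZl//; last 3 first.
    + apply/measurable_EFinP/cmeas_cmod2; have [c1 c2] := ccont_Gk k y.1.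
      by split; apply: continuous_measurable_fun.
    + by move=> y0 _; rewrite lee_fin sqr_ge0.
    + by rewrite lee_fin sqr_ge0.
    rewrite muleC; apply: lee_pmul => //; first by apply: integral_ge0 => x _; rewrite lee_fin sqr_ge0.
      by rewrite lee_fin sqr_ge0.
    exact: int_Gk.
have Lu : L2 (leb \x cyl)%E u by apply: L2I => //; apply: le_lt_trans le (ltry _).
have [jH eH] := nsq_fubini Lu; split; first exact: jH.
by rewrite -[leLHS]eH -lee_fin nsqE.
Qed.

Lemma Aop_inner f x1 : Aop f x1 =
  inner cyl (fun x' => (Gk k (x1 - x'.1) * r x')^*) f.
Proof. by apply: eq_cintegral => x'; rewrite conjCK mulrA. Qed.

Lemma Aop_bound f x1 : L2 cyl f -> cmod (Aop f x1) ^+ 2 <= H x1 * nsq cyl f.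
Proof.
move=> Lf; rewrite Aop_inner.
have -> : H x1 = nsq cyl (fun x' => (Gk k (x1 - x'.1) * r x')^*).
  by apply: eq_Rintegral => x' _; rewrite cmodJ.
rewrite -!nrm2 -exprMn ler_pXn2r ?nnegrE ?cmod_ge0 ?mulr_ge0 ?nrm_ge0//.
by apply: cauchy_schwarz => //; apply: L2J; exact: L2_Gr.
Qed.

Lemma cmeas_Aop f : cmeasurable_fun f -> cmeasurable_fun (Aop f : measurableTypeR R -> R[i]).
Proof.
move=> mf; apply: (@cmeas_cintegral _ _ _ _ R cyl
  (fun p : measurableTypeR R * Cyl R n => Gk k (p.1 - p.2.1) * (r p.2 * f p.2))).
apply: cmeasM; first exact: cmeas_Gk_prod.
apply: cmeasM; first exact: (@cmeas_snd _ _ _ _ R r (L2_meas Lr)).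
exact: (@cmeas_snd _ _ _ _ R f mf).
Qed.

Lemma L2_Aop f : L2 cyl f -> L2 leb (Aop f).
Proof.
move=> Lf; have [jH _] := Gr_fubini.
apply: (@L2_le _ (measurableTypeR R) R leb (Aop f) (fun x => nsq cyl f * H x)).
- exact: cmeas_Aop (L2_meas Lf).
- exact: integrable_scale.
- by move=> x; rewrite mulrC; exact: Aop_bound.
Qed.

Lemma nsq_Aop f : L2 cyl f -> nsq leb (Aop f) <= (4 * Re k ^+ 3)^-1 * nsq cyl r * nsq cyl f.
Proof.
move=> Lf; have [jH hH] := Gr_fubini.
apply: (@le_trans _ _ (Rintegral leb setT (fun x => nsq cyl f * H x))).
  apply: le_Rintegral => //; first exact: L2_int (L2_Aop Lf).
    exact: integrable_scale.
  by move=> x _; rewrite mulrC; exact: Aop_bound.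
rewrite RintegralZl// mulrC; apply: ler_wpM2r; [exact: nsq_ge0|exact: hH].
Qed.

(** For fixed x_1 the values [Aop (e i) x] are pairings of the e_i with one L^2 function, the row of
    the kernel. Bessel's inequality bounds their squares by [H x], which is integrated in x_1. *)
Lemma nsq_Aop_sum (e : nat -> Cyl R n -> R[i]) N :
  (forall i, L2 cyl (e i)) -> (forall i j, inner cyl (e i) (e j) = (i == j)%:R) ->
  \sum_(i < N) nsq leb (Aop (e i)) <= (4 * Re k ^+ 3)^-1 * nsq cyl r.
Proof.
move=> Le oe; have [jH hH] := Gr_fubini; apply: le_trans hH.
have jA i := L2_int (L2_Aop (Le i)).
have -> : \sum_(i < N) nsq leb (Aop (e i)) =
    Rintegral leb setT (fun x => \sum_(i < N) cmod (Aop (e i) x) ^+ 2).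
  elim: N => [|N IH]; first by rewrite big_ord0; under eq_Rintegral do rewrite big_ord0; rewrite Rintegral_cst// mul0r.
  rewrite big_ord_recr IH /= [X in _ + X]/nsq -RintegralD//.
    by apply: eq_Rintegral => x _; rewrite big_ord_recr.
  have := integrable_sum measurableT (index_enum 'I_N) (P := xpredT) (fun (i : 'I_N) _ => jA i).
  - by apply: eq_integrable => // x _; rewrite sumEFin.
  - exact: jA.
apply: le_Rintegral => //.
  have := integrable_sum measurableT (index_enum 'I_N) (P := xpredT) (fun (i : 'I_N) _ => jA i).
  by apply: eq_integrable => // x _; rewrite sumEFin.
move=> x _; change (\sum_(i < N) cmod (Aop (e i) x) ^+ 2 <= H x).
have -> : H x = nsq cyl (fun x' => (Gk k (x - x'.1) * r x')^*).
  by apply: eq_Rintegral => x' _; rewrite cmodJ.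
have LG : L2 cyl (fun x' => (Gk k (x - x'.1) * r x')^*) by apply: L2J; exact: L2_Gr.
have := bessel Le oe (iota_uniq 0 N) LG; apply: le_trans.
rewrite -[X in iota 0 X]subn0 big_mkord; apply: ler_sum => i _.
by rewrite Aop_inner innerC// cmodJ.
Qed.

Lemma Aop_lin a f g x1 : L2 cyl f -> L2 cyl g ->
  Aop (fun x => a * f x + g x) x1 = a * Aop f x1 + Aop g x1.
Proof.
move=> Lf Lg; rewrite !Aop_inner; have LG := L2J (L2_Gr x1).
by rewrite innerDr ?innerZr//; exact: L2Z.
Qed.

End green_operator.

(** * Bounded solutions of w'' = k^2 w vanish *)

Section ode.
Context {R : realType}.

(** The quantity e^{-2 Re(l) (s - t)} |f(s)|^2 is constant in [s], while for bounded [f] it tends to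
    0 in one of the two directions. *)
Lemma cder_exp0 (l : R[i]) (f : R -> R[i]) (C : R) : Re l != 0 ->
  cder f (fun t => l * f t) -> (forall t, cmod (f t) <= C) -> forall t, f t = 0.
Proof.
move=> l0 df fC t.
pose h (s : R) := expR (- (2 * Re l) * (s - t)) * cmod (f s) ^+ 2.
have dh s : is_derive s (1 : R) h 0.
  have [d1 d2] := df s.
  have dE := is_derive1_comp (f := expR) (g := fun s => - (2 * Re l) * (s - t)) (is_derive_expR _)
      (is_derive_affine_shift (- (2 * Re l)) t s).
  have dq := is_deriveD (is_deriveM d1 d1) (is_deriveM d2 d2).
  have -> : h = (fun s => expR (- (2 * Re l) * (s - t)) *
      (Re (f s) * Re (f s) + Im (f s) * Im (f s))).
    by apply/funext => y; rewrite /h cmod2E !expr2.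
  refine (is_derive_eq (is_deriveM dE dq) _).
  by rewrite !fctE !ReImE /GRing.scale/=; ring.
have hc s : h s = h t.
  exact: is_derive_0_is_cst.
have ht : h t = cmod (f t) ^+ 2 by rewrite /h subrr mulr0 expR0 mul1r.
apply/eqP; rewrite -cmod_eq0 -sqrf_eq0 -ht eq_le [X in _ && (0 <= X)]ht sqr_ge0 andbT.
have C0 : 0 <= C by exact: le_trans (cmod_ge0 _) (fC t).
apply/ler_addgt0Pl => eps e0; rewrite addr0.
(* The point [s] below makes the weight e^-L, and (1 + L) eps >= C^2 then gives e^-L C^2 <= eps. *)
pose L := C ^+ 2 / eps.
have L0 : 0 <= L by rewrite divr_ge0 ?sqr_ge0// ltW.
pose s := t + L / (2 * Re l).
rewrite -(hc s) /h.
have -> : - (2 * Re l) * (s - t) = - L by rewrite /s; field.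
apply: (@le_trans _ _ (expR (- L) * C ^+ 2)).
  rewrite ler_wpM2l ?expR_ge0// ler_pXn2r ?nnegrE ?cmod_ge0//.
rewrite expRN ler_pdivrMl ?expR_gt0//.
apply: (@le_trans _ _ ((1 + L) * eps)); last by rewrite ler_wpM2r ?expR_ge1Dx// ltW.
by rewrite mulrDl mul1r /L divfK ?gt_eqF// lerDr ltW.
Qed.

(** Factorisation: w' + k w and w' - k w solve first-order equations with rates k and -k and are
    bounded, so both vanish; their difference is 2 k w. *)
Lemma bounded_ode0 (k : R[i]) (w w1 : R -> R[i]) (C : R) : 0 < Re k ->
  cder w w1 -> cder w1 (fun t => k ^+ 2 * w t) ->
  (forall t, cmod (w t) <= C) -> (forall t, cmod (w1 t) <= C) -> forall t, w t = 0.
Proof.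
move=> k0 dw dw1 wC w1C t.
have kn : k != 0 by apply/eqP => h; move: k0; rewrite h ltxx.
have C0 : 0 <= C by exact: le_trans (cmod_ge0 _) (wC t).
have part (l : R[i]) : l ^+ 2 = k ^+ 2 -> Re l != 0 -> forall t, w1 t + l * w t = 0.
  move=> l2 l0; apply: (@cder_exp0 l _ (C + cmod l * C)) => // [|s].
    apply: (cder_eq (cderD dw1 (cderZ l dw))) => s.
    by rewrite mulrDr mulrA -expr2 l2 addrC.
  apply: le_trans (cmodD _ _) _; rewrite cmodM lerD// ler_wpM2l ?cmod_ge0//.
have h1 := part k erefl (negbT (gt_eqF k0)) t.
have h2 : w1 t + - k * w t = 0 by apply: part; rewrite ?sqrrN// ReImE oppr_eq0 gt_eqF.
have : 2 * k * w t = 0.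
  have -> : 2 * k * w t = (w1 t + k * w t) - (w1 t + - k * w t).
    rewrite mulNr opprD opprK addrACA subrr add0r -mulrDl; congr (_ * _).
    by rewrite mulr_natl mulr2n.
  by rewrite h1 h2 subrr.
by move/eqP; rewrite !mulf_eq0 (negbTE kn) pnatr_eq0/= => /eqP.
Qed.

End ode.

(** * Uniqueness of L^2 weak solutions *)

Section uniqueness.
Context {R : realType} (n : nat).
Local Notation leb := (@lebesgue_measure R).
Local Notation cyl := (cylm n : {sigma_finite_measure set (Cyl R n) -> \bar R}).

Definition csupp (g : R -> R) := exists M : R, forall x, M < `|x| -> g x = 0.

Lemma L2_band (M : R) : L2 cyl (fun x => (\1_(`[- M, M]%classic : set (measurableTypeR R)) x.1 : R)%:C).
Proof.
have h1 : L2 leb (fun x : measurableTypeR R => (\1_(`[- M, M]%classic : set (measurableTypeR R)) x : R)%:C).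
  apply: L2_indic; first exact: measurable_itv.
  exact/compact_finite_measure/segment_compact.
have := L2_tensor h1 (L2_character (0 : 'rV[int]_n)).
have -> // : (fun p : Cyl R n => (\1_(`[- M, M]%classic : set (measurableTypeR R)) p.1 : R)%:C *
    character 0 p.2) = (fun x => (\1_(`[- M, M]%classic : set (measurableTypeR R)) x.1 : R)%:C).
by apply/funext => p; rewrite character0 mulr1.
Qed.

Lemma continuous_bounded (g : R -> R) : continuous g -> csupp g ->
  exists2 C : R, 0 <= C & forall x, `|g x| <= C.
Proof.
move=> cg [M g0].
have [C hC] : exists C : R, forall x, - `|M| <= x <= `|M| -> `|g x| <= C.
  have cgn : {within `[- `|M|, `|M|]%classic, continuous (fun x => `|g x|)}.
    by apply: continuous_subspaceT => x; apply: cvg_norm; exact: cg.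
  have le : - `|M| <= `|M| by rewrite ge0_cp.
  have [c _ hc] := EVT_max le cgn.
  by exists `|g c| => x hx; apply: hc; rewrite in_itv.
exists `|C| => // x; have [h|h] := leP `|x| `|M|.
  by apply: le_trans (ler_norm C); apply: hC; rewrite -ler_norml.
by rewrite g0 ?normr0// (le_lt_trans (ler_norm M)).
Qed.

Lemma csupp_derive (g g1 : R -> R) : csupp g ->
  (forall x, is_derive x (1 : R) g (g1 x)) -> csupp g1.
Proof.
move=> [M g0] dg; exists M => x Mx; have d := dg x.
have := @near_eq_is_derive _ _ _ g (fun _ : R => 0 : R) x 1 (g1 x) _ d.
have h : \forall y \near x, g y = 0.
  have : \forall y \near x, M < `|y|.
    have cn : continuous (fun y : R => `|y|) by move=> y; apply: cvg_norm; exact: cvg_id.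
    by have /cvgr_gt := cn x; apply.
  by apply: filterS => y; exact: g0.
by move=> /(_ h) [_]; rewrite derive_cst.
Qed.

Lemma csupp_shift (g : R -> R) s : csupp g -> csupp (fun x => g (x - s)).
Proof.
move=> [M g0]; exists (M + `|s|) => x Mx; apply: g0.
by have := ler_distD s x 0; rewrite !subr0; have := ler_normB x s; have := lerB_dist x s; lra.
Qed.

(** Differentiation under the integral: for translations within 1 of [a] the integrand lives in a
    fixed band in x_1 and is dominated there by a multiple of |U|. *)
Lemma is_derive_pairing (U : Cyl R n -> R) (g g1 : R -> R) (a : R) :
  measurable_fun setT U ->
  (forall M, cyl.-integrable setT
    (fun x => (\1_(`[- M, M]%classic : set (measurableTypeR R)) x.1 * `|U x|)%:E)) ->
  csupp g -> (forall x, is_derive x (1 : R) g (g1 x)) -> continuous g1 ->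
  is_derive a (1 : R) (fun s => Rintegral cyl setT (fun x => g (x.1 - s) * U x))
    (- Rintegral cyl setT (fun x => g1 (x.1 - a) * U x)).
Proof.
move=> mU jU sg dg cg1; have sg1 := csupp_derive sg dg.
have cg : continuous g := is_derive_continuous dg.
pose f (s : R) (x : Cyl R n) := g (x.1 - s) * U x.
have dshift (s y : R) : is_derive s (1 : R) (fun t => g (y - t)) (- g1 (y - s)).
  have h : is_derive s (1 : R) (fun t : R => y - t) (-1).
    have -> : (fun t : R => y - t) = (fun t => -1 * t + y) by apply/funext => t; ring.
    exact: is_derive_affine.
  refine (is_derive_eq (is_derive1_comp (f := g) (g := fun t => y - t) (dg (y - s)) h) _).
  by rewrite mulrN1.
have df (x : Cyl R n) s : is_derive s (1 : R) (f^~ x) (- g1 (x.1 - s) * U x).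
  have -> : f^~ x = (fun t => U x * g (x.1 - t)) by apply/funext => t; rewrite /f mulrC.
  by refine (is_derive_eq (is_deriveZ (U x) (dshift s x.1)) _); rewrite /GRing.scale/= mulrC.
have mg (h : R -> R) s : continuous h -> measurable_fun setT (fun x : Cyl R n => h (x.1 - s)).
  move=> ch; apply: (measurableT_comp (f := fun t : measurableTypeR R => h (t - s))); last exact: measurable_fst.
  apply: continuous_measurable_fun => t.
  by apply: (continuous_comp (f := fun t : R => t - s)); [apply: cvgB; [exact: cvg_id|exact: cvg_cst]|exact: ch].
have dom (h : R -> R) : continuous h -> csupp h -> exists (C M : R), 0 <= C /\ forall (s : R) x,
    s \in `]a - 1, a + 1[ -> `|h (x.1 - s) * U x| <= C * (\1_(`[- M, M]%classic : set (measurableTypeR R)) x.1 * `|U x|).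
  move=> ch sh; have [C C0 hC] := continuous_bounded ch sh; have [M h0] := sh.
  (* This band contains the translated support for every [s] in ]a - 1, a + 1[. *)
  exists C, (M + `|a| + 1); split => // s x; rewrite in_itv/= => /andP[s1 s2].
  rewrite normrM mulrA ler_wpM2r// indicE; case: (boolP (x.1 \in _)) => [_|]; first by rewrite mulr1.
  move=> /negP xM; rewrite h0 ?normr0 ?mulr0// ltNge; apply/negP => xs; apply: xM.
  rewrite inE/= in_itv/= -ler_norml.
  have sa : `|s| <= `|a| + 1.
    have : `|s - a| <= 1 by rewrite ler_norml; apply/andP; split; lra.
    by have := lerB_dist s a; lra.
  by have := lerB_dist x.1 s; lra.
have jf (h : R -> R) s : continuous h -> csupp h -> s \in `]a - 1, a + 1[ ->
    cyl.-integrable setT (fun x => (h (x.1 - s) * U x)%:E).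
  move=> ch sh sI; have [C [M [C0 hC]]] := dom h ch sh.
  apply: (le_integrable measurableT _ _ (integrable_scale C (jU M))).
    by apply/measurable_EFinP; apply: measurable_funM => //; exact: mg.
  move=> x _ /=; rewrite lee_fin; apply: le_trans (hC s x sI) _; exact: ler_norm.
have [C [M [C0 hC]]] := dom g1 cg1 sg1.
have aI : `]a - 1, a + 1[%classic a by rewrite /= in_itv/=; apply/andP; split; lra.
have d1E x s : partial1of2 f s x = - g1 (x.1 - s) * U x.
  by rewrite partial1of2E; have h := df x s; exact: derive_val.
have Gb : forall s x, `]a - 1, a + 1[%classic s -> setT x -> `|partial1of2 f s x| <=
    C * (\1_(`[- M, M]%classic : set (measurableTypeR R)) x.1 * `|U x|).
  by move=> s x sI _; rewrite d1E mulNr normrN; exact: hC.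
have G0 (x : Cyl R n) : 0 <= C * (\1_(`[- M, M]%classic : set (measurableTypeR R)) x.1 * `|U x|).
  by rewrite !mulr_ge0// indicE ler0n.
have jfI s : `]a - 1, a + 1[%classic s -> cyl.-integrable setT (EFin \o f s).
  by move=> sI; exact: jf.
have derf s (x : Cyl R n) : `]a - 1, a + 1[%classic s -> setT x -> derivable (f^~ x) s 1.
  by move=> _ _; have [] := df x s.
have D := derivable_under_integral measurableT aI jfI derf G0 (integrable_scale C (jU M)) Gb.
have E := differentiation_under_integral measurableT aI jfI derf G0 (integrable_scale C (jU M)) Gb.
split; first exact: D.
rewrite -derive1E E -mulN1r -RintegralZl//; last exact: jf.
by apply: eq_Rintegral => x _; rewrite d1E mulN1r mulNr.
Qed.

Lemma Re_mulR (a : R) (z : R[i]) : Re (a%:C * z) = a * Re z.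
Proof. by case: z => x y; rewrite ReImE/= mul0r subr0. Qed.

Lemma Im_mulR (a : R) (z : R[i]) : Im (a%:C * z) = a * Im z.
Proof. by case: z => x y; rewrite ReImE/= mul0r addr0. Qed.

Section weak_solution.
Variables (u : Cyl R n -> R[i]) (k : R[i]) (m : 'rV[int]_n).
Hypothesis k0 : 0 < Re k.
Hypothesis Lu : L2 cyl u.
Hypothesis weak : forall g g1 g2 : R -> R, (forall j, ndiff j g) -> csupp g ->
  (forall x, is_derive x (1 : R) g (g1 x)) -> (forall x, is_derive x (1 : R) g1 (g2 x)) ->
  cintegral cyl (fun x => u x * ((g2 x.1)%:C * character m x.2)) =
  k ^+ 2 * cintegral cyl (fun x => u x * ((g x.1)%:C * character m x.2)).

Definition pairing (g : R -> R) (s : R) : R[i] :=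
  cintegral cyl (fun x => u x * ((g (x.1 - s))%:C * character m x.2)).

Lemma L2_profile (g : R -> R) s : continuous g -> csupp g ->
  L2 cyl (fun x => (g (x.1 - s))%:C * character m x.2).
Proof.
move=> cg sg; have [C C0 gC] := continuous_bounded cg sg.
have [M g0] := csupp_shift s sg.
have := @L2_tensor _ _ (measurableTypeR R) (Omega R n) R leb (torus n)
  (fun t => (g (t - s))%:C) (fun y => character m y) _ (L2_character m); apply.
apply: (@L2_supp _ _ _ leb _ (`[- M, M]%classic : set (measurableTypeR R)) C).
- apply: cmeasR; apply: continuous_measurable_fun => t.
  by apply: continuous_comp; [apply: cvgB; [exact: cvg_id|exact: cvg_cst]|exact: cg].
- exact: measurable_itv.
- exact/compact_finite_measure/segment_compact.
- move=> t; rewrite cmodR indicE; case: (boolP (t \in _)) => [_|]; first by rewrite mulr1.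
  move=> /negP h; rewrite g0 ?normr0 ?mulr0// ltNge; apply/negP => tM; apply: h.
  by rewrite inE/= in_itv/= -ler_norml.
Qed.

Lemma cintegrable_pairing (g : R -> R) s : continuous g -> csupp g ->
  cintegrable cyl (fun x => u x * ((g (x.1 - s))%:C * character m x.2)).
Proof.
move=> cg sg; have := cintegrable_inner (L2J Lu) (L2_profile s cg sg).
by under eq_fun do rewrite conjCK.
Qed.

Lemma Re_pairing g s : Re (pairing g s) =
  Rintegral cyl setT (fun x => g (x.1 - s) * Re (u x * character m x.2)).
Proof.
by apply: eq_Rintegral => x _; rewrite mulrCA Re_mulR.
Qed.

Lemma Im_pairing g s : Im (pairing g s) =
  Rintegral cyl setT (fun x => g (x.1 - s) * Im (u x * character m x.2)).
Proof.
by apply: eq_Rintegral => x _; rewrite mulrCA Im_mulR.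
Qed.

Lemma cder_pairing g g1 : csupp g -> (forall x, is_derive x (1 : R) g (g1 x)) ->
  continuous g1 -> cder (pairing g) (fun s => -1 * pairing g1 s).
Proof.
move=> sg dg cg1 s.
have muc : cmeasurable_fun (fun x : Cyl R n => u x * character m x.2).
  apply: cmeasM; first exact: L2_meas Lu.
  exact: (@cmeas_snd _ _ _ _ R _ (cmeas_character m)).
have [m1 m2] := muc.
have band M : cyl.-integrable setT
    (fun x => (\1_(`[- M, M]%classic : set (measurableTypeR R)) x.1 * cmod (u x))%:E).
  have := cintegrable_cmod (cintegrable_inner (L2_band M) Lu).
  apply: eq_integrable => // x _; congr (_%:E).
  by rewrite conjR cmodM cmodR ger0_norm// indicE ler0n.
have mI (M : R) : measurable_fun setT (fun x : Cyl R n => \1_(`[- M, M]%classic : set (measurableTypeR R)) x.1 : R).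
  exact: (L2_meas (L2_band M)).1.
have dom (U : Cyl R n -> R) : measurable_fun setT U -> (forall x, `|U x| <= cmod (u x)) ->
    forall M, cyl.-integrable setT
      (fun x => (\1_(`[- M, M]%classic : set (measurableTypeR R)) x.1 * `|U x|)%:E).
  move=> mU hU M; apply: (le_integrable measurableT _ _ (band M)).
    by apply/measurable_EFinP; apply: measurable_funM => //; exact: measurableT_comp.
  move=> x _ /=; rewrite lee_fin !normrM normr_id ler_wpM2l//.
  by rewrite [X in _ <= X]ger0_norm ?cmod_ge0.
have cu x : cmod (u x * character m x.2) = cmod (u x) by rewrite cmodM cmod_character mulr1.
have cR x : `|Re (u x * character m x.2)| <= cmod (u x) by rewrite -(cu x); exact: Re_le_cmod.
have cI x : `|Im (u x * character m x.2)| <= cmod (u x) by rewrite -(cu x); exact: Im_le_cmod.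
have h1 := is_derive_pairing s m1 (dom _ m1 cR) sg dg cg1.
have h2 := is_derive_pairing s m2 (dom _ m2 cI) sg dg cg1.
split.
- rewrite mulN1r ReImE Re_pairing.
  by have -> : (fun t => Re (pairing g t)) = (fun t => Rintegral cyl setT (fun x => g (x.1 - t) * Re (u x * character m x.2)))
    by apply/funext => t; rewrite Re_pairing.
- rewrite mulN1r ReImE Im_pairing.
  by have -> : (fun t => Im (pairing g t)) = (fun t => Rintegral cyl setT (fun x => g (x.1 - t) * Im (u x * character m x.2)))
    by apply/funext => t; rewrite Im_pairing.
Qed.

(** Cauchy-Schwarz: translates of the profile stay bounded by [C] on bands of equal measure, so
    their norms have a common bound. *)
Lemma pairing_bounded (g : R -> R) : continuous g -> csupp g ->
  exists C, forall s, cmod (pairing g s) <= C.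
Proof.
move=> cg sg; have [C C0 gC] := continuous_bounded cg sg; have [M g0] := sg.
pose T0 := fine (torus n setT : \bar R).
exists (nrm cyl u * Num.sqrt (C ^+ 2 * (2 * `|M| * T0))) => s.
have Lp := L2_profile s cg sg.
have -> : pairing g s = inner cyl (fun x => (u x)^*) (fun x => (g (x.1 - s))%:C * character m x.2).
  by apply: eq_cintegral => x; rewrite conjCK.
apply: le_trans (cauchy_schwarz (L2J Lu) Lp) _.
have -> : nrm cyl (fun x => (u x)^*) = nrm cyl u.
  by congr Num.sqrt; apply: eq_Rintegral => x _; rewrite cmodJ.
apply: ler_wpM2l; first exact: nrm_ge0.
apply: ler_wsqrtr; rewrite -lee_fin nsqE//.
pose A : set (measurableTypeR R) := `[s - `|M|, s + `|M|]%classic.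
have mA : measurable A by exact: measurable_itv.
have mAT : measurable (A `*` [set: Omega R n]) by exact: measurableX.
apply: (@le_trans _ _ (\int[cyl]_x ((C ^+ 2)%:E * (\1_(A `*` [set: Omega R n]) x)%:E))%E).
  apply: ge0_le_integral => //.
  - by move=> x _; rewrite lee_fin sqr_ge0.
  - by apply/measurable_EFinP; exact: cmeas_cmod2 (L2_meas Lp).
  - by apply: measurable_funeM; apply/measurable_EFinP; exact: measurable_indic.
  - move=> x _; rewrite -EFinM lee_fin cmodM cmodR cmod_character mulr1 indicE.
    case: (boolP (x \in _)) => [_|].
      by rewrite mulr1 ler_pXn2r ?nnegrE.
    move=> /negP h; rewrite g0 ?normr0 ?expr0n ?mulr0//.
    rewrite ltNge; apply/negP => xM; apply: h; rewrite inE; split => //=.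
    by rewrite /A/= in_itv/= -ler_distlC distrC; exact: le_trans xM (ler_norm M).
rewrite ge0_integralZl//; last 2 first.
- by apply/measurable_EFinP; exact: measurable_indic.
- by rewrite lee_fin sqr_ge0.
rewrite integral_indic// setIT.
rewrite [X in ((C ^+ 2)%:E * X <= _)%E](_ : _ = (leb A * torus n [set: Omega R n])%E); last first.
  exact: product_measure1E.
have -> : torus n [set: Omega R n] = T0%:E by rewrite fineK// fin_num_measure.
have -> : leb A = (2 * `|M|)%:E.
  rewrite lebesgue_measure_itv/= lte_fin; case: ifPn => h.
    by rewrite -EFinD; congr (_%:E); ring.
  congr (_%:E); move: h; rewrite -leNgt => h.
  by have := normr_ge0 M; lra.
by rewrite -!EFinM.
Qed.

Lemma ndiff_derive (g : R -> R) : (forall j, ndiff j g) ->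
  exists g1, (forall x, is_derive x (1 : R) g (g1 x)) /\ forall j, ndiff j g1.
Proof.
move=> sg; exists (fun x => 'D_1 g x).
have h j : exists2 g', (forall x, is_derive x (1 : R) g (g' x)) & ndiff j g' /\ g' = (fun x => 'D_1 g x).
  have [g' [dg s]] := sg j.+1; exists g' => //; split => //.
  by apply/funext => x; have d := dg x; rewrite derive_val.
split => [x|j].
  by apply: derivableP; have [g' dg _] := h 0%N; have [] := dg x.
by have [g' _ [sg' e]] := h j; rewrite e in sg'.
Qed.

(** As a function of the translation, the second derivative of the pairing with [g] is the pairing
    with g'', which the weak equation equates to k^2 times the pairing itself. It is bounded
    together with its derivative, so [bounded_ode0] applies. *)
Lemma pairing0 (g : R -> R) s : (forall j, ndiff j g) -> csupp g -> pairing g s = 0.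
Proof.
move=> sg cg; have [g1 [dg sg1]] := ndiff_derive sg.
have [g2 [dg1 sg2]] := ndiff_derive sg1.
have cg1 := csupp_derive cg dg; have cg2 := csupp_derive cg1 dg1.
have [C1 h1] := pairing_bounded (sg 0%N) cg; have [C2 h2] := pairing_bounded (sg1 0%N) cg1.
apply: (@bounded_ode0 _ k (pairing g) (fun s => -1 * pairing g1 s) (Num.max C1 C2)) => //.
- exact: cder_pairing (sg1 0%N).
- apply: (cder_eq (cderZ (-1) (cder_pairing cg1 dg1 (sg2 0%N)))) => t.
  rewrite mulrA mulN1r opprK mul1r /pairing.
  have sh (f : R -> R) : (fun x => f (1 * x + - t)) = (fun x => f (x - t)) by apply/funext => x; rewrite mul1r.
  have dsh (f f1 : R -> R) : (forall x, is_derive x (1 : R) f (f1 x)) ->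
      forall x, is_derive x (1 : R) (fun y => f (y - t)) (f1 (x - t)).
    move=> df x; rewrite -[f1 _]mulr1.
    apply: (is_derive1_comp (f := f) (g := fun y => y - t) (df (x - t))).
    have -> : (fun y : R => y - t) = (fun y => 1 * y + - t) by apply/funext => y; rewrite mul1r.
    exact: is_derive_affine.
  apply: (@weak (fun x => g (x - t)) (fun x => g1 (x - t)) (fun x => g2 (x - t))).
  + by move=> j; rewrite -sh; exact: ndiff_affine.
  + exact: csupp_shift.
- by move=> t; rewrite le_max h1.
- by move=> t; rewrite mulN1r cmodN le_max h2 orbT.
Qed.

End weak_solution.

(** Bumps are admissible profiles, so all pairings of [u] with bumps times characters vanish; the
    index changes sign because the inner product conjugates the character. *)
Lemma weak_unique (kap : 'rV[int]_n -> R[i]) (u : Cyl R n -> R[i]) :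
  (forall m, 0 < Re (kap m)) -> L2 cyl u ->
  (forall m (g g1 g2 : R -> R), (forall j, ndiff j g) -> csupp g ->
    (forall x, is_derive x (1 : R) g (g1 x)) -> (forall x, is_derive x (1 : R) g1 (g2 x)) ->
    cintegral cyl (fun x => u x * ((g2 x.1)%:C * character m x.2)) =
    kap m ^+ 2 * cintegral cyl (fun x => u x * ((g x.1)%:C * character m x.2))) ->
  ae_eq cyl setT u (fun=> 0).
Proof.
move=> k0 Lu weak; apply: separating_cylinder => // -[[[N a] b] m].
have sb : csupp (bump N.+1%:R a b).
  exists (Num.max `|a| `|b|) => x; rewrite gt_max => /andP[xa xb]; apply: bump_out => //.
  apply/negP => /andP[ax bx]; have [x0|x0] := leP 0 x.
    by move: xb; rewrite (ger0_norm x0) => xb; have := ler_norm b; lra.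
  by move: xa; rewrite (ltr0_norm x0) => xa; have := ler_norm (- a); rewrite normrN; lra.
have := @pairing0 u (kap (- m)) (- m) (k0 _) Lu (weak _) (bump N.+1%:R a b) 0 (fun j => ndiff_bump j _ _ _) sb.
move=> <-; apply: eq_cintegral => x /=.
by rewrite cconjM conj_character /bumps conjR subr0 mulrC.
Qed.

End uniqueness.

(** * Integration by parts on the torus *)

Section torus_coordinates.
Context {R : realType}.
Local Notation leb := (@lebesgue_measure R).

(** Translation of one coordinate without reduction modulo 2 pi; periodicity enters as a hypothesis
    on the functions. *)
Definition upd n (y : Omega R n) (i : 'I_n) (s : R) : Omega R n :=
  [tuple tnth y l + (if l == i then s else 0) | l < n].

Lemma upd0_cons n (t s : R) (y : Omega R n) :
  upd (cons_pair (t, y)) ord0 s = cons_pair (t + s, y).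
Proof.
apply: eq_from_tnth => l; rewrite tnth_mktuple; case: (unliftP ord0 l) => [l'|] ->.
  by rewrite !tnthS addr0.
by rewrite eqxx !tnth0.
Qed.

Lemma updS_cons n (t s : R) (y : Omega R n) (i : 'I_n) :
  upd (cons_pair (t, y)) (lift ord0 i) s = cons_pair (t, upd y i s).
Proof.
apply: eq_from_tnth => l; rewrite tnth_mktuple; case: (unliftP ord0 l) => [l'|] ->.
  by rewrite !tnthS tnth_mktuple (inj_eq lift_inj).
by rewrite !tnth0 /= addr0.
Qed.

Lemma vec_upd n (x1 s : R) (y : Omega R n) (i : 'I_n) :
  vec (x1, upd y i s) = s *: (0, delta_mx 0 i) + vec (x1, y).
Proof.
rewrite /vec /=; congr (_, _).
  by apply/esym; rewrite -[RHS]add0r; congr (_ + _); exact: mulr0.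
apply/rowP => l; rewrite !mxE tnth_mktuple eqxx /= addrC; congr (_ + _).
by case: eqP => _; rewrite ?mulr1 ?mulr0.
Qed.

Lemma circle_FTC (F f : R -> R[i]) : cder F f -> ccont f -> F (2 * pi) = F 0 ->
  cintegral circle f = 0.
Proof.
move=> dF [c1 c2] per.
have p0 : 0 < 2 * pi :> R by rewrite mulr_gt0 ?pi_gt0.
have part (G g : R -> R) : (forall x, is_derive x (1 : R) G (g x)) -> continuous g ->
    G (2 * pi) = G 0 -> Rintegral circle setT g = 0.
  move=> dG cg e; have jg : leb.-integrable I2pi (fun t => (g t)%:E).
    exact: continuous_integrable_itv.
  have mg : measurable_fun setT (fun t : measurableTypeR R => (g t)%:E).
    by apply/measurable_EFinP; exact: continuous_measurable_fun.
  have jc := (circle_integrable mg).2 jg.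
  by rewrite /Rintegral circle_integral// (FTC_integral p0 dG cg) /= e subrr.
apply: complex_ext; rewrite /cintegral/=.
- by apply: (part (fun t => Re (F t))) => // [x|]; [have [] := dF x|rewrite per].
- by apply: (part (fun t => Im (F t))) => // [x|]; [have [] := dF x|rewrite per].
Qed.

(** Integrating in coordinate [i] leaves the increment of [F] over one period, which is 0. The
    induction peels off the coordinates before it. *)
Lemma torus_FTC n (i : 'I_n) (F f : Omega R n -> R[i]) (C : R) :
  cmeasurable_fun f -> (forall y, cmod (f y) <= C) ->
  (forall y, cder (fun s => F (upd y i s)) (fun s => f (upd y i s))) ->
  (forall y, ccont (fun s => f (upd y i s))) ->
  (forall y, F (upd y i (2 * pi)) = F y) ->
  cintegral (torus n) f = 0.
Proof.
elim: n i F f => [[//]|n IH] i F f mf fC dF cf per.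
have jf : cintegrable (torus n.+1) f.
  have := cintegrable_inner (L2_character (0 : 'rV[int]_n.+1)) (@L2_bounded _ _ _ (torus n.+1) f C mf fC).
  by under eq_fun do rewrite character0 conjC1 mul1r.
have jc := (torusS_cintegrable mf).1 jf.
rewrite (torusS_cintegral jf).
have mp (t : R) : measurable_fun setT (fun y : Omega R n => cons_pair (t, y)).
  by apply: measurableT_comp; [exact: measurable_cons_pair|exact: measurable_pair1].
case: (unliftP ord0 i) dF cf per => [i'|] -> dF cf per.
- rewrite (cintegral_fubini1 jc).2.
  transitivity (cintegral circle (fun _ : measurableTypeR R => 0 : R[i])); last exact: cintegral0.
  apply: eq_cintegral => t.
  apply: (IH i' (fun y => F (cons_pair (t, y)))) => [|y|y|y|y].
  + exact: cmeas_comp mf (mp t).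
  + exact: fC.
  + have := dF (cons_pair (t, y)).
    have -> : (fun s => F (upd (cons_pair (t, y)) (lift ord0 i') s)) =
      (fun s => F (cons_pair (t, upd y i' s))) by apply/funext => s; rewrite updS_cons.
    by have -> : (fun s => f (upd (cons_pair (t, y)) (lift ord0 i') s)) =
      (fun s => f (cons_pair (t, upd y i' s))) by apply/funext => s; rewrite updS_cons.
  + have := cf (cons_pair (t, y)).
    by have -> : (fun s => f (upd (cons_pair (t, y)) (lift ord0 i') s)) =
      (fun s => f (cons_pair (t, upd y i' s))) by apply/funext => s; rewrite updS_cons.
  + by have := per (cons_pair (t, y)); rewrite updS_cons.
- rewrite (cintegral_fubini2 jc).2.
  transitivity (cintegral (torus n) (fun _ : Omega R n => 0 : R[i])); last exact: cintegral0.
  apply: eq_cintegral => y.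
  have e (G : Omega R n.+1 -> R[i]) : (fun s => G (upd (cons_pair (0, y)) ord0 s)) =
      (fun s => G (cons_pair (s, y))) by apply/funext => s; rewrite upd0_cons add0r.
  apply: (@circle_FTC (fun s => F (cons_pair (s, y)))).
  + by have := dF (cons_pair (0, y)); rewrite !e.
  + by have := cf (cons_pair (0, y)); rewrite e.
  + by have := per (cons_pair (0, y)); rewrite upd0_cons add0r.
Qed.

End torus_coordinates.

(** * Boundedness and measurability of test functions *)

Section test_functions.
Context {R : realType} (n : nat).
Local Notation E := (R * 'rV[R]_n)%type.
Local Notation leb := (@lebesgue_measure R).
Local Notation cyl := (cylm n : {sigma_finite_measure set (Cyl R n) -> \bar R}).
Implicit Types phi : E -> R.

Lemma test_derive phi v : test_function phi -> test_function ('D_v phi).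
Proof.
move=> [sp per [M phi0]]; split.
- by move=> vs; have := sp (rcons vs v); rewrite -cats1 foldr_cat.
- move=> i p; rewrite /derive.
  have e (q : E) : phi (q.1, q.2 + (2 * pi) *: delta_mx 0 i) = phi q := per i q.
  set g1 := fun h => h^-1 *: _; set g2 := fun h => h^-1 *: _; suff -> : g1 = g2 by [].
  apply/funext => h; rewrite /g1 /g2 /=; congr (_ *: (_ - _)); last exact: e.
  by rewrite -[RHS](e (h *: v + p)) /=; congr (phi (_, _)); rewrite addrA.
- exists M => p Mp; have := (sp [::]).2 p v => /= d.
  have h : \forall q \near p, (0 : R) = phi q.
    have : \forall q \near p, M < `|q.1|.
      have cn : continuous (fun q : E => `|q.1|) by move=> q; apply: cvg_norm; exact: cvg_fst.
      by have /cvgr_gt := cn p; apply.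
    by apply: filterS => q /phi0.
  have h' : \forall q \near p, phi q = (fun _ : E => 0 : R) q by apply: filterS h => q ->.
  by rewrite (near_eq_derive v h') derive_cst.
Qed.

Lemma test_periodic_int phi (k : 'rV[int]_n) p : test_function phi ->
  phi (p.1, p.2 + (2 * pi) *: (\row_i (k 0 i)%:~R)) = phi p.
Proof.
move=> [_ per _].
have nat1 i (l : nat) q : phi (q.1, q.2 + (2 * pi * l%:R) *: delta_mx 0 i) = phi q.
  elim: l => [|l IH]; first by rewrite mulr0 scale0r addr0; case: q.
  rewrite (_ : 2 * pi * l.+1%:R = 2 * pi * l%:R + 2 * pi); last by rewrite -[l.+1%:R]natr1 mulrDr mulr1.
  rewrite scalerDl addrA -[RHS]IH.
  exact: (per i (q.1, q.2 + (2 * pi * l%:R) *: delta_mx 0 i)).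
have int1 i (l : int) q : phi (q.1, q.2 + (2 * pi * l%:~R) *: delta_mx 0 i) = phi q.
  case: l => l; first exact: nat1.
  rewrite NegzE rmorphN mulrN scaleNr.
  rewrite -[LHS](nat1 i l.+1) /= subrK; by case: q.
have -> : \row_i (k 0 i)%:~R = \sum_(i <- enum 'I_n) (k 0 i)%:~R *: delta_mx 0 i :> 'rV[R]_n.
  rewrite big_enum /=; apply/rowP => j; rewrite mxE summxE (bigD1 j)//= !mxE !eqxx mulr1 big1 ?addr0// => i ij.
  by rewrite !mxE [j == i]eq_sym (negbTE ij) andbF mulr0.
elim: (enum _) p => [|i s IH] p; first by rewrite big_nil scaler0 addr0; case: p.
rewrite big_cons scalerDr addrA -[RHS](int1 i (k 0 i)) scalerA.
exact: (IH (p.1, p.2 + (2 * pi * (k 0 i)%:~R) *: delta_mx 0 i)).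
Qed.

(** Periodicity moves any point of the support band into a compact period cell, where continuity
    gives the bound. *)
Lemma test_bounded phi : test_function phi -> exists (C M : R), 0 <= C /\
  forall p, `|phi p| <= C * \1_(`[- M, M]%classic : set R) p.1.
Proof.
move=> tp; have [sp per [M phi0]] := tp; have [cp _] := sp [::].
pose A : set E := `[- `|M|, `|M|]%classic `*` [set v : 'rV[R]_n | forall i, `[0, 2 * pi]%classic (v ord0 i)].
have cA : compact A.
  apply: compact_setX; first exact: segment_compact.
  exact: (rV_compact (A := fun=> `[0, 2 * pi]%classic) (fun i => @segment_compact R _ _)).
have cim : compact (phi @` A) by apply: continuous_compact => //; apply: continuous_subspaceT; exact: cp.
have [N [_ /(_ (N + 1))]] := compact_bounded cim.
rewrite ltrDl ltr01 => /(_ isT) hN.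
exists `|N + 1|, `|M|; split => // p.
rewrite indicE; case: (boolP (p.1 \in _)) => [pM|]; last first.
  move=> /negP h; rewrite phi0 ?normr0 ?mulr0// ltNge; apply/negP => pM; apply: h.
  by rewrite inE/= in_itv/= -ler_norml; exact: le_trans pM (ler_norm M).
rewrite mulr1; apply: le_trans (ler_norm _).
have p0 : 0 < 2 * pi :> R by rewrite mulr_gt0 ?pi_gt0.
(* Number of periods by which each coordinate is moved to land in [0, 2 pi]. *)
pose k : 'rV[int]_n := \row_i (- Num.floor (p.2 0 i / (2 * pi))).
rewrite -(test_periodic_int k p tp); apply: hN; exists (p.1, p.2 + (2 * pi) *: \row_i (k 0 i)%:~R) => //.
split => [|i] /=; first by move: pM; rewrite inE.
rewrite !mxE in_itv/= rmorphN mulrN; set q := p.2 ord0 i.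
have /andP[f1 f2] := floor_itv (q / (2 * pi)).
rewrite subr_ge0 mulrC -ler_pdivlMr// f1/=.
move: f2; rewrite rmorphD/= ltr_pdivrMr// mulrDl mul1r => /ltW.
by rewrite lerBlDl.
Qed.

(** Rounding to a grid of mesh 1/(k+1) gives functions with countably many values on measurable
    cells; by continuity they converge pointwise to the given one. *)
Lemma measurable_vec (psi : E -> R) : continuous psi ->
  measurable_fun setT (fun x : Cyl R n => psi (vec x)).
Proof.
move=> cpsi.
pose disc k (x : Cyl R n) : int * 'rV[int]_n :=
  (Num.floor (k.+1%:R * x.1), \row_i Num.floor (k.+1%:R * tnth x.2 i)).
pose emb k (c : int * 'rV[int]_n) : E := (c.1%:~R / k.+1%:R, \row_i ((c.2 0 i)%:~R / k.+1%:R)).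
have mfl k (m : int) (g : Cyl R n -> R) : measurable_fun setT g ->
    measurable [set x : Cyl R n | Num.floor (k.+1%:R * g x) = m].
  move=> mg; pose I : set (measurableTypeR R) := `[(m%:~R / k.+1%:R : R), ((m + 1)%:~R / k.+1%:R : R)[%classic.
  have -> : [set x : Cyl R n | Num.floor (k.+1%:R * g x) = m] = g @^-1` I.
    apply/seteqP; split => x /=; rewrite /I /= in_itv/= ler_pdivrMr// ltr_pdivlMr// mulrC.
      by move=> <-; exact: floor_itv.
    exact: floor_def.
  by rewrite -[X in measurable X]setTI; apply: mg => //; exact: measurable_itv.
have mdisc k c : measurable [set x : Cyl R n | disc k x = c].
  have -> : [set x : Cyl R n | disc k x = c] =
      [set x | Num.floor (k.+1%:R * x.1) = c.1] `&`
      \bigcap_(i in [set: 'I_n]) [set x | Num.floor (k.+1%:R * tnth x.2 i) = c.2 0 i].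
    apply/seteqP; split => x /=.
      by move=> <-; split => //= i _; rewrite mxE.
    case: c => c1 c2 [/= e1 e2]; congr (_, _) => //.
    by apply/rowP => i; rewrite mxE; exact: e2.
  apply: measurableI; first exact: mfl measurable_fst.
  apply: fin_bigcap_measurable => // i _; apply: mfl.
  by apply: (measurableT_comp (f := fun y : Omega R n => tnth y i)); [exact: measurable_tnth|exact: measurable_snd].
apply: (@measurable_fun_cvg _ _ _ _ (fun k x => psi (emb k (disc k x)))) => [k|x _].
  move=> _ B mB; rewrite setTI.
  have -> : (fun x => psi (emb k (disc k x))) @^-1` B =
      \bigcup_(N in [set N | if unpickle N is Some c then B (psi (emb k c)) else False])
        [set x | unpickle N = Some (disc k x)].
    apply/seteqP; split => x /=.
      by move=> Bx; exists (pickle (disc k x)); rewrite /= pickleK.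
    by move=> [N /= BN e]; rewrite e in BN.
  apply: bigcup_measurable => N _; case e : (unpickle N) => [c|]; last first.
    by rewrite (_ : [set _ | _] = set0)//; apply/seteqP; split.
  rewrite (_ : [set _ | _] = [set x | disc k x = c])//.
  by apply/seteqP; split => y /=; [case => <-|move=> ->].
apply/cvgrPdist_lt => eps e0.
have /cvgrPdist_lt/(_ _ e0) := cpsi (vec x).
rewrite near_simpl => /nbhs_ballP[del /= d0 hd].
near=> k; apply: hd.
have kd : k.+1%:R^-1 < del.
  by near: k; exact: (near_infty_natSinv_lt (PosNum d0)).
have fl (t : R) : `|t - (Num.floor (k.+1%:R * t))%:~R / k.+1%:R| < del.
  have /andP[f1 f2] := floor_itv (k.+1%:R * t).
  have k0 : 0 < k.+1%:R :> R by [].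
  rewrite ger0_norm; last by rewrite subr_ge0 ler_pdivrMr// [t * _]mulrC.
  apply: le_lt_trans kd; rewrite lerBlDr -[X in _ <= X + _]mul1r -mulrDl ler_pdivlMr// [t * _]mulrC [1 + _]addrC.
  by move: f2; rewrite rmorphD/= => /ltW.
split; first exact: fl.
by split => // i j; rewrite ord1 !mxE; exact: fl.
Unshelve. all: by end_near. Qed.

Lemma L2_band_le (F : Cyl R n -> R[i]) (C M : R) : cmeasurable_fun F ->
  (forall x, cmod (F x) <= C * \1_(`[- M, M]%classic : set R) x.1) ->
  L2 cyl F /\ cintegrable cyl F.
Proof.
move=> mF FC; have LF : L2 cyl F.
  apply: (L2_le (h := fun x => C ^+ 2 * cmod ((\1_(`[- M, M]%classic : set (measurableTypeR R)) x.1 : R)%:C : R[i]) ^+ 2)) => //.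
    by apply: integrable_scale; exact: L2_int (L2_band n M).
  move=> x; rewrite cmodR -exprMn ger0_norm ?indicE ?ler0n// ler_pXn2r ?nnegrE ?cmod_ge0//.
    exact: le_trans (cmod_ge0 _) (FC x).
split => //; have := cintegrable_inner (L2_band n M) LF.
have -> // : (fun x : Cyl R n => ((\1_(`[- M, M]%classic : set (measurableTypeR R)) x.1 : R)%:C)^* * F x) = F.
apply/funext => x; rewrite conjR; have := FC x; rewrite indicE; case: (x.1 \in _) => /=.
  by rewrite mul1r.
rewrite mulr0 mul0r => h; apply/esym/eqP; by rewrite -cmod_eq0 eq_le h cmod_ge0.
Qed.

End test_functions.

(** * Green's identity on the line *)

Section green_line.
Context {R : realType}.
Local Notation leb := (@lebesgue_measure R).

Lemma cintegrable_csupp (f : measurableTypeR R -> R[i]) (a b : R) : ccont (f : R -> R[i]) ->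
  (forall x : R, ~ (a <= x <= b) -> f x = 0) -> cintegrable leb f.
Proof.
move=> [c1 c2] f0.
have part (g : measurableTypeR R -> R) : continuous (g : R -> R) -> (forall x : R, ~ (a <= x <= b) -> g x = 0) ->
    leb.-integrable setT (fun x => (g x)%:E).
  move=> cg g0; have mI : measurable (`[a, b]%classic : set (measurableTypeR R)) by exact: measurable_itv.
  have := continuous_integrable_itv a b cg; rewrite (integrable_mkcond _ mI).
  apply: eq_integrable => // x _; rewrite patchE; case: ifPn => // /negP h.
  by rewrite g0// => h'; apply: h; rewrite inE/= in_itv.
split; [apply: (part (fun x => Re (f x)))|apply: (part (fun x => Im (f x)))] => // x /f0 -> //.
Qed.

(** On each side of [c] the integrand has an explicit antiderivative, an exponential times k psi -
    psi' or k psi + psi'. The psi' terms cancel at [c] and the two k psi terms add up to psi(c). *)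
Lemma green_line (k : R[i]) (psi psi1 psi2 : R -> R) (c : R) : 0 < Re k ->
  (forall x, is_derive x (1 : R) psi (psi1 x)) -> (forall x, is_derive x (1 : R) psi1 (psi2 x)) ->
  continuous psi2 -> csupp psi ->
  cintegrable leb (fun t => Gk k (t - c) * (k ^+ 2 * (psi t)%:C - (psi2 t)%:C)) /\
  cintegral leb (fun t => Gk k (t - c) * (k ^+ 2 * (psi t)%:C - (psi2 t)%:C)) = (psi c)%:C.
Proof.
move=> k0 d0 d1 c2 s0; have s1 := csupp_derive s0 d0; have s2 := csupp_derive s1 d1.
have kn : k != 0 by apply/eqP => h; move: k0; rewrite h ltxx.
have [M0 h0] := s0; have [M1 h1] := s1; have [M2 h2] := s2.
(* One interval containing [c] and the supports of psi, psi' and psi''. *)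
pose B := `|M0| + `|M1| + `|M2| + `|c| + 1.
have big x : ~ (- B <= x <= B) -> [/\ psi x = 0, psi1 x = 0 & psi2 x = 0].
  move=> /negP; rewrite -ler_norml -ltNge => xB.
  have := ler_norm M0; have := ler_norm M1; have := ler_norm M2.
  have := normr_ge0 M0; have := normr_ge0 M1; have := normr_ge0 M2; have := normr_ge0 c.
  by move=> *; split; [apply: h0|apply: h1|apply: h2]; apply: le_lt_trans xB; rewrite /B; lra.
pose f t := Gk k (t - c) * (k ^+ 2 * (psi t)%:C - (psi2 t)%:C).
have f0 x : ~ (- B <= x <= B) -> f x = 0.
  by move=> /big[e0 _ e2]; rewrite /f e0 e2 mulr0 subr0 mulr0.
have cR (g : R -> R) : continuous g -> ccont (fun t => (g t)%:C) by exact: ccontR.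
have c0 := is_derive_continuous d0; have c1 := is_derive_continuous d1.
have cq : ccont (fun t => k ^+ 2 * (psi t)%:C - (psi2 t)%:C).
  have := ccontD (ccontM (ccont_cst (k ^+ 2)) (cR _ c0)) (ccontM (ccont_cst (-1)) (cR _ c2)).
  by under eq_fun do rewrite mulN1r.
have cf : ccont f by apply: ccontM => //; exact: ccont_Gk.
split; first exact: (cintegrable_csupp cf f0).
have cB : - B < c /\ c < B.
  have := normr_ge0 M0; have := normr_ge0 M1; have := normr_ge0 M2.
  have := ler_norm c; have := ler_norm (- c); rewrite normrN /B; lra.
have [Bc cB'] := cB.
have ce (l : R[i]) := cder_ccont (cder_exp l c).
pose F1 (t : R) := (2 * k)^-1 * (cexp (k * (t - c)%:C) * (k * (psi t)%:C + -1 * (psi1 t)%:C)).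
pose F2 (t : R) := - (2 * k)^-1 * (cexp (- k * (t - c)%:C) * (k * (psi t)%:C + (psi1 t)%:C)).
pose f1 (t : R) := (2 * k)^-1 * (cexp (k * (t - c)%:C) * (k ^+ 2 * (psi t)%:C - (psi2 t)%:C)).
pose f2 (t : R) := (2 * k)^-1 * (cexp (- k * (t - c)%:C) * (k ^+ 2 * (psi t)%:C - (psi2 t)%:C)).
have dF1 : cder F1 f1.
  have h := cderZ (2 * k)^-1 (cderM (cder_exp k c) (cderD (cderZ k (cderR d0)) (cderZ (-1) (cderR d1)))).
  by apply: (cder_eq h) => t; rewrite /f1; ring.
have dF2 : cder F2 f2.
  have h := cderZ (- (2 * k)^-1) (cderM (cder_exp (- k) c) (cderD (cderZ k (cderR d0)) (cderR d1))).
  by apply: (cder_eq h) => t; rewrite /f2; ring.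
have cf1 : ccont f1 by apply: ccontM; [exact: ccont_cst|apply: ccontM => //; exact: ce].
have cf2 : ccont f2 by apply: ccontM; [exact: ccont_cst|apply: ccontM => //; exact: ce].
have e1 x : x <= c -> f x = f1 x.
  move=> xc; rewrite /f /f1 /Gk ler0_norm ?subr_le0// rmorphN mulrNN; ring.
have e2 x : c <= x -> f x = f2 x.
  move=> xc; rewrite /f /f2 /Gk ger0_norm ?subr_ge0//; ring.
(* The endpoints are moved strictly outside the supports, so that the antiderivatives vanish
   there. *)
have f0' x : ~ (- (B + 1) <= x <= B + 1) -> f x = 0.
  by move=> h; apply: f0 => /andP[h1' h2']; apply: h; apply/andP; split; lra.
have Bc1 : - (B + 1) < c by lra.
have cB1 : c < B + 1 by lra.
rewrite (cFTC_split Bc1 cB1 cf cf1 cf2 f0' e1 e2 dF1 dF2).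
have [z0 z1 _] : [/\ psi (- (B + 1)) = 0, psi1 (- (B + 1)) = 0 & psi2 (- (B + 1)) = 0].
  by apply: big => /andP[]; lra.
have [y0 y1 _] : [/\ psi (B + 1) = 0, psi1 (B + 1) = 0 & psi2 (B + 1) = 0].
  by apply: big => /andP[]; lra.
have c00 : ((0 : R)%:C : R[i]) = 0 by [].
rewrite /F1 /F2 z0 z1 y0 y1 subrr !c00 !(mulr0, addr0) cexp0.
by field.
Qed.

End green_line.

(** * Green's identity for one mode on the cylinder *)

Section green_cylinder.
Context {R : realType} (n : nat).
Local Notation E := (R * 'rV[R]_n)%type.
Local Notation leb := (@lebesgue_measure R).
Local Notation cyl := (cylm n : {sigma_finite_measure set (Cyl R n) -> \bar R}).
Implicit Types phi : E -> R.

Lemma cmeas_test phi : continuous phi -> cmeasurable_fun (fun x : Cyl R n => (phi (vec x))%:C).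
Proof. by move=> cp; apply: cmeasR; exact: measurable_vec. Qed.

Lemma test_continuous phi : test_function phi -> continuous phi.
Proof. by move=> [sp _ _]; have [] := sp [::]. Qed.

Lemma test_derivable phi p v : test_function phi -> derivable phi p v.
Proof. by move=> [sp _ _]; have [_] := sp [::]; exact. Qed.

Lemma test_cintegrable phi (K : Cyl R n -> R[i]) B : test_function phi ->
  cmeasurable_fun K -> (forall x, cmod (K x) <= B) ->
  L2 cyl (fun x => K x * (phi (vec x))%:C) /\ cintegrable cyl (fun x => K x * (phi (vec x))%:C).
Proof.
move=> tp mK KB; have [C [M [C0 pC]]] := test_bounded tp.
have B0 : 0 <= B by exact: le_trans (cmod_ge0 _) (KB (0, [tuple 0 | i < n])).
apply: (@L2_band_le _ _ _ (B * C) M).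
  by apply: cmeasM => //; exact/cmeas_test/test_continuous.
move=> x; by rewrite cmodM cmodR -mulrA; apply: ler_pM => //; exact: cmod_ge0.
Qed.

Lemma is_derive_section phi (v p : E) (s : R) : derivable phi (s *: v + p) v ->
  is_derive s (1 : R) (fun t : R => phi (t *: v + p)) ('D_v phi (s *: v + p)).
Proof.
move=> dp; have e : (fun h : R => h^-1 *: (((fun t : R => phi (t *: v + p)) \o shift s) (h *: (1 : R)) - phi (s *: v + p))) =
    (fun h => h^-1 *: ((phi \o shift (s *: v + p)) (h *: v) - phi (s *: v + p))).
  by apply/funext => h /=; rewrite [h *: 1]mulr1 scalerDl addrA.
split; first by rewrite /derivable e.
by rewrite /derive e.
Qed.

Lemma is_derive_line1 phi (w : 'rV[R]_n) (s : R) : test_function phi ->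
  is_derive s (1 : R) (fun t : R => phi (t, w)) ('D_((1 : R), (0 : 'rV[R]_n)) phi (s, w)).
Proof.
move=> tp.
have e (t : R) : t *: ((1 : R), (0 : 'rV[R]_n)) + (0, w) = (t, w).
  by congr (_, _) => /=; [rewrite addr0; exact: mulr1|rewrite scaler0 add0r].
have := @is_derive_section phi (1, 0) (0, w) s (@test_derivable phi _ _ tp).
by rewrite e; under eq_fun do rewrite e.
Qed.

Lemma is_derive_upd phi (x1 : R) (y : Omega R n) i (s : R) : test_function phi ->
  is_derive s (1 : R) (fun t : R => phi (vec (x1, upd y i t)))
    ('D_((0 : R), delta_mx 0 i) phi (vec (x1, upd y i s))).
Proof.
move=> tp; rewrite vec_upd.
have -> : (fun t : R => phi (vec (x1, upd y i t))) =
    (fun t => phi (t *: ((0 : R), delta_mx 0 i) + vec (x1, y))) by apply/funext => t; rewrite vec_upd.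
exact: is_derive_section (@test_derivable phi _ _ tp).
Qed.

Lemma character_upd (j : 'rV[int]_n) (y : Omega R n) i (s : R) :
  character j (upd y i s) = character j y * cexp ((0 +i* (j 0 i)%:~R) * (s - 0)%:C).
Proof.
have -> : cexp ((0 +i* (j 0 i)%:~R) * (s - 0)%:C) = cis ((j 0 i)%:~R * s) :> R[i].
  by congr cexp; apply: complex_ext => /=; rewrite subr0; ring.
rewrite !characterE -cisD; congr cis.
rewrite (bigD1 i)//= [in RHS](bigD1 i)//= tnth_mktuple eqxx mulrDr addrAC; congr (_ + _ + _).
by apply: eq_bigr => l li; rewrite tnth_mktuple (negbTE li) addr0.
Qed.

(** With l = i j_i, the integrand is the derivative in y_i of the periodic function a e^{ij.y} (d_i
    phi - l phi), since -l^2 = j_i^2. *)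
Lemma green_torus (j : 'rV[int]_n) phi (a : R[i]) (x1 : R) i : test_function phi ->
  cintegral (torus n) (fun y : Omega R n => character j y * a *
    (('D_((0 : R), delta_mx 0 i) ('D_((0 : R), delta_mx 0 i) phi) (vec (x1, y)))%:C +
     (j 0 i)%:~R ^+ 2 * (phi (vec (x1, y)))%:C)) = 0.
Proof.
move=> tp; set v := (0, delta_mx 0 i); have tp1 := test_derive v tp; have tp2 := test_derive v tp1.
have [C0 [M0 [C00 h0]]] := test_bounded tp; have [C2 [M2 [C20 h2]]] := test_bounded tp2.
pose l : R[i] := 0 +i* (j 0 i)%:~R.
have l2 : l ^+ 2 = - ((j 0 i)%:~R ^+ 2).
  have -> : ((j 0 i)%:~R : R[i]) = ((j 0 i)%:~R : R)%:C by rewrite rmorph_int.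
  by rewrite !expr2; apply: complex_ext => /=; ring.
pose q : R := cmod ((j 0 i)%:~R ^+ 2 : R[i]).
apply: (@torus_FTC R n i (fun y => character j y * a *
   (('D_v phi (vec (x1, y)))%:C - l * (phi (vec (x1, y)))%:C)) _
   (cmod a * (C2 + q * C0))).
- have mp : measurable_fun setT (fun y : Omega R n => (x1, y) : Cyl R n) by exact: measurable_pair1.
  apply: cmeasM; first by apply: cmeasM; [exact: cmeas_character|exact: cmeas_cst].
  apply: cmeasD; first exact: cmeas_comp (cmeas_test (test_continuous tp2)) mp.
  by apply: cmeasM; [exact: cmeas_cst|exact: cmeas_comp (cmeas_test (test_continuous tp)) mp].
- move=> y; rewrite !cmodM cmod_character mul1r ler_wpM2l ?cmod_ge0//.
  apply: le_trans (cmodD _ _) _; rewrite [cmod (_ * _)]cmodM -/q !cmodR; apply: lerD.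
    by apply: le_trans (h2 _) _; rewrite ler_piMr// indicE lern1; case: (_ \in _).
  apply: ler_wpM2l; first exact: cmod_ge0.
  by apply: le_trans (h0 _) _; rewrite ler_piMr// indicE lern1; case: (_ \in _).
- move=> y.
  have dc : cder (fun s => character j (upd y i s) * a) (fun s => l * (character j (upd y i s) * a)).
    have := cderZ (character j y * a) (cder_exp l 0).
    have e : (fun t : R => character j y * a * cexp (l * (t - 0)%:C)) =
        (fun s => character j (upd y i s) * a) by apply/funext => s; rewrite character_upd; ring.
    rewrite e => h; apply: (cder_eq h) => s; rewrite character_upd -/l; ring.
  have d1 := cderR (fun s => is_derive_upd x1 y i s tp1).
  have d0 := cderR (fun s => is_derive_upd x1 y i s tp).
  have := cderM dc (cderD d1 (cderZ (- l) d0)).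
  have -> : (fun t : R => character j (upd y i t) * a * (('D_v phi (vec (x1, upd y i t)))%:C +
      - l * (phi (vec (x1, upd y i t)))%:C)) = (fun t => character j (upd y i t) * a *
      (('D_v phi (vec (x1, upd y i t)))%:C - l * (phi (vec (x1, upd y i t)))%:C)).
    by apply/funext => t; rewrite mulNr.
  move=> h; apply: (cder_eq h) => s /=.
  have -> : ((j 0 i)%:~R ^+ 2 : R[i]) = - l ^+ 2 by rewrite l2 opprK.
  ring.
- move=> y.
  have cd (psi : E -> R) : test_function psi -> ccont (fun s => (psi (vec (x1, upd y i s)))%:C).
    by move=> tpsi; exact: cder_ccont (cderR (fun s => is_derive_upd x1 y i s tpsi)).
  have cc : ccont (fun s => character j (upd y i s) * a).
    have := ccontM (ccont_cst (character j y * a)) (cder_ccont (cder_exp l 0)).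
    by have -> : (fun t : R => character j y * a * cexp (l * (t - 0)%:C)) =
        (fun s => character j (upd y i s) * a) by apply/funext => s; rewrite character_upd; ring.
  exact: (ccontM cc (ccontD (cd _ tp2) (ccontM (ccont_cst _) (cd _ tp)))).
- move=> y; have per (psi : E -> R) : test_function psi -> psi (vec (x1, upd y i (2 * pi))) = psi (vec (x1, y)).
    move=> [_ pp _]; rewrite -[RHS](pp i) vec_upd; congr psi; congr (_, _) => /=.
      by rewrite (_ : _ *: (0 : R) = 0) ?add0r//; exact: mulr0.
    by rewrite addrC.
  rewrite (per _ tp) (per _ tp1) character_upd; congr (_ * _ * _).
  have -> : cexp ((0 +i* (j 0 i)%:~R) * (2 * pi - 0)%:C) = cis ((j 0 i)%:~R * (2 * pi)) :> R[i].
    by congr cexp; apply: complex_ext => /=; rewrite subr0; ring.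
  by rewrite cis_int2pi mulr1.
Qed.

Variables (Vinf : R) (z : R[i]) (j : 'rV[int]_n) (k : R[i]).
Hypothesis k0 : 0 < Re k.
Hypothesis k2 : k ^+ 2 = (Vinf + znorm j ^+ 2)%:C - z.

(** The function (-Delta + Vinf - z) phi on the cylinder. *)
Definition weak_op phi (x : Cyl R n) : R[i] :=
  (- laplacian phi (vec x) + Vinf * phi (vec x))%:C - z * (phi (vec x))%:C.

(** Since k^2 = Vinf + |j|^2 - z, the operator splits into k^2 - d^2/dx_1^2, handled by
    [green_line], minus the terms d_i^2 + j_i^2, which integrate to 0 over the torus by
    [green_torus]. *)
Lemma green_identity phi c : test_function phi ->
  cintegral cyl (fun x => character j x.2 * Gk k (x.1 - c) * weak_op phi x) =
  cintegral (torus n) (fun y => character j y * (phi (vec (c, y)))%:C).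
Proof.
move=> tp.
pose D1 := 'D_((1 : R), (0 : 'rV[R]_n)) ('D_((1 : R), (0 : 'rV[R]_n)) phi).
pose D2 i := 'D_((0 : R), delta_mx 0 i) ('D_((0 : R), delta_mx 0 i) phi).
have t1 : test_function D1 by apply: test_derive; exact: test_derive.
have t2 i : test_function (D2 i) by apply: test_derive; exact: test_derive.
pose K (x : Cyl R n) := character j x.2 * Gk k (x.1 - c).
have mG : cmeasurable_fun (fun x : Cyl R n => Gk k (x.1 - c)).
  apply: (cmeas_comp (cmeas_Gk k)); apply: measurable_funB; last exact: measurable_cst.
  exact: measurable_fst.
have mK : cmeasurable_fun K.
  by apply: cmeasM; [exact: (@cmeas_snd _ _ _ _ R _ (cmeas_character j))|exact: mG].
have KB x : cmod (K x) <= (2 * Re k)^-1 by rewrite cmodM cmod_character mul1r; exact: cmod_Gk.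
have jK psi : test_function psi -> cintegrable cyl (fun x => K x * (psi (vec x))%:C).
  by move=> tpsi; have [] := test_cintegrable tpsi mK KB.
pose F1 x := K x * (k ^+ 2 * (phi (vec x))%:C - (D1 (vec x))%:C).
pose F2 i x := character j x.2 * Gk k (x.1 - c) * ((D2 i (vec x))%:C + (j 0 i)%:~R ^+ 2 * (phi (vec x))%:C).
have j1 : cintegrable cyl F1.
  have := cintegrableB (cintegrableZ (k ^+ 2) (jK _ tp)) (jK _ t1).
  by congr cintegrable; apply/funext => x; rewrite /F1; ring.
have j2 i : cintegrable cyl (F2 i).
  have := cintegrableD (jK _ (t2 i)) (cintegrableZ ((j 0 i)%:~R ^+ 2) (jK _ tp)).
  by congr cintegrable; apply/funext => x; rewrite /F2 /K; ring.
have -> : (fun x => character j x.2 * Gk k (x.1 - c) * weak_op phi x) =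
    (fun x => F1 x - \sum_(i < n) F2 i x).
  apply/funext => x; rewrite /F1 /F2 -mulr_sumr -/(K x) -mulrBr; congr (_ * _).
  rewrite big_split -mulr_suml k2 /weak_op /laplacian rmorphD rmorphN rmorphD rmorph_sum rmorphM rmorphD /=.
  have -> : \sum_(i < n) (j 0 i)%:~R ^+ 2 = (znorm j ^+ 2)%:C :> R[i].
    by rewrite znorm2 rmorph_sum; apply: eq_bigr => i _; rewrite rmorphXn rmorph_int.
  rewrite /D1 /D2; ring.
rewrite cintegralB//; last by apply: cintegrable_sum.
rewrite cintegral_sum// big1 ?subr0; last first.
  move=> i _; have := (cintegral_fubini1 (m1 := leb) (m2 := torus n) (F := F2 i) (j2 i)).2.
  move=> e; rewrite [LHS]e.
  transitivity (cintegral leb (fun _ : measurableTypeR R => 0 : R[i])); last exact: cintegral0.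
  by apply: eq_cintegral => x1; exact: (green_torus j (Gk k (x1 - c)) x1 i tp).
have := (cintegral_fubini2 (m1 := leb) (m2 := torus n) (F := F1) j1).2.
move=> e; rewrite [LHS]e; apply: eq_cintegral => y /=.
have csp : csupp (fun t => phi (t, \row_i tnth y i)).
  by have [_ _ [M h]] := tp; exists M => t Mt; exact: h.
have [jg eg] := @green_line R k (fun t => phi (t, \row_i tnth y i)) _ _ c k0
  (fun s => is_derive_line1 _ s tp) (fun s => is_derive_line1 _ s (test_derive _ tp))
  (is_derive_continuous (fun s => is_derive_line1 _ s t1)) csp.
transitivity (character j y * cintegral leb (fun t : measurableTypeR R => Gk k (t - c) *
    (k ^+ 2 * (phi (t, \row_i tnth y i))%:C - (D1 (t, \row_i tnth y i))%:C))).
  rewrite -cintegralZ; last exact: jg.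
  by apply: eq_cintegral => t; rewrite /F1 /K mulrA.
by congr (_ * _); exact: eg.
Qed.

End green_cylinder.

(** * Finite sums of modes *)

Section green_sums.
Context {R : realType} (n : nat).
Local Notation leb := (@lebesgue_measure R).
Local Notation zvec := 'rV[int]_n.
Local Notation cyl := (cylm n : {sigma_finite_measure set (Cyl R n) -> \bar R}).
Local Notation vol := ((2 * pi) ^+ n : R).
Variable kap : zvec -> R[i].
Hypothesis kap_gt0 : forall j, 0 < Re (kap j).
Implicit Types (r : zvec -> Cyl R n -> R[i]) (s : seq zvec) (f : Cyl R n -> R[i]).

(** Common shape of the resolvent times the potential, of the Galerkin operators and of their
    difference: only the profiles [r] change. *)
Definition Tsum s r f (x : Cyl R n) : R[i] :=
  \sum_(j <- s) character j x.2 * Aop (kap j) (r j) f x.1.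

(** Bound for the squared Hilbert-Schmidt norm of mode [j], before the factor vol coming from the
    character. *)
Definition weight r j := (4 * Re (kap j) ^+ 3)^-1 * nsq cyl (r j).

Lemma weight_ge0 r j : 0 <= weight r j.
Proof.
by rewrite mulr_ge0 ?nsq_ge0// invr_ge0 mulr_ge0// exprn_ge0// ltW.
Qed.

Section fixed_family.
Variable r : zvec -> Cyl R n -> R[i].
Hypothesis Lr : forall j, L2 cyl (r j).

Lemma L2_Tsum s f : L2 cyl f -> L2 cyl (Tsum s r f).
Proof.
move=> Lf; apply: L2_sum => j _.
have := L2_tensor (L2_Aop (kap_gt0 j) (Lr j) Lf) (L2_character j).
have -> // : (fun p : Cyl R n => Aop (kap j) (r j) f p.1 * character j p.2) =
  (fun p => character j p.2 * Aop (kap j) (r j) f p.1).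
by apply/funext => p; rewrite mulrC.
Qed.

(** On each slice of fixed x_1 this is Parseval for a trigonometric polynomial: characters are
    orthogonal, of squared norm vol. *)
Lemma nsq_Tsum s f : uniq s -> L2 cyl f ->
  nsq cyl (Tsum s r f) = vol * \sum_(j <- s) nsq leb (Aop (kap j) (r j) f).
Proof.
move=> us Lf.
have := (nsq_fubini (m1 := leb) (m2 := torus n) (u := Tsum s r f) (L2_Tsum s Lf)).2.
move=> e; rewrite [LHS]e.
have jA j := L2_int (L2_Aop (kap_gt0 j) (Lr j) Lf).
have -> : \sum_(j <- s) nsq leb (Aop (kap j) (r j) f) =
    Rintegral leb setT (fun x => \sum_(j <- s) cmod (Aop (kap j) (r j) f x) ^+ 2).
  elim: (s) => [|j t IH].
    by rewrite big_nil; under eq_Rintegral do rewrite big_nil; rewrite Rintegral_cst// mul0r.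
  rewrite big_cons IH /= [X in X + _]/nsq -RintegralD//.
  - by apply: eq_Rintegral => x _; rewrite big_cons.
  - exact: jA.
  - have := integrable_sum measurableT t (P := xpredT) (fun j _ => jA j).
    by apply: eq_integrable => // x _; rewrite sumEFin.
rewrite -RintegralZl//; last first.
  have := integrable_sum measurableT s (P := xpredT) (fun j _ => jA j).
  by apply: eq_integrable => // x _; rewrite sumEFin.
apply: eq_Rintegral => x _; rewrite -nsq_character_sum//.
by apply: eq_Rintegral => y _; rewrite /Tsum; under eq_bigr do rewrite mulrC.
Qed.

Lemma nsq_Tsum_le s f : uniq s -> L2 cyl f ->
  nsq cyl (Tsum s r f) <= vol * (\sum_(j <- s) weight r j) * nsq cyl f.
Proof.
move=> us Lf; rewrite nsq_Tsum// -mulrA ler_wpM2l ?(ltW (vol_gt0 _))// mulr_suml.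
by apply: ler_sum => j _; exact: nsq_Aop.
Qed.

Lemma Tsum_lin s a f g x : L2 cyl f -> L2 cyl g ->
  Tsum s r (fun x => a * f x + g x) x = a * Tsum s r f x + Tsum s r g x.
Proof.
move=> Lf Lg; rewrite /Tsum mulr_sumr -big_split; apply: eq_bigr => j _ /=.
by rewrite Aop_lin//; ring.
Qed.

Lemma Tsum_bounded s : uniq s -> bounded_operator cyl (Tsum s r).
Proof.
move=> us; split.
- by move=> f; exact: L2_Tsum.
- by move=> a f g Lf Lg; apply: aeW => x _; exact: Tsum_lin.
- exists (Num.sqrt (vol * \sum_(j <- s) weight r j)) => f Lf.
  rewrite !L2norm_nrm//; last exact: L2_Tsum.
  rewrite -EFinM lee_fin /nrm -sqrtrM; last first.
    by rewrite mulr_ge0 ?(ltW (vol_gt0 _))// sumr_ge0// => j _; exact: weight_ge0.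
  by apply: ler_wsqrtr; exact: nsq_Tsum_le.
Qed.

Lemma nsq_Tsum_onb s (e : nat -> Cyl R n -> R[i]) N : uniq s ->
  (forall i, L2 cyl (e i)) -> (forall i j, inner cyl (e i) (e j) = (i == j)%:R) ->
  \sum_(i < N) nsq cyl (Tsum s r (e i)) <= vol * \sum_(j <- s) weight r j.
Proof.
move=> us Le oe.
rewrite (eq_bigr (fun i : 'I_N => vol * \sum_(j <- s) nsq leb (Aop (kap j) (r j) (e i)))); last first.
  by move=> i _; rewrite nsq_Tsum.
rewrite -mulr_sumr ler_wpM2l ?(ltW (vol_gt0 _))// exchange_big.
by apply: ler_sum => j _; exact: nsq_Aop_sum.
Qed.

(** The difference of two balls is a sum over a shell of modes, so its squared norm is an increment
    of the bounded monotone sequence [a]. *)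
Lemma Tsum_cauchy f S : L2 cyl f -> (forall M, \sum_(j <- zball R M) weight r j <= S) ->
  forall eps : R, 0 < eps -> exists N, forall a b, (N <= a)%N -> (N <= b)%N ->
    nrm cyl (fun x => Tsum (zball R a) r f x - Tsum (zball R b) r f x) <= eps.
Proof.
move=> Lf hS eps e0.
pose a M := vol * \sum_(j <- zball R M) nsq leb (Aop (kap j) (r j) f).
have split_zball N M : (N <= M)%N -> forall (V : zmodType) (g : zvec -> V),
    \sum_(j <- zball R M) g j - \sum_(j <- zball R N) g j =
    \sum_(j <- [seq j <- zball R M | j \notin zball R N]) g j.
  move=> NM V g; rewrite (bigID (fun j => j \in zball R N))/= big_filter addrAC.
  rewrite (_ : \sum_(j <- zball R M | j \in zball R N) g j = \sum_(j <- zball R N) g j).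
    by rewrite subrr add0r.
  rewrite -big_filter; apply: perm_big; apply: uniq_perm => [||j].
  - by apply: filter_uniq; exact: zball_uniq.
  - exact: zball_uniq.
  rewrite mem_filter; case: (boolP (j \in zball R N)) => //= jN; exact: zball_sub jN.
have aE N M : (N <= M)%N ->
    nsq cyl (fun x => Tsum (zball R M) r f x - Tsum (zball R N) r f x) = a M - a N.
  move=> NM; have -> : (fun x => Tsum (zball R M) r f x - Tsum (zball R N) r f x) =
      Tsum [seq j <- zball R M | j \notin zball R N] r f.
    by apply/funext => x; rewrite /Tsum (split_zball _ _ NM).
  have uf : uniq [seq j <- (zball R M : seq zvec) | j \notin zball R N] by apply: filter_uniq; exact: zball_uniq.
  by rewrite nsq_Tsum// -(split_zball _ _ NM) mulrBr.
have nda : {homo a : m n / (m <= n)%N >-> m <= n}.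
  by move=> N M NM; rewrite -subr_ge0 -aE// nsq_ge0.
have ab M : a M <= vol * S * nsq cyl f.
  rewrite /a -mulrA ler_wpM2l ?(ltW (vol_gt0 _))//.
  apply: (@le_trans _ _ ((\sum_(j <- zball R M) weight r j) * nsq cyl f)).
    by rewrite mulr_suml; apply: ler_sum => j _; exact: nsq_Aop.
  by rewrite ler_wpM2r ?nsq_ge0.
have e2 : 0 < eps ^+ 2 by rewrite exprn_gt0.
have [N hN] := nondecreasing_bounded_cauchy nda ab e2.
exists N => p q Np Nq.
wlog qp : p q Np Nq / (q <= p)%N => [hw|].
  by have [|/ltnW] := leqP q p; [exact: hw|rewrite nrm_distC; exact: hw].
rewrite -(@ler_pXn2r _ 2)// ?nnegrE ?nrm_ge0 ?(ltW e0)// nrm2 aE//.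
exact: hN.
Qed.

End fixed_family.
End green_sums.

(** * The mode series solves the weak equation *)

Section weak_solutions.
Context {R : realType} (n : nat).
Local Notation leb := (@lebesgue_measure R).
Local Notation zvec := 'rV[int]_n.
Local Notation cyl := (cylm n : {sigma_finite_measure set (Cyl R n) -> \bar R}).
Local Notation vol := ((2 * pi) ^+ n : R).
Local Notation E := (R * 'rV[R]_n)%type.
Variables (kap : zvec -> R[i]) (Vinf : R) (z : R[i]).
Hypothesis kap_gt0 : forall j, 0 < Re (kap j).
Hypothesis kap2 : forall j, kap j ^+ 2 = (Vinf + znorm j ^+ 2)%:C - z.
Variables (W : Cyl R n -> R) (B : R).
Hypothesis LW : L2 cyl (fun x => (W x)%:C).
Hypothesis WB : forall x, `|W x| <= B.

(** Profile of row [j] of (H0 - z)^-1 W; the minus sign of K(z) is added later. *)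
Definition rK (j : zvec) (x : Cyl R n) : R[i] :=
  (vol^-1)%:C * ((W x)%:C * character (- j) x.2).

Lemma L2_rK j : L2 cyl (rK j).
Proof.
apply: L2Z.
have := @L2_bdM _ _ _ cyl (fun x => character (- j) x.2) _ 1
  (@cmeas_snd _ _ _ _ R _ (cmeas_character (- j))) _ LW.
have -> : (fun x : Cyl R n => character (- j) x.2 * (W x)%:C) = (fun x => (W x)%:C * character (- j) x.2).
  by apply/funext => x; rewrite mulrC.
by apply => x; rewrite cmod_character.
Qed.

Lemma L2_Wf f : L2 cyl f -> L2 cyl (fun x => (W x)%:C * f x).
Proof.
by move=> Lf; apply: (@L2_bdM _ _ _ cyl _ _ B) => //; [exact: L2_meas LW|move=> x; rewrite cmodR].
Qed.

Lemma test_weak_op phi (K : Cyl R n -> R[i]) b : test_function phi ->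
  cmeasurable_fun K -> (forall x, cmod (K x) <= b) ->
  L2 cyl (fun x => K x * weak_op Vinf z phi x) /\ cintegrable cyl (fun x => K x * weak_op Vinf z phi x).
Proof.
move=> tp mK Kb.
have t1 : test_function ('D_((1 : R), (0 : 'rV[R]_n)) ('D_((1 : R), (0 : 'rV[R]_n)) phi)).
  by apply: test_derive; exact: test_derive.
have t2 i : test_function ('D_((0 : R), delta_mx 0 i) ('D_((0 : R), delta_mx 0 i) phi)).
  by apply: test_derive; exact: test_derive.
have [L0 j0] := test_cintegrable tp mK Kb; have [L1 j1] := test_cintegrable t1 mK Kb.
have L2' i := (test_cintegrable (t2 i) mK Kb).1; have j2 i := (test_cintegrable (t2 i) mK Kb).2.
pose D1 := 'D_((1 : R), (0 : 'rV[R]_n)) ('D_((1 : R), (0 : 'rV[R]_n)) phi).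
pose D2 i := 'D_((0 : R), delta_mx 0 i) ('D_((0 : R), delta_mx 0 i) phi).
have e : (fun x => K x * weak_op Vinf z phi x) =
    (fun x => (Vinf%:C - z) * (K x * (phi (vec x))%:C) -
      (K x * (D1 (vec x))%:C + \sum_(i < n) K x * (D2 i (vec x))%:C)).
  apply/funext => x; rewrite -mulr_sumr /weak_op /laplacian -/D1.
  rewrite rmorphD rmorphN rmorphD rmorph_sum rmorphM /=; rewrite /D2; ring.
rewrite e; split.
- apply: L2B; first exact: L2Z.
  by apply: L2D => //; apply: L2_sum => i _; exact: L2'.
- apply: cintegrableB; first exact: cintegrableZ.
  by apply: cintegrableD => //; apply: cintegrable_sum => i _; exact: j2.
Qed.

Lemma test_section phi x1 : test_function phi ->
  L2 (torus n) (fun y : Omega R n => (phi (vec (x1, y)))%:C).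
Proof.
move=> tp; have [C [M [C0 h]]] := test_bounded tp.
apply: (@L2_bounded _ _ _ (torus n) _ C).
  exact: cmeas_comp (cmeas_test (test_continuous tp)) (measurable_pair1 x1).
by move=> y; rewrite cmodR; apply: le_trans (h _) _; rewrite ler_piMr// indicE lern1; case: (_ \in _).
Qed.

(** After exchanging the integrations, [green_identity] collapses the inner one to the integral of
    e^{ij.y} phi(x_1', y), which is vol times the Fourier coefficient of phi of index -j. *)
Lemma weak_green_term phi f j : test_function phi -> L2 cyl f ->
  cintegral cyl (fun x => character j x.2 * Aop (kap j) (rK j) f x.1 * weak_op Vinf z phi x) =
  cintegral cyl (fun x => (W x)%:C * f x *
    (fc (- j) (fun y => (phi (vec (x.1, y)))%:C) * character (- j) x.2)).
Proof.
move=> tp Lf.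
have [_ jL] := test_weak_op (K := fun=> 1) tp (cmeas_cst _ _) (fun _ => (lexx _)).
have {}jL : cintegrable cyl (weak_op Vinf z phi).
  by move: jL; under eq_fun do rewrite mul1r.
have jr : cintegrable cyl (fun x => rK j x * f x).
  by have := cintegrable_inner (L2J (L2_rK j)) Lf; under eq_fun do rewrite conjCK.
pose K (p : Cyl R n * Cyl R n) := character j p.1.2 * Gk (kap j) (p.1.1 - p.2.1).
have mK : cmeasurable_fun K.
  apply: cmeasM.
    apply: (cmeas_comp (cmeas_character j)).
    by apply: measurableT_comp; [exact: measurable_snd|exact: measurable_fst].
  apply: (cmeas_comp (cmeas_Gk (kap j))); apply: measurable_funB;
    apply: measurableT_comp; try exact: measurable_fst; exact: measurable_snd.
have KB p : cmod (K p) <= (2 * Re (kap j))^-1.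
  by rewrite cmodM cmod_character mul1r; exact: cmod_Gk.
have jT := cintegrable_tensor (m1 := cyl) (m2 := cyl) jL jr mK KB.
transitivity (cintegral (cyl \x cyl)%E (fun p => K p * (weak_op Vinf z phi p.1 * (rK j p.2 * f p.2)))).
  rewrite (cintegral_fubini1 jT).2; apply: eq_cintegral => x /=.
  have -> : character j x.2 * Aop (kap j) (rK j) f x.1 * weak_op Vinf z phi x =
      (character j x.2 * weak_op Vinf z phi x) * Aop (kap j) (rK j) f x.1 by ring.
  have jA : cintegrable cyl (fun x' => Gk (kap j) (x.1 - x'.1) * (rK j x' * f x')).
    have := cintegrable_inner (L2J (L2_Gr (kap_gt0 j) (L2_rK j) x.1)) Lf.
    by under eq_fun do rewrite conjCK -mulrA.
  rewrite -cintegralZ//; apply: eq_cintegral => x'; rewrite /K /=; ring.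
rewrite (cintegral_fubini2 jT).2; apply: eq_cintegral => x' /=.
transitivity (rK j x' * f x' * cintegral (torus n) (fun y => character j y * (phi (vec (x'.1, y)))%:C)).
  rewrite -(green_identity (kap_gt0 j) (kap2 j) x'.1 tp) -cintegralZ.
    by apply: eq_cintegral => x; rewrite /K /=; ring.
  have mG : cmeasurable_fun (fun x : Cyl R n => character j x.2 * Gk (kap j) (x.1 - x'.1)).
    apply: cmeasM; first exact: (@cmeas_snd _ _ _ _ R _ (cmeas_character j)).
    apply: (cmeas_comp (cmeas_Gk (kap j))); apply: measurable_funB; last exact: measurable_cst.
    exact: measurable_fst.
  have GB x : cmod (character j x.2 * Gk (kap j) (x.1 - x'.1)) <= (2 * Re (kap j))^-1.
    by rewrite cmodM cmod_character mul1r; exact: cmod_Gk.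
  by have [] := test_weak_op tp mG GB.
rewrite /fc /inner.
have -> : cintegral (torus n) (fun y => (character (- j) y)^* * (phi (vec (x'.1, y)))%:C) =
    cintegral (torus n) (fun y => character j y * (phi (vec (x'.1, y)))%:C).
  by apply: eq_cintegral => y; rewrite conj_character opprK.
rewrite /rK; ring.
Qed.

Lemma perm_zball_opp M : perm_eq [seq - j | j <- zball R M] (zball R M : seq zvec).
Proof.
apply: uniq_perm => [||j].
- by rewrite map_inj_uniq; [exact: zball_uniq|exact: oppr_inj].
- exact: zball_uniq.
apply/mapP/idP => [[i iM ->]|jM].
  by move: iM; rewrite !mem_zball znormN.
by exists (- j); rewrite ?opprK// mem_zball znormN -mem_zball.
Qed.

Definition ptest phi M (x : Cyl R n) : R[i] :=
  tsum (zball R M) (fun y => (phi (vec (x.1, y)))%:C) x.2.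

Lemma L2_ptest phi M : test_function phi -> L2 cyl (ptest phi M).
Proof.
move=> tp; have [C [Mx [C0 h]]] := test_bounded tp.
have [Lt _] := test_cintegrable (K := fun=> 1) tp (cmeas_cst _ _) (fun _ => (lexx _)).
have {}Lt : L2 cyl (fun x => (phi (vec x))%:C) by move: Lt; under eq_fun do rewrite mul1r.
apply: L2_sum => m _; rewrite /fc.
have L1 := L2_inner_section (m1 := leb) (m2 := torus n) (L2_character m) Lt.
have := L2Z ((vol^-1)%:C) (L2_tensor L1 (L2_character m)).
by congr L2; apply/funext => x; rewrite mulrA.
Qed.

(** Fourier series converge in L^2 on each slice, and the slice errors are dominated by the slice
    norms, so dominated convergence in x_1 applies. *)
Lemma ptest_cvg phi : test_function phi ->
  nrm cyl (fun x => ptest phi M x - (phi (vec x))%:C) @[M --> \oo] --> (0 : R).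
Proof.
move=> tp.
have [Lt _] := test_cintegrable (K := fun=> 1) tp (cmeas_cst _ _) (fun _ => (lexx _)).
have {}Lt : L2 cyl (fun x => (phi (vec x))%:C) by move: Lt; under eq_fun do rewrite mul1r.
pose d M x1 := nsq (torus n) (fun y : Omega R n => (phi (vec (x1, y)))%:C -
  tsum (zball R M) (fun y => (phi (vec (x1, y)))%:C) y).
have Ld M : L2 cyl (fun x => (phi (vec x))%:C - ptest phi M x) by apply: L2B => //; exact: L2_ptest.
have nd M : leb.-integrable setT (fun x1 => (d M x1)%:E) /\
    nsq cyl (fun x => (phi (vec x))%:C - ptest phi M x) = Rintegral leb setT (d M).
  exact: (nsq_fubini (m1 := leb) (m2 := torus n) (Ld M)).
have [jg _] := nsq_fubini (m1 := leb) (m2 := torus n) Lt.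
have FF := ae_filter_ringOfSetsType leb.
have c1 : \forall x \ae leb, setT x -> (d M x)%:E @[M --> \oo] --> 0%E.
  apply: aeW => x _; apply: cvg_EFin; first exact: nearW.
  have h := tsum_cvg (test_section x tp).
  have e : (fun M => d M x) = (fun M => nrm (torus n) (fun y : Omega R n => (phi (vec (x, y)))%:C -
      tsum (zball R M) (fun y => (phi (vec (x, y)))%:C) y) * nrm (torus n) (fun y : Omega R n => (phi (vec (x, y)))%:C -
      tsum (zball R M) (fun y => (phi (vec (x, y)))%:C) y)).
    by apply/funext => M; rewrite -expr2 nrm2.
  by rewrite [X in X @ _ --> _]e -[X in _ --> X](mulr0 (0 : R)); apply: cvgM.
have c2 : \forall x \ae leb, forall M : nat, setT x ->
    (`|(d M x)%:E| <= (nsq (torus n) (fun y : Omega R n => (phi (vec (x, y)))%:C))%:E)%E.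
  apply: aeW => x M _; rewrite gee0_abs ?lee_fin ?nsq_ge0//.
  by apply: nsq_sub_tsum_le; [exact: test_section|exact: zball_uniq].
have m0 : measurable_fun setT (fun _ : measurableTypeR R => 0%E : \bar R) by exact: measurable_cst.
have [_ _] := dominated_convergence measurableT (fun M => measurable_int _ (nd M).1) m0 c1 jg c2.
rewrite integral0 => D.
have nsq0 : nsq cyl (fun x => (phi (vec x))%:C - ptest phi M x) @[M --> \oo] --> (0 : R).
  have -> : (fun M => nsq cyl (fun x => (phi (vec x))%:C - ptest phi M x)) =
    (fun M => Rintegral leb setT (d M)) by apply/funext => M; rewrite (nd M).2.
  exact: (fine_cvg D).
have -> : (fun M => nrm cyl (fun x => ptest phi M x - (phi (vec x))%:C)) =
    (fun M => Num.sqrt (nsq cyl (fun x => (phi (vec x))%:C - ptest phi M x))).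
  by apply/funext => M; rewrite nrm_distC.
rewrite -sqrtr0; apply: continuous_cvg; [exact: sqrt_continuous|exact: nsq0].
Qed.

Lemma inner_cvg0 (u h : Cyl R n -> R[i]) (un : nat -> Cyl R n -> R[i]) :
  L2 cyl h -> L2 cyl u -> (forall M, L2 cyl (un M)) ->
  nrm cyl (fun x => un M x - u x) @[M --> \oo] --> (0 : R) ->
  forall eps, 0 < eps -> exists N, forall M, (N <= M)%N ->
    cmod (cintegral cyl (fun x => h x * un M x) - cintegral cyl (fun x => h x * u x)) <= eps.
Proof.
move=> Lh Lu Ln cv eps e0; have LhJ := L2J Lh.
have ci g : cintegral cyl (fun x => h x * g x) = inner cyl (fun x => (h x)^*) g.
  by apply: eq_cintegral => x; rewrite conjCK.
have he : 0 < eps / (nrm cyl (fun x => (h x)^*) + 1) by rewrite divr_gt0// ltr_wpDl ?nrm_ge0.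
have [N hN] := cvg_dist cv he; exists N => M NM.
have := hN M NM; rewrite subr0 ger0_norm ?nrm_ge0// => hM.
rewrite !ci -innerBr//; apply: le_trans (cauchy_schwarz LhJ (L2B (Ln M) Lu)) _.
apply: (@le_trans _ _ (nrm cyl (fun x => (h x)^*) * (eps / (nrm cyl (fun x => (h x)^*) + 1)))).
  by rewrite ler_wpM2l ?nrm_ge0.
rewrite mulrCA ler_piMr ?(ltW e0)// ler_pdivrMr ?mul1r ?lerDl//.
by rewrite ltr_wpDl ?nrm_ge0.
Qed.

(** Testing the M-th partial sum replaces phi by its M-th partial Fourier sum on the right; the
    balls being symmetric, -j runs over the same indices as j. Both sides then converge. *)
Lemma weak_solution_exists f S : L2 cyl f -> (forall M, \sum_(j <- zball R M) weight kap rK j <= S) ->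
  exists u, [/\ L2 cyl u,
    nrm cyl (fun x => Tsum kap (zball R M) rK f x - u x) @[M --> \oo] --> (0 : R)
  & forall phi, test_function phi ->
      cintegral cyl (fun x => u x * weak_op Vinf z phi x) =
      cintegral cyl (fun x => (W x)%:C * f x * (phi (vec x))%:C)].
Proof.
move=> Lf hS.
have Ln M : L2 cyl (Tsum kap (zball R M) rK f) by exact: (L2_Tsum kap_gt0 L2_rK).
have [u Lu cu] := L2_complete Ln (Tsum_cauchy kap_gt0 L2_rK Lf hS).
exists u; split => // phi tp.
have [Lw _] := test_weak_op (K := fun=> 1) tp (cmeas_cst _ _) (fun _ => (lexx _)).
have {}Lw : L2 cyl (weak_op Vinf z phi) by move: Lw; under eq_fun do rewrite mul1r.
have [Lt _] := test_cintegrable (K := fun=> 1) tp (cmeas_cst _ _) (fun _ => (lexx _)).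
have {}Lt : L2 cyl (fun x => (phi (vec x))%:C) by move: Lt; under eq_fun do rewrite mul1r.
have Lh := L2_Wf Lf.
have eM M : cintegral cyl (fun x => weak_op Vinf z phi x * Tsum kap (zball R M) rK f x) =
    cintegral cyl (fun x => (W x)%:C * f x * ptest phi M x).
  have jl j : cintegrable cyl (fun x => character j x.2 * Aop (kap j) (rK j) f x.1 * weak_op Vinf z phi x).
    have := cintegrable_inner (L2J (L2_Tsum kap_gt0 L2_rK [:: j] Lf)) Lw.
    by under eq_fun do rewrite conjCK /Tsum big_seq1.
  have jr m : cintegrable cyl (fun x => (W x)%:C * f x *
      (fc m (fun y => (phi (vec (x.1, y)))%:C) * character m x.2)).
    have L1 := L2_inner_section (m1 := leb) (m2 := torus n) (L2_character m) Lt.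
    have L3 := L2Z ((vol^-1)%:C) (L2_tensor L1 (L2_character m)).
    have := cintegrable_inner (L2J Lh) L3; congr cintegrable; apply/funext => x.
    by rewrite conjCK /fc mulrA.
  transitivity (\sum_(j <- zball R M) cintegral cyl (fun x => (W x)%:C * f x *
      (fc (- j) (fun y => (phi (vec (x.1, y)))%:C) * character (- j) x.2))).
    transitivity (cintegral cyl (fun x => \sum_(j <- zball R M)
        character j x.2 * Aop (kap j) (rK j) f x.1 * weak_op Vinf z phi x)).
      by apply: eq_cintegral => x; rewrite mulrC mulr_suml.
    rewrite cintegral_sum => [|j _]; last exact: jl.
    by apply: eq_bigr => j _; exact: weak_green_term.
  rewrite -(big_map (fun j => - j) xpredT (fun m => cintegral cyl (fun x => (W x)%:C * f x *
      (fc m (fun y => (phi (vec (x.1, y)))%:C) * character m x.2)))).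
  rewrite (perm_big _ (perm_zball_opp M)) -cintegral_sum => [|m _]; last exact: jr.
  by apply: eq_cintegral => x; rewrite /ptest /tsum mulr_sumr.
apply/eqP; rewrite -subr_eq0 -cmod_eq0 eq_le cmod_ge0 andbT.
apply/ler_addgt0Pl => eps e0; rewrite addr0.
have he : 0 < eps / 2 by rewrite divr_gt0.
have [N1 h1] := inner_cvg0 Lw Lu Ln cu he.
have [N2 h2] := inner_cvg0 Lh Lt (fun M => L2_ptest M tp) (ptest_cvg tp) he.
have := h1 (maxn N1 N2) (leq_maxl _ _); have := h2 (maxn N1 N2) (leq_maxr _ _).
rewrite eM; set a := cintegral _ _; set b := cintegral _ _; set c := cintegral _ _.
have -> : cintegral cyl (fun x => u x * weak_op Vinf z phi x) = c.
  by apply: eq_cintegral => x; rewrite mulrC.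
move=> ab ac; have -> : c - b = (a - b) + - (a - c) by ring.
by apply: le_trans (cmodD _ _) _; rewrite cmodN; lra.
Qed.

End weak_solutions.

(** * The chosen resolvent is the mode series *)

Section resolvent_representation.
Context {R : realType} (n : nat).
Local Notation leb := (@lebesgue_measure R).
Local Notation zvec := 'rV[int]_n.
Local Notation cyl := (cylm n : {sigma_finite_measure set (Cyl R n) -> \bar R}).
Local Notation E := (R * 'rV[R]_n)%type.

Lemma trig_periodic (t : R) (k : int) :
  cos (t + k%:~R * (2 * pi)) = cos t /\ sin (t + k%:~R * (2 * pi)) = sin t.
Proof.
have : cis (t + k%:~R * (2 * pi)) = cis t :> R[i] by rewrite cisD cis_int2pi mulr1.
by rewrite !cisE => -[].
Qed.

Variables (kap : zvec -> R[i]) (Vinf : R) (z : R[i]).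
Hypothesis kap_gt0 : forall j, 0 < Re (kap j).
Hypothesis kap2 : forall j, kap j ^+ 2 = (Vinf + znorm j ^+ 2)%:C - z.

Lemma derive_unique (g g1 : R -> R) : (forall j, ndiff j g) ->
  (forall x, is_derive x (1 : R) g (g1 x)) -> forall j, ndiff j g1.
Proof.
move=> sg dg; have [g' [dg' sg']] := ndiff_derive sg.
suff -> : g1 = g' by [].
by apply/funext => x; have d1 := dg x; have d2 := dg' x; rewrite -(@derive_val _ _ _ x 1 g (g1 x)) derive_val.
Qed.

(** Testing with g cos(m.y) plus i times g sin(m.y) yields the equation for g e^{im.y} required by
    [weak_unique]. *)
Lemma weak_op_unique (w : Cyl R n -> R[i]) : L2 cyl w ->
  (forall phi, test_function phi -> cintegral cyl (fun x => w x * weak_op Vinf z phi x) = 0) ->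
  ae_eq cyl setT w (fun=> 0).
Proof.
move=> Lw w0; apply: (weak_unique kap_gt0 Lw) => m g g1 g2 sg cg dg dg1.
have sg1 := derive_unique sg dg; have sg2 := derive_unique sg1 dg1.
have cg2 := csupp_derive (csupp_derive cg dg) dg1.
have [M g0] := cg.
have tc : test_function (tf g (@cos R) m).
  exact: (@tf_test R n g (@cos R) m M sg (fun k => (@ndiff_trig R k).1) g0 (fun t k => (trig_periodic t k).1)).
have ts : test_function (tf g (@sin R) m).
  exact: (@tf_test R n g (@sin R) m M sg (fun k => (@ndiff_trig R k).2) g0 (fun t k => (trig_periodic t k).2)).
have lc p : laplacian (tf g (@cos R) m) p = tf g2 (@cos R) m p - znorm m ^+ 2 * tf g (@cos R) m p.
  by apply: (laplacian_tf (q1 := fun x => - sin x) m p dg dg1).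
have ls p : laplacian (tf g (@sin R) m) p = tf g2 (@sin R) m p - znorm m ^+ 2 * tf g (@sin R) m p.
  by apply: (laplacian_tf (q1 := @cos R) m p dg dg1).
have one (h : R -> R) : continuous h -> csupp h ->
    cintegrable cyl (fun x => w x * ((h x.1)%:C * character m x.2)).
  move=> ch sh; have := cintegrable_pairing m Lw 0 ch sh.
  by congr cintegrable; apply/funext => x; rewrite subr0.
have jL phi : test_function phi -> cintegrable cyl (fun x => w x * weak_op Vinf z phi x).
  move=> tp; have [Lp _] := test_weak_op Vinf z (K := fun=> 1) tp (cmeas_cst _ _) (fun _ => (lexx _)).
  have := cintegrable_inner (L2J Lw) Lp; congr cintegrable; apply/funext => x.
  by rewrite conjCK mul1r.
have e x : w x * weak_op Vinf z (tf g (@cos R) m) x +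
    'i * (w x * weak_op Vinf z (tf g (@sin R) m) x) =
    kap m ^+ 2 * (w x * ((g x.1)%:C * character m x.2)) - w x * ((g2 x.1)%:C * character m x.2).
  have -> : character m x.2 = (cos (ell m (vec x)))%:C + 'i * (sin (ell m (vec x)))%:C.
    rewrite characterE cisE /ell /=.
    have -> : \sum_(i < n) (m 0 i)%:~R * (\row_i tnth x.2 i) 0 i = \sum_(i < n) (m 0 i)%:~R * tnth x.2 i :> R.
      by apply: eq_bigr => i _; rewrite mxE.
    by apply: complex_ext => /=; ring.
  rewrite /weak_op lc ls kap2 /tf /= !(rmorphD, rmorphN, rmorphM) /=; ring.
have : cintegral cyl (fun x => w x * weak_op Vinf z (tf g (@cos R) m) x +
    'i * (w x * weak_op Vinf z (tf g (@sin R) m) x)) = 0.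
  rewrite cintegralD; [|exact: jL|exact/cintegrableZ/jL].
  by rewrite cintegralZ ?w0// ?mulr0 ?addr0//; exact: jL.
have -> : (fun x => w x * weak_op Vinf z (tf g (@cos R) m) x +
    'i * (w x * weak_op Vinf z (tf g (@sin R) m) x)) =
  (fun x => kap m ^+ 2 * (w x * ((g x.1)%:C * character m x.2)) - w x * ((g2 x.1)%:C * character m x.2)).
  by apply/funext => x; exact: e.
have jg := one g (sg 0%N) cg; have jg2 := one g2 (sg2 0%N) cg2.
rewrite cintegralB; [|exact: cintegrableZ|exact: jg2].
by rewrite cintegralZ// => /eqP; rewrite subr_eq0 => /eqP.
Qed.

Variables (W : Cyl R n -> R) (B : R).
Hypothesis LW : L2 cyl (fun x => (W x)%:C).
Hypothesis WB : forall x, `|W x| <= B.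
Variable S : R.
Hypothesis hS : forall M, \sum_(j <- zball R M) weight kap (rK W) j <= S.

Lemma H0_graph_weak (v g h : Cyl R n -> R[i]) phi : test_function phi ->
  H0_graph Vinf v g -> L2 cyl h -> ae_eq cyl setT (fun x => g x - z * v x) h ->
  cintegral cyl (fun x => v x * weak_op Vinf z phi x) = cintegral cyl (fun x => h x * (phi (vec x))%:C).
Proof.
move=> tp [Lv Lg wk] Lh gh.
have [Lt _] := test_cintegrable (K := fun=> 1) tp (cmeas_cst _ _) (fun _ => (lexx _)).
have {}Lt : L2 cyl (fun x => (phi (vec x))%:C) by move: Lt; under eq_fun do rewrite mul1r.
have [Lw _] := test_weak_op Vinf z (K := fun=> 1) tp (cmeas_cst _ _) (fun _ => (lexx _)).
have {}Lw : L2 cyl (weak_op Vinf z phi) by move: Lw; under eq_fun do rewrite mul1r.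
have ji (a b : Cyl R n -> R[i]) : L2 cyl a -> L2 cyl b -> cintegrable cyl (fun x => a x * b x).
  by move=> La Lb; have := cintegrable_inner (L2J La) Lb; under eq_fun do rewrite conjCK.
have jvw := ji _ _ Lv Lw; have jvp := ji _ _ Lv Lt; have jgp := ji _ _ Lg Lt.
have e : cintegral cyl (fun x => v x * (- laplacian phi (vec x) + Vinf * phi (vec x))%:C) =
    cintegral cyl (fun x => v x * weak_op Vinf z phi x) + z * cintegral cyl (fun x => v x * (phi (vec x))%:C).
  rewrite -cintegralZ// -cintegralD//; last exact: cintegrableZ.
  by apply: eq_cintegral => x; rewrite /weak_op; ring.
have := wk phi tp; rewrite [X in X = _]e => {}e.
have -> : cintegral cyl (fun x => v x * weak_op Vinf z phi x) =
    cintegral cyl (fun x => g x * (phi (vec x))%:C) - z * cintegral cyl (fun x => v x * (phi (vec x))%:C).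
  by rewrite -[X in X - _]e addrK.
rewrite -cintegralZ// -cintegralB//; last exact: cintegrableZ.
transitivity (cintegral cyl (fun x => (g x - z * v x) * (phi (vec x))%:C)).
  by apply: eq_cintegral => x; ring.
apply: ae_eq_cintegral.
- by apply: cmeasM; [exact: L2_meas (L2B Lg (L2Z z Lv))|exact: L2_meas Lt].
- by apply: cmeasM; [exact: L2_meas Lh|exact: L2_meas Lt].
- have FF := ae_filter_ringOfSetsType cyl.
  by move: gh; apply: filterS => x /= gx _; rewrite gx.
Qed.

(** The series limit shows that the set behind the choice is non-empty; any chosen solution has the
    same pairings with test functions, so uniqueness identifies the two almost everywhere. *)
Lemma resolvent_representation f h : L2 cyl f ->
  ae_eq cyl setT (fun x => (W x)%:C * f x) h ->
  exists u, [/\ L2 cyl u, L2 cyl (resolvent Vinf z h),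
    nrm cyl (fun x => Tsum kap (zball R M) (rK W) f x - u x) @[M --> \oo] --> (0 : R)
    & ae_eq cyl setT (resolvent Vinf z h) u].
Proof.
move=> Lf hWf.
have [u [Lu cu wu]] := weak_solution_exists kap_gt0 kap2 LW WB Lf hS.
have LWf := L2_Wf LW WB Lf.
have FF := ae_filter_ringOfSetsType cyl.
have nonempty : exists v, [set v | exists2 g, H0_graph Vinf v g &
    ae_eq cyl setT (fun x => g x - z * v x) h] v.
  (* The image of [u] under H0 is read off from (H0 - z) u = W f. *)
  exists u, (fun x => (W x)%:C * f x + z * u x); last first.
    by move: hWf; apply: filterS => x /= e /e <-; rewrite addrK.
  split => //; first by apply: L2D => //; exact: L2Z.
  move=> phi tp.
  have [Lt _] := test_cintegrable (K := fun=> 1) tp (cmeas_cst _ _) (fun _ => (lexx _)).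
  have {}Lt : L2 cyl (fun x => (phi (vec x))%:C) by move: Lt; under eq_fun do rewrite mul1r.
  have [Lw _] := test_weak_op Vinf z (K := fun=> 1) tp (cmeas_cst _ _) (fun _ => (lexx _)).
  have {}Lw : L2 cyl (weak_op Vinf z phi) by move: Lw; under eq_fun do rewrite mul1r.
  have ji (a b : Cyl R n -> R[i]) : L2 cyl a -> L2 cyl b -> cintegrable cyl (fun x => a x * b x).
    by move=> La Lb; have := cintegrable_inner (L2J La) Lb; under eq_fun do rewrite conjCK.
  transitivity (cintegral cyl (fun x => u x * weak_op Vinf z phi x) +
      z * cintegral cyl (fun x => u x * (phi (vec x))%:C)).
    rewrite -cintegralZ; last exact: ji.
    rewrite -cintegralD; [|exact: ji|exact/cintegrableZ/ji].
    by apply: eq_cintegral => x; rewrite /weak_op; ring.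
  rewrite wu// -cintegralZ; last exact: ji.
  rewrite -cintegralD; [|exact: ji|exact/cintegrableZ/ji].
  by apply: eq_cintegral => x; ring.
have [g gr gh] : [set v | exists2 g, H0_graph Vinf v g &
    ae_eq cyl setT (fun x => g x - z * v x) h] (resolvent Vinf z h) := xgetPex (cst 0) nonempty.
have Lr : L2 cyl (resolvent Vinf z h) by case: gr.
exists u; split => //.
have gWf : ae_eq cyl setT (fun x => g x - z * resolvent Vinf z h x) (fun x => (W x)%:C * f x).
  by move: hWf gh; apply: filterS2 => x /= e1 e2 Tx; rewrite e2// e1.
have w0 : ae_eq cyl setT (fun x => resolvent Vinf z h x - u x) (fun=> 0).
  apply: weak_op_unique; first exact: L2B.
  move=> phi tp.
  have [Lw _] := test_weak_op Vinf z (K := fun=> 1) tp (cmeas_cst _ _) (fun _ => (lexx _)).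
  have {}Lw : L2 cyl (weak_op Vinf z phi) by move: Lw; under eq_fun do rewrite mul1r.
  have ji (a b : Cyl R n -> R[i]) : L2 cyl a -> L2 cyl b -> cintegrable cyl (fun x => a x * b x).
    by move=> La Lb; have := cintegrable_inner (L2J La) Lb; under eq_fun do rewrite conjCK.
  transitivity (cintegral cyl (fun x => resolvent Vinf z h x * weak_op Vinf z phi x) -
      cintegral cyl (fun x => u x * weak_op Vinf z phi x)).
    rewrite -cintegralB; [|exact: ji|exact: ji].
    by apply: eq_cintegral => x; rewrite mulrBl.
  by rewrite wu// (H0_graph_weak tp gr LWf gWf) subrr.
by move: w0; apply: filterS => x /= e Tx; apply/eqP; rewrite -subr_eq0 e.
Qed.

End resolvent_representation.

(** * Convergence of the lattice sum *)

Section lattice_sums.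
Context {R : realType}.

(** With p and q the fourth roots of l + 2 and l + 1, p^4 - q^4 = 1 forces 4 p^3 (p - q) >= 1, hence
    1/q - 1/p >= 1/(4 p^5): a discrete mean value inequality for x^(-1/4). *)
Lemma telescope_root (l : nat) :
  (l.+2%:R : R) `^ (- (5 / 4)) <= 4 * ((l.+1%:R : R) `^ (- (1 / 4)) - (l.+2%:R : R) `^ (- (1 / 4))).
Proof.
set q := (l.+1%:R : R) `^ (1 / 4); set p := (l.+2%:R : R) `^ (1 / 4).
have q0 : 0 < q by rewrite powR_gt0.
have p0 : 0 < p by rewrite powR_gt0.
have q4 : q ^+ 4 = l.+1%:R.
  by rewrite /q -powR_mulrn ?powR_ge0// -powRrM (_ : 1 / 4 * 4%:R = 1) ?powRr1//; field.
have p4 : p ^+ 4 = l.+2%:R.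
  by rewrite /p -powR_mulrn ?powR_ge0// -powRrM (_ : 1 / 4 * 4%:R = 1) ?powRr1//; field.
have -> : (l.+1%:R : R) `^ (- (1 / 4)) = q^-1 by rewrite powRN.
have -> : (l.+2%:R : R) `^ (- (1 / 4)) = p^-1 by rewrite powRN.
have -> : (l.+2%:R : R) `^ (- (5 / 4)) = (p ^+ 5)^-1.
  by rewrite powRN /p -[in RHS]powR_mulrn ?powR_ge0// -powRrM; congr (_ `^ _)^-1; field.
have qp : q <= p.
  by rewrite -(@ler_pXn2r _ 4)// ?nnegrE ?(ltW q0) ?(ltW p0)// q4 p4 ler_nat.
have d : (p - q) * (p ^+ 3 + p ^+ 2 * q + p * q ^+ 2 + q ^+ 3) = 1.
  have -> : (p - q) * (p ^+ 3 + p ^+ 2 * q + p * q ^+ 2 + q ^+ 3) = p ^+ 4 - q ^+ 4 by ring.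
  by rewrite p4 q4 -(natr1 l.+1) addrAC subrr add0r.
have h3 : p ^+ 3 + p ^+ 2 * q + p * q ^+ 2 + q ^+ 3 <= 4 * p ^+ 3.
  have a1 : p ^+ 2 * q <= p ^+ 3 by rewrite [leRHS]exprSr ler_wpM2l// exprn_ge0// ltW.
  have a2 : q ^+ 2 <= p ^+ 2 by rewrite ler_pXn2r// nnegrE ltW.
  have a3 : p * q ^+ 2 <= p ^+ 3 by rewrite [leRHS]exprS ler_wpM2l// ltW.
  have a4 : q ^+ 3 <= p ^+ 3 by rewrite ler_pXn2r// nnegrE ltW.
  lra.
have pq : 0 <= p - q by rewrite subr_ge0.
have h4 : 1 <= (p - q) * (4 * p ^+ 3) by rewrite -[leLHS]d ler_wpM2l.
have -> : q^-1 - p^-1 = (p - q) / (p * q) by field; rewrite !gt_eqF.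
rewrite -[leLHS]mul1r ler_pdivrMr ?exprn_gt0//.
have -> : 4 * ((p - q) / (p * q)) * p ^+ 5 = ((p - q) * (4 * p ^+ 3)) * (p / q).
  by field; rewrite !gt_eqF.
rewrite -[leLHS]mulr1; apply: ler_pM => //.
by rewrite ler_pdivlMr// mul1r.
Qed.

Lemma sum_root M : \sum_(l < M) (l.+1%:R : R) `^ (- (5 / 4)) <= 5.
Proof.
case: M => [|M]; first by rewrite big_ord0.
rewrite big_ord_recl powR1.
apply: (@le_trans _ _ (1 + \sum_(l < M) 4 * ((l.+1%:R : R) `^ (- (1 / 4)) - (l.+2%:R : R) `^ (- (1 / 4))))).
  by rewrite lerD2l; apply: ler_sum => l _; exact: telescope_root.
rewrite -mulr_sumr.
have -> : \sum_(l < M) ((l.+1%:R : R) `^ (- (1 / 4)) - (l.+2%:R : R) `^ (- (1 / 4))) =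
    1 - (M.+1%:R : R) `^ (- (1 / 4)).
  elim: M => [|M IH]; first by rewrite big_ord0 powR1 subrr.
  by rewrite big_ord_recr IH /=; ring.
have := powR_ge0 (M.+1%:R : R) (- (1 / 4)); lra.
Qed.

(** Since 1 + l^2 >= (l+1)^2 / 2, each term is at most 2 (l+1)^(-5/4). The two half-lines contribute
    at most 10 each. *)
Lemma sum_line M : \sum_(i < (2 * M).+1) (1 + ((i : nat)%:R - M%:R) ^+ 2 : R) `^ (- (5 / 8)) <= 20.
Proof.
have term (l : nat) : (1 + (l%:R : R) ^+ 2) `^ (- (5 / 8)) <= 2 * (l.+1%:R : R) `^ (- (5 / 4)).
  have l0 : 0 < 1 + (l%:R : R) ^+ 2 by rewrite ltr_pwDl// sqr_ge0.
  have h : (l.+1%:R : R) ^+ 2 / 2 <= 1 + (l%:R : R) ^+ 2.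
    by rewrite -natr1; have := sqr_ge0 ((l%:R : R) - 1); nra.
  have h0 : 0 < (l.+1%:R : R) ^+ 2 / 2 by rewrite divr_gt0.
  apply: (@le_trans _ _ (((l.+1%:R : R) ^+ 2 / 2) `^ (- (5 / 8)))).
    rewrite !powRN lef_pV2 ?posrE ?powR_gt0//; apply: ge0_ler_powR; rewrite ?nnegrE ?(ltW h0) ?(ltW l0)//.
  rewrite powRM ?invr_ge0 ?sqr_ge0// mulrC; apply: ler_pM; rewrite ?powR_ge0//.
    rewrite -powR_inv1// -powRrM mulN1r opprK -[leRHS]powRr1//.
    by rewrite ler_powR ?ler1n//; lra.
  by rewrite -powR_mulrn// -powRrM (_ : 2%:R * - (5 / 8) = - (5 / 4))//; field.
pose c (l : nat) := (1 + (l%:R : R) ^+ 2) `^ (- (5 / 8)).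
have c0 l : 0 <= c l by exact: powR_ge0.
have cS K : \sum_(l < K) c l <= 10.
  apply: (@le_trans _ _ (\sum_(l < K) 2 * (l.+1%:R : R) `^ (- (5 / 4)))).
    by apply: ler_sum => l _; exact: term.
  by rewrite -mulr_sumr; have := sum_root K; lra.
rewrite (_ : (2 * M).+1 = M + M.+1)%N; last by lia.
rewrite big_split_ord /= (_ : 20 = 10 + 10 :> R); last by ring.
apply: lerD.
- rewrite (reindex_inj rev_ord_inj)/=; apply: le_trans (cS M.+1); rewrite big_ord_recl.
  rewrite -[leLHS]add0r; apply: lerD; first exact: c0.
  apply: ler_sum => i _; rewrite le_eqVlt; apply/orP; left; apply/eqP.
  rewrite (_ : c (lift ord0 i) = c i.+1); last by rewrite lift0.
  by rewrite /c natrB//; congr ((1 + _) `^ _); ring.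
- apply: le_trans (cS M.+1); apply: ler_sum => i _; rewrite le_eqVlt; apply/orP; left; apply/eqP.
  by rewrite /c; congr ((1 + _) `^ _); rewrite natrD addrAC subrr add0r.
Qed.

(** Each 1 + j_i^2 is at most 1 + |j|^2, and 5n/8 <= (n+3)/4 for n <= 2, so the summand is below a
    product of one-dimensional terms and the sum over the enclosing cube factorises. *)
Lemma sum_zball n M : (n <= 2)%N ->
  \sum_(j <- (zball R M : seq 'rV[int]_n)) (1 + znorm j ^+ 2 : R) `^ (- ((n%:R + 3) / 4)) <= 20 ^+ n.
Proof.
move=> n2.
have pos (j : 'rV[int]_n) : 1 <= 1 + znorm j ^+ 2 :> R by rewrite lerDl sqr_ge0.
apply: (@le_trans _ _ (\sum_(j <- (zcube n M)) \prod_(i < n) (1 + (j 0 i)%:~R ^+ 2 : R) `^ (- (5 / 8)))).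
  rewrite /zball big_filter big_mkcond/=; apply: ler_sum => j _; case: ifP => _; last first.
    by apply: prodr_ge0 => i _; exact: powR_ge0.
  apply: (@le_trans _ _ (\prod_(i < n) (1 + znorm j ^+ 2 : R) `^ (- (5 / 8)))).
    rewrite prodr_const card_ord -[leRHS]powR_mulrn ?powR_ge0// -powRrM ler_powR//.
    have : (n%:R : R) <= 2 by rewrite ler_nat.
    lra.
  apply: ler_prod => i _; rewrite powR_ge0/=.
  have i0 : 0 < 1 + (j 0 i)%:~R ^+ 2 :> R by rewrite ltr_pwDl// sqr_ge0.
  rewrite !powRN lef_pV2 ?posrE ?powR_gt0 ?(lt_le_trans ltr01 (pos j))//.
  apply: ge0_ler_powR; rewrite ?nnegrE ?(ltW i0) ?(le_trans ler01 (pos j))//.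
  rewrite lerD2l znorm2 (bigD1 i)//= lerDl sumr_ge0// => l _; exact: sqr_ge0.
rewrite /zcube big_map big_enum /=.
rewrite (eq_bigr (fun f : {ffun 'I_n -> 'I_(2 * M).+1} =>
   \prod_(i < n) (1 + ((f i : nat)%:R - M%:R) ^+ 2 : R) `^ (- (5 / 8)))); last first.
  move=> f _; apply: eq_bigr => i _; rewrite mxE rmorphB/=; by [].
rewrite -(bigA_distr_bigA (fun (i : 'I_n) (l : 'I_(2 * M).+1) => (1 + ((l : nat)%:R - M%:R) ^+ 2 : R) `^ (- (5 / 8)))).
rewrite prodr_const card_ord; apply: lerXn2r; rewrite ?nnegrE//; last exact: sum_line.
by apply: sumr_ge0 => l _; exact: powR_ge0.
Qed.

End lattice_sums.

(** * Hilbert-Schmidt bounds for limits of mode sums *)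

Section hilbert_schmidt_limits.
Context {R : realType} (n : nat).
Local Notation leb := (@lebesgue_measure R).
Local Notation zvec := 'rV[int]_n.
Local Notation cyl := (cylm n : {sigma_finite_measure set (Cyl R n) -> \bar R}).
Local Notation vol := ((2 * pi) ^+ n : R).
Variable kap : zvec -> R[i].
Hypothesis kap_gt0 : forall j, 0 < Re (kap j).
Variable r : zvec -> Cyl R n -> R[i].
Hypothesis Lr : forall j, L2 cyl (r j).
Variable S : R.
Hypothesis hS : forall M, \sum_(j <- zball R M) weight kap r j <= S.

Lemma nsq_le_limit (a : nat -> Cyl R n -> R[i]) (u : Cyl R n -> R[i]) :
  (forall M, L2 cyl (a M)) -> L2 cyl u ->
  nrm cyl (fun x => a M x - u x) @[M --> \oo] --> (0 : R) ->
  nsq cyl (a M) @[M --> \oo] --> nsq cyl u.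
Proof.
move=> La Lu cv.
have cn : nrm cyl (a M) @[M --> \oo] --> nrm cyl u.
  apply/cvgrPdist_le => eps e0; have [N hN] := cvg_dist cv e0.
  exists N => // M /= NM; have := hN M NM; rewrite subr0 ger0_norm ?nrm_ge0// => h.
  apply: le_trans _ h; rewrite ler_norml; apply/andP; split.
  - have := nrmD Lu (L2B (La M) Lu).
    have -> : (fun x => u x + (a M x - u x)) = a M by apply/funext => x; rewrite addrC subrK.
    lra.
  - have := nrmD (La M) (L2B Lu (La M)).
    have -> : (fun x => a M x + (u x - a M x)) = u by apply/funext => x; rewrite addrC subrK.
    by rewrite (nrm_distC _ u (a M)); lra.
have -> : (fun M => nsq cyl (a M)) = (fun M => nrm cyl (a M) * nrm cyl (a M)).
  by apply/funext => M; rewrite -expr2 nrm2.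
by rewrite -nrm2 expr2; apply: cvgM.
Qed.

Lemma nsq_limit_le (T : Cyl R n -> R[i]) f : L2 cyl f -> L2 cyl T ->
  nrm cyl (fun x => Tsum kap (zball R M) r f x - T x) @[M --> \oo] --> (0 : R) ->
  nsq cyl T <= vol * S * nsq cyl f.
Proof.
move=> Lf LT cT; apply: (cvg_le_bound (nsq_le_limit (fun M => L2_Tsum kap_gt0 Lr _ Lf) LT cT)) => M.
apply: le_trans (nsq_Tsum_le kap_gt0 Lr (zball_uniq _ _) Lf) _.
by rewrite ler_wpM2r ?nsq_ge0// ler_wpM2l ?(ltW (vol_gt0 _)).
Qed.

(** For finitely many basis vectors the bound holds for every partial sum in [M] by [nsq_Tsum_onb];
    first [M] and then the number of basis vectors goes to infinity. *)
Lemma hs_norm_limit (T : (Cyl R n -> R[i]) -> Cyl R n -> R[i]) e :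
  orthonormal_basis cyl e -> (forall f, L2 cyl f -> L2 cyl (T f)) ->
  (forall f, L2 cyl f ->
    nrm cyl (fun x => Tsum kap (zball R M) r f x - T f x) @[M --> \oo] --> (0 : R)) ->
  (hs_norm cyl e T <= (Num.sqrt (vol * S))%:E)%E.
Proof.
move=> [Le oe _] LT cT.
have S0 : 0 <= S.
  by apply: le_trans (hS 0); apply: sumr_ge0 => j _; exact: weight_ge0.
have vS : 0 <= vol * S by rewrite mulr_ge0 ?(ltW (vol_gt0 _)).
apply/hs_norm_le; first exact: sqrtr_ge0.
rewrite sqr_sqrtr//; apply: lime_le.
  by apply: is_cvg_nneseries => i _ _; rewrite sqre_ge0.
apply: nearW => N; rewrite big_mkord.
have -> : (\sum_(i < N) L2norm cyl (T (e i)) ^+ 2 = (\sum_(i < N) nsq cyl (T (e i)))%:E)%E.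
  by rewrite -sumEFin; apply: eq_bigr => i _; rewrite L2norm_nrm -?EFin_expe ?nrm2//; exact/LT/Le.
rewrite lee_fin.
have cs : \sum_(i < N) nsq cyl (Tsum kap (zball R M) r (e i)) @[M --> \oo] -->
    \sum_(i < N) nsq cyl (T (e i)).
  elim: N => [|N IH].
    rewrite big_ord0; have -> : (fun M => \sum_(i < 0) nsq cyl (Tsum kap (zball R M) r (e i))) = fun=> 0.
      by apply/funext => M; rewrite big_ord0.
    exact: cvg_cst.
  rewrite big_ord_recr; have -> : (fun M => \sum_(i < N.+1) nsq cyl (Tsum kap (zball R M) r (e i))) =
      (fun M => \sum_(i < N) nsq cyl (Tsum kap (zball R M) r (e i)) + nsq cyl (Tsum kap (zball R M) r (e N))).
    by apply/funext => M; rewrite big_ord_recr.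
  apply: cvgD; first exact: IH.
  by apply: nsq_le_limit; [move=> M; exact: L2_Tsum|exact: LT|exact: cT].
apply: (cvg_le_bound cs) => M.
apply: le_trans (nsq_Tsum_onb kap_gt0 Lr _ (zball_uniq _ _) Le oe) _.
by rewrite ler_wpM2l ?(ltW (vol_gt0 _)).
Qed.

End hilbert_schmidt_limits.

(** * Fourier tails controlled by the H^{3/2} norm *)

Section sobolev_torus.
Context {R : realType} (n : nat).

Lemma one_le_powR (a s : R) : 1 <= a -> 0 <= s -> 1 <= a `^ s.
Proof.
move=> a1 s0; have := ge0_ler_powR s0 _ _ a1; rewrite powR1; apply; rewrite nnegrE//.
exact: le_trans ler01 a1.
Qed.

Local Notation zvec := 'rV[int]_n.
Local Notation vol := ((2 * pi) ^+ n : R).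
Implicit Types (w : Omega R n -> R).

Definition sob2 w : \bar R := (\esum_(m in [set: zvec])
  ((1 + znorm m ^+ 2) `^ (3 / 2) * cmod (fourier w m) ^+ 2)%:E)%E.

Lemma sob2_ge0 w : (0 <= sob2 w)%E.
Proof. by apply: esum_ge0 => m _; rewrite lee_fin mulr_ge0 ?powR_ge0 ?sqr_ge0. Qed.

Lemma sobolev_norm2 w : (sobolev_norm (3 / 2) w ^+ 2 = sob2 w)%E.
Proof. by rewrite /sobolev_norm poweR12_sqrt ?sqr_sqrte//; exact: sob2_ge0. Qed.

Lemma sum_le_esum (t : seq zvec) (a : zvec -> R) : uniq t ->
  ((\sum_(m <- t) a m)%:E <= \esum_(m in [set: zvec]) (a m)%:E)%E.
Proof.
move=> ut; apply: esum_ge; exists [set` t]; first by split; [exact: finite_seq|].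
by rewrite -fsbig_seq// sumEFin.
Qed.

Lemma torus_setT : torus n [set: Omega R n] = vol%:E.
Proof.
have := congr1 (@complex.Re R) (torus_character (0 : zvec)).
rewrite eqxx mul1r /cintegral /=.
have -> : (fun y : Omega R n => Re (character 0 y)) = (fun=> 1).
  by apply/funext => y; rewrite character0.
rewrite Rintegral_cst// mul1r => <-.
by rewrite fineK// fin_num_measure.
Qed.

Definition twisted w (j : zvec) (y : Omega R n) : R[i] := (w y)%:C * character (- j) y.

Lemma L2_twisted w j : L2 (torus n) (fun y => (w y)%:C) -> L2 (torus n) (twisted w j).
Proof.
move=> Lw; have := L2_bdM (K := fun y => character (- j) y) (B := 1) (cmeas_character (- j)) _ Lw.
have -> : (fun y : Omega R n => character (- j) y * (w y)%:C) = twisted w j.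
  by apply/funext => y; rewrite mulrC.
by apply => y; rewrite cmod_character.
Qed.

(** The discarded coefficient of index [m] is that of [w] at m + j; inserting the factor c (1 +
    |m+j|^2)^(3/2) >= 1 and reindexing produces the Sobolev sum. If that sum is infinite there is
    nothing to show. *)
Lemma tail_bound w (j : zvec) (t : seq zvec) (c : R) :
  L2 (torus n) (fun y => (w y)%:C) -> uniq t -> 0 < c ->
  (forall m, m \notin t -> 1 <= c * (1 + znorm (m + j) ^+ 2) `^ (3 / 2)) ->
  ((nsq (torus n) (fun y => twisted w j y - tsum t (twisted w j) y))%:E <= (vol * c)%:E * sob2 w)%E.
Proof.
move=> Lw ut c0 hc; have Lg := L2_twisted j Lw.
have vc : 0 < vol * c by rewrite mulr_gt0// vol_gt0.
have := sob2_ge0 w; case e : (sob2 w) => [q| |] // q0; last by rewrite gt0_muley ?lte_fin// leey.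
rewrite -EFinM lee_fin; apply: nsq_sub_tsum => // M.
apply: (@le_trans _ _ (vol * c * \sum_(m <- [seq m + j | m <- zball R M])
    (1 + znorm m ^+ 2) `^ (3 / 2) * cmod (fourier w m) ^+ 2)).
  rewrite big_map -mulrA mulr_sumr mulr_sumr big_mkcond /=; apply: ler_sum => m _.
  case: ifPn => [mt|_]; last first.
    by rewrite mulr_ge0 ?(ltW (vol_gt0 _))// mulr_ge0 ?(ltW c0)// mulr_ge0 ?powR_ge0 ?sqr_ge0.
  rewrite fc_shift ler_wpM2l ?(ltW (vol_gt0 _))// mulrA -[leLHS]mul1r.
  by rewrite ler_wpM2r ?sqr_ge0//; exact: hc.
rewrite ler_wpM2l ?(ltW vc)// -lee_fin -e; apply: sum_le_esum.
by rewrite map_inj_uniq ?zball_uniq//; exact: addIr.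
Qed.

Lemma nsq_tsum_le (g : Omega R n -> R[i]) (t : seq zvec) : L2 (torus n) g -> uniq t ->
  nsq (torus n) (tsum t g) <= nsq (torus n) g.
Proof.
move=> Lg ut; rewrite -proj_echar// (nsq_proj (@L2_echar R n) (@echar_orthonormal R n))//.
exact: (bessel (@L2_echar R n) (@echar_orthonormal R n)).
Qed.

Lemma nsq_twisted_le w (j : zvec) : L2 (torus n) (fun y => (w y)%:C) ->
  ((nsq (torus n) (twisted w j))%:E <= vol%:E * sob2 w)%E.
Proof.
move=> Lw; have := @tail_bound w j [::] 1 Lw isT ltr01.
have -> : (fun y => twisted w j y - tsum [::] (twisted w j) y) = twisted w j.
  by apply/funext => y; rewrite /tsum big_nil subr0.
rewrite mulr1; apply => m _; rewrite mul1r.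
by apply: one_le_powR; [rewrite lerDl sqr_ge0|rewrite divr_ge0].
Qed.

(** Only [s] of the available 3/2 orders on m + j is spent on decay in [J], at the cost of growth of
    order [s] in 1 + |j|^2, which the Green function weights absorb. *)
Lemma tail_constant (s : R) (J : nat) (j m : zvec) : 0 <= s -> s <= 3 / 2 -> (0 < J)%N ->
  (m \notin zball R J \/ j \notin zball R J) ->
  1 <= (2 / J%:R ^+ 2 * (1 + znorm j ^+ 2)) `^ s * (1 + znorm (m + j) ^+ 2 : R) `^ (3 / 2).
Proof.
move=> s0 s3 J0 hm.
set a : R := 1 + znorm j ^+ 2; set b : R := 1 + znorm (m + j) ^+ 2.
have a1 : 1 <= a by rewrite lerDl sqr_ge0.
have b1 : 1 <= b by rewrite lerDl sqr_ge0.
have J2 : 0 < (J%:R : R) ^+ 2 by rewrite exprn_gt0// ltr0n.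
have key : (J%:R : R) ^+ 2 <= 2 * a * b.
  have pn (x : zvec) : x \notin zball R J -> (J%:R : R) ^+ 2 <= znorm x ^+ 2.
    by rewrite mem_zball -ltNge => /ltW h; rewrite ler_pXn2r// nnegrE ?znorm_ge0.
  have := sqr_ge0 (znorm j : R); have := sqr_ge0 (znorm (m + j) : R).
  case: hm => /pn.
  - have := @znormD2 R n (m + j) (- j); rewrite addrK znormN /a /b.
    by set x := znorm j ^+ 2; set y := znorm (m + j) ^+ 2; set u := znorm m ^+ 2; set v := _ ^+ 2; nra.
  - by rewrite /a /b; set x := znorm j ^+ 2; set y := znorm (m + j) ^+ 2; set v := _ ^+ 2; nra.
have c0 : 0 <= 2 / J%:R ^+ 2 * a by rewrite mulr_ge0 ?divr_ge0 ?(ltW J2)// (le_trans ler01).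
apply: (@le_trans _ _ ((2 / J%:R ^+ 2 * a * b) `^ s)).
  apply: one_le_powR => //.
  by rewrite mulrAC mulrAC -!mulrA mulrCA [_^-1 * _]mulrC !mulrA ler_pdivlMr// mul1r.
rewrite powRM; [|exact: c0|exact: (le_trans ler01 b1)].
by rewrite ler_wpM2l ?powR_ge0// ler_powR.
Qed.

End sobolev_torus.

(** * The potential: essential bound and Sobolev integral *)

Section potential.
Context {R : realType} (n : nat).
Local Notation leb := (@lebesgue_measure R).
Local Notation zvec := 'rV[int]_n.
Local Notation cyl := (cylm n : {sigma_finite_measure set (Cyl R n) -> \bar R}).
Local Notation vol := ((2 * pi) ^+ n : R).
Variable w : Cyl R n -> R.
Hypothesis mw : measurable_fun setT w.
Hypothesis hoo : in_Lp leb +oo%E (fun x1 => Lnorm (torus n) +oo%E (fun y => (w (x1, y))%:E)).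
Hypothesis h2 : in_Lp leb 2%:E (fun x1 => sobolev_norm (3 / 2) (fun y => w (x1, y))).

(** Both L^infinity norms are essential suprema, since both measures are non-zero; unfolding the
    outer and then the inner one gives nested almost-everywhere bounds. *)
Lemma essentially_bounded : exists2 B : R, 0 <= B &
  {ae leb, forall x1, {ae torus n, forall y, `|w (x1, y)| <= B}}.
Proof.
have FF := ae_filter_ringOfSetsType leb; have FT := ae_filter_ringOfSetsType (torus n).
have lT : (0 < leb [set: measurableTypeR R])%E.
  apply: (@lt_le_trans _ _ (leb (`[0, 1]%classic : set (measurableTypeR R)))).
    by rewrite lebesgue_measure_itv/= lte_fin ltr01 oppr0 adde0 lte_fin.
  by apply: le_measure; rewrite ?inE//; exact: measurable_itv.
have tT : (0 < torus n [set: Omega R n])%E by rewrite torus_setT lte_fin vol_gt0.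
pose N x1 := Lnorm (torus n) +oo%E (fun y => (w (x1, y))%:E).
have : (Lnorm leb +oo N < +oo)%E by case: hoo.
rewrite unlock lT; set e := ess_sup _ _ => eoo.
have [B B0 eB] : exists2 B : R, 0 <= B & (e <= B%:E)%E.
  move: eoo; case: e => [r _| |_] //; last by exists 0 => //; exact: leNye.
  by exists `|r| => //; rewrite lee_fin ler_norm.
exists B => //; have := ess_sup_ge leb (abse \o N); apply: filterS => x1 h1.
have {h1} : (`|N x1| <= B%:E)%E := le_trans h1 eB.
rewrite gee0_abs ?Lnorm_ge0// /N unlock tT => h1.
have := ess_sup_ge (torus n) (abse \o (fun y => (w (x1, y))%:E)).
by apply: filterS => y /= h; have := le_trans h h1; rewrite lee_fin.
Qed.

Lemma measurable_sob2 : measurable_fun setT (fun x1 => sob2 (fun y => w (x1, y))).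
Proof.
have [m2 _] := h2.
have -> : (fun x1 => sob2 (fun y => w (x1, y))) =
    (fun x1 => sobolev_norm (3 / 2) (fun y => w (x1, y)) * sobolev_norm (3 / 2) (fun y => w (x1, y)))%E.
  by apply/funext => x1; rewrite -sobolev_norm2.
exact: emeasurable_funM.
Qed.

Lemma sob2_integral : exists2 S0 : R, 0 <= S0 &
  (\int[leb]_x1 sob2 (fun y => w (x1, y)) = S0%:E)%E.
Proof.
have [_] := h2; rewrite unlock => /lty_poweRy h.
have {}h : (\int[leb]_x1 (`|sobolev_norm (3 / 2) (fun y => w (x1, y))| `^ 2) < +oo)%E.
  by apply: h; rewrite invr_neq0.
have e : (\int[leb]_x1 sob2 (fun y => w (x1, y)) =
    \int[leb]_x1 (`|sobolev_norm (3 / 2) (fun y => w (x1, y))| `^ 2))%E.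
  apply: eq_integral => x1 _; rewrite -sobolev_norm2 gee0_abs ?poweR_ge0//.
  rewrite /sobolev_norm -poweRrM mulVf// poweRe1 ?sob2_ge0//.
  by rewrite poweR12_sqrt ?sqr_sqrte//; exact: sob2_ge0.
have i0 : (0 <= \int[leb]_x1 sob2 (fun y => w (x1, y)))%E by apply: integral_ge0 => x _; exact: sob2_ge0.
exists (fine (\int[leb]_x1 sob2 (fun y => w (x1, y)))); first exact: fine_ge0.
by rewrite fineK// ge0_fin_numE// e.
Qed.

Lemma nsq_le_sob2 (r : Cyl R n -> R[i]) (c S0 : R) : cmeasurable_fun r -> 0 <= c ->
  (\int[leb]_x1 sob2 (fun y => w (x1, y)) = S0%:E)%E ->
  {ae leb, forall x1, (\int[torus n]_y (cmod (r (x1, y)) ^+ 2)%:E <= c%:E * sob2 (fun y => w (x1, y)))%E} ->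
  L2 cyl r /\ nsq cyl r <= c * S0.
Proof.
move=> mr c0 eS h.
have mc : measurable_fun setT (fun x => (cmod (r x) ^+ 2)%:E) by exact/measurable_EFinP/cmeas_cmod2.
have p0 : forall x, (0 <= (cmod (r x) ^+ 2)%:E)%E by move=> x; rewrite lee_fin sqr_ge0.
have le : (\int[cyl]_x (cmod (r x) ^+ 2)%:E <= (c * S0)%:E)%E.
  have := @fubini_tonelli1 _ _ (measurableTypeR R) (Omega R n) R leb (torus n) _ mc p0.
  move=> e; rewrite [X in (X <= _)%E]e EFinM -eS -ge0_integralZl//; last 2 first.
  - exact: measurable_sob2.
  - by move=> x _; exact: sob2_ge0.
  apply: ae_ge0_le_integral => //.
  - by move=> x _; apply: integral_ge0 => y _.
  - exact: (measurable_fun_fubini_tonelli_F _ mc p0).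
  - by move=> x _; rewrite mule_ge0// ?lee_fin// sob2_ge0.
  - by apply: measurable_funeM; exact: measurable_sob2.
  - by have FF := ae_filter_ringOfSetsType leb; move: h; apply: filterS => x hx _.
have Lr : L2 cyl r by apply: L2I => //; exact: le_lt_trans le (ltry _).
by split => //; rewrite -lee_fin nsqE.
Qed.

Variable B : R.
Hypothesis B0 : 0 <= B.
Hypothesis wB : {ae leb, forall x1, {ae torus n, forall y, `|w (x1, y)| <= B}}.

(** A representative of the potential that is bounded everywhere, equal to it almost everywhere. *)
Definition wb (x : Cyl R n) : R := if `|w x| <= B then w x else 0.

Lemma wb_bounded x : `|wb x| <= B.
Proof. by rewrite /wb; case: ifP => //; rewrite normr0. Qed.

Lemma measurable_wb : measurable_fun setT wb.
Proof.
apply: measurable_fun_ifT => //; apply: measurable_fun_ler => //.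
exact: measurableT_comp.
Qed.

Lemma wb_section_ae : {ae leb, forall x1, {ae torus n, forall y, w (x1, y) = wb (x1, y)}}.
Proof.
have FF := ae_filter_ringOfSetsType leb; have FT := ae_filter_ringOfSetsType (torus n).
by move: wB; apply: filterS => x1; apply: filterS => y h; rewrite /wb h.
Qed.

Lemma wb_ae : {ae cyl, forall x, w x = wb x}.
Proof.
pose A := [set x : Cyl R n | ~~ (`|w x| <= B)].
have mA : measurable A.
  rewrite (_ : A = (fun x => `|w x| <= B) @^-1` [set false]); last first.
    by apply/seteqP; split => x; rewrite /A /=; [move/negbTE|move=> ->].
  rewrite -[X in measurable X]setTI.
  have mle : measurable_fun setT (fun x => `|w x| <= B).
    by apply: measurable_fun_ler => //; exact: measurableT_comp.
  exact: mle.
exists A; split => //; last first.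
  by move=> x /= h; apply/negP => hB; apply: h; rewrite /wb hB.
have e : cyl A = (\int[leb]_x (torus n (xsection A x)))%E by [].
rewrite [LHS]e; have FF := ae_filter_ringOfSetsType leb.
transitivity (\int[leb]_x (cst 0%E : measurableTypeR R -> \bar R) x)%E; last by rewrite integral0.
apply: ae_eq_integral => //.
- exact: (measurable_fun_xsection (torus n) mA).
- move: wB; apply: filterS => x1 hx _ /=.
  have mx : measurable (xsection A x1) by exact: measurable_xsection.
  have hn : (torus n).-negligible (xsection A x1).
    by move: hx; apply: negligibleS => y /=; rewrite /xsection /= inE /A /= => /negP.
  move: hn => [C [mC C0 sub]]; apply/eqP; rewrite eq_le measure_ge0 andbT -C0.
  by apply: le_measure => //; rewrite inE.
Qed.

End potential.

(** * Limits of mode sums are Hilbert-Schmidt operators *)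

Section limit_operators.
Context {R : realType} (n : nat).
Local Notation leb := (@lebesgue_measure R).
Local Notation zvec := 'rV[int]_n.
Local Notation cyl := (cylm n : {sigma_finite_measure set (Cyl R n) -> \bar R}).
Local Notation vol := ((2 * pi) ^+ n : R).
Variable kap : zvec -> R[i].
Hypothesis kap_gt0 : forall j, 0 < Re (kap j).
Implicit Types r : zvec -> Cyl R n -> R[i].

Lemma Aop_comb (k : R[i]) (r1 r2 : Cyl R n -> R[i]) (a b : R[i]) f x1 : 0 < Re k ->
  L2 cyl r1 -> L2 cyl r2 -> L2 cyl f ->
  Aop k (fun x => a * r1 x + b * r2 x) f x1 = a * Aop k r1 f x1 + b * Aop k r2 f x1.
Proof.
move=> k0 L1 L2' Lf.
have jA (q : Cyl R n -> R[i]) : L2 cyl q -> cintegrable cyl (fun x' => Gk k (x1 - x'.1) * (q x' * f x')).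
  move=> Lq; have := cintegrable_inner (L2J (L2_Gr k0 Lq x1)) Lf.
  by under eq_fun do rewrite conjCK -mulrA.
rewrite /Aop -!cintegralZ; [|exact: jA|exact: jA].
rewrite -cintegralD; [|exact/cintegrableZ/jA|exact/cintegrableZ/jA].
by apply: eq_cintegral => x'; ring.
Qed.

Lemma Tsum_comb r1 r2 s f (a b : R[i]) x : (forall j, L2 cyl (r1 j)) -> (forall j, L2 cyl (r2 j)) ->
  L2 cyl f ->
  Tsum kap s (fun j x => a * r1 j x + b * r2 j x) f x = a * Tsum kap s r1 f x + b * Tsum kap s r2 f x.
Proof.
move=> L1 L2' Lf; rewrite /Tsum !mulr_sumr -big_split; apply: eq_bigr => j _ /=.
by rewrite Aop_comb//; ring.
Qed.

Variables (r : zvec -> Cyl R n -> R[i]) (S : R) (T : (Cyl R n -> R[i]) -> Cyl R n -> R[i]).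
Hypothesis Lr : forall j, L2 cyl (r j).
Hypothesis hS : forall M, \sum_(j <- zball R M) weight kap r j <= S.
Hypothesis LT : forall f, L2 cyl f -> L2 cyl (T f).
Hypothesis cT : forall f, L2 cyl f ->
  nrm cyl (fun x => Tsum kap (zball R M) r f x - T f x) @[M --> \oo] --> (0 : R).

Lemma limit_bounded_operator : bounded_operator cyl T.
Proof.
have S0 : 0 <= S.
  by apply: le_trans (hS 0); apply: sumr_ge0 => j _; exact: weight_ge0.
have vS : 0 <= vol * S by rewrite mulr_ge0 ?(ltW (vol_gt0 _)).
split => //.
- move=> a f g Lf Lg.
  have Lh : L2 cyl (fun x => a * f x + g x) by apply: L2D => //; exact: L2Z.
  have Ln h M : L2 cyl h -> L2 cyl (fun x => Tsum kap (zball R M) r h x - T h x).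
    by move=> Lh'; apply: L2B; [exact: L2_Tsum|exact: LT].
  pose F x := T (fun x => a * f x + g x) x - (a * T f x + T g x).
  have LF : L2 cyl F.
    apply: L2B; first exact: LT.
    by apply: L2D; [exact/L2Z/LT|exact: LT].
  have F0 : nrm cyl F <= 0.
    (* [Tsum] is exactly linear, so the linearity defect of [T] consists of three approximation
       errors; [b M] bounds its norm and tends to 0. *)
    pose b M := nrm cyl (fun x => Tsum kap (zball R M) r (fun x => a * f x + g x) x - T (fun x => a * f x + g x) x) +
      (cmod a * nrm cyl (fun x => Tsum kap (zball R M) r f x - T f x) +
       nrm cyl (fun x => Tsum kap (zball R M) r g x - T g x)).
    have cb : nrm cyl F - b M @[M --> \oo] --> nrm cyl F - (0 + (cmod a * 0 + 0)).
      apply: cvgB; first exact: cvg_cst.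
      apply: cvgD; first exact: cT.
      by apply: cvgD; [apply: cvgMl_tmp; exact: cT|exact: cT].
    rewrite mulr0 !addr0 subr0 in cb; apply: (cvg_le_bound cb) => M.
    rewrite subr_le0 /b.
    have -> : F = (fun x => - 1 * (Tsum kap (zball R M) r (fun x => a * f x + g x) x - T (fun x => a * f x + g x) x) +
        (a * (Tsum kap (zball R M) r f x - T f x) + (Tsum kap (zball R M) r g x - T g x))).
      by apply/funext => x; rewrite /F Tsum_lin//; ring.
    apply: le_trans (nrmD _ _) _.
    - by apply: L2Z; exact: Ln.
    - by apply: L2D; [apply: L2Z; exact: Ln|exact: Ln].
    rewrite nrmZ; last exact: Ln.
    rewrite cmodN cmod1 mul1r lerD2l; apply: le_trans (nrmD _ _) _.
    - by apply: L2Z; exact: Ln.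
    - exact: Ln.
    by rewrite nrmZ//; exact: Ln.
  have {}F0 : nrm cyl F = 0 by apply/eqP; rewrite eq_le F0 nrm_ge0.
  have FF := ae_filter_ringOfSetsType cyl.
  have := nrm_eq0 LF F0; apply: filterS => x /= h Tx.
  by apply/eqP; rewrite -subr_eq0; apply/eqP; exact: h.
- exists (Num.sqrt (vol * S)) => f Lf.
  rewrite !L2norm_nrm//; last exact: LT.
  rewrite -EFinM lee_fin /nrm -sqrtrM//.
  apply: ler_wsqrtr; exact: (nsq_limit_le kap_gt0 Lr hS Lf (LT Lf) (cT Lf)).
Qed.

Lemma limit_hilbert_schmidt : hilbert_schmidt cyl T.
Proof.
split; first exact: limit_bounded_operator.
move=> e oe; apply: le_lt_trans (hs_norm_limit kap_gt0 Lr hS oe LT cT) _.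
exact: ltry.
Qed.

End limit_operators.

(** * Summing the weights *)

Section weights.
Context {R : realType} (n : nat).
Local Notation zvec := 'rV[int]_n.
Local Notation cyl := (cylm n : {sigma_finite_measure set (Cyl R n) -> \bar R}).
Variables (kap : zvec -> R[i]) (c0 : R).
Hypothesis n2 : (n <= 2)%N.
Hypothesis kap_gt0 : forall j, 0 < Re (kap j).
Hypothesis c0_gt0 : 0 < c0.
Hypothesis kap_lower : forall j, c0 * (1 + znorm j ^+ 2) <= Re (kap j) ^+ 2.

(** The allowed growth (3-n)/4 of the profiles against the decay 3/2 of (Re kappa_j)^-3 leaves the
    exponent -(n+3)/4 of [sum_zball]. *)
Lemma sum_weight_le (r : zvec -> Cyl R n -> R[i]) (D : R) M : 0 <= D ->
  (forall j, nsq cyl (r j) <= D * (1 + znorm j ^+ 2) `^ ((3 - n%:R) / 4)) ->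
  \sum_(j <- zball R M) weight kap r j <= (4 * c0 `^ (3 / 2))^-1 * D * 20 ^+ n.
Proof.
move=> D0 hr; set K0 := (4 * c0 `^ (3 / 2))^-1.
have cp : 0 < c0 `^ (3 / 2) by rewrite powR_gt0.
have K0p : 0 <= K0 by rewrite invr_ge0 mulr_ge0// ltW.
apply: (@le_trans _ _ (\sum_(j <- zball R M) K0 * D * (1 + znorm j ^+ 2) `^ (- ((n%:R + 3) / 4)))).
  apply: ler_sum => j _; rewrite /weight.
  have p1 : 0 < 1 + znorm j ^+ 2 :> R by rewrite ltr_pwDl// sqr_ge0.
  have k3 : c0 `^ (3 / 2) * (1 + znorm j ^+ 2) `^ (3 / 2) <= Re (kap j) ^+ 3.
    rewrite -powRM ?(ltW c0_gt0) ?(ltW p1)//.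
    have -> : Re (kap j) ^+ 3 = (Re (kap j) ^+ 2) `^ (3 / 2).
      rewrite -powR_mulrn ?(ltW (kap_gt0 j))// -[in RHS]powR_mulrn ?(ltW (kap_gt0 j))// -powRrM.
      by congr (_ `^ _); field.
    have h32 : 0 <= 3 / 2 :> R by rewrite divr_ge0.
    by apply: (ge0_ler_powR h32); rewrite ?nnegrE ?sqr_ge0 ?kap_lower// mulr_ge0 ?(ltW c0_gt0) ?(ltW p1).
  have p3 : 0 < (1 + znorm j ^+ 2 : R) `^ (3 / 2) by rewrite powR_gt0.
  apply: (@le_trans _ _ ((4 * (c0 `^ (3 / 2) * (1 + znorm j ^+ 2) `^ (3 / 2)))^-1 *
      (D * (1 + znorm j ^+ 2) `^ ((3 - n%:R) / 4)))).
    apply: ler_pM => //; rewrite ?nsq_ge0 ?invr_ge0 ?mulr_ge0 ?exprn_ge0 ?(ltW (kap_gt0 j))//.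
    rewrite lef_pV2 ?posrE ?mulr_gt0 ?exprn_gt0//.
    by rewrite ler_wpM2l.
  have -> : - ((n%:R + 3) / 4) = (3 - n%:R) / 4 - 3 / 2 :> R by field.
  rewrite powRB; last by apply/implyP => _; rewrite gt_eqF.
  rewrite le_eqVlt; apply/orP; left; apply/eqP; rewrite /K0.
  by field; rewrite !gt_eqF.
rewrite -mulr_sumr ler_wpM2l ?mulr_ge0//; exact: sum_zball.
Qed.

End weights.

(** * Profiles of the exact, Galerkin and difference kernels *)

Section kernels.
Context {R : realType} (n : nat).
Local Notation leb := (@lebesgue_measure R).
Local Notation zvec := 'rV[int]_n.
Local Notation cyl := (cylm n : {sigma_finite_measure set (Cyl R n) -> \bar R}).
Local Notation vol := ((2 * pi) ^+ n : R).
Variables (w : Cyl R n -> R) (B S0 : R).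
Hypothesis mw : measurable_fun setT w.
Hypothesis h2 : in_Lp leb 2%:E (fun x1 => sobolev_norm (3 / 2) (fun y => w (x1, y))).
Hypothesis B0 : 0 <= B.
Hypothesis wB : {ae leb, forall x1, {ae torus n, forall y, `|w (x1, y)| <= B}}.
Hypothesis S00 : 0 <= S0.
Hypothesis eS : (\int[leb]_x1 sob2 (fun y => w (x1, y)) = S0%:E)%E.
Local Notation v := (wb w B).

Definition rJ (J : nat) (j : zvec) (x : Cyl R n) : R[i] :=
  - (vol^-1)%:C * \sum_(m <- zball R J)
    fourier (fun y => w (x.1, y)) (j - m) * character (- m) x.2.

(** Extending by 0 to all rows makes the Galerkin operator a mode sum over every larger ball, so it
    can be subtracted from the full series row by row. *)
Definition rJ0 J j (x : Cyl R n) : R[i] := if j \in zball R J then rJ J j x else 0.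

Lemma measurable_section (f : Cyl R n -> R) x1 : measurable_fun setT f ->
  measurable_fun setT (fun y => f (x1, y)).
Proof. by move=> mf; apply: measurableT_comp => //; exact: measurable_pair1. Qed.

Lemma L2_v_section x1 : L2 (torus n) (fun y => (v (x1, y))%:C).
Proof.
apply: (@L2_bounded _ _ _ (torus n) _ B) => [|y].
  by apply: cmeasR; apply: measurable_section; exact: measurable_wb.
by rewrite cmodR; exact: wb_bounded.
Qed.

Lemma fourier_ae (a b : Omega R n -> R) m : measurable_fun setT a -> measurable_fun setT b ->
  {ae torus n, forall y, a y = b y} -> fourier a m = fourier b m.
Proof.
move=> ma mb ab; congr (_ * _); apply: ae_eq_cintegral.
- by apply: cmeasM; [exact: cmeasR|exact: cmeas_character].
- by apply: cmeasM; [exact: cmeasR|exact: cmeas_character].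
- have FT := ae_filter_ringOfSetsType (torus n).
  by move: ab; apply: filterS => y h _; rewrite h.
Qed.

(** Slices on which the potential and its bounded version have the same Fourier coefficients; almost
    every slice is of this kind. *)
Definition good x1 := {ae torus n, forall y, w (x1, y) = v (x1, y)}.

Lemma good_ae : {ae leb, forall x1, good x1}.
Proof. exact: wb_section_ae. Qed.

Lemma good_fourier x1 m : good x1 ->
  fourier (fun y => w (x1, y)) m = fourier (fun y => v (x1, y)) m.
Proof.
move=> g; apply: fourier_ae => //; apply: measurable_section => //.
exact: measurable_wb.
Qed.

Lemma good_sob2 x1 : good x1 -> sob2 (fun y => v (x1, y)) = sob2 (fun y => w (x1, y)).
Proof. by move=> g; apply: eq_esum => m _; rewrite good_fourier. Qed.

(** The substitution m to -m in the symmetric ball exhibits the Galerkin row as a partial Fourier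
    sum of the twisted potential. *)
Lemma rJ_section J j x1 y : good x1 ->
  rJ J j (x1, y) = - (vol^-1)%:C * tsum (zball R J) (twisted (fun y => v (x1, y)) j) y.
Proof.
move=> g; rewrite /rJ /tsum; congr (_ * _).
rewrite -[RHS](perm_big _ (perm_zball_opp n J)) big_map; apply: eq_bigr => m _.
by rewrite /= good_fourier// fc_shift addrC.
Qed.

Lemma cmeas_rJ J j : cmeasurable_fun (rJ J j).
Proof.
apply: cmeasM; first exact: cmeas_cst.
apply: cmeas_sum => m; apply: (@cmeasM _ _ _ (fun x => fourier (fun y => w (x.1, y)) (j - m))
  (fun x => character (- m) x.2)); last exact: (@cmeas_snd _ _ _ _ R _ (cmeas_character (- m))).
apply: cmeasM; first exact: cmeas_cst.
have mF : cmeasurable_fun (fun p : measurableTypeR R * Omega R n => (w p)%:C * character (- (j - m)) p.2).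
  by apply: cmeasM; [exact: cmeasR|exact: (@cmeas_snd _ _ _ _ R _ (cmeas_character (- (j - m))))].
have mc := @cmeas_cintegral _ _ _ _ R (torus n) _ mF.
exact: (@cmeas_fst _ _ _ _ R _ mc).
Qed.

Lemma cmeas_rK j : cmeasurable_fun (rK v j).
Proof.
apply: cmeasM; first exact: cmeas_cst.
apply: cmeasM; first by apply: cmeasR; exact: measurable_wb.
exact: (@cmeas_snd _ _ _ _ R _ (cmeas_character (- j))).
Qed.

Lemma vol_neq0 : vol != 0. Proof. by rewrite gt_eqF// vol_gt0. Qed.

(** Common pattern for the three profiles: estimate almost every slice by the Sobolev norm of that
    slice, then integrate in x_1. *)
Lemma family_bound (r : Cyl R n -> R[i]) (g : R -> Omega R n -> R[i]) (c : R) :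
  cmeasurable_fun r -> 0 <= c -> (forall x1, L2 (torus n) (g x1)) ->
  (forall x1, good x1 -> forall y, cmod (r (x1, y)) = vol^-1 * cmod (g x1 y)) ->
  (forall x1, good x1 -> ((nsq (torus n) (g x1))%:E <= (vol * c)%:E * sob2 (fun y => w (x1, y)))%E) ->
  L2 cyl r /\ nsq cyl r <= vol^-1 * c * S0.
Proof.
move=> mr c0 Lg rg gc; have v0 := vol_gt0 n : 0 < vol.
apply: (nsq_le_sob2 h2 mr) => //; first by rewrite mulr_ge0// invr_ge0 ltW.
have FF := ae_filter_ringOfSetsType leb; move: good_ae; apply: filterS => x1 gx.
have -> : (\int[torus n]_y (cmod (r (x1, y)) ^+ 2)%:E = (vol^-1 ^+ 2)%:E * (nsq (torus n) (g x1))%:E)%E.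
  rewrite nsqE// -ge0_integralZl//; last 3 first.
  - by apply/measurable_EFinP; exact: cmeas_cmod2 (L2_meas (Lg x1)).
  - by move=> y _; rewrite lee_fin sqr_ge0.
  - by rewrite lee_fin sqr_ge0.
  by apply: eq_integral => y _; rewrite rg// exprMn EFinM.
have p : (0 <= (vol^-1 ^+ 2)%:E :> \bar R)%E by rewrite lee_fin sqr_ge0.
apply: le_trans (lee_wpmul2l p (gc x1 gx)) _.
rewrite muleA -EFinM (_ : vol^-1 ^+ 2 * (vol * c) = vol^-1 * c)//.
by rewrite expr2 mulrA -[_ * _ * vol]mulrA mulVf ?mulr1// vol_neq0.
Qed.

Lemma rK_bound j : L2 cyl (rK v j) /\ nsq cyl (rK v j) <= vol^-1 * 1 * S0.
Proof.
have v0 := vol_gt0 n : 0 < vol.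
apply: (@family_bound _ (fun x1 => twisted (fun y => v (x1, y)) j)) => //.
- exact: cmeas_rK.
- by move=> x1; apply: L2_twisted; exact: L2_v_section.
- by move=> x1 _ y; rewrite /rK cmodM cmodR ger0_norm// invr_ge0 ltW.
- by move=> x1 gx; rewrite mulr1 -good_sob2//; apply: nsq_twisted_le; exact: L2_v_section.
Qed.

Lemma rJ0_bound J j : L2 cyl (rJ0 J j) /\ nsq cyl (rJ0 J j) <= vol^-1 * 1 * S0.
Proof.
have v0 := vol_gt0 n : 0 < vol.
apply: (@family_bound _ (fun x1 => if j \in zball R J then
    tsum (zball R J) (twisted (fun y => v (x1, y)) j) else fun=> 0)) => //.
- by rewrite /rJ0; case: (j \in zball R J); [exact: cmeas_rJ|exact: cmeas_cst].
- move=> x1; case: ifP => _; last exact: L2_0.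
  by apply: L2_sum => m _; apply: L2Z; exact: L2_character.
- move=> x1 gx y; rewrite /rJ0; case: ifP => _; last by rewrite cmod0 mulr0.
  by rewrite rJ_section// cmodM cmodN cmodR ger0_norm// invr_ge0 ltW.
- move=> x1 gx; rewrite mulr1 -good_sob2//.
  apply: le_trans (nsq_twisted_le j (L2_v_section x1)); rewrite lee_fin.
  case: ifP => _; last by rewrite nsq0 nsq_ge0.
  by apply: nsq_tsum_le; [apply: L2_twisted; exact: L2_v_section|exact: zball_uniq].
Qed.

(** Profile of K(z) - K_J(z): K(z) carries -[rK], whereas [rJ] already contains the sign of the
    Galerkin kernel. *)
Definition rD J j (x : Cyl R n) : R[i] := - 1 * rK v j x + - 1 * rJ0 J j x.

Lemma rD_bound (s : R) J j : 0 <= s -> s <= 3 / 2 -> (0 < J)%N ->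
  nsq cyl (rD J j) <= vol^-1 * ((2 / J%:R ^+ 2 * (1 + znorm j ^+ 2)) `^ s) * S0.
Proof.
move=> s0 s3 J0; have v0 := vol_gt0 n : 0 < vol.
have c1 : 0 < 2 / J%:R ^+ 2 * (1 + znorm j ^+ 2) :> R.
  by rewrite mulr_gt0// ?divr_gt0 ?exprn_gt0 ?ltr0n// ltr_pwDl// sqr_ge0.
have cp : 0 < (2 / J%:R ^+ 2 * (1 + znorm j ^+ 2) : R) `^ s by rewrite powR_gt0.
suff [] : L2 cyl (rD J j) /\ nsq cyl (rD J j) <=
    vol^-1 * ((2 / J%:R ^+ 2 * (1 + znorm j ^+ 2)) `^ s) * S0 by [].
(* For |j| > J nothing is subtracted from the row, so the truncation list is empty and the whole row
   is tail. *)
pose t := if j \in zball R J then (zball R J : seq zvec) else [::].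
have ut : uniq t by rewrite /t; case: ifP => _ //; exact: zball_uniq.
apply: (@family_bound _ (fun x1 y => twisted (fun y => v (x1, y)) j y -
    tsum t (twisted (fun y => v (x1, y)) j) y)); last 3 first.
- move=> x1; apply: L2B; first by apply: L2_twisted; exact: L2_v_section.
  by apply: L2_sum => m _; apply: L2Z; exact: L2_character.
- move=> x1 gx y.
  have -> : rD J j (x1, y) = - (vol^-1)%:C * (twisted (fun y => v (x1, y)) j y -
      tsum t (twisted (fun y => v (x1, y)) j) y).
    rewrite /rD /rJ0 /t; case: ifP => _; first by rewrite rJ_section// /rK /twisted /=; ring.
    by rewrite /tsum big_nil /rK /twisted /=; ring.
  by rewrite cmodM cmodN cmodR ger0_norm// invr_ge0 ltW.
- move=> x1 gx; rewrite -good_sob2//; apply: tail_bound => //; first exact: L2_v_section.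
  move=> m mt; apply: tail_constant => //; move: mt; rewrite /t.
  by case: (boolP (j \in zball R J)) => jJ; [left|right].
- apply: cmeasD; (apply: cmeasM; first exact: cmeas_cst); first exact: cmeas_rK.
  by rewrite /rJ0; case: (j \in zball R J); [exact: cmeas_rJ|exact: cmeas_cst].
- exact: ltW.
Qed.

End kernels.

(** * Convergence of the Galerkin operators and determinants *)

Section galerkin_operators.
Context {R : realType} (n : nat).
Local Notation leb := (@lebesgue_measure R).
Local Notation zvec := 'rV[int]_n.
Local Notation cyl := (cylm n : {sigma_finite_measure set (Cyl R n) -> \bar R}).
Local Notation vol := ((2 * pi) ^+ n : R).
Variables (Vinf : R) (V : Cyl R n -> R) (z : R[i]).
Hypothesis n2 : (n <= 2)%N.
Hypothesis hz : ~ (Im z = 0 /\ Vinf <= Re z).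
Local Notation w := (perturbation Vinf V).

Definition kappa (j : zvec) : R[i] := csqrt ((Vinf + znorm j ^+ 2)%:C - z).

Lemma kappaP j : kappa j ^+ 2 = (Vinf + znorm j ^+ 2)%:C - z /\ 0 < Re (kappa j).
Proof.
apply: csqrtP; case: (z) hz => a b /= h [b0 ab]; apply: h.
have := sqr_ge0 (znorm j : R); split; lra.
Qed.

Lemma kappa_gt0 j : 0 < Re (kappa j). Proof. by have [] := kappaP j. Qed.

Lemma kappa_lower : exists2 c : R, 0 < c &
  forall j, c * (1 + znorm j ^+ 2) <= Re (kappa j) ^+ 2.
Proof.
have [|c c0 hc] := @Re_csqrt_lower R (Vinf - Re z) (- Im z).
  by move=> [b0 a0]; apply: hz; split; lra.
exists c => // j; have := hc _ (sqr_ge0 (znorm j)); rewrite /kappa.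
have -> // : (Vinf - Re z + znorm j ^+ 2) +i* - Im z = (Vinf + znorm j ^+ 2)%:C - z.
by case: (z) => a b; apply/eqP; rewrite eq_complex /= sub0r eqxx andbT; apply/eqP; ring.
Qed.

Variables (B S0 c0 : R).
Hypothesis mw : measurable_fun setT w.
Hypothesis h2 : in_Lp leb 2%:E (fun x1 => sobolev_norm (3 / 2) (fun y => w (x1, y))).
Hypothesis B0 : 0 <= B.
Hypothesis wB : {ae leb, forall x1, {ae torus n, forall y, `|w (x1, y)| <= B}}.
Hypothesis S00 : 0 <= S0.
Hypothesis eS : (\int[leb]_x1 sob2 (fun y => w (x1, y)) = S0%:E)%E.
Hypothesis c0_gt0 : 0 < c0.
Hypothesis kap_lower : forall j, c0 * (1 + znorm j ^+ 2) <= Re (kappa j) ^+ 2.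
Local Notation v := (wb w B).
Local Notation rate J := ((J%:R : R) `^ ((n.+1%:R - 4) / 4)).
Let K0 : R := (4 * c0 `^ (3 / 2))^-1.
Let s : R := (3 - n%:R) / 4.

Lemma sobolev_gain_ge0 : 0 <= s.
Proof. by rewrite /s divr_ge0// subr_ge0 ler_nat (leq_trans n2). Qed.

Lemma L2_rK_wb j : L2 cyl (rK v j).
Proof. by have [] := rK_bound mw h2 B0 wB eS j. Qed.

Lemma L2_rJ0 J j : L2 cyl (rJ0 w J j).
Proof. by have [] := rJ0_bound mw h2 B0 wB eS J j. Qed.

Lemma L2_rD J j : L2 cyl (rD w B J j).
Proof. by apply: L2D; apply: L2Z; [exact: L2_rK_wb|exact: L2_rJ0]. Qed.

Lemma L2_wb : L2 cyl (fun x => (v x)%:C).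
Proof.
have -> : (fun x => (v x)%:C) = (fun x => vol%:C * rK v 0 x).
  apply/funext => x; rewrite /rK oppr0 character0 mulr1 mulrA -rmorphM mulfV ?mul1r//.
  exact: vol_neq0.
by apply: L2Z; exact: L2_rK_wb.
Qed.

(** Bound for the sum of weights when the squared norms of the profiles carry the factor [a]: 1 for
    the operators themselves, (2/J^2)^s for the difference. *)
Definition Sbound (a : R) : R := K0 * (vol^-1 * a * S0) * 20 ^+ n.

Lemma weights_uniform (r : zvec -> Cyl R n -> R[i]) :
  (forall j, nsq cyl (r j) <= vol^-1 * 1 * S0) ->
  forall M, \sum_(j <- zball R M) weight kappa r j <= Sbound 1.
Proof.
move=> hr M; have v0 : 0 < vol := vol_gt0 n.
have D0 : 0 <= vol^-1 * 1 * S0 by rewrite mulr1 mulr_ge0// invr_ge0 ltW.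
apply: (sum_weight_le n2 kappa_gt0 c0_gt0 kap_lower) => // j.
apply: le_trans (hr j) _; rewrite ler_peMr//.
by apply: one_le_powR; [rewrite lerDl sqr_ge0|exact: sobolev_gain_ge0].
Qed.

Lemma weights_rD J M : (0 < J)%N ->
  \sum_(j <- zball R M) weight kappa (rD w B J) j <= Sbound ((2 / J%:R ^+ 2) `^ s).
Proof.
move=> J0; have v0 : 0 < vol := vol_gt0 n.
have D0 : 0 <= vol^-1 * ((2 / J%:R ^+ 2) `^ s) * S0.
  by rewrite mulr_ge0// mulr_ge0 ?invr_ge0 ?powR_ge0// ltW.
apply: (sum_weight_le n2 kappa_gt0 c0_gt0 kap_lower) => // j.
have s3 : s <= 3 / 2 by rewrite /s; have := ler0n R n; lra.
have := rD_bound mw h2 B0 wB eS j sobolev_gain_ge0 s3 J0.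
rewrite powRM ?divr_ge0 ?exprn_ge0// ?addr_ge0 ?sqr_ge0// => h.
by apply: le_trans h _; rewrite le_eqVlt; apply/orP; left; apply/eqP; ring.
Qed.

Lemma Aop_0 (k : R[i]) (f : Cyl R n -> R[i]) x1 : Aop k (fun=> 0) f x1 = 0.
Proof.
rewrite /Aop (_ : (fun _ => _) = fun=> 0) ?cintegral0//.
by apply/funext => x; rewrite mul0r mulr0.
Qed.

Lemma Tsum_rJ0 J M f x : (J <= M)%N ->
  Tsum kappa (zball R M) (rJ0 w J) f x = Tsum kappa (zball R J) (rJ w J) f x.
Proof.
move=> JM; rewrite /Tsum (bigID (fun j => j \in zball R J)) /= addrC big1 => [|j jJ]; last first.
  have -> : rJ0 w J j = fun=> 0 by apply/funext => y; rewrite /rJ0 (negbTE jJ).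
  by rewrite Aop_0 mulr0.
rewrite add0r -big_filter.
have e : perm_eq [seq j <- zball R M | j \in zball R J] (zball R J : seq zvec).
  apply: uniq_perm; [by rewrite filter_uniq// zball_uniq|exact: zball_uniq|move=> j].
  rewrite mem_filter; case: (boolP (j \in zball R J)) => // jJ /=.
  exact: (zball_sub JM jJ).
rewrite (perm_big _ e) /=; apply: eq_big_seq => j jJ.
suff -> : rJ0 w J j = rJ w J j by [].
by apply/funext => y; rewrite /rJ0 jJ.
Qed.

(** Only finitely many modes occur, so sum and integral may be exchanged and the kernel regrouped by
    rows. *)
Lemma galerkinE J f x : L2 cyl f ->
  galerkin Vinf V z J f x = Tsum kappa (zball R J) (rJ w J) f x.
Proof.
move=> Lf; rewrite -(Tsum_rJ0 f x (leqnn J)).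
have jA j : cintegrable cyl (fun x' => Gk (kappa j) (x.1 - x'.1) * (rJ0 w J j x' * f x')).
  have := cintegrable_inner (L2J (L2_Gr (kappa_gt0 j) (L2_rJ0 J j) x.1)) Lf.
  by under eq_fun do rewrite conjCK -mulrA.
rewrite /Tsum /Aop.
under eq_bigr do rewrite -cintegralZ//.
rewrite -cintegral_sum => [|j _]; last by apply: cintegrableZ; exact: jA.
apply: eq_cintegral => x'; rewrite /galerkin_kernel fsum_zball mulr_sumr mulr_suml.
apply: eq_big_seq => j jJ; rewrite fsum_zball /rJ0 jJ /rJ /Gk mulr_sumr.
rewrite [in RHS]mulr_sumr !mulr_suml !mulr_sumr; apply: eq_bigr => m _.
by rewrite -/(kappa j); ring.
Qed.

(** The series representation applies to the bounded version of the potential, whose product with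
    [f] agrees almost everywhere with that of the potential; the plus sign reflects the minus in
    K(z). *)
Lemma resolvent_limit f : L2 cyl f ->
  L2 cyl (birman_schwinger Vinf V z f) /\
  nrm cyl (fun x => Tsum kappa (zball R M) (rK v) f x + birman_schwinger Vinf V z f x) @[M --> \oo] --> (0 : R).
Proof.
move=> Lf; have FF := ae_filter_ringOfSetsType cyl.
have kap2 j : kappa j ^+ 2 = (Vinf + znorm j ^+ 2)%:C - z by have [] := kappaP j.
have hS := weights_uniform (fun j => (rK_bound mw h2 B0 wB eS j).2).
have vw : ae_eq cyl setT (fun x => (v x)%:C * f x) (fun x => (w x)%:C * f x).
  by move: (wb_ae mw wB); apply: filterS => x h _; rewrite h.
have [u [Lu Lr cu ru]] := resolvent_representation kappa_gt0 kap2 L2_wb (wb_bounded w B0) hS Lf vw.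
have Lb : L2 cyl (birman_schwinger Vinf V z f) by exact: L2N.
split => //.
suff -> : (fun M => nrm cyl (fun x => Tsum kappa (zball R M) (rK v) f x + birman_schwinger Vinf V z f x)) =
    (fun M => nrm cyl (fun x => Tsum kappa (zball R M) (rK v) f x - u x)) by [].
have LT M : L2 cyl (Tsum kappa (zball R M) (rK v) f) by apply: (L2_Tsum kappa_gt0 L2_rK_wb).
apply/funext => M; apply: ae_eq_nrm.
- by apply: cmeasD; [exact: L2_meas (LT M)|exact: L2_meas Lb].
- by apply: cmeasB; [exact: L2_meas (LT M)|exact: L2_meas Lu].
- by move: ru; apply: filterS => x h _; rewrite /birman_schwinger h.
Qed.

(** The negated profile is written as a linear combination so that [Tsum_comb] moves the sign out of
    the mode sum. *)
Lemma birman_schwinger_limit f : L2 cyl f ->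
  nrm cyl (fun x => Tsum kappa (zball R M) (fun j x => -1 * rK v j x + 0 * rK v j x) f x -
    birman_schwinger Vinf V z f x) @[M --> \oo] --> (0 : R).
Proof.
move=> Lf; have [_ cu] := resolvent_limit Lf; apply: cvg_trans cu.
apply: near_eq_cvg; apply: nearW => M; rewrite -nrmN; congr nrm; apply/funext => x.
by rewrite Tsum_comb//; [ring|exact: kappa_gt0|exact: L2_rK_wb|exact: L2_rK_wb].
Qed.

Lemma L2_galerkin J f : L2 cyl f -> L2 cyl (galerkin Vinf V z J f).
Proof.
move=> Lf; have -> : galerkin Vinf V z J f = Tsum kappa (zball R J) (rJ0 w J) f.
  by apply/funext => x; rewrite galerkinE// Tsum_rJ0.
by apply: L2_Tsum => //; [exact: kappa_gt0|exact: L2_rJ0].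
Qed.

Lemma galerkin_limit J f : L2 cyl f ->
  nrm cyl (fun x => Tsum kappa (zball R M) (rJ0 w J) f x - galerkin Vinf V z J f x)
    @[M --> \oo] --> (0 : R).
Proof.
move=> Lf; apply: cvg_near_cst; near=> M.
have JM : (J <= M)%N by near: M; exact: nbhs_infty_ge.
have -> : (fun x => Tsum kappa (zball R M) (rJ0 w J) f x - galerkin Vinf V z J f x) = fun=> 0.
  by apply/funext => x; rewrite Tsum_rJ0// galerkinE// subrr.
by rewrite /nrm nsq0 sqrtr0.
Unshelve. all: by end_near. Qed.

Lemma difference_limit J f : L2 cyl f ->
  nrm cyl (fun x => Tsum kappa (zball R M) (rD w B J) f x -
    op_sub (birman_schwinger Vinf V z) (galerkin Vinf V z J) f x) @[M --> \oo] --> (0 : R).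
Proof.
move=> Lf; have [_ cu] := resolvent_limit Lf; apply: cvg_trans cu.
apply: near_eq_cvg; near=> M.
have JM : (J <= M)%N by near: M; exact: nbhs_infty_ge.
rewrite -nrmN; congr nrm; apply/funext => x; rewrite /op_sub /rD Tsum_comb//; last 3 first.
- exact: kappa_gt0.
- exact: L2_rK_wb.
- exact: L2_rJ0.
by rewrite (Tsum_rJ0 f x JM) galerkinE//; ring.
Unshelve. all: by end_near. Qed.

Lemma nsq_negated j :
  nsq cyl (fun x => -1 * rK v j x + 0 * rK v j x) <= vol^-1 * 1 * S0.
Proof.
apply: le_trans (rK_bound mw h2 B0 wB eS j).2; rewrite le_eqVlt; apply/orP; left; apply/eqP.
by apply: eq_Rintegral => x _; rewrite mul0r addr0 mulN1r cmodN.
Qed.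

Lemma L2_negated j : L2 cyl (fun x => -1 * rK v j x + 0 * rK v j x).
Proof. by apply: L2D; apply: L2Z; exact: L2_rK_wb. Qed.

Lemma birman_schwinger_hs : hilbert_schmidt cyl (birman_schwinger Vinf V z).
Proof.
apply: (limit_hilbert_schmidt kappa_gt0 L2_negated (weights_uniform nsq_negated)).
- by move=> f /resolvent_limit[].
- exact: birman_schwinger_limit.
Qed.

Lemma galerkin_hs J : hilbert_schmidt cyl (galerkin Vinf V z J).
Proof.
apply: (limit_hilbert_schmidt kappa_gt0 (L2_rJ0 J)
  (weights_uniform (fun j => (rJ0_bound mw h2 B0 wB eS J j).2))).
- exact: L2_galerkin.
- exact: galerkin_limit.
Qed.

(** Here -2 s = 2 ((n+1) - 4)/4: the squared Hilbert-Schmidt norm carries the square of the rate. *)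
Lemma powR_rate J : (0 < J)%N -> (2 / J%:R ^+ 2 : R) `^ s = 2 `^ s * rate J ^+ 2.
Proof.
move=> J0; have p : 0 < J%:R :> R by rewrite ltr0n.
rewrite powRM// ?invr_ge0 ?exprn_ge0//; congr (_ * _).
rewrite -(powR_mulrn 2 (ltW p)) -(powR_mulrn 2 (powR_ge0 J%:R ((n.+1%:R - 4) / 4))).
rewrite -(powR_inv1 (powR_ge0 J%:R 2%:R)) -!powRrM.
by congr (_ `^ _); rewrite /s -[n.+1]addn1 natrD; field.
Qed.

Let Crate : R := Num.sqrt (vol * Sbound (2 `^ s)).

Lemma hs_norm_difference e J : orthonormal_basis cyl e -> (0 < J)%N ->
  (hs_norm cyl e (op_sub (birman_schwinger Vinf V z) (galerkin Vinf V z J)) <=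
    (Crate * rate J)%:E)%E.
Proof.
move=> oe J0.
apply: le_trans (hs_norm_limit kappa_gt0 (L2_rD J) (fun M => weights_rD M J0) oe _ _) _.
- move=> f Lf; apply: L2B; last exact: L2_galerkin.
  by have [] := resolvent_limit Lf.
- exact: difference_limit.
rewrite lee_fin powR_rate// le_eqVlt; apply/orP; left; apply/eqP.
have -> : vol * Sbound (2 `^ s * rate J ^+ 2) = rate J ^+ 2 * (vol * Sbound (2 `^ s)).
  by rewrite /Sbound; ring.
by rewrite sqrtrM ?sqr_ge0// sqrtr_sqr ger0_norm ?powR_ge0// mulrC.
Qed.

(** K(z) and all K_J(z) lie in one Hilbert-Schmidt ball, of squared radius [vol * Sbound 1], so a
    single Lipschitz constant of det_2 transfers the operator rate to the determinants. *)
Theorem galerkin_convergence e : orthonormal_basis cyl e ->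
  (exists C : R, \forall J \near \oo, (hs_norm cyl e
     (op_sub (birman_schwinger Vinf V z) (galerkin Vinf V z J)) <= (C * rate J)%:E)%E) /\
  (exists C : R, \forall J \near \oo,
     cmod (det2 cyl e (birman_schwinger Vinf V z) - det2 cyl e (galerkin Vinf V z J)) <= C * rate J).
Proof.
move=> oe; split.
  by exists Crate; near=> J; apply: hs_norm_difference => //; near: J; exact: nbhs_infty_gt.
have [K K0' hK] := det2_lipschitz oe (sqrtr_ge0 (vol * Sbound 1)).
exists (K * Crate); near=> J.
have J0 : (0 < J)%N by near: J; exact: nbhs_infty_gt.
rewrite -mulrA; apply: hK.
- by have [] := birman_schwinger_hs.
- by have [] := galerkin_hs J.
- apply: (hs_norm_limit kappa_gt0 L2_negated (weights_uniform nsq_negated) oe).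
    by move=> f /resolvent_limit[].
  exact: birman_schwinger_limit.
- apply: (hs_norm_limit kappa_gt0 (L2_rJ0 J)
    (weights_uniform (fun j => (rJ0_bound mw h2 B0 wB eS J j).2)) oe).
    exact: L2_galerkin.
  exact: galerkin_limit.
- by rewrite mulr_ge0 ?sqrtr_ge0 ?powR_ge0.
- exact: hs_norm_difference.
Unshelve. all: by end_near. Qed.

End galerkin_operators.

Theorem theorem4p9 (R : realType) (d : nat) (hd : d = 2%N \/ d = 3%N)
    (Vinf : R) (hVinf : 0 < Vinf) (V : Cyl R d.-1 -> R)
    (hVm : measurable_fun setT V)
    (hV1 : in_Lp (@lebesgue_measure R) 1%:E
       (fun x1 => Lnorm (torus d.-1) +oo%E
          (fun y => (perturbation Vinf V (x1, y))%:E)))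
    (hVoo : in_Lp (@lebesgue_measure R) +oo%E
       (fun x1 => Lnorm (torus d.-1) +oo%E
          (fun y => (perturbation Vinf V (x1, y))%:E)))
    (hV2 : in_Lp (@lebesgue_measure R) 2%:E
       (fun x1 => sobolev_norm (3 / 2)
          (fun y => perturbation Vinf V (x1, y))))
    (z : R[i]) (hz : ~ (complex.Im z = 0 /\ Vinf <= complex.Re z)) :
  let mu := cylinder d.-1 in
  let K := birman_schwinger Vinf V z in
  let KJ := galerkin Vinf V z in
  let rate := fun J : nat => (J%:R : R) `^ ((d%:R - 4) / 4) in
  [/\ forall J, hilbert_schmidt mu (KJ J),
      hilbert_schmidt mu K
    & forall e, orthonormal_basis mu e ->
        (exists C : R, \forall J \near \oo,
           (hs_norm mu e (op_sub K (KJ J)) <= (C * rate J)%:E)%E) /\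
        (exists C : R, \forall J \near \oo,
           cmod (det2 mu e K - det2 mu e (KJ J)) <= C * rate J)].
Proof.
have n2 : (d.-1 <= 2)%N by case: hd => ->.
have [n dn] : exists n, d = n.+1 by case: hd => ->; eexists.
(* With d = n + 1 the cross-section dimension is n <= 2 and the exponent (d - 4)/4 is that of the
   local [rate]. *)
subst d; 
have mw : measurable_fun setT (perturbation Vinf V) by exact: measurable_funB.
have [B B0 wB] := essentially_bounded hVoo.
have [S0 S00 eS] := sob2_integral hV2.
have [c c0 hc] := kappa_lower n hz.
split.
- by move=> J; exact: (galerkin_hs n2 hz mw hV2 B0 wB S00 eS c0 hc).
- exact: (birman_schwinger_hs n2 hz mw hV2 B0 wB S00 eS c0 hc).
- by move=> e oe; exact: (galerkin_convergence n2 hz mw hV2 B0 wB S00 eS c0 hc oe).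
Qed.
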